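(* Let $x$ be a real number with $\log x\geq 10^6$. Then $$\left|S(x)-\frac{x^2}{2}+2\sum_{|\rho|<x}\frac{x^{\rho+1}}{\rho(\rho+1)}\right|\leq 13.149(\log x)^5x^{2B_1^*(x)},$$ where the sum runs over the non-trivial zeros $\rho$ of the Riemann zeta function (counted with multiplicity) with $|\rho|<x$.
   Context: $\Lambda$ denotes the von Mangoldt function. For a positive integer $n$, $G(n)=\sum_{\ell+m=n}\Lambda(\ell)\Lambda(m)$ (sum over positive integers $\ell,m$), and $S(x)=\sum_{n\leq x}G(n)$. Non-trivial zeros of $\zeta$ are its zeros with $0<\Re s<1$. Let $B_1=\sup\{\Re(\rho)\}$ over these zeros and $$B_1^*(x)=\min\left\{B_1,\ 1-\frac{1}{53.989(\log x)^{2/3}(\log\log x)^{1/3}}\right\}.$$ *)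

(* Defs.v *)
From Stdlib Require Import Reals ZArith Znumtheory List.
From Coquelicot Require Import Coquelicot.
Open Scope R_scope.

(* Lambda(n) = log p if n = p^k with p prime and k >= 1, else 0.
   Written as a sum over all pairs (p,k) with 2 <= p <= n, 1 <= k <= n;
   at most one pair satisfies p^k = n (unique factorisation), and any such
   pair has p <= n and k <= n. *)
Definition vonMangoldt (n : nat) : R :=
  fold_right Rplus 0
    (map (fun p =>
       fold_right Rplus 0
         (map (fun k =>
            if prime_dec (Z.of_nat p) then
              if Nat.eqb (Nat.pow p k) n then ln (INR p) else 0
            else 0) (seq 1 n)))
     (seq 2 n)).

Definition G (n : nat) : R :=
  fold_right Rplus 0
    (map (fun l => vonMangoldt l * vonMangoldt (n - l)) (seq 1 (n - 1))).

Definition S_sum (x : R) : R :=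
  fold_right Rplus 0 (map G (seq 1 (Z.to_nat (Int_part x)))).

Definition Cexp (z : C) : C :=
  (exp (Re z) * cos (Im z), exp (Re z) * sin (Im z)).

Definition Rcpow (a : R) (z : C) : C := Cexp (Cmult z (RtoC (ln a))).

Fixpoint Cpown (z : C) (m : nat) : C :=
  match m with O => RtoC 1 | S m' => Cmult z (Cpown z m') end.

Fixpoint eta_partial (s : C) (N : nat) : C :=
  match N with
  | O => RtoC 0
  | S N' => Cplus (eta_partial s N')
                  (Cmult (RtoC ((-1) ^ N')) (Rcpow (INR N) (Copp s)))
  end.

(* eta(s): limit of the partial sums (converges for Re s > 0) *)
Definition eta (s : C) : C :=
  (real (Lim_seq (fun N => Re (eta_partial s N))),
   real (Lim_seq (fun N => Im (eta_partial s N)))).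

(* zeta(s) = eta(s) / (1 - 2^(1-s)), the analytic continuation of zeta
   valid for Re s > 0, s <> 1 (in particular throughout 0 < Re s < 1). *)
Definition zeta (s : C) : C :=
  Cdiv (eta s) (Cminus (RtoC 1) (Rcpow 2 (Cminus (RtoC 1) s))).

Definition nontrivial_zero (rho : C) : Prop :=
  0 < Re rho < 1 /\ zeta rho = RtoC 0.

Definition zero_order (rho : C) (m : nat) : Prop :=
  exists g : C -> C,
    continuous g rho /\ g rho <> RtoC 0 /\
    exists eps : R, 0 < eps /\
      forall s : C, Cmod (Cminus s rho) < eps ->
        zeta s = Cmult (Cpown (Cminus s rho) m) (g s).

Definition B1 : R :=
  real (Lub_Rbar (fun r => exists rho, nontrivial_zero rho /\ Re rho = r)).

Definition B1star (x : R) : R :=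
  Rmin B1 (1 - 1 / (53.989 * Rpower (ln x) (2/3) * Rpower (ln (ln x)) (1/3))).

(* the zero sum  sum_{rho} m_rho * x^(rho+1) / (rho (rho+1)), over a list of
   (zero, multiplicity) pairs *)
Definition zero_sum (x : R) (l : list (C * nat)) : C :=
  fold_right Cplus (RtoC 0)
    (map (fun p => Cmult (RtoC (INR (snd p)))
                     (Cdiv (Rcpow x (Cplus (fst p) (RtoC 1)))
                           (Cmult (fst p) (Cplus (fst p) (RtoC 1))))) l).

(* Main.v *)
(** Put a = Lambda - 1, D(N) = sum of a(m) a(n) over m + n <= N, and A1(u) = sum of a(n) (u - n)_+ with the
 1 replaced by its integral. Since S(x) = x^2/2 + 2 A1(x) + D + O(x log x), the Perron formula for A1 turns the
 second term into the sum over zeros with an error O(x log^3 x), and D has to be bounded.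

 The cubic Riesz mean of the a(m) a(n) is the convolution A1 * A1, and D is its third difference with step 1/3
 at N + 1. Telescoping over the steps h = 2^k/3 leaves fourth differences, which are convolutions of second
 differences of A1; by Cauchy-Schwarz |D| is at most (3/2) sum h^-3 V(h), where V(h) is the integral of
 (nabla_h^2 A1)^2. Shifting the Mellin integral of A1 to Re s = B1 + 1/log x, where -zeta'/zeta is controlled by
 Landau's lemma, and applying Parseval gives V(h) << h^3 x^(2 B1) log^3 x, hence |D| << x^(2 B1) log^4 x.
 The same bound with h = 1/2, where V is bounded below because 6k is not a prime power, shows B1 >= 1/2, so the
 errors of size x log^3 x are absorbed.

 When the minimum defining B1star is attained at the other term, D is bounded trivially for log x <= 10^9, and by the
 classical zero-free region beyond; neither the functional equation nor a Vinogradov-Korobov region is needed. *)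

From Stdlib Require Import Reals ZArith Znumtheory Zpow_facts List Lra Lia Classical ClassicalEpsilon.
From Coquelicot Require Import Coquelicot.
Require Import Defs.
Open Scope R_scope.

(** The sharp condition m + l <= N cannot be treated by contours or mean squares directly. As m + l
    is an integer, a third difference with step 1/3 of a cubic recovers it exactly, and only smooth
    quantities remain. Every scale 2^k/3 then contributes equally, which is the logarithm that |D|
    has beyond V(h)/h^3.

    That x^(2 B1) is lost by no more than a constant has two sources: the line lies only 1/log x to
    the right of all zeros, and in mean square a zero at distance d costs 1/d instead of 1/d^2.

    The argument loses large absolute constants (several millions in the main case), far above
    13.149. They are paid for by the spare logarithm: |D| has log^4 where log^5 is allowed, and log
    x >= 10^6.

    Two matters of encoding: multiplicities are carried by a list of zeros with repetition, divided
    out of (s-1) zeta(s) up to a given height, and compared with [zero_order] only when the sum of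
    the statement is formed. [B1] is the real part of an extended supremum, so a zero must be
    exhibited before it has the intended meaning. *)

(** * Tactics, complex numbers and the complex exponential *)

Ltac pos := solve [ assumption | lra | apply Cmod_ge_0 | apply Rabs_pos | apply pow2_ge_0 | match goal with
 | |- 0 < exp _ => apply exp_pos
 | |- 0 < Rpower _ _ => apply exp_pos
 | |- 0 < _*_ => apply Rmult_lt_0_compat; pos
 | |- 0 < _/_ => apply Rdiv_lt_0_compat; pos
 | |- 0 < / _ => apply Rinv_0_lt_compat; pos
 | |- 0 < _^_ => apply pow_lt; pos
 | |- 0 <= INR _ => apply pos_INR
 | |- 0 <= _*_ => apply Rmult_le_pos; pos
 | |- 0 <= _/_ => apply Rmult_le_pos; pos
 | |- 0 <= _^_ => apply pow_le; pos
 | |- 0 <= _+_ => apply Rplus_le_le_0_compat; pos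
 | |- 0 < INR _ => apply lt_0_INR; lia
 | |- 0 <= _ => left; pos
 | |- _ <> 0 => apply Rgt_not_eq; pos
 end ].
Ltac mull := apply Rmult_le_compat_l; [try pos|].
Ltac mulr := apply Rmult_le_compat_r; [try pos|].
Ltac mul := apply Rmult_le_compat; try pos.
Ltac fld := field; lra.
Create HintDb cont.
#[export] Hint Extern 6 (_ < _) => lra : cont.
#[export] Hint Extern 6 (_ <= _) => lra : cont.
#[export] Hint Extern 8 (continuous ?f _) => apply (ex_derive_continuous f); auto_derive; solve [auto | lra] : cont.
Ltac cont := solve [auto 9 with cont].
Ltac minmax := rewrite Rmin_left, Rmax_right by lra.
Tactic Notation "tr" uconstr(H) := eapply Rle_trans; [apply H|].
Tactic Notation "trr" uconstr(H) := eapply Rle_trans; [|apply H].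
Tactic Notation "via" uconstr(b) := apply Rle_trans with b.

Lemma Re_Cplus a b : Re (a+b)%C = Re a+Re b. Proof. auto. Qed.
Lemma Im_Cplus a b : Im (a+b)%C = Im a+Im b. Proof. auto. Qed.
Lemma Re_Copp a : Re (- a)%C = - Re a. Proof. auto. Qed.
Lemma Re_Cminus a b : Re (a-b)%C = Re a-Re b. Proof. auto. Qed.
Lemma Im_Cminus a b : Im (a-b)%C = Im a-Im b. Proof. auto. Qed.
Lemma Re_Cmult a b : Re (a*b)%C = Re a*Re b-Im a*Im b. Proof. auto. Qed.
Lemma Im_Cmult a b : Im (a*b)%C = Re a*Im b+Im a*Re b. Proof. auto. Qed.
Lemma Re_RtoC a : Re (RtoC a) = a. Proof. auto. Qed.
Lemma Im_RtoC a : Im (RtoC a) = 0. Proof. auto. Qed.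
Lemma C_eq a b : Re a = Re b -> Im a = Im b -> a = b.
Proof. destruct a, b; simpl; intros; subst; cont. Qed.

Lemma im_le_Cmod z : Rabs (Im z) <= Cmod z.
Proof. generalize (Rmax_Cmod z); intro H; tr Rmax_r; apply H. Qed.
Lemma Cmod_le_Re_Im z : Cmod z <= Rabs (Re z)+Rabs (Im z).
Proof.
 replace z with (RtoC (Re z)+Ci*RtoC (Im z))%C at 1.
 tr Cmod_triangle. rewrite Cmod_mult, Cmod_Ci, !Cmod_R; lra.
 apply C_eq; simpl; lra.
Qed.
Lemma Cmod_minus_sym a b : Cmod (a-b) = Cmod (b-a).
Proof. rewrite <- Cmod_opp; f_equal; ring. Qed.
Lemma Cmod_minus_le a b c : Cmod (a-c) <= Cmod (a-b)+Cmod (b-c).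
Proof. replace (a-c)%C with ((a-b)+(b-c))%C by ring. apply Cmod_triangle. Qed.
Lemma Cmod_le_minus a b : Cmod a <= Cmod b+Cmod (a-b).
Proof. replace a with (b+(a-b))%C at 1 by ring. apply Cmod_triangle. Qed.
Lemma Cmod_sub_le a b : Cmod (a-b) <= Cmod a+Cmod b.
Proof. tr Cmod_triangle; rewrite Cmod_opp; lra. Qed.
Lemma Cminus_eq_0 a b : (a-b = 0)%C -> a = b.
Proof. intro H. replace a with (a-b+b)%C by ring. rewrite H; ring. Qed.
Lemma Cmod_sq z : Cmod z*Cmod z = Re z*Re z+Im z*Im z.
Proof. generalize (Cmod2_alt z); lra. Qed.
Lemma Cmod_lt_neq a b : Cmod a < Cmod b -> (b-a <> 0)%C.
Proof. intros H E. apply Cminus_eq_0 in E; subst; lra. Qed.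
Lemma Cmult_eq_0 (a b : C) : (a*b = 0)%C -> a = 0 \/ b = 0.
Proof. destruct (classic (a = 0)) as [|Ha]; [auto|right].
 replace b with (/ a*(a*b))%C by (field; pos). rewrite H; ring.
Qed.

Lemma Cexp_plus a b : Cexp (a+b) = (Cexp a*Cexp b)%C.
Proof.
 apply C_eq; unfold Cexp; unfold Re, Im in *; simpl; rewrite exp_plus.
 rewrite cos_plus; lra. rewrite sin_plus; lra.
Qed.
Lemma Cexp_0 : Cexp 0 = 1.
Proof. apply C_eq; simpl; rewrite exp_0, ?cos_0, ?sin_0; lra. Qed.
Lemma Cmod_Cexp z : Cmod (Cexp z) = exp (Re z).
Proof.
 assert (H : 0 < exp (Re z)) by apply exp_pos.
 unfold Cmod, Cexp; simpl. generalize (sin2_cos2 (Im z)); unfold Rsqr; intro E.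
 replace (_+_) with (exp (Re z)*exp (Re z)); [apply sqrt_square; lra|nra].
Qed.
Lemma Cexp_neq_0 z : Cexp z <> 0.
Proof. intro H. generalize (Cmod_Cexp z), (exp_pos (Re z)). rewrite H, Cmod_0. lra. Qed.
Lemma Cexp_opp z : Cexp (- z) = (/ Cexp z)%C.
Proof.
 assert (Cexp (-z)*Cexp z = 1)%C by (rewrite <- Cexp_plus; replace (-z+z)%C with (RtoC 0) by ring; apply Cexp_0).
 replace (Cexp (-z)) with (Cexp (-z)*Cexp z * / Cexp z)%C by (field; apply Cexp_neq_0).
 rewrite H; ring.
Qed.
Lemma Cexp_RtoC r : Cexp (RtoC r) = RtoC (exp r).
Proof. apply C_eq; simpl; rewrite ?cos_0, ?sin_0; lra. Qed.

Lemma Rcpow_plus a z w : Rcpow a (z+w) = (Rcpow a z*Rcpow a w)%C.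
Proof. unfold Rcpow. rewrite <- Cexp_plus. f_equal; ring. Qed.
Lemma Rcpow_mult a b z : 0 < a -> 0 < b -> Rcpow (a*b) z = (Rcpow a z*Rcpow b z)%C.
Proof. intros. unfold Rcpow. rewrite <- Cexp_plus, ln_mult, RtoC_plus by auto. f_equal; ring. Qed.
Lemma Cmod_Rcpow a z : Cmod (Rcpow a z) = Rpower a (Re z).
Proof. unfold Rcpow, Rpower. rewrite Cmod_Cexp, Re_Cmult; simpl. f_equal; lra. Qed.
Lemma Rcpow_RtoC a r : Rcpow a (RtoC r) = RtoC (Rpower a r).
Proof. unfold Rcpow, Rpower. rewrite <- RtoC_mult. apply Cexp_RtoC. Qed.
Lemma Rcpow_1 a : 0 < a -> Rcpow a 1 = RtoC a.
Proof. intros; rewrite Rcpow_RtoC, Rpower_1; auto. Qed.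
Lemma Rcpow_1_l z : Rcpow 1 z = 1.
Proof. unfold Rcpow. rewrite ln_1, Cmult_0_r. apply Cexp_0. Qed.
Lemma Rcpow_opp a z : Rcpow a (- z) = (/ Rcpow a z)%C.
Proof. unfold Rcpow. rewrite <- Cexp_opp. f_equal; ring. Qed.

(** * Complex differentiation *)

(** Stated in the modulus with the value [l] as an argument: a derivative is a relation between
    total functions and numbers. The non-strict inequality makes [w = z] harmless. *)
Definition cderiv (f : C -> C) (z l : C) : Prop :=
 forall eps, 0 < eps -> exists d, 0 < d /\ forall w, Cmod (w-z) < d ->
  Cmod (f w-f z-l*(w-z)) <= eps*Cmod (w-z).
Definition ccont (f : C -> C) (z : C) : Prop :=
 forall eps, 0 < eps -> exists d, 0 < d /\ forall w, Cmod (w-z) < d ->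
  Cmod (f w-f z) < eps.

Lemma cderiv_ext_loc f g z l : (exists d, 0 < d /\ forall w, Cmod (w-z) < d -> f w = g w) ->
 cderiv f z l -> cderiv g z l.
Proof.
 intros (d & Hd & E) H eps He. destruct (H eps He) as (d' & Hd' & K).
 exists (Rmin d d'). split; [now apply Rmin_pos|]. intros w Hw.
 assert (Cmod (z-z) < d) by (replace (z-z)%C with (RtoC 0) by ring; rewrite Cmod_0; lra).
 rewrite <- !E; auto. apply K. eapply Rlt_le_trans; [apply Hw|apply Rmin_r].
 eapply Rlt_le_trans; [apply Hw|apply Rmin_l].
Qed.
Lemma cderiv_ext f g z l : (forall w, f w = g w) -> cderiv f z l -> cderiv g z l.
Proof. intros E; apply cderiv_ext_loc; exists 1; cont. Qed.
Lemma ccont_ext_loc f g z : (exists d, 0 < d /\ forall w, Cmod (w-z) < d -> f w = g w) ->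
 ccont f z -> ccont g z.
Proof.
 intros (d & Hd & E) H eps He. destruct (H eps He) as (d' & Hd' & K).
 exists (Rmin d d'). split; [now apply Rmin_pos|]. intros w Hw.
 assert (Cmod (z-z) < d) by (replace (z-z)%C with (RtoC 0) by ring; rewrite Cmod_0; lra).
 rewrite <- !E; auto. apply K. eapply Rlt_le_trans; [apply Hw|apply Rmin_r].
 eapply Rlt_le_trans; [apply Hw|apply Rmin_l].
Qed.
Lemma ccont_ext f g z : (forall w, f w = g w) -> ccont f z -> ccont g z.
Proof. intros E; apply ccont_ext_loc; exists 1; cont. Qed.

Lemma cderiv_ccont f z l : cderiv f z l -> ccont f z.
Proof.
 intros H eps He. destruct (H 1 Rlt_0_1) as (d & Hd & K).
 assert (Hl := Cmod_ge_0 l). assert (0 < eps/(Cmod l+2)) by pos.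
 exists (Rmin d (eps/(Cmod l+2))). split; [now apply Rmin_pos|]. intros w Hw.
 assert (W1 := Rlt_le_trans _ _ _ Hw (Rmin_l _ _)). assert (W2 := Rlt_le_trans _ _ _ Hw (Rmin_r _ _)).
 specialize (K w W1).
 replace (f w-f z)%C with ((f w-f z-l*(w-z))+l*(w-z))%C by ring.
 eapply Rle_lt_trans; [apply Cmod_triangle|]. rewrite Cmod_mult.
 apply (Rmult_lt_compat_r (Cmod l+2)) in W2; [|lra]. unfold Rdiv in W2. rewrite Rmult_assoc, Rinv_l in W2 by lra.
 nra.
Qed.

Lemma ccont_const (c : C) z : ccont (fun _ => c) z.
Proof. intros eps He. exists 1; split; [lra|]. intros. replace (c-c)%C with (RtoC 0) by ring. rewrite Cmod_0; lra. Qed.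
Lemma ccont_id z : ccont (fun w => w) z.
Proof. intros eps He. exists eps; auto. Qed.
Lemma ccont_plus f g z : ccont f z -> ccont g z -> ccont (fun w => f w+g w)%C z.
Proof.
 intros Hf Hg eps He. destruct (Hf (eps/2)) as (d1&D1&K1); [lra|]. destruct (Hg (eps/2)) as (d2&D2&K2); [lra|].
 exists (Rmin d1 d2); split; [now apply Rmin_pos|]. intros w Hw.
 specialize (K1 w (Rlt_le_trans _ _ _ Hw (Rmin_l _ _))). specialize (K2 w (Rlt_le_trans _ _ _ Hw (Rmin_r _ _))).
 replace (f w+g w-(f z+g z))%C with ((f w-f z)+(g w-g z))%C by ring.
 eapply Rle_lt_trans; [apply Cmod_triangle|lra].
Qed.
Lemma ccont_opp f z : ccont f z -> ccont (fun w => - f w)%C z.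
Proof.
 intros H eps He. destruct (H eps He) as (d&D&K). exists d; split; auto. intros w Hw.
 replace (- f w - - f z)%C with (-(f w-f z))%C by ring. rewrite Cmod_opp; auto.
Qed.
Lemma ccont_minus f g z : ccont f z -> ccont g z -> ccont (fun w => f w-g w)%C z.
Proof. intros. apply ccont_plus; auto. apply ccont_opp; pos. Qed.
Lemma ccont_mult f g z : ccont f z -> ccont g z -> ccont (fun w => f w*g w)%C z.
Proof.
 intros Hf Hg eps He. assert (Ff := Cmod_ge_0 (f z)). assert (Gg := Cmod_ge_0 (g z)).
 set (e := Rmin 1 (eps/(Cmod (f z)+Cmod (g z)+2))).
 assert (E0 : 0 < e) by (apply Rmin_pos; pos).
 assert (E1 : e <= 1) by apply Rmin_l.
 assert (E2 : e*(Cmod (f z)+Cmod (g z)+2) <= eps).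
 { replace eps with (eps/(Cmod (f z)+Cmod (g z)+2)*(Cmod (f z)+Cmod (g z)+2)) by fld.
  mulr; apply Rmin_r. }
 destruct (Hf e E0) as (d1&D1&K1). destruct (Hg e E0) as (d2&D2&K2).
 exists (Rmin d1 d2); split; [now apply Rmin_pos|]. intros w Hw.
 specialize (K1 w (Rlt_le_trans _ _ _ Hw (Rmin_l _ _))). specialize (K2 w (Rlt_le_trans _ _ _ Hw (Rmin_r _ _))).
 replace (f w*g w-f z*g z)%C with ((f w-f z)*(g w-g z)+f z*(g w-g z)+(f w-f z)*g z)%C by ring.
 eapply Rle_lt_trans; [apply Cmod_triangle|].
 eapply Rle_lt_trans; [apply Rplus_le_compat_r, Cmod_triangle|]. rewrite !Cmod_mult.
 assert (P1 := Cmod_ge_0 (f w-f z)). nra.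
Qed.
#[export] Hint Resolve ccont_const ccont_id ccont_plus ccont_opp ccont_minus ccont_mult : cont.
Lemma ccont_comp f g z : ccont g z -> ccont f (g z) -> ccont (fun w => f (g w)) z.
Proof.
 intros Hg Hf eps He. destruct (Hf eps He) as (d&D&K). destruct (Hg d D) as (d'&D'&K').
 exists d'; auto.
Qed.
Lemma ccont_neq_0 f z : ccont f z -> f z <> 0 -> exists d, 0 < d /\ forall w, Cmod (w-z) < d -> Cmod (f z)/2 < Cmod (f w).
Proof.
 intros H Hz. apply Cmod_gt_0 in Hz. destruct (H (Cmod (f z)/2)) as (d&D&K); [lra|].
 exists d; split; auto. intros w Hw. specialize (K w Hw).
 assert (X := Cmod_le_minus (f z) (f w)). rewrite Cmod_minus_sym in X. lra.
Qed.

Lemma cderiv_const (c z : C) : cderiv (fun _ => c) z 0.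
Proof.
 intros eps He. exists 1; split; [lra|]. intros. replace (c-c-0*(w-z))%C with (RtoC 0) by ring.
 rewrite Cmod_0. pos.
Qed.
Lemma cderiv_id z : cderiv (fun w => w) z 1.
Proof.
 intros eps He. exists 1; split; [lra|]. intros. replace (w-z-1*(w-z))%C with (RtoC 0) by ring.
 rewrite Cmod_0. pos.
Qed.
Lemma cderiv_plus f g z a b : cderiv f z a -> cderiv g z b -> cderiv (fun w => f w+g w)%C z (a+b).
Proof.
 intros Hf Hg eps He. destruct (Hf (eps/2)) as (d1&D1&K1); [lra|]. destruct (Hg (eps/2)) as (d2&D2&K2); [lra|].
 exists (Rmin d1 d2); split; [now apply Rmin_pos|]. intros w Hw.
 specialize (K1 w (Rlt_le_trans _ _ _ Hw (Rmin_l _ _))). specialize (K2 w (Rlt_le_trans _ _ _ Hw (Rmin_r _ _))).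
 replace (f w+g w-(f z+g z)-(a+b)*(w-z))%C with ((f w-f z-a*(w-z))+(g w-g z-b*(w-z)))%C by ring.
 tr Cmod_triangle; lra.
Qed.
Lemma cderiv_comp f g z a b : cderiv g z a -> cderiv f (g z) b -> cderiv (fun w => f (g w)) z (b*a).
Proof.
 intros Hg Hf eps He. assert (A := Cmod_ge_0 a). assert (B := Cmod_ge_0 b).
 set (e1 := eps/2/(Cmod a+1)). set (e2 := Rmin 1 (eps/2/(Cmod b+1))).
 assert (E1 : 0 < e1) by (apply Rdiv_lt_0_compat; lra).
 assert (E2 : 0 < e2) by (apply Rmin_pos; pos).
 assert (X1 : e1*(Cmod a+1) = eps/2) by (unfold e1; fld).
 assert (X2 : e2*(Cmod b+1) <= eps/2).
 { replace (eps/2) with (eps/2/(Cmod b+1)*(Cmod b+1)) by fld.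
  mulr; apply Rmin_r. }
 assert (X3 : e2 <= 1) by apply Rmin_l.
 destruct (Hf e1 E1) as (d1&D1&K1). destruct (Hg e2 E2) as (d2&D2&K2).
 destruct (cderiv_ccont _ _ _ Hg d1 D1) as (d3&D3&K3).
 exists (Rmin d2 d3); split; [now apply Rmin_pos|]. intros w Hw.
 specialize (K2 w (Rlt_le_trans _ _ _ Hw (Rmin_l _ _))). specialize (K3 w (Rlt_le_trans _ _ _ Hw (Rmin_r _ _))).
 specialize (K1 (g w) K3).
 replace (f (g w)-f (g z)-b*a*(w-z))%C with
  ((f (g w)-f (g z)-b*(g w-g z))+b*(g w-g z-a*(w-z)))%C by ring.
 tr Cmod_triangle. rewrite Cmod_mult.
 assert (Y : Cmod (g w-g z) <= (Cmod a+1)*Cmod (w-z)).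
 { replace (g w-g z)%C with ((g w-g z-a*(w-z))+a*(w-z))%C by ring.
  tr Cmod_triangle. rewrite Cmod_mult. assert (P := Cmod_ge_0 (w-z)). nra. }
 assert (P := Cmod_ge_0 (w-z)).
 nra.
Qed.
Lemma cderiv_mult_const c f z a : cderiv f z a -> cderiv (fun w => c*f w)%C z (c*a).
Proof.
 intros Hf. apply (cderiv_comp (fun w => c*w)%C f z a c Hf).
 intros eps He. exists 1; split; [lra|]. intros. replace (c*w-c* f z-c*(w-f z))%C with (RtoC 0) by ring.
 rewrite Cmod_0. pos.
Qed.
Lemma cderiv_opp f z a : cderiv f z a -> cderiv (fun w => - f w)%C z (- a).
Proof.
 intros H. apply (cderiv_mult_const (-(1))) in H. replace (-a)%C with (-(1)*a)%C by ring.
 eapply cderiv_ext; [|apply H]. intros; simpl; ring.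
Qed.
Lemma cderiv_minus f g z a b : cderiv f z a -> cderiv g z b -> cderiv (fun w => f w-g w)%C z (a-b).
Proof. intros. apply cderiv_plus; auto. apply cderiv_opp; pos. Qed.
Lemma cderiv_sqr z : cderiv (fun w => w*w)%C z (2*z).
Proof.
 intros eps He. exists eps; split; auto. intros w Hw.
 replace (w*w-z*z-2*z*(w-z))%C with ((w-z)*(w-z))%C by ring. rewrite Cmod_mult.
 mulr; lra.
Qed.
(* Polarisation reduces the product rule to the chain rule for squaring. *)
Lemma cderiv_mult f g z a b : cderiv f z a -> cderiv g z b -> cderiv (fun w => f w*g w)%C z (a*g z+f z*b).
Proof.
 intros Hf Hg.
 assert (H1 := cderiv_comp _ _ _ _ _ (cderiv_plus _ _ _ _ _ Hf Hg) (cderiv_sqr _)).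
 assert (H2 := cderiv_comp _ _ _ _ _ (cderiv_minus _ _ _ _ _ Hf Hg) (cderiv_sqr _)).
 assert (H3 := cderiv_mult_const (/4) _ _ _ (cderiv_minus _ _ _ _ _ H1 H2)).
 replace (a*g z+f z*b)%C with (/ 4*(2*(f z+g z)*(a+b)-2*(f z-g z)*(a-b)))%C.
 eapply cderiv_ext; [|apply H3]. intros; simpl.
 all: fld.
Qed.
Lemma cderiv_inv (z : C) : z <> 0 -> cderiv (fun w => / w)%C z (- / (z*z)).
Proof.
 intros Hz eps He. assert (Z : 0 < Cmod z) by now apply Cmod_gt_0.
 set (e := eps*(Cmod z*Cmod z*Cmod z)/2).
 assert (E : 0 < e) by (unfold e; pos).
 exists (Rmin (Cmod z/2) e). split; [apply Rmin_pos; lra|]. intros w Hw.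
 assert (W1 := Rlt_le_trans _ _ _ Hw (Rmin_l _ _)). assert (W2 := Rlt_le_trans _ _ _ Hw (Rmin_r _ _)).
 assert (Wz : Cmod z/2 < Cmod w).
 { assert (X := Cmod_le_minus z w). rewrite Cmod_minus_sym in X. lra. }
 assert (Hw0 : w <> 0) by (apply Cmod_gt_0; lra).
 replace (/ w - / z - - / (z*z)*(w-z))%C with ((w-z)*(w-z) * / (w*(z*z)))%C by (field; auto).
 rewrite Cmod_mult, Cmod_inv, !Cmod_mult by (repeat apply Cmult_neq_0; pos).
 assert (Cmod (w-z) * / (Cmod w*(Cmod z*Cmod z)) <= eps).
 { assert (PP : 0 < Cmod w*(Cmod z*Cmod z)) by pos.
  apply (Rmult_le_reg_r (Cmod w*(Cmod z*Cmod z))); auto. rewrite Rmult_assoc, Rinv_l, Rmult_1_r by lra.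
  unfold e in W2. assert (Cmod z/2*(Cmod z*Cmod z)*eps <= Cmod w*(Cmod z*Cmod z)*eps).
  repeat mulr; lra. nra. }
 assert (P := Cmod_ge_0 (w-z)). nra.
Qed.
Lemma cderiv_div f g z a b : cderiv f z a -> cderiv g z b -> g z <> 0 ->
 cderiv (fun w => f w/g w)%C z ((a*g z-f z*b)/(g z*g z)).
Proof.
 intros Hf Hg Hz. assert (H := cderiv_mult _ _ _ _ _ Hf (cderiv_comp _ _ _ _ _ Hg (cderiv_inv _ Hz))). eapply eq_ind; [apply H|]. field; pos.
Qed.
Lemma ccont_inv f z : ccont f z -> f z <> 0 -> ccont (fun w => / f w)%C z.
Proof. intros H Hz. apply (ccont_comp (fun w => / w)%C f); auto. eapply cderiv_ccont, cderiv_inv; pos. Qed.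

(** The lower bound is [1+a <= exp a]; the upper one is the same inequality at [-a/2], squared and
    inverted. *)
Lemma exp_small_bound a : Rabs a <= 1/4 -> Rabs (exp a-1-a) <= a*a.
Proof.
 intros Ha. apply Rabs_le_between in Ha.
 assert (H1 : 1+a <= exp a) by (destruct (Req_dec a 0); [subst; rewrite exp_0; lra|left; apply exp_ineq1; lra]).
 rewrite Rabs_right by lra.
 assert (H2 : 1-a/2 <= exp (-(a/2))).
 { destruct (Req_dec a 0); [subst; replace (-(0/2)) with 0 by lra; lra|]. left. apply exp_ineq1; lra. }
 assert (H3 : exp a*(exp (-(a/2))*exp (-(a/2))) = 1) by (rewrite <- !exp_plus; replace (a+_) with 0 by lra; apply exp_0).
 assert (H4 : exp a*((1-a/2)*(1-a/2)) <= 1).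
 { rewrite <- H3. mull. nra. }
 nra.
Qed.

Lemma Rabs_sqr_eq a : Rabs a*Rabs a = a*a.
Proof. generalize (Rsqr_abs a); auto. Qed.
Lemma sin_abs_le b : Rabs (sin b) <= Rabs b.
Proof.
 assert (P : forall x, 0 < x -> - x <= sin x <= x).
 { intros x Hx. split; [|left; apply sin_lt_x; lra].
  destruct (Rle_dec x 1). assert (0 <= sin x); [|lra]. apply sin_ge_0; generalize PI2_1; lra.
  generalize (SIN_bound x); lra. }
 destruct (Rtotal_order b 0) as [H|[H|H]].
 - rewrite (Rabs_left b) by auto. generalize (P (-b)); rewrite sin_neg; intro. apply Rabs_le_between; lra.
 - subst; rewrite sin_0; lra.
 - rewrite (Rabs_right b) by lra. apply Rabs_le_between, P; lra.
Qed.
Lemma cos_sub_1_abs_le b : Rabs (cos b-1) <= b*b/2.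
Proof.
 replace (cos b-1) with (- (2*sin (b/2)*sin (b/2))).
 2: replace b with (2*(b/2)) at 3 by lra; rewrite cos_2a_sin; lra.
 rewrite Rabs_Ropp. assert (H := sin_abs_le (b/2)).
 rewrite !Rabs_mult, (Rabs_right 2) by lra. assert (P := Rabs_pos (sin (b/2))).
 replace (b*b/2) with (2*(Rabs (b/2)*Rabs (b/2))). nra.
 rewrite <- Rabs_mult, Rabs_right by nra. lra.
Qed.
Lemma sin_sub_abs_le b : Rabs b <= 1 -> Rabs (sin b-b) <= b*b.
Proof. destruct (MVT_gen (fun x => sin x-x) 0 b (fun x => cos x-1)) as (c & Hc & E).
 { intros; auto_derive; lra. }
 { intros x _. apply derivable_continuous_pt. reg. }
 rewrite sin_0 in E. replace (sin b-b) with ((cos c-1)*(b-0)) by lra.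
 rewrite Rabs_mult, Rminus_0_r.
 assert (Hc' : Rabs c <= Rabs b).
 { revert Hc. unfold Rmin, Rmax, Rabs. destruct (Rle_dec 0 b), (Rcase_abs c), (Rcase_abs b); lra. }
 assert (X := cos_sub_1_abs_le c).
 assert (c*c <= Rabs b*Rabs b) by (rewrite <- (Rabs_right (c*c)), Rabs_mult by nra; mul).
 replace (b*b) with (Rabs b*Rabs b) by (rewrite <- Rabs_mult, Rabs_right by nra; lra).
 assert (P := Rabs_pos b). nra.
Qed.
(** This estimate at 0 carries the differentiability of the exponential everywhere: the functional
    equation multiplies it by [Cexp z]. *)
Lemma Cexp_quadratic h : Cmod h <= 1/4 -> Cmod (Cexp h-1-h) <= 3*(Cmod h*Cmod h).
Proof.
 intro H. assert (Ha := re_le_Cmod h). assert (Hb := im_le_Cmod h).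
 tr Cmod_le_Re_Im. rewrite Cmod_sq, !Re_Cminus, !Im_Cminus. simpl.
 set (a := Re h) in *; set (b := Im h) in *.
 assert (E1 := exp_small_bound a ltac:(lra)). assert (E2 := cos_sub_1_abs_le b). assert (E3 := sin_sub_abs_le b ltac:(lra)).
 assert (E4 := sin_abs_le b).
 assert (Ea : Rabs (exp a-1) <= 2*Rabs a).
 { replace (exp a-1) with ((exp a-1-a)+a) by ring. tr Rabs_triang.
  assert (a*a <= Rabs a). { rewrite <- (Rabs_right (a*a)), Rabs_mult by nra. assert (P := Rabs_pos a). nra. } lra. }
 assert (E5 : exp a <= 2). { apply Rabs_le_between in Ea. lra. }
 assert (exp a > 0) by apply exp_pos.
 assert (K1 : Rabs (exp a*cos b-1-a) <= a*a+b*b).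
 { replace (exp a*cos b-1-a) with ((exp a-1-a)+exp a*(cos b-1)) by ring.
  tr Rabs_triang. rewrite Rabs_mult, (Rabs_right (exp a)) by lra. nra. }
 assert (K2 : Rabs (exp a*sin b-0-b) <= a*a+b*b+b*b).
 { replace (exp a*sin b-0-b) with ((exp a-1)*sin b+(sin b-b)) by ring.
  tr Rabs_triang. rewrite Rabs_mult.
  assert (Rabs (exp a-1)*Rabs (sin b) <= 2*Rabs a*Rabs b) by (mul).
  assert (2*Rabs a*Rabs b <= a*a+b*b).
  { rewrite <- (Rabs_sqr_eq a), <- (Rabs_sqr_eq b). generalize (Rle_0_sqr (Rabs a-Rabs b)); unfold Rsqr; lra. } lra. }
 nra.
Qed.
Lemma cderiv_Cexp z : cderiv Cexp z (Cexp z).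
Proof.
 intros eps He. assert (P : 0 < Cmod (Cexp z)) by (rewrite Cmod_Cexp; pos).
 exists (Rmin (1/4) (eps/(3*Cmod (Cexp z)))). split; [apply Rmin_pos; pos|].
 intros w Hw. assert (W1 := Rlt_le_trans _ _ _ Hw (Rmin_l _ _)). assert (W2 := Rlt_le_trans _ _ _ Hw (Rmin_r _ _)).
 replace (Cexp w) with (Cexp z*Cexp (w-z))%C by (rewrite <- Cexp_plus; f_equal; ring).
 replace (Cexp z*Cexp (w-z)-Cexp z-Cexp z*(w-z))%C with (Cexp z*(Cexp (w-z)-1-(w-z)))%C by ring.
 rewrite Cmod_mult. assert (Q := Cexp_quadratic (w-z) (Rlt_le _ _ W1)). assert (P2 := Cmod_ge_0 (w-z)).
 apply (Rmult_le_compat_l (Cmod (Cexp z))) in Q; [|lra].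
 apply (Rmult_lt_compat_r (3*Cmod (Cexp z))) in W2; [|lra].
 replace (eps/(3*Cmod (Cexp z))*(3*Cmod (Cexp z))) with eps in W2 by fld.
 nra.
Qed.
Lemma cderiv_Rcpow_comp a f z l : cderiv f z l -> cderiv (fun w => Rcpow a (f w)) z (RtoC (ln a)*Rcpow a (f z)*l).
Proof.
 intro H. assert (K := cderiv_comp Cexp _ _ _ _ (cderiv_mult_const (RtoC (ln a)) _ _ _ H) (cderiv_Cexp _)).
 unfold Rcpow. replace (RtoC (ln a)*Cexp (f z*RtoC (ln a))*l)%C with (Cexp (RtoC (ln a)*f z)*(RtoC (ln a)*l))%C
  by (rewrite (Cmult_comm (f z)); ring).
 eapply cderiv_ext; [|apply K]. intro w; simpl. f_equal; ring.
Qed.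
Lemma ccont_Rcpow_comp a f z : ccont f z -> ccont (fun w => Rcpow a (f w)) z.
Proof.
 intro H. apply (ccont_comp Cexp (fun w => f w*RtoC (ln a))%C).
 cont. eapply cderiv_ccont, cderiv_Cexp.
Qed.
#[export] Hint Resolve ccont_inv ccont_Rcpow_comp : cont.

(** * Curves and integrals of complex-valued functions of a real variable *)

(** Continuity of a curve is phrased as continuity of [g (Re z)] on C, so that the closure lemmas
    for [ccont] apply verbatim. *)
Definition rcont (g : R -> C) (t : R) : Prop := ccont (fun z => g (Re z)) (RtoC t).
Definition rderiv (g : R -> C) (t : R) (l : C) : Prop :=
 forall eps, 0 < eps -> exists d, 0 < d /\ forall u, Rabs (u-t) < d ->
  Cmod (g u-g t-l*RtoC (u-t)) <= eps*Rabs (u-t).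

Lemma ccont_RtoC_comp (h : R -> R) (p : C -> R) z :
 continuous h (p z) -> (forall w, Rabs (p w-p z) <= Cmod (w-z)) -> ccont (fun w => RtoC (h (p w))) z.
Proof.
 intros H Hp eps He. apply filterlim_locally with (eps := mkposreal eps He) in H.
 destruct H as (d & K). exists d; split; [apply cond_pos|]. intros w Hw.
 rewrite <- RtoC_minus, Cmod_R. apply (K (p w)).
 apply Rle_lt_trans with (2:=Hw). auto.
Qed.
Lemma ccont_Re_comp h z : continuous h (Re z) -> ccont (fun w => RtoC (h (Re w))) z.
Proof. intros H; apply ccont_RtoC_comp; auto. intro w. rewrite <- Re_Cminus. apply re_le_Cmod. Qed.
Lemma ccont_Im_comp h z : continuous h (Im z) -> ccont (fun w => RtoC (h (Im w))) z.
Proof. intros H; apply ccont_RtoC_comp; auto. intro w. rewrite <- Im_Cminus. apply im_le_Cmod. Qed.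
Lemma rcont_eps g t : rcont g t <-> forall eps, 0 < eps -> exists d, 0 < d /\ forall u, Rabs (u-t) < d -> Cmod (g u-g t) < eps.
Proof.
 split; intros H eps He; destruct (H eps He) as (d & D & K); exists d; split; auto.
 - intros u Hu. apply (K (RtoC u)). rewrite <- RtoC_minus, Cmod_R; lra.
 - intros w Hw. apply (K (Re w)). apply Rle_lt_trans with (2:=Hw).
  replace (Re w-t) with (Re (w-RtoC t)) by auto. apply re_le_Cmod.
Qed.
Lemma rcont_continuous_comp (p : C -> R) g t : (forall z w, Rabs (p w-p z) <= Cmod (w-z)) ->
 rcont g t -> continuous (fun u => p (g u)) t.
Proof.
 intros Hp H. apply filterlim_locally. intro eps. destruct (proj1 (rcont_eps g t) H eps (cond_pos eps)) as (d & D & K).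
 exists (mkposreal d D). intros u Hu. eapply Rle_lt_trans; [auto|]. auto.
Qed.
Lemma rcont_Re g t : rcont g t -> continuous (fun u => Re (g u)) t.
Proof. apply rcont_continuous_comp. intros; rewrite <- Re_Cminus; apply re_le_Cmod. Qed.
Lemma rcont_Im g t : rcont g t -> continuous (fun u => Im (g u)) t.
Proof. apply rcont_continuous_comp. intros; rewrite <- Im_Cminus; apply im_le_Cmod. Qed.
Lemma Cmod_lipschitz z w : Rabs (Cmod w-Cmod z) <= Cmod (w-z).
Proof.
 assert (A := Cmod_le_minus w z). assert (B := Cmod_le_minus z w). rewrite Cmod_minus_sym in B.
 apply Rabs_le_between; lra.
Qed.
Lemma rcont_Cmod g t : rcont g t -> continuous (fun u => Cmod (g u)) t.
Proof. apply rcont_continuous_comp. apply Cmod_lipschitz. Qed.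
Lemma rcont_const c t : rcont (fun _ => c) t. Proof. apply ccont_const. Qed.
Lemma rcont_plus f g t : rcont f t -> rcont g t -> rcont (fun u => f u+g u)%C t. Proof. apply ccont_plus. Qed.
Lemma rcont_minus f g t : rcont f t -> rcont g t -> rcont (fun u => f u-g u)%C t. Proof. apply ccont_minus. Qed.
Lemma rcont_mult f g t : rcont f t -> rcont g t -> rcont (fun u => f u*g u)%C t. Proof. apply ccont_mult. Qed.
Lemma rcont_inv f t : rcont f t -> f t <> 0 -> rcont (fun u => / f u)%C t. Proof. apply ccont_inv. Qed.
Lemma rcont_comp f g t : ccont f (g t) -> rcont g t -> rcont (fun u => f (g u)) t.
Proof. intros H K. apply (ccont_comp f (fun z => g (Re z))); pos. Qed.
Lemma rcont_RtoC h t : continuous h t -> rcont (fun u => RtoC (h u)) t. Proof. intro; apply ccont_Re_comp; pos. Qed.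
Lemma rcont_ext f g t : (forall u, f u = g u) -> rcont f t -> rcont g t.
Proof. intro E. apply ccont_ext. auto. Qed.
Lemma rcont_pair (f g : R -> R) t : continuous f t -> continuous g t -> rcont (fun u => (f u, g u)) t.
Proof.
 intros Hf Hg. apply rcont_ext with (fun u => RtoC (f u)+Ci*RtoC (g u))%C.
 intro; apply C_eq; simpl; lra.
 apply rcont_plus; [|apply rcont_mult; [apply rcont_const|]]; apply rcont_RtoC; pos.
Qed.
Lemma rcont_conj f t : rcont f t -> rcont (fun u => Cconj (f u)) t.
Proof. intro H. apply rcont_pair. apply rcont_Re; pos. apply (continuous_opp (fun u => Im (f u))), rcont_Im; pos. Qed.
Lemma continuous_mult_R (f g : R -> R) t : continuous f t -> continuous g t -> continuous (fun u => f u*g u) t. Proof. apply (continuous_mult (K := R_AbsRing)). Qed.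
Lemma continuous_plus_R (f g : R -> R) t : continuous f t -> continuous g t -> continuous (fun u => f u+g u) t. Proof. apply (continuous_plus (V := R_NormedModule)). Qed.
Lemma continuous_minus_R (f g : R -> R) t : continuous f t -> continuous g t -> continuous (fun u => f u-g u) t. Proof. apply (continuous_minus (V := R_NormedModule)). Qed.
#[export] Hint Resolve rcont_Re rcont_Im rcont_Cmod rcont_const rcont_plus rcont_minus rcont_mult rcont_inv rcont_RtoC rcont_pair rcont_conj continuous_mult_R continuous_plus_R continuous_minus_R continuous_const continuous_id : cont.

Lemma rderiv_rcont g t l : rderiv g t l -> rcont g t.
Proof.
 intro H. apply rcont_eps. intros eps He. destruct (H 1 Rlt_0_1) as (d & D & K).
 assert (Hl := Cmod_ge_0 l). assert (0 < eps/(Cmod l+2)) by pos.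
 exists (Rmin d (eps/(Cmod l+2))). split; [now apply Rmin_pos|]. intros w Hw.
 assert (W1 := Rlt_le_trans _ _ _ Hw (Rmin_l _ _)). assert (W2 := Rlt_le_trans _ _ _ Hw (Rmin_r _ _)).
 specialize (K w W1).
 replace (g w-g t)%C with ((g w-g t-l*RtoC (w-t))+l*RtoC (w-t))%C by ring.
 eapply Rle_lt_trans; [apply Cmod_triangle|]. rewrite Cmod_mult, Cmod_R.
 apply (Rmult_lt_compat_r (Cmod l+2)) in W2; [|lra]. unfold Rdiv in W2. rewrite Rmult_assoc, Rinv_l in W2 by lra.
 nra.
Qed.
Lemma is_derive_eps (f : R -> R) t l : is_derive f t l <->
 forall eps, 0 < eps -> exists d, 0 < d /\ forall u, Rabs (u-t) < d -> Rabs (f u-f t-l*(u-t)) <= eps*Rabs (u-t).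
Proof.
 split.
 - intros (_ & H) eps He. destruct (H t (fun P K => K) (mkposreal eps He)) as (d & K).
  exists d; split; [apply cond_pos|]. intros u Hu. specialize (K u Hu).
  replace (f u-f t-l*(u-t)) with (f u + - f t + - ((u + - t)*l)) by ring. pos.
 - split; [apply is_linear_scal_l|]. intros x Hx. apply (@is_filter_lim_locally_unique R_AbsRing (AbsRing_NormedModule R_AbsRing)) in Hx. subst x.
  intros eps. destruct (H eps (cond_pos eps)) as (d & D & K). exists (mkposreal d D). intros u Hu. specialize (K u Hu).
  unfold norm, minus, plus, opp, scal; simpl. unfold mult, abs; simpl.
  replace (f u + - f t + - ((u + - t)*l)) with (f u-f t-l*(u-t)) by ring. pos.
Qed.
Lemma rderiv_Re g t l : rderiv g t l -> is_derive (fun u => Re (g u)) t (Re l).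
Proof.
 intro H. apply is_derive_eps. intros eps He. destruct (H eps He) as (d & D & K). exists d; split; auto.
 intros u Hu. specialize (K u Hu). trr K. trr re_le_Cmod.
 right; f_equal. rewrite !Re_Cminus, Re_Cmult; simpl; lra.
Qed.
Lemma rderiv_Im g t l : rderiv g t l -> is_derive (fun u => Im (g u)) t (Im l).
Proof.
 intro H. apply is_derive_eps. intros eps He. destruct (H eps He) as (d & D & K). exists d; split; auto.
 intros u Hu. specialize (K u Hu). trr K. trr im_le_Cmod.
 right; f_equal. rewrite !Im_Cminus, Im_Cmult; simpl; lra.
Qed.
Lemma rderiv_components g t l : is_derive (fun u => Re (g u)) t (Re l) -> is_derive (fun u => Im (g u)) t (Im l) -> rderiv g t l.
Proof.
 intros H1 H2 eps He. destruct (proj1 (is_derive_eps _ _ _) H1 (eps/2)) as (d1&D1&K1); [lra|].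
 destruct (proj1 (is_derive_eps _ _ _) H2 (eps/2)) as (d2&D2&K2); [lra|].
 exists (Rmin d1 d2); split; [now apply Rmin_pos|]. intros w Hw.
 specialize (K1 w (Rlt_le_trans _ _ _ Hw (Rmin_l _ _))). specialize (K2 w (Rlt_le_trans _ _ _ Hw (Rmin_r _ _))).
 tr Cmod_le_Re_Im.
 replace (Re (g w-g t-l*RtoC (w-t))) with (Re (g w)-Re (g t)-Re l*(w-t)) by (rewrite !Re_Cminus, Re_Cmult; simpl; lra).
 replace (Im (g w-g t-l*RtoC (w-t))) with (Im (g w)-Im (g t)-Im l*(w-t)) by (rewrite !Im_Cminus, Im_Cmult; simpl; lra).
 lra.
Qed.
Lemma rderiv_comp f g t a b : rderiv g t a -> cderiv f (g t) b -> rderiv (fun w => f (g w)) t (b*a).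
Proof.
 intros Hg Hf eps He. assert (A := Cmod_ge_0 a). assert (B := Cmod_ge_0 b).
 set (e1 := eps/2/(Cmod a+1)). set (e2 := Rmin 1 (eps/2/(Cmod b+1))).
 assert (E1 : 0 < e1) by (apply Rdiv_lt_0_compat; lra).
 assert (E2 : 0 < e2) by (apply Rmin_pos; pos).
 assert (X1 : e1*(Cmod a+1) = eps/2) by (unfold e1; fld).
 assert (X2 : e2*(Cmod b+1) <= eps/2).
 { replace (eps/2) with (eps/2/(Cmod b+1)*(Cmod b+1)) by fld.
  mulr; apply Rmin_r. }
 assert (X3 : e2 <= 1) by apply Rmin_l.
 destruct (Hf e1 E1) as (d1&D1&K1). destruct (Hg e2 E2) as (d2&D2&K2).
 destruct (proj1 (rcont_eps _ _) (rderiv_rcont _ _ _ Hg) d1 D1) as (d3&D3&K3).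
 exists (Rmin d2 d3); split; [now apply Rmin_pos|]. intros w Hw.
 specialize (K2 w (Rlt_le_trans _ _ _ Hw (Rmin_l _ _))). specialize (K3 w (Rlt_le_trans _ _ _ Hw (Rmin_r _ _))).
 specialize (K1 (g w) K3).
 replace (f (g w)-f (g t)-b*a*RtoC (w-t))%C with
  ((f (g w)-f (g t)-b*(g w-g t))+b*(g w-g t-a*RtoC (w-t)))%C by ring.
 tr Cmod_triangle. rewrite Cmod_mult.
 assert (P := Rabs_pos (w-t)).
 assert (Y : Cmod (g w-g t) <= (Cmod a+1)*Rabs (w-t)).
 { replace (g w-g t)%C with ((g w-g t-a*RtoC (w-t))+a*RtoC (w-t))%C by ring.
  tr Cmod_triangle. rewrite Cmod_mult, Cmod_R. nra. }
 nra.
Qed.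
Lemma rderiv_ext_loc f g t l : (exists d, 0 < d /\ forall u, Rabs (u-t) < d -> f u = g u) -> rderiv f t l -> rderiv g t l.
Proof.
 intros (d & Hd & E) H eps He. destruct (H eps He) as (d' & Hd' & K).
 exists (Rmin d d'). split; [now apply Rmin_pos|]. intros w Hw.
 assert (Rabs (t-t) < d) by (replace (t-t) with 0 by ring; rewrite Rabs_R0; lra).
 rewrite <- !E; auto. apply K. eapply Rlt_le_trans; [apply Hw|apply Rmin_r].
 eapply Rlt_le_trans; [apply Hw|apply Rmin_l].
Qed.
Lemma rderiv_ext f g t l : (forall u, f u = g u) -> rderiv f t l -> rderiv g t l.
Proof. intro E. apply rderiv_ext_loc; exists 1; cont. Qed.
Lemma rderiv_affine (a b : C) t : rderiv (fun u => a+b*RtoC u)%C t b.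
Proof.
 intros eps He. exists 1; split; [lra|]. intros u _.
 replace (a+b*u-(a+b*t)-b*RtoC (u-t))%C with (RtoC 0) by (rewrite RtoC_minus; ring).
 rewrite Cmod_0. pos.
Qed.
Lemma rderiv_mult_const c f t a : rderiv f t a -> rderiv (fun w => c*f w)%C t (c*a).
Proof.
 intros Hf. apply (rderiv_comp (fun w => c*w)%C f t a c Hf).
 assert (H := cderiv_mult_const c _ _ _ (cderiv_id (f t))). replace (c*1)%C with c in H by ring. pos.
Qed.

Lemma rderiv_plus f g t a b : rderiv f t a -> rderiv g t b -> rderiv (fun u => f u+g u)%C t (a+b).
Proof.
 intros Hf Hg eps He. destruct (Hf (eps/2)) as (d1&D1&K1); [lra|]. destruct (Hg (eps/2)) as (d2&D2&K2); [lra|].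
 exists (Rmin d1 d2); split; [now apply Rmin_pos|]. intros w Hw.
 specialize (K1 w (Rlt_le_trans _ _ _ Hw (Rmin_l _ _))). specialize (K2 w (Rlt_le_trans _ _ _ Hw (Rmin_r _ _))).
 replace (f w+g w-(f t+g t)-(a+b)*RtoC (w-t))%C with ((f w-f t-a*RtoC (w-t))+(g w-g t-b*RtoC (w-t)))%C by ring.
 tr Cmod_triangle; lra.
Qed.
Lemma rderiv_mult f g t a b : rderiv f t a -> rderiv g t b -> rderiv (fun u => f u*g u)%C t (a*g t+f t*b).
Proof.
 intros Hf Hg.
 assert (H1 := rderiv_comp _ _ _ _ _ (rderiv_plus _ _ _ _ _ Hf Hg) (cderiv_sqr _)).
 assert (H2 := rderiv_comp _ _ _ _ _ (rderiv_plus _ _ _ _ _ Hf (rderiv_mult_const (-(1)) _ _ _ Hg)) (cderiv_sqr _)).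
 assert (H3 := rderiv_mult_const (/4) _ _ _ (rderiv_plus _ _ _ _ _ H1 (rderiv_mult_const (-(1)) _ _ _ H2))). simpl in H3.
 match type of H3 with rderiv _ _ ?l => replace l with (a*g t+f t*b)%C in H3 end.
 eapply rderiv_ext; [|apply H3]. intros; simpl.
 all: fld.
Qed.

Definition CInt (f : R -> C) (a b : R) : C := (RInt (fun t => Re (f t)) a b, RInt (fun t => Im (f t)) a b).
Definition contin (f : R -> C) (a b : R) : Prop := forall t, a <= t <= b -> rcont f t.

Lemma contin_Re f a b : a <= b -> contin f a b -> ex_RInt (fun t => Re (f t)) a b.
Proof. intros H K. apply (@ex_RInt_continuous R_CompleteNormedModule). minmax. cont. Qed.
Lemma contin_Im f a b : a <= b -> contin f a b -> ex_RInt (fun t => Im (f t)) a b.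
Proof. intros H K. apply (@ex_RInt_continuous R_CompleteNormedModule). minmax. cont. Qed.
#[export] Hint Resolve contin_Re contin_Im : cont.

Lemma RInt_plus_R (f g : R -> R) a b : ex_RInt f a b -> ex_RInt g a b -> RInt (fun x => f x+g x) a b = RInt f a b+RInt g a b.
Proof. apply (@RInt_plus R_CompleteNormedModule). Qed.
Lemma RInt_scal_R (f : R -> R) a b k : ex_RInt f a b -> RInt (fun x => k*f x) a b = k*RInt f a b.
Proof. apply (@RInt_scal R_CompleteNormedModule). Qed.
Lemma ex_RInt_plus_R (f g : R -> R) a b : ex_RInt f a b -> ex_RInt g a b -> ex_RInt (fun x => f x+g x) a b.
Proof. apply (@ex_RInt_plus R_NormedModule). Qed.
Lemma ex_RInt_scal_R (f : R -> R) a b k : ex_RInt f a b -> ex_RInt (fun x => k*f x) a b.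
Proof. apply (@ex_RInt_scal R_NormedModule). Qed.
Lemma RInt_Chasles_R (f : R -> R) a b c : ex_RInt f a b -> ex_RInt f b c -> RInt f a b+RInt f b c = RInt f a c.
Proof. apply (@RInt_Chasles R_CompleteNormedModule). Qed.
Lemma RInt_const_R a b c : RInt (fun _ => c) a b = (b-a)*c.
Proof. apply (@RInt_const R_CompleteNormedModule). Qed.
Lemma ex_RInt_cont_R (f : R -> R) a b : a <= b -> (forall t, a <= t <= b -> continuous f t) -> ex_RInt f a b.
Proof. intros H K. apply (@ex_RInt_continuous R_CompleteNormedModule). minmax. auto. Qed.
#[export] Hint Resolve ex_RInt_scal_R ex_RInt_plus_R ex_RInt_cont_R : cont.

Lemma CInt_ext f g a b : a <= b -> (forall t, a <= t <= b -> f t = g t) -> CInt f a b = CInt g a b.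
Proof.
 intros H E. apply C_eq; apply RInt_ext; minmax; intros; rewrite E by lra; lra.
Qed.
Lemma CInt_plus f g a b : a <= b -> contin f a b -> contin g a b -> CInt (fun t => f t+g t)%C a b = (CInt f a b+CInt g a b)%C.
Proof.
 intros H Hf Hg. apply C_eq; simpl.
 apply (RInt_plus_R (fun t => Re (f t)) (fun t => Re (g t))); cont.
 apply (RInt_plus_R (fun t => Im (f t)) (fun t => Im (g t))); cont.
Qed.
Lemma CInt_mult_const c f a b : a <= b -> contin f a b -> CInt (fun t => c*f t)%C a b = (c*CInt f a b)%C.
Proof.
 intros H Hf. assert (X := contin_Re f a b H Hf). assert (Y := contin_Im f a b H Hf). apply C_eq; simpl.
 - rewrite (RInt_ext _ (fun t => Re c*Re (f t)+(- Im c)*Im (f t))).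
  2: intros; unfold Re, Im; lra.
  rewrite RInt_plus_R, !RInt_scal_R; auto using ex_RInt_scal_R. unfold Re, Im; lra.
 - rewrite (RInt_ext _ (fun t => Re c*Im (f t)+Im c*Re (f t))).
  2: intros; cont.
  rewrite RInt_plus_R, !RInt_scal_R; cont.
Qed.
Lemma CInt_minus f g a b : a <= b -> contin f a b -> contin g a b -> CInt (fun t => f t-g t)%C a b = (CInt f a b-CInt g a b)%C.
Proof.
 intros H Hf Hg. rewrite (CInt_ext _ (fun t => f t+(-(1))*g t)%C) by (auto; intros; ring).
 rewrite CInt_plus, CInt_mult_const; auto. ring. intros t Ht. cont.
Qed.
Lemma CInt_const c a b : CInt (fun _ => c) a b = (c*RtoC (b-a))%C.
Proof. apply C_eq; simpl; rewrite RInt_const_R; unfold Re, Im; lra. Qed.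
Lemma CInt_Chasles f a b c : a <= b -> b <= c -> contin f a c -> (CInt f a b+CInt f b c = CInt f a c)%C.
Proof.
 intros H1 H2 Hf.
 apply C_eq; apply RInt_Chasles_R; cont.
Qed.
Lemma CInt_norm_le f a b : a <= b -> contin f a b -> Cmod (CInt f a b) <= RInt (fun t => Cmod (f t)) a b.
Proof.
 intros H Hf. destruct (Req_dec (Cmod (CInt f a b)) 0) as [E|E].
 - rewrite E. apply RInt_ge_0; auto. cont. intros; pos.
 - assert (P : 0 < Cmod (CInt f a b)) by (generalize (Cmod_ge_0 (CInt f a b)); lra).
  (* The unimodular factor [u] rotates the integral onto the positive real axis, where its modulus
     is the real part of an integral. *)
  set (I := CInt f a b) in *. set (u := (Cconj I*RtoC (/ Cmod I))%C).
  assert (U : Cmod u = 1). { unfold u. rewrite Cmod_mult, Cmod_conj, Cmod_R, Rabs_right. fld. left. apply Rinv_0_lt_compat; lra. }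
  assert (V : Cmod I = Re (u*I)%C).
  { unfold u. replace (Cconj I*RtoC (/ Cmod I)*I)%C with (RtoC (/ Cmod I)*(I*Cconj I))%C by ring.
   rewrite <- Cmod2_conj, <- RtoC_mult. simpl. fld. }
  rewrite V. unfold I. rewrite <- CInt_mult_const by auto.
  apply RInt_le; auto.
  + cont.
  + cont.
  + intros t Ht. tr Rle_abs.
   tr re_le_Cmod. rewrite Cmod_mult, U; lra.
Qed.
Lemma CInt_bound f a b M : a <= b -> contin f a b -> (forall t, a <= t <= b -> Cmod (f t) <= M) -> Cmod (CInt f a b) <= M*(b-a).
Proof.
 intros H Hf HM. eapply Rle_trans; [apply CInt_norm_le; pos|].
 replace (M*(b-a)) with (RInt (fun _ => M) a b) by (rewrite RInt_const_R; lra).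
 apply RInt_le; auto. cont. cont. cont.
Qed.
Lemma CInt_bound_RInt f (g : R -> R) a b : a <= b -> contin f a b -> ex_RInt g a b -> (forall t, a <= t <= b -> Cmod (f t) <= g t) -> Cmod (CInt f a b) <= RInt g a b.
Proof.
 intros H Hf Hg HM. eapply Rle_trans; [apply CInt_norm_le; pos|].
 apply RInt_le; auto. cont. cont.
Qed.
Lemma CInt_FTC f df a b : a <= b -> (forall t, a <= t <= b -> rderiv f t (df t)) -> contin df a b -> CInt df a b = (f b-f a)%C.
Proof.
 intros H Hf Hd. apply C_eq; simpl; apply is_RInt_unique.
 - apply (is_RInt_derive (fun t => Re (f t)) (fun t => Re (df t))); minmax; intros.
  apply rderiv_Re; auto. cont.
 - apply (is_RInt_derive (fun t => Im (f t)) (fun t => Im (df t))); minmax; intros.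
  apply rderiv_Im; auto. cont.
Qed.
Lemma CInt_point f a : CInt f a a = 0.
Proof. apply C_eq; simpl; rewrite RInt_point; auto. Qed.

Lemma ccont_continuity_2d (F : R -> R -> C) x y (p : C -> R) : (forall z w, Rabs (p w-p z) <= Cmod (w-z)) ->
 ccont (fun z => F (Re z) (Im z)) (x, y) -> continuity_2d_pt (fun u v => p (F u v)) x y.
Proof.
 intros Hp H eps. destruct (H eps (cond_pos eps)) as (d & D & K).
 assert (D2 : 0 < d/2) by lra. exists (mkposreal _ D2). simpl. intros u v Hu Hv.
 eapply Rle_lt_trans; [auto|]. apply (K (u, v)). eapply Rle_lt_trans; [apply Cmod_le_Re_Im|].
 simpl. unfold Rminus in *. lra.
Qed.
(** Both components are instances of the real theorem on differentiation under the integral sign,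
    hence the common proof for a 1-Lipschitz projection [p]. The margin [e] around the interval
    provides the two-dimensional neighbourhoods that theorem asks for. *)
Lemma CInt_param (F dF : R -> R -> C) a b l d e : a <= b -> 0 < d -> 0 < e ->
 (forall m t, Rabs (m-l) < d -> a-e < t < b+e -> rderiv (fun m => F m t) m (dF m t)) ->
 (forall t, a-e < t < b+e -> ccont (fun z => dF (Re z) (Im z)) (l, t)) ->
 (forall m, Rabs (m-l) < d -> contin (F m) a b) ->
 rderiv (fun m => CInt (F m) a b) l (CInt (dF l) a b).
Proof.
 intros H Hd He HF Hc HI.
 assert (gen : forall p : C -> R, (forall z w, Rabs (p w-p z) <= Cmod (w-z)) ->
  (forall m t, Rabs (m-l) < d -> a-e < t < b+e -> is_derive (fun m => p (F m t)) m (p (dF m t))) ->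
  (forall m, Rabs (m-l) < d -> ex_RInt (fun t => p (F m t)) a b) ->
  is_derive (fun m => RInt (fun t => p (F m t)) a b) l (RInt (fun t => p (dF l t)) a b)).
 { intros p Hp Hder Hex.
  assert (Dl : forall t, a <= t <= b -> Derive (fun m => p (F m t)) l = p (dF l t)).
  { intros t Ht. apply is_derive_unique, Hder; [replace (l-l) with 0 by ring; rewrite Rabs_R0; lra|lra]. }
  replace (RInt (fun t => p (dF l t)) a b) with (RInt (fun t => Derive (fun m => p (F m t)) l) a b).
  2:{ apply RInt_ext. minmax. cont. }
  apply is_derive_RInt_param.
  - exists (mkposreal d Hd). intros m Hm t Ht. rewrite Rmin_left, Rmax_right in Ht by auto.
   eexists. cont.
  - intros t Ht. rewrite Rmin_left, Rmax_right in Ht by auto.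
   apply continuity_2d_pt_ext_loc with (fun u v => p (dF u v)).
   + assert (M : 0 < Rmin d e) by now apply Rmin_pos. exists (mkposreal _ M). intros u v Hu Hv. symmetry.
    assert (U1 := Rlt_le_trans _ _ _ Hu (Rmin_l _ _)). assert (V1 := Rlt_le_trans _ _ _ Hv (Rmin_r _ _)).
    apply is_derive_unique, Hder; auto. apply Rabs_lt_between in V1. lra.
   + apply (ccont_continuity_2d dF); auto. cont.
  - exists (mkposreal d Hd). pos. }
 apply rderiv_components; simpl.
 - apply (gen Re). intros; rewrite <- Re_Cminus; apply re_le_Cmod. intros; apply rderiv_Re; auto. intros; apply contin_Re; auto.
 - apply (gen Im). intros; rewrite <- Im_Cminus; apply im_le_Cmod. intros; apply rderiv_Im; auto. intros; apply contin_Im; auto.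
Qed.
Lemma rderiv_0_constant f a b : a <= b -> (forall t, a <= t <= b -> rderiv f t 0) -> f b = f a.
Proof.
 intros H K. assert (E := CInt_FTC f (fun _ => 0) a b H K (fun t _ => rcont_const 0 t)).
 rewrite CInt_const in E. symmetry in E. replace (0*RtoC (b-a))%C with (RtoC 0) in E by ring. apply Cminus_eq_0; pos.
Qed.

(** * Cauchy's integral formula on discs *)

(** Continuity of the derivative belongs to the definition: it permits differentiation under the
    integral sign, on which the proofs of Cauchy's theorems rest. *)
Definition Holo (D : C -> Prop) (f f' : C -> C) : Prop := forall z, D z -> cderiv f z (f' z) /\ ccont f' z.
Definition cdisc (c : C) (r : R) (z : C) : Prop := Cmod (z-c) < r.
Definition cis (t : R) : C := (cos t, sin t).

Lemma Holo_sub (D E : C -> Prop) f f' : (forall z, E z -> D z) -> Holo D f f' -> Holo E f f'.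
Proof. intros H K z Hz. auto. Qed.
Lemma Cmod_cis t : Cmod (cis t) = 1.
Proof. unfold Cmod, cis; simpl. generalize (sin2_cos2 t); unfold Rsqr; intro E. replace (_+_) with 1 by lra. apply sqrt_1. Qed.
Lemma cis_2PI : cis (2*PI) = cis 0.
Proof. unfold cis. rewrite cos_2PI, sin_2PI, cos_0, sin_0; auto. Qed.
Lemma rderiv_cis t : rderiv cis t (Ci*cis t).
Proof.
 apply rderiv_components; simpl. auto_derive; lra. auto_derive; lra.
Qed.
Lemma rcont_cis t : rcont cis t. Proof. eapply rderiv_rcont, rderiv_cis. Qed.
#[export] Hint Resolve rcont_cis : cont.
Lemma ccont_cis_Im z : ccont (fun w => cis (Im w)) z.
Proof.
 apply ccont_ext with (fun w => RtoC (cos (Im w))+Ci*RtoC (sin (Im w)))%C.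
 intro; apply C_eq; simpl; lra.
 apply ccont_plus; [|apply ccont_mult; [cont|]].
 apply (ccont_Im_comp cos). cont.
 apply (ccont_Im_comp sin). cont.
Qed.
#[export] Hint Resolve ccont_cis_Im : cont.
Lemma Cmod_RtoC_pos r : 0 <= r -> Cmod (RtoC r) = r.
Proof. intro; rewrite Cmod_R, Rabs_right; lra. Qed.
Lemma circle_neq r (v : C) t : Cmod v < r -> (RtoC r*cis t-v <> 0)%C.
Proof.
 intro H. assert (0 < r) by (generalize (Cmod_ge_0 v); lra). apply Cmod_lt_neq. rewrite Cmod_mult, Cmod_cis, Cmod_RtoC_pos; lra.
Qed.
Lemma circle_dist r (v : C) t : 0 <= r -> r-Cmod v <= Cmod (RtoC r*cis t-v)%C.
Proof.
 intro H. assert (X := Cmod_le_minus (RtoC r*cis t) v). rewrite Cmod_mult, Cmod_cis, Cmod_RtoC_pos in X; lra.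
Qed.
Lemma two_PI_pos : 0 <= 2*PI. Proof. generalize PI_RGT_0; lra. Qed.


(** Replace [v] by [v m] with [m] between 0 and 1: the derivative in [m] of the integrand is the
    derivative in [t] of a periodic function, so the integral does not depend on [m], and at [m = 0]
    the integrand is 1. *)
Lemma circle_kernel r (v : C) : Cmod v < r -> CInt (fun t => RtoC r*cis t/(RtoC r*cis t-v))%C 0 (2*PI) = RtoC (2*PI).
Proof.
 intro H. assert (Hr : 0 < r) by (generalize (Cmod_ge_0 v); lra).
 set (F := fun (m t : R) => (RtoC r*cis t/(RtoC r*cis t-v*RtoC m))%C).
 set (dF := fun (m t : R) => (v*(RtoC r*cis t/((RtoC r*cis t-v*RtoC m)*(RtoC r*cis t-v*RtoC m))))%C).
 (* The margin keeps [v m] strictly inside the circle for [-d < m < 1+d], so that [m] can be varied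
    around both end points. *)
 set (d := (r-Cmod v)/(2*r)). assert (Hd : 0 < d) by (apply Rdiv_lt_0_compat; lra).
 assert (N : forall m t, -d < m < 1+d -> (RtoC r*cis t-v*RtoC m <> 0)%C).
 { intros m t Hm. apply circle_neq. rewrite Cmod_mult, Cmod_R.
  assert (Rabs m < 1+d) by (apply Rabs_lt_between; lra). assert (0 <= Cmod v) by apply Cmod_ge_0.
  assert (d*r = (r-Cmod v)/2) by (unfold d; fld).
  nra. }
 assert (E : CInt (F 1) 0 (2*PI) = CInt (F 0) 0 (2*PI)).
 { apply (rderiv_0_constant (fun m => CInt (F m) 0 (2*PI))); [lra|]. intros l Hl.
  assert (Z : CInt (dF l) 0 (2*PI) = 0).
  { rewrite (CInt_FTC (fun t => v*Ci * / (RtoC r*cis t-v*RtoC l))%C).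
   - rewrite cis_2PI. ring.
   - apply two_PI_pos.
   - intros t _. unfold dF.
    replace (v*(r*cis t/((r*cis t-v*l)*(r*cis t-v*l))))%C with
     (v*Ci*(- / ((r*cis t-v*l)*(r*cis t-v*l))*(r*(Ci*cis t))))%C.
    + apply rderiv_mult_const. apply (rderiv_comp (fun w => / w)%C).
     apply rderiv_ext with (fun u => (-(v*l))+RtoC r*cis u)%C. intro; ring.
     apply (rderiv_comp (fun w => -(v*l)+RtoC r*w)%C). apply rderiv_cis.
     assert (K := cderiv_plus _ _ _ _ _ (cderiv_const (-(v*l)) (cis t)) (cderiv_mult_const (RtoC r) _ _ _ (cderiv_id (cis t)))). replace (0+RtoC r*1)%C with (RtoC r) in K by ring. pos.
     apply cderiv_inv, N; lra.
    + assert (Q : (Ci*Ci = -(1))%C) by (apply C_eq; simpl; lra).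
     replace (v*Ci*(- / ((r*cis t-v*l)*(r*cis t-v*l))*(r*(Ci*cis t))))%C with
      (-(Ci*Ci)*(v*(/ ((r*cis t-v*l)*(r*cis t-v*l))*(r*cis t))))%C by ring.
     rewrite Q. field. cont.
   - intros t _. apply rcont_mult; [cont|]. apply rcont_mult; [cont|].
    apply rcont_inv; [|apply Cmult_neq_0; cont]. cont. }
  rewrite <- Z. apply CInt_param with (d := d) (e := 1); try lra.
  - apply two_PI_pos.
  - intros m t Hm _. unfold F, dF. apply Rabs_lt_between in Hm.
   replace (v*(r*cis t/((r*cis t-v*m)*(r*cis t-v*m))))%C with
    (r*cis t*(- / ((r*cis t-v*m)*(r*cis t-v*m)) * - v))%C by (field; cont).
   apply rderiv_mult_const. apply (rderiv_comp (fun w => / w)%C).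
   apply rderiv_ext with (fun u => r*cis t + - v*RtoC u)%C. intro; ring. apply rderiv_affine.
   apply cderiv_inv, N; lra.
  - intros t _. apply ccont_mult; [cont|]. apply ccont_mult.
   cont.
   assert (W : ccont (fun z => (r*cis (Im z)-v*RtoC (Re z)))%C (l, t)).
   { apply ccont_minus; apply ccont_mult; try apply ccont_const; [cont|]. apply (ccont_Re_comp (fun x => x)). cont. }
   apply ccont_inv; [cont|]. simpl. apply Cmult_neq_0; cont.
  - intros m Hm t _. apply Rabs_lt_between in Hm. apply rcont_mult; [cont|].
   cont. }
 transitivity (CInt (F 1) 0 (2*PI)).
 { apply CInt_ext; [apply two_PI_pos|]. intros; unfold F. rewrite Cmult_1_r; auto. }
 rewrite E, (CInt_ext _ (fun _ => RtoC 1)), CInt_const, Rminus_0_r. ring.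
 apply two_PI_pos. intros; unfold F. field. assert (K := N 0 t ltac:(lra)). split.
 intro Q; apply K; rewrite Q; ring. intro Q; apply K. rewrite Q; ring.
Qed.

Section Cauchy.
Variables (f f' : C -> C) (c : C) (R0 r : R).
Hypotheses (Hf : Holo (cdisc c R0) f f') (Hr : 0 < r) (HrR : r < R0).

Lemma Holo_circle_rcont t : rcont (fun u => f (c+RtoC r*cis u)%C) t.
Proof.
 apply rcont_comp.
 - eapply cderiv_ccont, Hf. unfold cdisc. replace (c+r*cis t-c)%C with (RtoC r*cis t)%C by ring.
  rewrite Cmod_mult, Cmod_cis, Cmod_RtoC_pos; lra.
 - cont.
Qed.

(** The circle is contracted onto [w] along straight lines [p m t]. Up to the factor [m i], the
    derivative in [m] is the derivative in [t] of [f (p m t)], so the integral is constant in [m];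
    at [m = 0] it is [f w] times [circle_kernel]. *)
Lemma Cauchy_formula w : Cmod (w-c) < r ->
 CInt (fun t => f (c+RtoC r*cis t)*(RtoC r*cis t/(RtoC r*cis t-(w-c))))%C 0 (2*PI) = (RtoC (2*PI)*f w)%C.
Proof.
 intro Hw. set (v := (w-c)%C) in *.
 set (p := fun (m t : R) => (w+RtoC m*(RtoC r*cis t-v))%C).
 set (k := fun t => (RtoC r*cis t/(RtoC r*cis t-v))%C).
 set (F := fun m t => (f (p m t)*k t)%C).
 set (dF := fun m t => (f' (p m t)*(RtoC r*cis t))%C).
 set (d := (R0-r)/(4*r)). assert (Hd : 0 < d) by (apply Rdiv_lt_0_compat; lra).
 assert (N : forall t, (RtoC r*cis t-v <> 0)%C) by (intro; apply circle_neq; lra).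
 assert (IN : forall m t, -d < m < 1+d -> cdisc c R0 (p m t)).
 { intros m t Hm. unfold cdisc, p. replace (w+m*(r*cis t-v)-c)%C with (RtoC (1-m)*v+RtoC m*(RtoC r*cis t))%C
   by (unfold v; rewrite RtoC_minus; ring).
  eapply Rle_lt_trans; [apply Cmod_triangle|]. rewrite !Cmod_mult, Cmod_cis, !Cmod_R, (Rabs_right r) by lra.
  assert (E : d*r = (R0-r)/4) by (unfold d; fld).
  assert (Rabs (1-m)*Cmod v <= Rabs (1-m)*r) by (mull; lra).
  assert (Rabs (1-m)+Rabs m <= 1+2*d) by (unfold Rabs; destruct (Rcase_abs (1-m)), (Rcase_abs m); lra). nra. }
 assert (kc : forall t, rcont k t).
 { intro t. apply rcont_mult; [cont|]. cont. }
 assert (pm : forall m t, rderiv (fun m => p m t) m (RtoC r*cis t-v)).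
 { intros m t. apply rderiv_ext with (fun u => w+(RtoC r*cis t-v)*RtoC u)%C. intro; unfold p; ring. apply rderiv_affine. }
 assert (pt : forall m t, rderiv (fun t => p m t) t (RtoC m*(RtoC r*(Ci*cis t)))).
 { intros m t. apply rderiv_ext with (fun u => (w-RtoC m*v)+(RtoC m*RtoC r)*cis u)%C. intro; unfold p; ring.
  replace (m*(r*(Ci*cis t)))%C with ((RtoC m*RtoC r)*(Ci*cis t))%C by ring.
  apply (rderiv_comp (fun z => (w-RtoC m*v)+(RtoC m*RtoC r)*z)%C cis). apply rderiv_cis.
  assert (K := cderiv_plus _ _ _ _ _ (cderiv_const (w-RtoC m*v) (cis t)) (cderiv_mult_const (RtoC m*RtoC r) _ _ _ (cderiv_id (cis t)))). replace (0+RtoC m*RtoC r*1)%C with (RtoC m*RtoC r)%C in K by ring. pos. }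
 assert (dFc : forall m, -d < m < 1+d -> forall t, rcont (dF m) t).
 { intros m Hm t. apply rcont_mult; [|cont]. apply rcont_comp. apply Hf, IN; lra. eapply rderiv_rcont, pt. }
 assert (E : CInt (F 1) 0 (2*PI) = CInt (F 0) 0 (2*PI)).
 { apply (rderiv_0_constant (fun m => CInt (F m) 0 (2*PI))); [lra|]. intros l Hl.
  assert (Z : CInt (dF l) 0 (2*PI) = 0).
  (* The factor [l i] cannot be divided out at [l = 0]; there the integrand is a constant multiple
     of [cis] and is integrated directly. *)
  { destruct (Req_dec l 0) as [L0|L0].
   - subst l. rewrite (CInt_FTC (fun t => f' w*RtoC r * - Ci*cis t)%C). rewrite cis_2PI; ring. apply two_PI_pos.
    2: intros t _; cont.
    intros t _. unfold dF, p. replace (w+0*(r*cis t-v))%C with w by ring.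
    replace (f' w*(r*cis t))%C with (f' w*RtoC r * - Ci*(Ci*cis t))%C. apply rderiv_mult_const, rderiv_cis.
    assert (Q : (Ci*Ci = -(1))%C) by (apply C_eq; simpl; lra).
    replace (f' w*r * - Ci*(Ci*cis t))%C with (-(Ci*Ci)*(f' w*r*cis t))%C by ring. rewrite Q; ring.
   - assert (L0' : RtoC l <> 0) by (intro Q; apply RtoC_inj in Q; lra). assert (I0 : Ci <> 0) by (intro Q; apply (f_equal Im) in Q; simpl in Q; lra).
    assert (Z : (RtoC l*Ci*CInt (dF l) 0 (2*PI) = 0)%C).
    { rewrite <- CInt_mult_const. 2: apply two_PI_pos. 2: intros t _; cont.
     rewrite (CInt_FTC (fun t => f (p l t))). unfold p. rewrite cis_2PI; ring. apply two_PI_pos.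
     - intros t _. unfold dF. replace (l*Ci*(f' (p l t)*(r*cis t)))%C with (f' (p l t)*(RtoC l*(RtoC r*(Ci*cis t))))%C by ring.
      apply (rderiv_comp f (fun t => p l t)). auto. apply Hf, IN; lra.
     - intros t _. cont. }
    apply Cmult_eq_0 in Z. destruct Z as [Z|Z]; auto. apply Cmult_eq_0 in Z. tauto. }
  rewrite <- Z. apply CInt_param with (d := d) (e := 1); try lra. apply two_PI_pos.
  - intros m t Hm _. apply Rabs_lt_between in Hm. unfold F, dF.
   replace (f' (p m t)*(r*cis t))%C with (k t*(f' (p m t)*(RtoC r*cis t-v)))%C by (unfold k; field; auto).
   apply rderiv_ext with (fun m => k t*f (p m t))%C. intro; ring.
   apply rderiv_mult_const, (rderiv_comp f (fun m => p m t)); [auto|]. apply Hf, IN; lra.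
  - intros t _. apply ccont_mult. 2: apply ccont_mult; cont.
   apply (ccont_comp f' (fun z => p (Re z) (Im z))). 2: apply Hf; simpl; cont. apply ccont_plus; [cont|]. apply ccont_mult.
   apply (ccont_Re_comp (fun x => x)), continuous_id. cont.
  - intros m Hm t _. apply Rabs_lt_between in Hm. apply rcont_mult; auto. apply rcont_comp. eapply cderiv_ccont, Hf, IN; lra. eapply rderiv_rcont, pt. }
 transitivity (CInt (F 1) 0 (2*PI)).
 { apply CInt_ext; [apply two_PI_pos|]. intros; unfold F, k, p. do 2 f_equal. unfold v; ring. }
 rewrite E, (CInt_ext _ (fun t => f w*k t)%C), CInt_mult_const. unfold k. rewrite circle_kernel by auto. ring.
 apply two_PI_pos. intros t _; auto. apply two_PI_pos. intros; unfold F, p. do 2 f_equal; ring.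
Qed.
End Cauchy.

(** A quadratic remainder that is uniform in both points gives differentiability at once; adding the
    estimates for (w, s) and (s, w) bounds f' w - f' s, which gives continuity of the derivative. *)
Lemma quadratic_Holo D f f' : (forall s, D s -> exists d K, 0 < d /\ 0 <= K /\ forall z w, Cmod (z-s) < d -> Cmod (w-s) < d ->
  Cmod (f z-f w-f' w*(z-w)) <= K*(Cmod (z-w)*Cmod (z-w))) -> Holo D f f'.
Proof.
 intros H s Hs. destruct (H s Hs) as (d & K & Hd & HK & Q).
 assert (S0 : Cmod (s-s) < d) by (replace (s-s)%C with (RtoC 0) by ring; rewrite Cmod_0; lra).
 split.
 - intros eps He. exists (Rmin d (eps/(K+1))). split; [apply Rmin_pos; pos|]. intros w Hw.
  assert (W1 := Rlt_le_trans _ _ _ Hw (Rmin_l _ _)). assert (W2 := Rlt_le_trans _ _ _ Hw (Rmin_r _ _)).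
  eapply Rle_trans; [auto|]. assert (P := Cmod_ge_0 (w-s)).
  apply (Rmult_lt_compat_r (K+1)) in W2; [|lra]. replace (eps/(K+1)*(K+1)) with eps in W2 by fld. nra.
 - intros eps He. exists (Rmin d (eps/(2*K+1))). split; [apply Rmin_pos; pos|]. intros w Hw.
  assert (W1 := Rlt_le_trans _ _ _ Hw (Rmin_l _ _)). assert (W2 := Rlt_le_trans _ _ _ Hw (Rmin_r _ _)).
  apply (Rmult_lt_compat_r (2*K+1)) in W2; [|lra]. replace (eps/(2*K+1)*(2*K+1)) with eps in W2 by fld.
  destruct (Req_dec (Cmod (w-s)) 0) as [Z|Z].
  { apply Cmod_eq_0, Cminus_eq_0 in Z. subst w. replace (f' s-f' s)%C with (RtoC 0) by ring. rewrite Cmod_0; lra. }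
  assert (P := Cmod_ge_0 (w-s)).
  assert (Q1 := Q w s W1 S0). assert (Q2 := Q s w S0 W1). rewrite (Cmod_minus_sym s w) in Q2.
  assert (Y : Cmod ((f' w-f' s)*(w-s)) <= 2*K*(Cmod (w-s)*Cmod (w-s))).
  { replace ((f' w-f' s)*(w-s))%C with ((f w-f s-f' s*(w-s))+(f s-f w-f' w*(s-w)))%C by ring.
   tr Cmod_triangle; lra. }
  rewrite Cmod_mult in Y. nra.
Qed.
Lemma CInt_quadratic (k k1 : C -> R -> C) a b K z w : a <= b -> contin (k z) a b -> contin (k w) a b -> contin (k1 w) a b ->
 (forall t, a <= t <= b -> Cmod (k z t-k w t-k1 w t*(z-w)) <= K) ->
 Cmod (CInt (k z) a b-CInt (k w) a b-CInt (k1 w) a b*(z-w)) <= K*(b-a).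
Proof.
 intros H H1 H2 H3 B. rewrite (Cmult_comm (CInt (k1 w) a b)), <- CInt_mult_const, <- !CInt_minus; auto.
 - apply CInt_bound; auto.
  + intros t Ht. cont.
  + intros t Ht. rewrite (Cmult_comm (z-w)). auto.
 - intros t Ht; cont.
 - intros t Ht; cont.
Qed.

Lemma cderiv_unique f z a b : cderiv f z a -> cderiv f z b -> a = b.
Proof.
 intros Ha Hb. apply Cminus_eq_0, Cmod_eq_0. destruct (Req_dec (Cmod (a-b)) 0) as [|N]; auto.
 assert (P : 0 < Cmod (a-b)) by (generalize (Cmod_ge_0 (a-b)); lra). set (e := Cmod (a-b)/4).
 destruct (Ha e) as (d1&D1&K1); [unfold e; lra|]. destruct (Hb e) as (d2&D2&K2); [unfold e; lra|].
 set (h := Rmin d1 d2/2). assert (M : 0 < Rmin d1 d2) by now apply Rmin_pos.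
 assert (Cmod (z+RtoC h-z) = h). { replace (z+h-z)%C with (RtoC h) by ring. rewrite Cmod_R, Rabs_right; unfold h; lra. }
 specialize (K1 (z+RtoC h)%C). specialize (K2 (z+RtoC h)%C). rewrite H in K1, K2.
 assert (L1 := Rmin_l d1 d2). assert (L2 := Rmin_r d1 d2).
 specialize (K1 ltac:(unfold h; lra)). specialize (K2 ltac:(unfold h; lra)).
 assert (X : Cmod ((a-b)*(z+RtoC h-z)) <= 2*e*h).
 { replace ((a-b)*(z+h-z))%C with ((f (z+h)%C-f z-b*(z+h-z))-(f (z+h)%C-f z-a*(z+h-z)))%C by ring.
  tr Cmod_sub_le; lra. }
 rewrite Cmod_mult, H in X. unfold e in X. assert (0 < h) by (unfold h; lra). nra.
Qed.
(** A derivative picked by choice, to name second derivatives whose existence comes from a local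
    Cauchy integral; uniqueness makes the local pieces agree. *)
Definition Cder (f : C -> C) (z : C) : C := epsilon (inhabits (RtoC 0)) (cderiv f z).
Lemma Cder_eq f z l : cderiv f z l -> Cder f z = l.
Proof. intro H. apply (cderiv_unique f z); auto. unfold Cder. apply epsilon_spec. eauto. Qed.
Definition copen (D : C -> Prop) : Prop := forall z, D z -> exists d, 0 < d /\ forall w, Cmod (w-z) < d -> D w.
Lemma Cmod_self z : Cmod (z-z) = 0.
Proof. replace (z-z)%C with (RtoC 0) by ring. apply Cmod_0. Qed.
Lemma copen_disc c r : copen (cdisc c r).
Proof.
 intros z Hz. exists (r-Cmod (z-c)). unfold cdisc in *. split; [lra|]. intros w Hw.
 assert (X := Cmod_minus_le w z c). lra.
Qed.
Lemma Holo_local D g : (forall z, D z -> exists d g', 0 < d /\ Holo (cdisc z d) g g') -> Holo D g (Cder g).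
Proof.
 intros H z Hz. destruct (H z Hz) as (d & g' & Hd & K).
 assert (Z : cdisc z d z) by (unfold cdisc; rewrite Cmod_self; lra).
 rewrite (Cder_eq g z (g' z)) by apply K, Z. split. apply K, Z.
 apply ccont_ext_loc with g'; [|apply K, Z]. exists d; split; auto. intros w Hw. symmetry. apply Cder_eq, K, Hw.
Qed.
Lemma Holo_ccont D f f' z : Holo D f f' -> D z -> ccont f z.
Proof. intros H Hz. eapply cderiv_ccont, H, Hz. Qed.

Lemma Holo_plus D f g f' g' : Holo D f f' -> Holo D g g' -> Holo D (fun z => f z+g z)%C (fun z => f' z+g' z)%C.
Proof. intros Hf Hg z Hz. split. apply cderiv_plus; [apply Hf|apply Hg]; pos. apply ccont_plus; [apply Hf|apply Hg]; pos. Qed.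
Lemma Holo_mult D f g f' g' : Holo D f f' -> Holo D g g' -> Holo D (fun z => f z*g z)%C (fun z => f' z*g z+f z*g' z)%C.
Proof.
 intros Hf Hg z Hz. split. apply cderiv_mult; [apply Hf|apply Hg]; pos.
 apply ccont_plus; apply ccont_mult; try apply Hf; try apply Hg; auto; eapply Holo_ccont; eauto.
Qed.
Lemma Holo_div D f g f' g' : Holo D f f' -> Holo D g g' -> (forall z, D z -> g z <> 0) ->
 Holo D (fun z => f z/g z)%C (fun z => (f' z*g z-f z*g' z)/(g z*g z))%C.
Proof.
 intros Hf Hg N z Hz. assert (Cf := Holo_ccont _ _ _ _ Hf Hz). assert (Cg := Holo_ccont _ _ _ _ Hg Hz). split.
 apply cderiv_div; [apply Hf|apply Hg|]; auto.
 apply ccont_mult. apply ccont_minus; apply ccont_mult; try apply Hf; try apply Hg; pos.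
 apply ccont_inv. cont. apply Cmult_neq_0; auto.
Qed.
Lemma Holo_const D c : Holo D (fun _ => c) (fun _ => 0).
Proof. intros z _. split. apply cderiv_const. cont. Qed.
Lemma Holo_id D : Holo D (fun z => z) (fun _ => 1).
Proof. intros z _. split. apply cderiv_id. cont. Qed.
Lemma Holo_ext D f g f' : copen D -> (forall z, D z -> f z = g z) -> Holo D f f' -> Holo D g f'.
Proof.
 intros O E H z Hz. split; [|apply H; pos]. destruct (O z Hz) as (d & Hd & K).
 apply cderiv_ext_loc with f; [|apply H; pos]. exists d; auto.
Qed.
Lemma Holo_sub_const D c : Holo D (fun z => z-c)%C (fun _ => 1).
Proof.
 intros z _. split. assert (K := cderiv_minus _ _ _ _ _ (cderiv_id z) (cderiv_const c z)). replace (1-0)%C with (RtoC 1) in K by ring. pos.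
 cont.
Qed.
#[export] Hint Resolve Holo_plus Holo_const Holo_id Holo_sub_const Holo_mult : cont.

(** * Cauchy transforms, Cauchy's estimates and division by a zero *)

(** The Cauchy transform of data [phi] on the circle of radius [r] about 0; [CT2] and [CT3] are its
    first and second derivatives. The quantitative remainders proved for them serve both for
    holomorphy and for explicit Cauchy estimates. *)
Definition CT (phi : R -> C) (r : R) (v : C) : C := CInt (fun t => phi t/(RtoC r*cis t-v))%C 0 (2*PI).
Definition CT2 (phi : R -> C) (r : R) (v : C) : C :=
 CInt (fun t => phi t/((RtoC r*cis t-v)*(RtoC r*cis t-v)))%C 0 (2*PI).
Definition CT3 (phi : R -> C) (r : R) (v : C) : C :=
 CInt (fun t => phi t*(2/((RtoC r*cis t-v)*(RtoC r*cis t-v)*(RtoC r*cis t-v))))%C 0 (2*PI).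

Section CauchyTransform.
Variables (phi : R -> C) (r q M : R).
Hypotheses (Hphi : contin phi 0 (2*PI)) (HM : forall t, 0 <= t <= 2*PI -> Cmod (phi t) <= M) (Hq : 0 <= q) (Hqr : q < r).

Let N v t : Cmod v <= q -> (RtoC r*cis t-v <> 0)%C.
Proof. intro; apply circle_neq; lra. Qed.
Let B v t : Cmod v <= q -> Cmod (/ (RtoC r*cis t-v)) <= / (r-q).
Proof.
 intro H. rewrite Cmod_inv by auto. apply Rinv_le_contravar; [lra|]. assert (X := circle_dist r v t ltac:(lra)). lra.
Qed.
Let c1 v t : Cmod v <= q -> rcont (fun t => RtoC r*cis t-v)%C t.
Proof. cont. Qed.
Let M0 : 0 <= M.
Proof. generalize (HM 0 (conj (Rle_refl _) two_PI_pos)), (Cmod_ge_0 (phi 0)); lra. Qed.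
Let C1 v : Cmod v <= q -> contin (fun t => phi t/(RtoC r*cis t-v))%C 0 (2*PI).
Proof. intros H t Ht. apply rcont_mult; auto. cont. Qed.
Let C2 v : Cmod v <= q -> contin (fun t => phi t/((RtoC r*cis t-v)*(RtoC r*cis t-v)))%C 0 (2*PI).
Proof. intros H t Ht. apply rcont_mult; auto. apply rcont_inv. cont. apply Cmult_neq_0; auto. Qed.
Let C3 v : Cmod v <= q -> contin (fun t => phi t*(2/((RtoC r*cis t-v)*(RtoC r*cis t-v)*(RtoC r*cis t-v))))%C 0 (2*PI).
Proof.
 intros H t Ht. apply rcont_mult; auto. apply rcont_mult; [cont|]. apply rcont_inv. cont.
 repeat apply Cmult_neq_0; auto.
Qed.

Lemma CT_bound v : Cmod v <= q -> Cmod (CT phi r v) <= M/(r-q)*(2*PI).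
Proof.
 intro H. rewrite <- (Rminus_0_r (2*PI)). apply CInt_bound; [apply two_PI_pos|auto|].
 intros t Ht. unfold Cdiv. rewrite Cmod_mult. mul; cont.
Qed.
Lemma CT2_bound v : Cmod v <= q -> Cmod (CT2 phi r v) <= M/((r-q)*(r-q))*(2*PI).
Proof.
 intro H. rewrite <- (Rminus_0_r (2*PI)). apply CInt_bound; [apply two_PI_pos|auto|].
 intros t Ht. assert (Nt := N v t H). replace (phi t/((r*cis t-v)*(r*cis t-v)))%C with (phi t*(/ (r*cis t-v) * / (r*cis t-v)))%C by (field; pos).
 rewrite !Cmod_mult. unfold Rdiv. rewrite Rinv_mult by lra.
 apply Rmult_le_compat; auto; try apply Cmod_ge_0. pos.
 mul; cont.
Qed.
Lemma CT_quadratic z w : Cmod z <= q -> Cmod w <= q ->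
 Cmod (CT phi r z-CT phi r w-CT2 phi r w*(z-w)) <= M/((r-q)*(r-q)*(r-q))*(2*PI)*(Cmod (z-w)*Cmod (z-w)).
Proof.
 intros Hz Hw. replace (M/((r-q)*(r-q)*(r-q))*(2*PI)*(Cmod (z-w)*Cmod (z-w))) with
  (M*(/ (r-q) * / (r-q) * / (r-q)*(Cmod (z-w)*Cmod (z-w)))*(2*PI-0)) by fld.
 apply (CInt_quadratic (fun v t => phi t/(RtoC r*cis t-v))%C (fun v t => phi t/((RtoC r*cis t-v)*(RtoC r*cis t-v)))%C); auto.
 apply two_PI_pos. intros t Ht.
 replace (_-_-_)%C with (phi t*(/ (r*cis t-z) * / (r*cis t-w) * / (r*cis t-w)*((z-w)*(z-w))))%C by (field; auto).
 rewrite !Cmod_mult. assert (P1 := Cmod_ge_0 (/ (r*cis t-z))). assert (P2 := Cmod_ge_0 (/ (r*cis t-w))).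
 mul; auto.
 mulr.
 repeat apply Rmult_le_compat; auto. pos.
Qed.
Lemma CT2_quadratic z w : Cmod z <= q -> Cmod w <= q ->
 Cmod (CT2 phi r z-CT2 phi r w-CT3 phi r w*(z-w)) <=
  M*(6*r)/((r-q)*(r-q)*(r-q)*(r-q)*(r-q))*(2*PI)*(Cmod (z-w)*Cmod (z-w)).
Proof.
 intros Hz Hw. replace (M*(6*r)/((r-q)*(r-q)*(r-q)*(r-q)*(r-q))*(2*PI)*(Cmod (z-w)*Cmod (z-w))) with
  (M*(/ (r-q) * / (r-q) * / (r-q) * / (r-q) * / (r-q)*(6*r)*(Cmod (z-w)*Cmod (z-w)))*(2*PI-0)) by fld.
 apply (CInt_quadratic (fun v t => phi t/((RtoC r*cis t-v)*(RtoC r*cis t-v)))%C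
  (fun v t => phi t*(2/((RtoC r*cis t-v)*(RtoC r*cis t-v)*(RtoC r*cis t-v))))%C); auto.
 apply two_PI_pos. intros t Ht.
 replace (_-_-_)%C with (phi t*(/ (r*cis t-z) * / (r*cis t-z) * / (r*cis t-w) * / (r*cis t-w) * / (r*cis t-w)
   * ((r*cis t-w)+(r*cis t-z)+(r*cis t-z))*((z-w)*(z-w))))%C by (field; auto).
 rewrite !Cmod_mult.
 assert (S : Cmod (r*cis t-w+(r*cis t-z)+(r*cis t-z)) <= 6*r).
 { tr Cmod_triangle. assert (X := Cmod_triangle (r*cis t-w) (r*cis t-z)).
  assert (Y := Cmod_sub_le (r*cis t) w). assert (Y' := Cmod_sub_le (r*cis t) z). rewrite Cmod_mult, Cmod_cis, Cmod_RtoC_pos in Y, Y' by lra. lra. }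
 repeat mul; auto; pos.
Qed.
End CauchyTransform.

Lemma contin_bounded f a b : a <= b -> contin f a b -> exists M, forall t, a <= t <= b -> Cmod (f t) <= M.
Proof.
 intros H Hf. destruct (continuity_ab_maj (fun t => Cmod (f t)) a b H) as (m & Hm & _).
 - intros t Ht. apply continuity_pt_filterlim. apply rcont_Cmod, Hf; lra.
 - eauto.
Qed.
Lemma CT_Holo phi r : contin phi 0 (2*PI) -> 0 < r -> Holo (cdisc 0 r) (CT phi r) (CT2 phi r) /\ Holo (cdisc 0 r) (CT2 phi r) (CT3 phi r).
Proof.
 intros Hp Hr. destruct (contin_bounded phi 0 (2*PI) two_PI_pos Hp) as (M & HM).
 assert (M0 : 0 <= M) by (generalize (HM 0 (conj (Rle_refl _) two_PI_pos)), (Cmod_ge_0 (phi 0)); lra).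
 assert (G : forall s, cdisc 0 r s -> let q := (r+Cmod s)/2 in 0 <= q < r /\ 0 < r-q /\ 0 < (r-Cmod s)/2 /\ forall z, Cmod (z-s) < (r-Cmod s)/2 -> Cmod z <= q).
 { unfold cdisc. intros s Hs. replace (s-0)%C with s in Hs by ring. assert (S0 := Cmod_ge_0 s).
  split; [lra|]. split; [lra|]. split; [lra|]. intros z Hz. assert (X := Cmod_le_minus z s). lra. }
 assert (PP := PI_RGT_0).
 split; apply quadratic_Holo; intros s Hs; destruct (G s Hs) as (Q1 & Q2 & Q3 & Q4); set (q := (r+Cmod s)/2) in *; clearbody q; exists ((r-Cmod s)/2).
 - exists (M/((r-q)*(r-q)*(r-q))*(2*PI)). split; auto. split.
  + pos.
  + intros z w Hz Hw. apply CT_quadratic; cont.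
 - exists (M*(6*r)/((r-q)*(r-q)*(r-q)*(r-q)*(r-q))*(2*PI)). split; auto. split.
  + pos.
  + intros z w Hz Hw. apply CT2_quadratic; cont.
Qed.
Lemma Holo_shift c r f f' : Holo (cdisc 0 r) f f' -> Holo (cdisc c r) (fun z => f (z-c)%C) (fun z => f' (z-c)%C).
Proof.
 intros H z Hz. assert (Hz' : cdisc 0 r (z-c)%C) by (unfold cdisc in *; replace (z-c-0)%C with (z-c)%C by ring; lra).
 split.
 - assert (K := cderiv_comp f (fun z => z-c)%C z 1 (f' (z-c)%C)). replace (f' (z-c)%C*1)%C with (f' (z-c)%C) in K by ring.
  apply K; [|apply H; pos]. apply (Holo_sub_const (fun _ => True) c z I).
 - apply (ccont_comp f' (fun z => z-c)%C). cont. apply H; pos.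
Qed.
Lemma Holo_mult_const D a f f' : Holo D f f' -> Holo D (fun z => a*f z)%C (fun z => a*f' z)%C.
Proof. intros H z Hz. split. apply cderiv_mult_const, H; pos. apply ccont_mult; [cont|apply H; pos]. Qed.

Section CauchyConsequences.
Variables (f f' : C -> C) (c : C) (R0 r : R).
Hypotheses (Hf : Holo (cdisc c R0) f f') (Hr : 0 < r) (HrR : r < R0).
Let phi := fun t => (f (c+RtoC r*cis t)*(RtoC r*cis t))%C.
Let Hphi : contin phi 0 (2*PI).
Proof. intros t _. apply rcont_mult; [|cont]. eapply Holo_circle_rcont; eauto. Qed.
Let PI0 : RtoC (2*PI) <> 0.
Proof. intro E. apply RtoC_inj in E. generalize PI_RGT_0; lra. Qed.

Lemma Cauchy_CT w : Cmod (w-c) < r -> f w = (/ RtoC (2*PI)*CT phi r (w-c))%C.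
Proof.
 intro H. assert (E := Cauchy_formula f f' c R0 r Hf Hr HrR w H).
 assert (CT phi r (w-c) = RtoC (2*PI)*f w)%C as ->.
 { rewrite <- E. apply CInt_ext; [apply two_PI_pos|]. intros; unfold phi. unfold Cdiv; ring. }
 field; pos.
Qed.
Lemma Cauchy_CT2 w : Cmod (w-c) < r -> f' w = (/ RtoC (2*PI)*CT2 phi r (w-c))%C.
Proof.
 intro H. apply (cderiv_unique f w). apply Hf. unfold cdisc; lra.
 assert (K := Holo_mult_const _ (/ RtoC (2*PI)) _ _ (Holo_shift c r _ _ (proj1 (CT_Holo phi r Hphi Hr)))).
 apply cderiv_ext_loc with (2 := proj1 (K w H)). exists (r-Cmod (w-c)). split; [lra|].
 intros z Hz. symmetry. apply Cauchy_CT. assert (X := Cmod_minus_le z w c). lra.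
Qed.
Lemma Holo_deriv_disc : Holo (cdisc c r) f' (fun w => / RtoC (2*PI)*CT3 phi r (w-c))%C.
Proof.
 assert (K := Holo_mult_const _ (/ RtoC (2*PI)) _ _ (Holo_shift c r _ _ (proj2 (CT_Holo phi r Hphi Hr)))).
 apply Holo_ext with (3 := K). apply copen_disc. intros z Hz. symmetry. apply Cauchy_CT2, Hz.
Qed.
Variable M : R.
Hypothesis HM : forall t, Cmod (f (c+RtoC r*cis t)) <= M.
Let HM' : forall t, 0 <= t <= 2*PI -> Cmod (phi t) <= M*r.
Proof. intros t _. unfold phi. rewrite !Cmod_mult, Cmod_cis, Cmod_RtoC_pos, Rmult_1_r by lra. mulr; cont. Qed.
Let I2 x : / (2*PI)*(x*(2*PI)) = x.
Proof. field. generalize PI_RGT_0; lra. Qed.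
Let Cm : Cmod (/ RtoC (2*PI)) = / (2*PI).
Proof. rewrite Cmod_inv, Cmod_RtoC_pos by (auto; apply two_PI_pos). auto. Qed.
Let Ip : 0 <= / (2*PI).
Proof. left. apply Rinv_0_lt_compat. generalize PI_RGT_0; lra. Qed.
Lemma Cauchy_bound w q : 0 <= q < r -> Cmod (w-c) <= q -> Cmod (f w) <= M*r/(r-q).
Proof.
 intros Hq H. rewrite Cauchy_CT by lra. rewrite Cmod_mult, Cm, <- (I2 (M*r/(r-q))).
 mull. apply CT_bound; pos.
Qed.
Lemma Cauchy_deriv_bound w q : 0 <= q < r -> Cmod (w-c) <= q -> Cmod (f' w) <= M*r/((r-q)*(r-q)).
Proof.
 intros Hq H. rewrite Cauchy_CT2 by lra. rewrite Cmod_mult, Cm, <- (I2 (M*r/((r-q)*(r-q)))).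
 mull. apply CT2_bound; pos.
Qed.
Lemma Cauchy_quadratic_bound z w q : 0 <= q < r -> Cmod (z-c) <= q -> Cmod (w-c) <= q ->
 Cmod (f z-f w-f' w*(z-w)) <= M*r/((r-q)*(r-q)*(r-q))*(Cmod (z-w)*Cmod (z-w)).
Proof.
 intros Hq Hz Hw. rewrite (Cauchy_CT z), (Cauchy_CT w), (Cauchy_CT2 w) by lra.
 replace (_-_-_)%C with (/ RtoC (2*PI)*(CT phi r (z-c)-CT phi r (w-c)-CT2 phi r (w-c)*((z-c)-(w-c))))%C by ring.
 rewrite Cmod_mult, Cm, <- (I2 (M*r/((r-q)*(r-q)*(r-q)))), Rmult_assoc.
 mull. replace (Cmod (z-w)) with (Cmod ((z-c)-(w-c))) by (f_equal; ring).
 apply CT_quadratic; pos.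
Qed.
End CauchyConsequences.

Lemma Holo_deriv D f f' : copen D -> Holo D f f' -> Holo D f' (Cder f').
Proof.
 intros O H. apply Holo_local. intros z Hz. destruct (O z Hz) as (d & Hd & K).
 exists (d/2). eexists. split; [lra|]. apply (Holo_deriv_disc f f' z d (d/2)); try lra.
 intros w Hw. auto.
Qed.
(** The Cauchy integral over one circle between [r] and [R0] bounds [f] inside it, so compactness
    enters only for a closed interval of angles. *)
Lemma Holo_bounded_disc f f' c R0 r : Holo (cdisc c R0) f f' -> 0 < r < R0 -> exists M, forall w, Cmod (w-c) <= r -> Cmod (f w) <= M.
Proof.
 intros H Hr. set (q := (r+R0)/2).
 destruct (contin_bounded (fun t => f (c+RtoC q*cis t)%C) 0 (2*PI) two_PI_pos) as (M & HM).
 { intros t _. eapply Holo_circle_rcont; eauto; unfold q; lra. }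
 exists (/ (2*PI)*(M*q/(q-r)*(2*PI))). intros w Hw.
 rewrite (Cauchy_CT f f' c R0 q) by (auto; unfold q; lra). rewrite Cmod_mult, Cmod_inv, Cmod_RtoC_pos.
 2: apply two_PI_pos. 2:{ intro E. apply RtoC_inj in E. generalize PI_RGT_0; lra. }
 mull. left; apply Rinv_0_lt_compat; generalize PI_RGT_0; lra.
 apply CT_bound; try (unfold q; lra).
 - intros t _. apply rcont_mult; [|cont]. eapply Holo_circle_rcont; eauto; unfold q; lra.
 - intros t Ht. rewrite !Cmod_mult, Cmod_cis, Cmod_RtoC_pos, Rmult_1_r by (unfold q; lra). mulr; auto; unfold q; lra.
Qed.


Definition divide_zero (f f' : C -> C) (rho z : C) : C :=
 if excluded_middle_informative (z = rho) then f' rho else (f z/(z-rho))%C.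
Lemma divide_zero_eq (f f' : C -> C) rho z : f rho = 0 -> (f z = (z-rho)*divide_zero f f' rho z)%C.
Proof.
 intro H. unfold divide_zero. destruct (excluded_middle_informative (z = rho)) as [->|N].
 rewrite H; ring. field. intro E. apply N, Cminus_eq_0; pos.
Qed.
(** Near [rho] the quotient is itself a Cauchy transform: subtracting Cauchy's formula at [rho],
    where [f] vanishes, takes a factor [w-rho] out of the kernel. Elsewhere it is an ordinary
    quotient. *)
Lemma Holo_divide_zero D (f f' : C -> C) rho : copen D -> Holo D f f' -> D rho -> f rho = 0 ->
 Holo D (divide_zero f f' rho) (Cder (divide_zero f f' rho)).
Proof.
 intros O H Hr0 Z. apply Holo_local. intros z Hz. destruct (O z Hz) as (d & Hd & K).
 destruct (classic (z = rho)) as [->|N].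
 - assert (Hf : Holo (cdisc rho d) f f') by (intros w Hw; cont).
  set (r := d/2). assert (Hr : 0 < r) by (unfold r; lra). assert (HrR : r < d) by (unfold r; lra).
  set (phi := fun t => (f (rho+RtoC r*cis t))%C).
  assert (Hphi : contin phi 0 (2*PI)) by (intros t _; eapply Holo_circle_rcont; eauto).
  exists r. eexists. split; auto.
  assert (KK := Holo_mult_const _ (/ RtoC (2*PI)) _ _ (Holo_shift rho r _ _ (proj1 (CT_Holo phi r Hphi Hr)))).
  apply Holo_ext with (3 := KK). apply copen_disc. intros w Hw. symmetry. unfold cdisc in Hw.
  assert (R0 : RtoC r <> 0) by (intro E; apply RtoC_inj in E; lra).
  assert (Cn : forall t, cis t <> 0) by (intro t; apply Cmod_gt_0; rewrite Cmod_cis; lra).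
  unfold divide_zero. destruct (excluded_middle_informative (w = rho)) as [->|N].
  + rewrite (Cauchy_CT2 f f' rho d r Hf Hr HrR rho) by lra. f_equal.
   apply CInt_ext; [apply two_PI_pos|]. intros t _. unfold phi. replace (rho-rho)%C with (RtoC 0) by ring. field. auto.
  + assert (N' : (w-rho <> 0)%C) by (intro E; apply N, Cminus_eq_0; pos).
   rewrite (Cauchy_CT f f' rho d r Hf Hr HrR w) by auto.
   assert (E0 := Cauchy_CT f f' rho d r Hf Hr HrR rho ltac:(rewrite Cmod_self; lra)). rewrite Z in E0.
   set (psi := fun t => (f (rho+RtoC r*cis t)*(RtoC r*cis t))%C) in *.
   assert (Hpsi : contin psi 0 (2*PI)) by (intros t Ht; apply rcont_mult; cont).
   assert (CC : forall v, Cmod v < r -> contin (fun t => psi t/(RtoC r*cis t-v))%C 0 (2*PI)).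
   { intros v Hv t Ht. apply rcont_mult; auto. apply rcont_inv; [|apply circle_neq; lra]. cont. }
   replace (/ RtoC (2*PI)*CT psi r (w-rho))%C with (/ RtoC (2*PI)*(CT psi r (w-rho)-CT psi r (rho-rho)))%C.
   2:{ replace (/ RtoC (2*PI)*(CT psi r (w-rho)-CT psi r (rho-rho)))%C with (/ RtoC (2*PI)*CT psi r (w-rho) - / RtoC (2*PI)*CT psi r (rho-rho))%C by ring. rewrite <- E0; ring. }
   unfold CT at 1 2. rewrite <- CInt_minus; [|apply two_PI_pos|auto|apply CC; rewrite Cmod_self; lra].
   unfold Cdiv at 1. rewrite <- Cmult_assoc. f_equal. rewrite Cmult_comm, <- CInt_mult_const. 2: apply two_PI_pos.
   2:{ intros t Ht. apply rcont_minus; apply CC; auto. rewrite Cmod_self; lra. }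
   apply CInt_ext; [apply two_PI_pos|]. intros t _. unfold psi, phi.
   assert (X := circle_neq r (w-rho) t Hw). replace (rho-rho)%C with (RtoC 0) by ring. field.
   auto.
 - assert (N' : (z-rho <> 0)%C) by (intro E; apply N, Cminus_eq_0; pos). apply Cmod_gt_0 in N'.
  set (e := Rmin d (Cmod (z-rho))). assert (He : 0 < e) by now apply Rmin_pos.
  assert (NZ : forall w, cdisc z e w -> (w-rho <> 0)%C).
  { intros w Hw E. apply Cminus_eq_0 in E. subst w. unfold cdisc in Hw. rewrite Cmod_minus_sym in Hw.
   assert (X := Rmin_r d (Cmod (z-rho))). unfold e in Hw; lra. }
  exists e. eexists. split; auto.
  assert (Hf : Holo (cdisc z e) f f') by (intros w Hw; apply H, K; eapply Rlt_le_trans; [apply Hw|apply Rmin_l]).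
  assert (KK := Holo_div _ _ _ _ _ Hf (Holo_sub_const _ rho) NZ).
  apply Holo_ext with (3 := KK). apply copen_disc. intros w Hw. unfold divide_zero.
  destruct (excluded_middle_informative (w = rho)) as [->|]; auto. exfalso. apply (NZ _ Hw). ring.
Qed.

(** * Logarithmic derivatives: the lemmas of Borel-Caratheodory and Landau *)

(** The primitive is the integral along the radius from [c]; its derivative is the integral over
    [0, 1] of the derivative of [t phi (c+(z-c) t)] in [t]. *)
Lemma Holo_primitive c r phi phi' : Holo (cdisc c r) phi phi' -> exists G : C -> C, G c = 0 /\ Holo (cdisc c r) G phi.
Proof.
 intro H. set (p := fun (z : C) (t : R) => (c+(z-c)*RtoC t)%C).
 set (J := fun z => CInt (fun t => phi (p z t)) 0 1). set (J1 := fun z => CInt (fun t => phi' (p z t)*RtoC t)%C 0 1).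
 assert (pt : forall z t, rderiv (p z) t (z-c)) by (intros; apply rderiv_affine).
 assert (IN : forall z t q, 0 <= t <= 1 -> Cmod (z-c) <= q -> Cmod (p z t-c) <= q).
 { intros z t q Ht Hz. unfold p. replace (c+(z-c)*t-c)%C with ((z-c)*RtoC t)%C by ring.
  rewrite Cmod_mult, Cmod_RtoC_pos by lra. assert (0 <= Cmod (z-c)) by apply Cmod_ge_0. nra. }
 assert (IN' : forall z t, 0 <= t <= 1 -> cdisc c r z -> cdisc c r (p z t)).
 { intros z t Ht Hz. eapply Rle_lt_trans; [apply IN; auto; apply Rle_refl|pos]. }
 assert (c1 : forall z, cdisc c r z -> contin (fun t => phi (p z t)) 0 1).
 { intros z Hz t Ht. apply rcont_comp. eapply Holo_ccont; eauto. eapply rderiv_rcont, pt. }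
 assert (c2 : forall z, cdisc c r z -> contin (fun t => phi' (p z t)*RtoC t)%C 0 1).
 { intros z Hz t Ht. apply rcont_mult. apply rcont_comp. apply H; auto. eapply rderiv_rcont, pt. cont. }
 assert (HJ : Holo (cdisc c r) J J1).
 { apply quadratic_Holo. intros s Hs. unfold cdisc in Hs. assert (S0 := Cmod_ge_0 (s-c)).
  set (q := (r+Cmod (s-c))/2). set (q2 := (r+q)/2).
  destruct (Holo_bounded_disc phi phi' c r q2 H) as (M & HM); [unfold q2, q; lra|].
  assert (M0 : 0 <= M). { generalize (HM c), (Cmod_ge_0 (phi c)). rewrite Cmod_self. intros X Y. specialize (X ltac:(unfold q2, q; lra)). lra. }
  assert (Hq : 0 < q2-q) by (unfold q2, q; lra).
  exists (q-Cmod (s-c)), (M*q2/((q2-q)*(q2-q)*(q2-q)) ). split; [unfold q; lra|]. split.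
  { apply Rmult_le_pos; [apply Rmult_le_pos; unfold q2, q; lra|]. pos. }
  intros z w Hz Hw.
  assert (Z1 : Cmod (z-c) <= q) by (generalize (Cmod_minus_le z s c); lra).
  assert (W1 : Cmod (w-c) <= q) by (generalize (Cmod_minus_le w s c); lra).
  assert (Z2 : cdisc c r z) by (unfold cdisc; unfold q2, q in *; lra). assert (W2 : cdisc c r w) by (unfold cdisc; unfold q2, q in *; lra).
  set (K := M*q2/((q2-q)*(q2-q)*(q2-q))*(Cmod (z-w)*Cmod (z-w))). replace K with (K*(1-0)) by ring.
  apply (CInt_quadratic (fun z t => phi (p z t)) (fun z t => phi' (p z t)*RtoC t)%C); auto; [lra|].
  intros t Ht. replace (phi' (p w t)*t*(z-w))%C with (phi' (p w t)*(p z t-p w t))%C by (unfold p; ring).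
  eapply Rle_trans. apply (Cauchy_quadratic_bound phi phi' c r q2 H) with (M := M) (q := q); try (unfold q2, q; lra); auto.
  - intros u. apply HM. replace (c+q2*cis u-c)%C with (RtoC q2*cis u)%C by ring. rewrite Cmod_mult, Cmod_cis, Cmod_RtoC_pos; unfold q2, q; lra.
  - mull. apply Rmult_le_pos; [apply Rmult_le_pos; unfold q2, q; lra|]. pos.
   replace (p z t-p w t)%C with ((z-w)*RtoC t)%C by (unfold p; ring). rewrite Cmod_mult, Cmod_RtoC_pos by lra. mul; try apply Rmult_le_pos; try lra; rewrite <- (Rmult_1_r (Cmod (z-w))) at 2; mull; lra. }
 exists (fun z => (z-c)*J z)%C. split; [ring|].
 intros z Hz. split; [|eapply Holo_ccont; eauto].
 assert (K := cderiv_mult _ _ _ _ _ (proj1 (Holo_sub_const (fun _ => True) c z I)) (proj1 (HJ z Hz))).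
 replace (phi z) with (1*J z+(z-c)*J1 z)%C; auto.
 unfold J, J1. rewrite Cmult_1_l, <- CInt_mult_const by cont. rewrite <- CInt_plus; auto; [|lra|].
 2:{ intros t Ht. apply rcont_mult; [cont|apply c2; pos]. }
 rewrite (CInt_FTC (fun t => RtoC t*phi (p z t))%C); try lra.
 - unfold p. replace (c+(z-c)*1)%C with z by ring. ring.
 - intros t Ht.
  assert (E := rderiv_comp phi (p z) t _ _ (pt z t) (proj1 (H _ (IN' z t Ht Hz)))).
  assert (E' := rderiv_mult _ _ _ _ _ (rderiv_affine 0 1 t) E).
  replace (phi (p z t)+(z-c)*(phi' (p z t)*t))%C with (1*phi (p z t)+(0+1*t)*(phi' (p z t)*(z-c)))%C by ring.
  apply rderiv_ext with (2 := E'). intro; ring.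
 - intros t Ht. apply rcont_plus. apply c1; pos. apply rcont_mult; [cont|]. apply c2; pos.
Qed.

Lemma Cconj_cis t : (Cconj (cis t)*cis t = 1)%C.
Proof. apply C_eq; simpl; generalize (sin2_cos2 t); unfold Rsqr; lra. Qed.
Lemma Cconj_RtoC a : Cconj (RtoC a) = RtoC a. Proof. apply C_eq; simpl; lra. Qed.
Lemma CInt_conj f a b : a <= b -> contin f a b -> CInt (fun t => Cconj (f t)) a b = Cconj (CInt f a b).
Proof.
 intros H Hf. apply C_eq; simpl; auto.
 rewrite (RInt_ext _ (fun t => -1*Im (f t))) by (intros; unfold Im; lra).
 rewrite RInt_scal_R by cont. lra.
Qed.

(** [h / h c] is the exponential of a primitive [G] of h'/h, and Re G <= m. In the Cauchy integral
    for G' the conjugate of [G] and any constant may be added freely, so the integrand becomes 2 (Re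
    G - m) times the kernel; this weight has one sign and mean -2m because [G c = 0]. *)
Lemma Borel_Caratheodory (h h' : C -> C) c r q q' m : Holo (cdisc c r) h h' -> (forall z, cdisc c r z -> h z <> 0) -> 0 <= q' -> q' < q -> q < r ->
 (forall z, cdisc c r z -> Cmod (h z) <= exp m*Cmod (h c)) ->
 forall w, Cmod (w-c) <= q' -> Cmod (h' w) <= 2*q*m/((q-q')*(q-q'))*Cmod (h w).
Proof.
 intros H NZ Q0 Q1 Q2 HM w Hw. assert (Hq : 0 < q) by lra.
 assert (HL := Holo_div _ _ _ _ _ (Holo_deriv _ _ _ (copen_disc c r) H) H NZ).
 destruct (Holo_primitive _ _ _ _ HL) as (G & G0 & HG).
 assert (EG : forall z, cdisc c r z -> (h z*Cexp (- G z) = h c)%C).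
 { intros z Hz. set (p := fun t => (c+(z-c)*RtoC t)%C).
  assert (IN : forall t, 0 <= t <= 1 -> cdisc c r (p t)).
  { intros t Ht. unfold cdisc, p in *. replace (c+(z-c)*t-c)%C with ((z-c)*RtoC t)%C by ring.
   rewrite Cmod_mult, Cmod_RtoC_pos by lra. assert (0 <= Cmod (z-c)) by apply Cmod_ge_0. nra. }
  assert (E := rderiv_0_constant (fun t => h (p t)*Cexp (- G (p t)))%C 0 1 Rle_0_1).
  cbv beta in E. replace (p 0) with c in E by (unfold p; ring). replace (p 1) with z in E by (unfold p; ring). rewrite G0 in E.
  replace (h c) with (h c*Cexp (-0))%C. apply E. 2: replace (-0)%C with (RtoC 0) by ring; rewrite Cexp_0; ring.
  intros t Ht. specialize (IN t Ht).
  assert (D := cderiv_mult _ _ _ _ _ (proj1 (H _ IN)) (cderiv_comp Cexp _ _ _ _ (cderiv_opp _ _ _ (proj1 (HG _ IN))) (cderiv_Cexp _))).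
  assert (D' := rderiv_comp _ p t _ _ (rderiv_affine c (z-c) t) D). cbv beta in D'.
  match type of D' with rderiv _ _ ?l => replace l with (RtoC 0) in D' end. exact D'. field. auto. }
 assert (RG : forall z, cdisc c r z -> Re (G z) <= m).
 { intros z Hz. specialize (HM z Hz). assert (E := EG z Hz). assert (P : 0 < Cmod (h z)) by (apply Cmod_gt_0; auto).
  rewrite <- E, Cmod_mult, Cmod_Cexp, Re_Copp in HM.
  assert (1 <= exp (m-Re (G z))).
  { unfold Rminus. rewrite exp_plus. nra. }
  destruct (Rle_dec (Re (G z)) m); auto. assert (exp (m-Re (G z)) < exp 0) by (apply exp_increasing; lra). rewrite exp_0 in H1. lra. }
 set (L := (h' w/h w)%C).
 assert (Wr : cdisc c r w) by (unfold cdisc; lra).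
 assert (PI0 : RtoC (2*PI) <> 0) by (intro E; apply RtoC_inj in E; generalize PI_RGT_0; lra).
 set (v := (w-c)%C) in *. assert (Hv : Cmod v < q) by lra.
 set (k := fun t => (RtoC q*cis t/((RtoC q*cis t-v)*(RtoC q*cis t-v)))%C).
 set (g := fun t => G (c+RtoC q*cis t)%C).
 assert (Nt : forall t, (RtoC q*cis t-v <> 0)%C) by (intro; apply circle_neq; lra).
 assert (kc : forall t, rcont k t).
 { intro t. apply rcont_mult; [cont|]. apply rcont_inv; [|apply Cmult_neq_0; auto].
  cont. }
 assert (gc : forall t, rcont g t) by (eapply Holo_circle_rcont; eauto).
 assert (I1 : CInt (fun t => g t*k t)%C 0 (2*PI) = (RtoC (2*PI)*L)%C).
 { unfold L. rewrite (Cauchy_CT2 _ _ c r q HG Hq Q2 w Hv). fold v. unfold CT2.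
  replace (RtoC (2*PI)*(/ RtoC (2*PI)*CInt (fun t => G (c+q*cis t)*(q*cis t)/((q*cis t-v)*(q*cis t-v))) 0 (2*PI)))%C with
   (CInt (fun t => G (c+q*cis t)*(q*cis t)/((q*cis t-v)*(q*cis t-v)))%C 0 (2*PI)) by (field; pos).
  apply CInt_ext; [apply two_PI_pos|]. intros t _. unfold g, k, Cdiv; ring. }
 assert (I2 : CInt k 0 (2*PI) = 0).
 { assert (E := Cauchy_CT2 _ _ c r q (Holo_const _ 1) Hq Q2 w Hv). fold v in E. unfold CT2 in E.
  replace (CInt k 0 (2*PI)) with (RtoC (2*PI)*(/ RtoC (2*PI)*CInt (fun t => 1*(q*cis t)/((q*cis t-v)*(q*cis t-v))) 0 (2*PI)))%C.
  rewrite <- E; ring. transitivity (CInt (fun t => 1*(q*cis t)/((q*cis t-v)*(q*cis t-v)))%C 0 (2*PI)). field; pos.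
  apply CInt_ext; [apply two_PI_pos|]. intros t _. rewrite Cmult_1_l; auto. }
 assert (V0 := Cmod_ge_0 v).
 (* After conjugation the kernel is, on the circle, the boundary value of a function that vanishes
    at [c]. Its pole lies at distance q^2/|v| from [c], which is at least 2q - |v|, so the disc of
    radius [R1] avoids it and still reaches beyond the circle. *)
 assert (I3 : CInt (fun t => Cconj (g t)*k t)%C 0 (2*PI) = 0).
 { set (R1 := Rmin r (q+(q-Cmod v))). assert (HR1 : q < R1) by (apply Rmin_glb_lt; lra).
  assert (R1r : R1 <= r) by apply Rmin_l. assert (R1v : R1 <= q+(q-Cmod v)) by apply Rmin_r.
  assert (q0 : RtoC q <> 0) by (intro E; apply RtoC_inj in E; lra).
  assert (ND : forall z, cdisc c R1 z -> (RtoC q-Cconj v*(z-c)/RtoC q <> 0)%C).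
  { intros z Hz. unfold cdisc in Hz. apply Cmod_lt_neq. rewrite Cmod_div, Cmod_mult, Cmod_conj, Cmod_RtoC_pos by pos. apply (Rmult_lt_reg_r q); auto. replace (Cmod v*Cmod (z-c)/q*q) with (Cmod v*Cmod (z-c)) by fld.
   nra. }
  assert (HD : Holo (cdisc c R1) (fun z => RtoC q-Cconj v*(z-c)/RtoC q)%C (fun _ => - (Cconj v/RtoC q))%C).
  { apply Holo_ext with (fun z => RtoC q+(- (Cconj v/RtoC q))*(z-c))%C. apply copen_disc. intros; field; pos.
   assert (X := Holo_plus (cdisc c R1) _ _ _ _ (Holo_const _ (RtoC q)) (Holo_mult_const _ (-(Cconj v/RtoC q)) _ _ (Holo_sub_const _ c))).
   intros z Hz. destruct (X z Hz) as (X1 & X2). split; [|cont].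
   replace (0 + - (Cconj v/q)*1)%C with (-(Cconj v/q))%C in X1 by ring. pos. }
  assert (HG1 : Holo (cdisc c R1) G (fun z => h' z/h z)%C). { intros z Hz. apply HG. unfold cdisc in *; lra. }
  assert (HK := Holo_div _ _ _ _ _ (Holo_mult _ _ _ _ _ HG1 (Holo_sub_const _ c)) (Holo_mult _ _ _ _ _ HD HD) (fun z Hz => Cmult_neq_0 _ _ (ND z Hz) (ND z Hz))).
  assert (E := Cauchy_formula _ _ c R1 q HK Hq HR1 c ltac:(rewrite Cmod_self; lra)). cbv beta in E.
  assert (E' : CInt (fun t => Cconj (Cconj (g t)*k t)) 0 (2*PI) = 0).
  { rewrite <- (Cmult_0_r (RtoC (2*PI))). match type of E with _ = (_ * ?X)%C => replace X with (RtoC 0) in E end.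
   2:{ unfold Cdiv; ring. }
   rewrite <- E. apply CInt_ext; [apply two_PI_pos|]. intros t _.
   assert (Cn : cis t <> 0) by (apply Cmod_gt_0; rewrite Cmod_cis; lra).
   assert (Cb : Cconj (cis t) = (/ cis t)%C).
   { replace (Cconj (cis t)) with (Cconj (cis t)*cis t * / cis t)%C by (field; pos). rewrite Cconj_cis; ring. }
   assert (Z1 : cdisc c R1 (c+RtoC q*cis t)%C). { unfold cdisc. replace (c+q*cis t-c)%C with (RtoC q*cis t)%C by ring. rewrite Cmod_mult, Cmod_cis, Cmod_RtoC_pos; lra. }
   assert (N1 := ND _ Z1). replace (c+q*cis t-c)%C with (RtoC q*cis t)%C in * by ring.
   replace (q-Cconj v*(q*cis t)/q)%C with (q-Cconj v*cis t)%C in * by (field; pos).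
   unfold k. rewrite !Cmult_conj, Cconj_conj, Cdiv_conj by (apply Cmult_neq_0; auto). rewrite !Cmult_conj, !Cminus_conj, !Cmult_conj, Cconj_RtoC, Cb.
   fold (g t). replace (q*cis t-(c-c))%C with (q*cis t)%C by ring.
   field. auto. }
  rewrite CInt_conj in E'; [|apply two_PI_pos|].
  2:{ intros t _. cont. }
  apply (f_equal Cconj) in E'. rewrite Cconj_conj, Cconj_RtoC in E'. auto. }
 assert (I4 : RInt (fun t => Re (g t)) 0 (2*PI) = 0).
 { assert (E := Cauchy_formula _ _ c r q HG Hq Q2 c ltac:(rewrite Cmod_self; lra)). rewrite G0 in E.
  assert (X : CInt g 0 (2*PI) = 0).
  { rewrite <- (Cmult_0_r (RtoC (2*PI))), <- E. apply CInt_ext; [apply two_PI_pos|]. intros t _. unfold g.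
   assert (Cn : cis t <> 0) by (apply Cmod_gt_0; rewrite Cmod_cis; lra). assert (q0 : RtoC q <> 0) by (intro E'; apply RtoC_inj in E'; lra).
   replace (q*cis t-(c-c))%C with (q*cis t)%C by ring. field. auto. }
  apply (f_equal Re) in X. pos. }
 assert (I5 : CInt (fun t => (RtoC (2*(Re (g t)-m)))*k t)%C 0 (2*PI) = (RtoC (2*PI)*L)%C).
 { rewrite (CInt_ext _ (fun t => (g t*k t+Cconj (g t)*k t)+RtoC (-2*m)*k t)%C); [|apply two_PI_pos|].
  - assert (A1 : contin (fun t => g t*k t)%C 0 (2*PI)) by (intros t _; cont).
   assert (A2 : contin (fun t => Cconj (g t)*k t)%C 0 (2*PI)) by (intros t _; cont).
   assert (A3 : contin (fun t => RtoC (-2*m)*k t)%C 0 (2*PI)) by (intros t _; cont).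
   rewrite CInt_plus; auto using two_PI_pos; [|intros t Ht; cont].
   rewrite CInt_plus, CInt_mult_const, I1, I2, I3; auto using two_PI_pos. ring. intros t _; auto.
  - intros t _. replace (RtoC (2*(Re (g t)-m))) with (g t+Cconj (g t)+RtoC (-2*m))%C. ring.
   apply C_eq; simpl; unfold Re, Im; lra. }
 assert (B : Cmod (RtoC (2*PI)*L) <= 2*m*(2*PI)*(q/((q-q')*(q-q')))).
 { rewrite <- I5. set (K := q/((q-q')*(q-q'))).
  assert (IR : ex_RInt (fun t => Re (g t)) 0 (2*PI)) by (apply contin_Re; [apply two_PI_pos|intros t _; auto]).
  assert (EI : (RInt (fun t => K*(2*m)+(-2*K)*Re (g t)) 0 (2*PI) : R) = 2*m*(2*PI)*K) by (rewrite RInt_plus_R, (RInt_scal_R (fun t => Re (g t))), RInt_const_R, I4; auto using ex_RInt_scal_R; [lra|apply ex_RInt_const]).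
  rewrite <- EI.
  apply CInt_bound_RInt. apply two_PI_pos.
  - intros t _. cont.
  - apply ex_RInt_plus_R; [apply ex_RInt_const|]. cont.
  - intros t _. rewrite Cmod_mult. assert (Re (g t) <= m).
   { apply RG. unfold cdisc. replace (c+q*cis t-c)%C with (RtoC q*cis t)%C by ring. rewrite Cmod_mult, Cmod_cis, Cmod_RtoC_pos; lra. }
   rewrite Cmod_R, Rabs_left1 by lra.
   assert (Bk : Cmod (k t) <= K).
   { unfold k. rewrite Cmod_div by (apply Cmult_neq_0; auto). rewrite !Cmod_mult, Cmod_cis, Cmod_RtoC_pos, Rmult_1_r by lra.
    mull. apply Rinv_le_contravar. nra. assert (X := circle_dist q v t ltac:(lra)). nra. }
   nra. }
 rewrite Cmod_mult, Cmod_RtoC_pos in B by apply two_PI_pos.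
 assert (BL : Cmod L <= 2*q*m/((q-q')*(q-q'))).
 { apply (Rmult_le_reg_l (2*PI)). generalize PI_RGT_0; lra. nra. }
 replace (h' w) with (L*h w)%C by (unfold L; field; auto). rewrite Cmod_mult. apply Rmult_le_compat_r; auto. pos.
Qed.

(** * Finite lists of zeros, Blaschke factors and Landau's lemma *)

Definition Cprod (Z : list C) (z : C) : C := fold_right (fun rho a => (z-rho)*a)%C (RtoC 1) Z.
(** Zeros with multiplicity are a list with repetitions, and being a list of zeros of [f] means that
    the product of linear factors splits off with a holomorphic cofactor. *)
Definition divides_on (D : C -> Prop) (Z : list C) (f g g' : C -> C) : Prop :=
 Holo D g g' /\ forall z, D z -> f z = (Cprod Z z*g z)%C.

(** While the cofactor vanishes somewhere in [P], one more zero can be divided out; the bound on the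
    length of such lists stops this. *)
Lemma max_zero_list D (f f' : C -> C) (P : C -> Prop) N : copen D -> Holo D f f' -> (forall z, P z -> D z) ->
 (forall Z g g', divides_on D Z f g g' -> (forall rho, In rho Z -> P rho) -> (length Z <= N)%nat) ->
 exists Z g g', divides_on D Z f g g' /\ (forall rho, In rho Z -> P rho) /\ (forall rho, P rho -> g rho <> 0).
Proof.
 intros O H HP HN. apply NNPP. intro Neg.
 assert (Step : forall k, exists Z g g', divides_on D Z f g g' /\ (forall rho, In rho Z -> P rho) /\ length Z = k).
 { induction k as [|k (Z & g & g' & (Hg & E) & HZ & L)].
  - exists nil, f, f'. repeat split; try apply H; auto. intros; simpl; ring. simpl; tauto.
  - destruct (classic (forall rho, P rho -> g rho <> 0)) as [Q|Q].
   { exfalso. apply Neg. exists Z, g, g'. repeat split; auto; apply Hg; pos. }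
   apply not_all_ex_not in Q. destruct Q as (rho & Q). apply imply_to_and in Q. destruct Q as (Pr & Q). apply NNPP in Q.
   exists (rho :: Z), (divide_zero g g' rho), (Cder (divide_zero g g' rho)). split; split.
   + apply Holo_divide_zero; auto.
   + intros z Hz. simpl. rewrite E, (divide_zero_eq g g' rho z) by auto. ring.
   + intros r [<-|K]; auto.
   + simpl; auto. }
 destruct (Step (S N)) as (Z & g & g' & Hd & HZ & L). specialize (HN Z g g' Hd HZ). lia.
Qed.

(** The denominator of a Blaschke factor, scaled. Substituting it for the factor [z-rho] removes a
    zero from the disc. *)
Definition bfactor (c : C) (R1 : R) (rho z : C) : C := ((RtoC (R1*R1)-Cconj (rho-c)*(z-c))/RtoC R1)%C.
Definition bprod (c : C) (R1 : R) (Z : list C) (z : C) : C := fold_right (fun rho a => bfactor c R1 rho z*a)%C (RtoC 1) Z.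
Fixpoint bprod' (c : C) (R1 : R) (Z : list C) (z : C) : C :=
 match Z with nil => RtoC 0 | rho :: Z' => ((- (Cconj (rho-c)/RtoC R1))*bprod c R1 Z' z+bfactor c R1 rho z*bprod' c R1 Z' z)%C end.

Section Blaschke.
Variables (c : C) (R1 r : R).
Hypotheses (Hr : 0 < r) (HR : r < R1).
Let R1n : RtoC R1 <> 0. Proof. intro E; apply RtoC_inj in E; lra. Qed.
Lemma Holo_bprod D Z : Holo D (bprod c R1 Z) (bprod' c R1 Z).
Proof.
 induction Z as [|rho Z IH]; [apply Holo_const|].
 assert (HB : Holo D (bfactor c R1 rho) (fun _ => - (Cconj (rho-c)/RtoC R1))%C).
 { intros z Hz. split; [|cont].
  assert (X := cderiv_plus _ _ _ _ _ (cderiv_const (RtoC R1) z) (cderiv_mult_const (-(Cconj (rho-c)/RtoC R1)) _ _ _ (proj1 (Holo_sub_const D c z Hz)))). replace (0 + - (Cconj (rho-c)/R1)*1)%C with (- (Cconj (rho-c)/R1))%C in X by ring.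
  apply cderiv_ext with (2 := X). intro w. unfold bfactor. rewrite RtoC_mult. field; pos. }
 exact (Holo_mult _ _ _ _ _ HB IH).
Qed.
(* On the circle |z - c| = R1 a Blaschke factor has the modulus of the linear factor it replaces. *)
Lemma bfactor_circle rho z : Cmod (z-c) = R1 -> Cmod (bfactor c R1 rho z) = Cmod (z-rho).
Proof.
 intro H. unfold bfactor. set (a := (rho-c)%C). set (v := (z-c)%C) in *.
 assert (E : RtoC (R1*R1) = (v*Cconj v)%C). { rewrite <- Cmod2_conj, H. f_equal; lra. }
 rewrite E. replace (v*Cconj v-Cconj a*v)%C with (v*Cconj (v-a))%C by (rewrite Cminus_conj; ring).
 rewrite Cmod_div, Cmod_mult, Cmod_conj, H, Cmod_RtoC_pos by pos.
 replace (z-rho)%C with (v-a)%C by (unfold v, a; ring). fld.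
Qed.
Lemma bprod_circle Z z : Cmod (z-c) = R1 -> Cmod (bprod c R1 Z z) = Cmod (Cprod Z z).
Proof. intro H. induction Z as [|rho Z IH]; simpl; auto. rewrite !Cmod_mult, IH, bfactor_circle; lra. Qed.
Lemma bprod_center Z : Cmod (bprod c R1 Z c) = R1^length Z.
Proof.
 induction Z as [|rho Z IH]; simpl. apply Cmod_1. rewrite Cmod_mult, IH. f_equal. unfold bfactor.
 replace (RtoC (R1*R1)-Cconj (rho-c)*(c-c))%C with (RtoC R1*RtoC R1)%C by (rewrite RtoC_mult; ring).
 replace (R1*R1/R1)%C with (RtoC R1) by (field; pos). apply Cmod_RtoC_pos; lra.
Qed.
Lemma bfactor_lower rho z : Cmod (rho-c) <= r -> Cmod (z-c) < r -> (R1*R1-r*r)/R1 <= Cmod (bfactor c R1 rho z).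
Proof.
 intros H1 H2. unfold bfactor. rewrite Cmod_div, Cmod_RtoC_pos by pos.
 apply Rmult_le_compat_r. pos.
 assert (X := Cmod_le_minus (RtoC (R1*R1)) (RtoC (R1*R1)-Cconj (rho-c)*(z-c))).
 replace (RtoC (R1*R1)-(RtoC (R1*R1)-Cconj (rho-c)*(z-c)))%C with (Cconj (rho-c)*(z-c))%C in X by ring.
 rewrite Cmod_mult, Cmod_conj, Cmod_RtoC_pos in X by nra.
 assert (Cmod (rho-c)*Cmod (z-c) <= r*r). mul; pos. lra.
Qed.
Lemma bprod_neq_0 Z z : (forall rho, In rho Z -> Cmod (rho-c) <= r) -> Cmod (z-c) < r -> bprod c R1 Z z <> 0.
Proof.
 intros HZ Hz. induction Z as [|rho Z IH]; simpl. intro E; apply RtoC_inj in E; lra.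
 apply Cmult_neq_0; [|apply IH; intros; apply HZ; right; pos].
 apply Cmod_gt_0. eapply Rlt_le_trans; [|apply bfactor_lower; auto; apply HZ; left; auto].
 apply Rdiv_lt_0_compat; nra.
Qed.
Lemma bprod'_bound Z z : (forall rho, In rho Z -> Cmod (rho-c) <= r) -> Cmod (z-c) < r ->
 Cmod (bprod' c R1 Z z) <= INR (length Z)*(r/(R1*R1-r*r))*Cmod (bprod c R1 Z z).
Proof.
 intros HZ Hz. assert (P : 0 < R1*R1-r*r) by nra.
 induction Z as [|rho Z IH]. simpl. rewrite Cmod_0; lra.
 assert (HZ' : forall rho, In rho Z -> Cmod (rho-c) <= r) by (intros; apply HZ; right; pos). specialize (IH HZ').
 assert (B := bfactor_lower rho z (HZ rho (or_introl eq_refl)) Hz). assert (Hrho := HZ rho (or_introl eq_refl)).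
 change (bprod' c R1 (rho :: Z) z) with ((- (Cconj (rho-c)/RtoC R1))*bprod c R1 Z z+bfactor c R1 rho z*bprod' c R1 Z z)%C.
 change (bprod c R1 (rho :: Z) z) with (bfactor c R1 rho z*bprod c R1 Z z)%C.
 change (length (rho :: Z)) with (S (length Z)). rewrite S_INR.
 tr Cmod_triangle. rewrite !Cmod_mult, Cmod_opp, Cmod_div, Cmod_conj, Cmod_RtoC_pos by pos.
 set (k := r/(R1*R1-r*r)). set (b := Cmod (bprod c R1 Z z)) in *. set (u := Cmod (bfactor c R1 rho z)) in *.
 assert (b0 : 0 <= b) by apply Cmod_ge_0.
 assert (K1 : Cmod (rho-c)/R1 <= k*u).
 { via (k*((R1*R1-r*r)/R1)). unfold k. replace (r/(R1*R1-r*r)*((R1*R1-r*r)/R1)) with (r/R1) by fld.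
  apply Rmult_le_compat_r; auto. pos. mull; auto. left; apply Rdiv_lt_0_compat; lra. }
 assert (u0 : 0 <= u) by apply Cmod_ge_0.
 apply (Rmult_le_compat_r b) in K1; auto. fold k in IH. nra.
Qed.
End Blaschke.

Section Landau.
Variables (c : C) (r R1 R0 M : R) (Z : list C) (f g g' : C -> C).
Hypotheses (Hr : 0 < r) (HrR : r < R1) (HR0 : R1 < R0) (Hd : divides_on (cdisc c R0) Z f g g')
 (HZ : forall rho, In rho Z -> Cmod (rho-c) <= r) (Hc : f c <> 0)
 (HM : forall z, Cmod (z-c) = R1 -> Cmod (f z) <= M*Cmod (f c)).
Let h z := (g z*bprod c R1 Z z)%C.
Let h' z := (g' z*bprod c R1 Z z+g z*bprod' c R1 Z z)%C.
Let Hh : Holo (cdisc c R0) h h'.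
Proof. apply Holo_mult. apply Hd. apply Holo_bprod with r; lra. Qed.
Let Hcirc : forall t, Cmod (h (c+RtoC R1*cis t)%C) <= M*Cmod (f c).
Proof.
 intro t. assert (E : Cmod (c+RtoC R1*cis t-c) = R1).
 { replace (c+R1*cis t-c)%C with (RtoC R1*cis t)%C by ring. rewrite Cmod_mult, Cmod_cis, Cmod_RtoC_pos; lra. }
 eapply Rle_trans; [|apply HM; apply E]. right. unfold h. rewrite Cmod_mult, (bprod_circle c R1 r) by lra.
 rewrite (proj2 Hd) by (unfold cdisc; lra). rewrite Cmod_mult; lra.
Qed.
Let fc : Cmod (f c) <= Cmod (g c)*r^length Z.
Proof.
 rewrite (proj2 Hd) by (unfold cdisc; rewrite Cmod_self; lra). rewrite Cmod_mult, Rmult_comm. mull.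
 clear-HZ. induction Z as [|rho Z' IH]; simpl. rewrite Cmod_1; lra. rewrite Cmod_mult. mul.
 rewrite Cmod_minus_sym. apply HZ; left; auto. apply IH. intros; apply HZ; right; pos.
Qed.
Let hc : Cmod (h c) = Cmod (g c)*R1^length Z.
Proof. unfold h. rewrite Cmod_mult, (bprod_center c R1 r); lra. Qed.
Let gc0 : 0 < Cmod (g c).
Proof.
 apply Cmod_gt_0. intro E. apply Hc. rewrite (proj2 Hd) by (unfold cdisc; rewrite Cmod_self; lra). rewrite E; ring.
Qed.
(** Jensen's inequality in multiplicative form. With Blaschke factors in place of linear ones the
    modulus on the circle [R1] is that of [f], whereas at the centre each of the listed zeros gains
    at least a factor [R1/r]. *)
Lemma zero_count : (R1/r)^length Z <= M.
Proof.
 assert (B := Cauchy_bound h h' c R0 R1 Hh ltac:(lra) HR0 (M*Cmod (f c)) Hcirc c 0 ltac:(lra) ltac:(rewrite Cmod_self; lra)). replace (M*Cmod (f c)*R1/(R1-0)) with (M*Cmod (f c)) in B by fld.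
 assert (F0 : 0 < Cmod (f c)) by now apply Cmod_gt_0.
 assert (P1 : 0 < r^length Z) by pos. assert (P2 : 0 < R1^length Z) by pos.
 unfold Rdiv. rewrite Rpow_mult_distr, pow_inv by lra. apply (Rmult_le_reg_r (r^length Z)); auto.
 rewrite Rmult_assoc, Rinv_l by lra. nra.
Qed.
Hypothesis NZ : forall z, Cmod (z-c) < r -> g z <> 0.
(** The product [h] of [g] with the Blaschke factors has no zero in the disc [r], so
    Borel-Caratheodory applies; the factors are then taken off, each costing at most
    [r/(R1*R1-r*r)]. The upper bound inside the circle comes from Cauchy's integral, hence the
    quotient [R1/(R1-r)] in the logarithm. *)
Lemma Landau_log_derivative q q' w : 0 <= q' -> q' < q -> q < r -> Cmod (w-c) <= q' ->
 Cmod (g' w) <= (2*q*ln (M*R1/(R1-r))/((q-q')*(q-q'))+INR (length Z)*(r/(R1*R1-r*r)))*Cmod (g w).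
Proof.
 intros Q0 Q1 Q2 Hw.
 assert (M1 : 1 <= M). { trr zero_count. apply pow_R1_Rle. apply (Rmult_le_reg_r r); auto. unfold Rdiv. rewrite Rmult_assoc, Rinv_l; lra. }
 assert (X0 : 0 < M*R1/(R1-r)) by pos.
 assert (Hh' : Holo (cdisc c r) h h'). { intros z Hz. apply Hh. unfold cdisc in *; lra. }
 assert (fh : Cmod (f c) <= Cmod (h c)). { rewrite hc. tr fc. mull. apply pow_incr; lra. }
 assert (hb : forall z, cdisc c r z -> Cmod (h z) <= exp (ln (M*R1/(R1-r)))*Cmod (h c)).
 { intros z Hz. rewrite exp_ln by auto.
  eapply Rle_trans. apply (Cauchy_bound h h' c R0 R1 Hh ltac:(lra) HR0 (M*Cmod (f c)) Hcirc z r ltac:(lra)). unfold cdisc in Hz; lra.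
  nra. }
 assert (hn : forall z, cdisc c r z -> h z <> 0).
 { intros z Hz. apply Cmult_neq_0; [auto|]. apply bprod_neq_0 with r; pos. }
 assert (BC := Borel_Caratheodory h h' c r q q' _ Hh' hn Q0 Q1 Q2 hb w Hw).
 assert (bn : bprod c R1 Z w <> 0) by (apply bprod_neq_0 with r; pos).
 assert (bb := bprod'_bound c R1 r Hr HrR Z w HZ ltac:(lra)).
 set (b := bprod c R1 Z w) in *. set (b' := bprod' c R1 Z w) in *. assert (b0 : 0 < Cmod b) by now apply Cmod_gt_0.
 apply (Rmult_le_reg_r (Cmod b)); auto. rewrite <- Cmod_mult.
 replace (g' w*b)%C with (h' w-g w*b')%C by (unfold h', b, b'; ring).
 tr Cmod_sub_le. rewrite Cmod_mult. replace (h w) with (g w*b)%C in BC by reflexivity. rewrite Cmod_mult in BC.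
 assert (Cmod (g w)*Cmod b' <= Cmod (g w)*(INR (length Z)*(r/(R1*R1-r*r))*Cmod b)) by (mull; lra).
 lra.
Qed.
End Landau.

(** * Series of holomorphic functions *)

Definition clim (a : nat -> C) (l : C) : Prop :=
 forall eps, 0 < eps -> exists N, forall n, (N <= n)%nat -> Cmod (a n-l) < eps.
Fixpoint cpsum (u : nat -> C) (N : nat) : C := match N with O => RtoC 0 | S k => (cpsum u k+u k)%C end.
Definition Csum (u : nat -> C) : C := (Series (fun n => Re (u n)), Series (fun n => Im (u n))).

Lemma clim_components a l : is_lim_seq (fun n => Re (a n)) (Re l) -> is_lim_seq (fun n => Im (a n)) (Im l) -> clim a l.
Proof.
 intros H1 H2 eps He. apply is_lim_seq_spec in H1. apply is_lim_seq_spec in H2.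
 assert (E2 : 0 < eps/2) by lra. destruct (H1 (mkposreal _ E2)) as (N1 & K1). destruct (H2 (mkposreal _ E2)) as (N2 & K2). simpl in *.
 exists (N1+N2)%nat. intros n Hn. specialize (K1 n ltac:(lia)). specialize (K2 n ltac:(lia)).
 eapply Rle_lt_trans; [apply Cmod_le_Re_Im|]. rewrite Re_Cminus, Im_Cminus. lra.
Qed.
Lemma clim_Re a l : clim a l -> is_lim_seq (fun n => Re (a n)) (Re l).
Proof.
 intros H. apply is_lim_seq_spec. intros eps. destruct (H eps (cond_pos eps)) as (N & K). exists N. intros n Hn.
 rewrite <- Re_Cminus. eapply Rle_lt_trans; [apply re_le_Cmod|auto].
Qed.
Lemma clim_Im a l : clim a l -> is_lim_seq (fun n => Im (a n)) (Im l).
Proof.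
 intros H. apply is_lim_seq_spec. intros eps. destruct (H eps (cond_pos eps)) as (N & K). exists N. intros n Hn.
 rewrite <- Im_Cminus. eapply Rle_lt_trans; [apply im_le_Cmod|auto].
Qed.
Lemma clim_unique a l m : clim a l -> clim a m -> l = m.
Proof.
 intros H K. apply C_eq.
 assert (X := is_lim_seq_unique _ _ (clim_Re _ _ H)). rewrite (is_lim_seq_unique _ _ (clim_Re _ _ K)) in X. congruence.
 assert (X := is_lim_seq_unique _ _ (clim_Im _ _ H)). rewrite (is_lim_seq_unique _ _ (clim_Im _ _ K)) in X. congruence.
Qed.
Lemma clim_ext a b l : (forall n, a n = b n) -> clim a l -> clim b l.
Proof. intros E H eps He. destruct (H eps He) as (N & K). exists N. intros; rewrite <- E; auto. Qed.
Lemma clim_const c : clim (fun _ => c) c.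
Proof. intros eps He. exists O. intros. rewrite Cmod_self; lra. Qed.
Lemma clim_plus a b l m : clim a l -> clim b m -> clim (fun n => a n+b n)%C (l+m).
Proof.
 intros H K eps He. destruct (H (eps/2)) as (N1 & K1); [lra|]. destruct (K (eps/2)) as (N2 & K2); [lra|].
 exists (N1+N2)%nat. intros n Hn. specialize (K1 n ltac:(lia)). specialize (K2 n ltac:(lia)).
 replace (a n+b n-(l+m))%C with ((a n-l)+(b n-m))%C by ring. eapply Rle_lt_trans; [apply Cmod_triangle|lra].
Qed.
Lemma clim_mult_const c a l : clim a l -> clim (fun n => c*a n)%C (c*l).
Proof.
 intros H eps He. assert (P := Cmod_ge_0 c). destruct (H (eps/(Cmod c+1))) as (N & K); [pos|].
 exists N. intros n Hn. specialize (K n Hn). replace (c*a n-c*l)%C with (c*(a n-l))%C by ring. rewrite Cmod_mult.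
 apply (Rmult_lt_compat_r (Cmod c+1)) in K; [|lra]. replace (eps/(Cmod c+1)*(Cmod c+1)) with eps in K by fld.
 nra.
Qed.
Lemma clim_opp a l : clim a l -> clim (fun n => - a n)%C (- l).
Proof. intro H. apply (clim_mult_const (-(1))) in H. replace (-l)%C with (-(1)*l)%C by ring. apply clim_ext with (2 := H). intro; ring. Qed.
Lemma clim_minus a b l m : clim a l -> clim b m -> clim (fun n => a n-b n)%C (l-m).
Proof. intros. apply clim_plus; auto. apply clim_opp; pos. Qed.
Lemma clim_bound a l B : clim a l -> (forall n, Cmod (a n) <= B) -> Cmod l <= B.
Proof.
 intros H K. destruct (Rle_dec (Cmod l) B); auto. destruct (H (Cmod l-B)) as (N & KN); [lra|].
 specialize (KN N (le_n _)). rewrite Cmod_minus_sym in KN. assert (X := Cmod_le_minus l (a N)). specialize (K N). lra.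
Qed.
Lemma clim_0_bound a b : (forall n, Cmod (a n) <= b n) -> is_lim_seq b 0 -> clim a 0.
Proof.
 intros H K eps He. apply is_lim_seq_spec in K. destruct (K (mkposreal eps He)) as (N & KN). exists N. intros n Hn.
 specialize (KN n Hn). simpl in KN. rewrite Rminus_0_r in KN. replace (a n-0)%C with (a n) by ring.
 eapply Rle_lt_trans; [auto|]. eapply Rle_lt_trans; [apply Rle_abs|lra].
Qed.
Lemma clim_shift a l : clim a l -> clim (fun n => a (S n)) l.
Proof. intros H eps He. destruct (H eps He) as (N & K). exists N. intros n Hn. auto. Qed.

Lemma Re_cpsum u N : Re (cpsum u (S N)) = sum_n (fun n => Re (u n)) N.
Proof.
 induction N as [|N IH]. simpl. rewrite sum_O. unfold Re. ring.
 change (cpsum u (S (S N))) with (cpsum u (S N)+u (S N))%C. rewrite Re_Cplus, IH, sum_Sn. auto.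
Qed.
Lemma Im_cpsum u N : Im (cpsum u (S N)) = sum_n (fun n => Im (u n)) N.
Proof.
 induction N as [|N IH]. simpl. rewrite sum_O. unfold Im. ring.
 change (cpsum u (S (S N))) with (cpsum u (S N)+u (S N))%C. rewrite Im_Cplus, IH, sum_Sn. auto.
Qed.
Lemma clim_Csum u M : (forall n, Cmod (u n) <= M n) -> ex_series M -> clim (cpsum u) (Csum u).
Proof.
 intros H K.
 assert (E1 : ex_series (fun n => Re (u n))).
 { apply (ex_series_le (K := R_AbsRing) (V := R_CompleteNormedModule) _ M); auto. intro n. trr H. apply re_le_Cmod. }
 assert (E2 : ex_series (fun n => Im (u n))).
 { apply (ex_series_le (K := R_AbsRing) (V := R_CompleteNormedModule) _ M); auto. intro n. trr H. apply im_le_Cmod. }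
 apply clim_components; apply is_lim_seq_incr_1.
 - apply is_lim_seq_ext with (1 := fun n => eq_sym (Re_cpsum u n)). apply (Series_correct _ E1).
 - apply is_lim_seq_ext with (1 := fun n => eq_sym (Im_cpsum u n)). apply (Series_correct _ E2).
Qed.
Lemma cpsum_bound u M N : (forall n, Cmod (u n) <= M n) -> ex_series M -> Cmod (cpsum u N) <= Series M.
Proof.
 intros H K. assert (M0 : forall n, 0 <= M n) by (intro n; tr Cmod_ge_0; cont).
 assert (P : forall N, Cmod (cpsum u N) <= sum_n M N).
 { clear N. intro N. assert (Q : forall N, Cmod (cpsum u (S N)) <= sum_n M N).
  { clear N. induction N as [|N IH]. simpl. rewrite sum_O. replace (0+u O)%C with (u O) by ring. auto. rewrite sum_Sn. tr Cmod_triangle. apply Rplus_le_compat; auto. }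
  destruct N. simpl. rewrite Cmod_0, sum_O; auto. tr Q. rewrite sum_Sn. unfold plus; simpl. generalize (M0 (S N)); lra. }
 tr P. assert (L := Series_correct _ K).
 apply (is_lim_seq_incr_compare (sum_n M)); auto. intro n. rewrite sum_Sn. unfold plus; simpl. generalize (M0 (S n)); lra.
Qed.
Lemma Csum_bound u M : (forall n, Cmod (u n) <= M n) -> ex_series M -> Cmod (Csum u) <= Series M.
Proof. intros H K. apply clim_bound with (cpsum u). eapply clim_Csum; cont. intro; apply cpsum_bound; pos. Qed.
Lemma cpsum_plus u v N : cpsum (fun n => u n+v n)%C N = (cpsum u N+cpsum v N)%C.
Proof. induction N; simpl; [ring|rewrite IHN; ring]. Qed.
Lemma cpsum_mult_const c u N : cpsum (fun n => c*u n)%C N = (c*cpsum u N)%C.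
Proof. induction N; simpl; [ring|rewrite IHN; ring]. Qed.
Lemma cpsum_ext u v N : (forall n, (n < N)%nat -> u n = v n) -> cpsum u N = cpsum v N.
Proof. intro H. induction N; simpl; auto. rewrite IHN, H; auto. Qed.

(** Weierstrass' theorem: a summable local bound for the terms becomes, by Cauchy's estimates, a
    summable bound for their derivatives and for their quadratic remainders. *)
Lemma Holo_Csum D (u u' : nat -> C -> C) : copen D -> (forall n, Holo D (u n) (u' n)) ->
 (forall s, D s -> exists d M, 0 < d /\ ex_series M /\ forall n z, Cmod (z-s) <= d -> Cmod (u n z) <= M n) ->
 Holo D (fun z => Csum (fun n => u n z)) (fun z => Csum (fun n => u' n z)) /\
 (forall z, D z -> clim (cpsum (fun n => u n z)) (Csum (fun n => u n z)) /\ clim (cpsum (fun n => u' n z)) (Csum (fun n => u' n z))).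
Proof.
 intros O H HB.
 assert (KEY : forall s, D s -> exists d M, 0 < d /\ ex_series M /\ (forall n, 0 <= M n) /\
  (forall n z, Cmod (z-s) <= d -> Cmod (u n z) <= M n /\ Cmod (u' n z) <= M n) /\
  (forall n z w, Cmod (z-s) <= d -> Cmod (w-s) <= d -> Cmod (u n z-u n w-u' n w*(z-w)) <= M n*(Cmod (z-w)*Cmod (z-w)))).
 { intros s Hs. destruct (HB s Hs) as (d1 & M & D1 & EM & B). destruct (O s Hs) as (d2 & D2 & IN).
  set (r := Rmin d1 (d2/2)). assert (Hr : 0 < r) by (apply Rmin_pos; lra).
  assert (r1 : r <= d1) by apply Rmin_l. assert (r2 : r <= d2/2) by apply Rmin_r.
  assert (HH : forall n, Holo (cdisc s d2) (u n) (u' n)) by (intros n z Hz; apply H, IN, Hz).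
  assert (M0 : forall n, 0 <= M n). { intro n. tr Cmod_ge_0; apply (B n s). rewrite Cmod_self; lra. }
  assert (CB : forall n t, Cmod (u n (s+RtoC r*cis t)%C) <= M n).
  { intros n t. apply B. replace (s+r*cis t-s)%C with (RtoC r*cis t)%C by ring. rewrite Cmod_mult, Cmod_cis, Cmod_RtoC_pos; lra. }
  (* The three summands serve the function, its derivative and the quadratic remainder, by Cauchy's
     estimates from radius [r] to radius [r/2]. *)
  set (K := 1+4/r+8/(r*r)).
  assert (K1 : 0 < 4/r) by pos. assert (K2 : 0 < 8/(r*r)) by pos.
  exists (r/2), (fun n => M n*K). repeat split.
  - lra.
  - apply ex_series_scal_r; pos.
  - intro n. apply Rmult_le_pos; auto. unfold K; lra.
  - eapply Rle_trans; [cont|]. rewrite <- (Rmult_1_r (M n)) at 1. mull; auto. unfold K; lra.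
  - eapply Rle_trans. apply (Cauchy_deriv_bound (u n) (u' n) s d2 r (HH n) Hr ltac:(lra) (M n) (CB n) z (r/2)); lra.
   replace (M n*r/((r-r/2)*(r-r/2))) with (M n*(4/r)) by fld. mull; auto. unfold K; lra.
  - intros n z w Hz Hw. eapply Rle_trans. apply (Cauchy_quadratic_bound (u n) (u' n) s d2 r (HH n) Hr ltac:(lra) (M n) (CB n) z w (r/2)); lra.
   apply Rmult_le_compat_r. pos.
   replace (M n*r/((r-r/2)*(r-r/2)*(r-r/2))) with (M n*(8/(r*r))) by fld. mull; auto. unfold K; lra. }
 split.
 - apply quadratic_Holo. intros s Hs. destruct (KEY s Hs) as (d & M & Hd & EM & M0 & B & Q).
  exists d, (Series M). split; auto. split.
  { tr Cmod_ge_0; apply (Csum_bound (fun n => u n s) M); auto. intro n. apply B. rewrite Cmod_self; lra. }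
  intros z w Hz Hw.
  assert (Lz := clim_Csum (fun n => u n z) M (fun n => proj1 (B n z (Rlt_le _ _ Hz))) EM).
  assert (Lw := clim_Csum (fun n => u n w) M (fun n => proj1 (B n w (Rlt_le _ _ Hw))) EM).
  assert (Lw' := clim_Csum (fun n => u' n w) M (fun n => proj2 (B n w (Rlt_le _ _ Hw))) EM).
  set (P := Cmod (z-w)*Cmod (z-w)).
  apply clim_bound with (cpsum (fun n => u n z-u n w-u' n w*(z-w))%C).
  + apply clim_ext with (fun N => cpsum (fun n => u n z) N-cpsum (fun n => u n w) N-(z-w)*cpsum (fun n => u' n w) N)%C.
   { intro N. unfold Cminus. rewrite !cpsum_plus. f_equal; [f_equal|].
    - replace (- cpsum (fun n => u n w) N)%C with (-(1)*cpsum (fun n => u n w) N)%C by ring. rewrite <- cpsum_mult_const. apply cpsum_ext; intros; ring.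
    - replace (- ((z + - w)*cpsum (fun n => u' n w) N))%C with (-(z + - w)*cpsum (fun n => u' n w) N)%C by ring. rewrite <- cpsum_mult_const. apply cpsum_ext; intros; ring. }
   rewrite (Cmult_comm (Csum (fun n => u' n w))). apply clim_minus; [apply clim_minus; pos|apply clim_mult_const; pos].
  + intro N. rewrite <- (Series_scal_r P M). apply cpsum_bound. cont. apply ex_series_scal_r; pos.
 - intros z Hz. destruct (KEY z Hz) as (d & M & Hd & EM & M0 & B & Q).
  assert (Z0 : Cmod (z-z) <= d) by (rewrite Cmod_self; lra).
  split; apply (clim_Csum _ M); auto; intro n; apply B; lra.
Qed.

(** * The function (s-1) zeta(s) *)

Lemma Rpower_pos a b : 0 < Rpower a b. Proof. pos. Qed.
Lemma Rpower_le_contra a b p : 0 < a -> a <= b -> 0 <= p -> Rpower b (-p) <= Rpower a (-p).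
Proof.
 intros Ha Hab Hp. unfold Rpower. destruct (Req_dec (-p*ln b) (-p*ln a)) as [->|]; [lra|]. left. apply exp_increasing.
 assert (ln a <= ln b) by (destruct Hab as [L| ->]; left; apply ln_increasing; lra). nra.
Qed.
Lemma is_derive_Rpower x p : 0 < x -> is_derive (fun x => Rpower x p) x (p*Rpower x (p-1)).
Proof.
 intro H. unfold Rpower. auto_derive; auto. replace ((p-1)*ln x) with (p*ln x + - ln x) by ring. rewrite exp_plus, exp_Ropp, exp_ln by auto. lra.
Qed.
Lemma Rpower_sum_step x p : 0 < x -> 1 < p -> Rpower (x+1) (-p) <= (Rpower x (1-p)-Rpower (x+1) (1-p))/(p-1).
Proof.
 intros Hx Hp. destruct (MVT_gen (fun x => Rpower x (1-p)) x (x+1) (fun x => (1-p)*Rpower x (1-p-1))) as (c & Hc & E).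
 - minmax. intros y Hy. apply is_derive_Rpower; lra.
 - minmax. intros y Hy. apply continuity_pt_filterlim. apply (ex_derive_continuous (fun x => Rpower x (1-p))). eexists. apply is_derive_Rpower; lra.
 - rewrite Rmin_left, Rmax_right in Hc by lra.
  replace (Rpower x (1-p)-Rpower (x+1) (1-p)) with ((p-1)*Rpower c (1-p-1)) by lra.
  replace (1-p-1) with (-p) by ring. replace ((p-1)*Rpower c (- p)/(p-1)) with (Rpower c (-p)) by fld.
  apply Rpower_le_contra; lra.
Qed.
Lemma Rpower_sum_bound p N : 1 < p -> sum_n (fun n => Rpower (INR (S n)) (-p)) N <= 1+(1-Rpower (INR (S N)) (1-p))/(p-1).
Proof.
 intro Hp. induction N as [|N IH].
 - rewrite sum_O. simpl INR. unfold Rpower. rewrite ln_1, !Rmult_0_r, exp_0. lra.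
 - rewrite sum_Sn. unfold plus; simpl. change (match N with O => 1 | S _ => INR N+1 end) with (INR (S N)) in *.
  assert (S := Rpower_sum_step (INR (S N)) p ltac:(pos) Hp).
  replace (1+(1-Rpower (INR (Datatypes.S N)+1) (1-p))/(p-1)) with
   (1+(1-Rpower (INR (Datatypes.S N)) (1-p))/(p-1)+(Rpower (INR (Datatypes.S N)) (1-p)-Rpower (INR (Datatypes.S N)+1) (1-p))/(p-1)) by lra.
  apply Rplus_le_compat; pos.
Qed.
Lemma bounded_ex_series (a : nat -> R) B : (forall n, 0 <= a n) -> (forall N, sum_n a N <= B) -> ex_series a /\ Series a <= B.
Proof.
 intros A H. assert (I : forall n, sum_n a n <= sum_n a (S n)) by (intro n; rewrite sum_Sn; unfold plus; simpl; generalize (A (S n)); lra).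
 destruct (ex_finite_lim_seq_incr (sum_n a) B I H) as (l & L). split. exists l; pos.
 assert (E : is_series a l) by exact L. rewrite (is_series_unique _ _ E).
 apply (is_lim_seq_le (sum_n a) (fun _ => B) l B); auto. apply is_lim_seq_const.
Qed.
Lemma Rpower_series p : 1 < p -> ex_series (fun n => Rpower (INR (S n)) (-p)) /\ Series (fun n => Rpower (INR (S n)) (-p)) <= 1+1/(p-1).
Proof.
 intro Hp. apply bounded_ex_series. intro; pos. intro N. eapply Rle_trans; [apply Rpower_sum_bound; lra|].
 apply Rplus_le_compat_l. apply Rmult_le_compat_r. pos. generalize (Rpower_pos (INR (S N)) (1-p)); lra.
Qed.

Lemma Rcpow_minus_1 x z : 0 < x -> Rcpow x (z-1) = (Rcpow x z/RtoC x)%C.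
Proof. intro H. unfold Cminus. rewrite Rcpow_plus, Rcpow_opp, Rcpow_1; auto. Qed.
Lemma rderiv_Rcpow_base z x : 0 < x -> rderiv (fun x => Rcpow x z) x (z*Rcpow x (z-1)).
Proof.
 intro H. rewrite Rcpow_minus_1 by auto.
 replace (z*(Rcpow x z/x))%C with (Cexp (z*RtoC (ln x))*(z*RtoC (/ x)))%C.
 2:{ unfold Rcpow. rewrite RtoC_inv by lra. field. intro E; apply RtoC_inj in E; lra. }
 apply (rderiv_comp Cexp (fun x => z*RtoC (ln x))%C). 2: apply cderiv_Cexp.
 apply rderiv_mult_const. apply rderiv_components; simpl. auto_derive; lra. apply (is_derive_const (K := R_AbsRing) (V := R_NormedModule) 0).
Qed.
Lemma rderiv_shift f a t l : rderiv f (a+t) l -> rderiv (fun u => f (a+u)) t l.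
Proof.
 intros H eps He. destruct (H eps He) as (d & D & K). exists d; split; auto. intros u Hu.
 specialize (K (a+u)). replace (a+u-(a+t)) with (u-t) in K by ring. auto.
Qed.

(** (s-1) times the error of the trapezoidal rule for x^(-s) on [n, n+1]; multiplying by s-1 removes
    the singularity of the integral at s = 1. *)
Definition gz (n : nat) (s : C) : C :=
 ((s-1)*((Rcpow (INR n) (- s)+Rcpow (INR n+1) (- s))/2)+(Rcpow (INR n+1) (1-s)-Rcpow (INR n) (1-s)))%C.
Definition gz' (n : nat) (s : C) : C :=
 ((Rcpow (INR n) (- s)+Rcpow (INR n+1) (- s))/2
  - (s-1)*((RtoC (ln (INR n))*Rcpow (INR n) (- s)+RtoC (ln (INR n+1))*Rcpow (INR n+1) (- s))/2)
  - (RtoC (ln (INR n+1))*Rcpow (INR n+1) (1-s)-RtoC (ln (INR n))*Rcpow (INR n) (1-s)))%C.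

Lemma C2_neq_0 : RtoC 2 <> 0. Proof. intro E; apply RtoC_inj in E; lra. Qed.
Ltac cnz := repeat split; try apply C2_neq_0; try (let E := fresh in intro E; apply (f_equal Re) in E; simpl in E; lra).
Lemma cderiv_opp_id z : cderiv (fun s => - s)%C z (-(1)).
Proof. apply cderiv_opp, cderiv_id. Qed.
Lemma cderiv_1_minus z : cderiv (fun s => 1-s)%C z (-(1)).
Proof. assert (K := cderiv_minus _ _ _ _ _ (cderiv_const 1 z) (cderiv_id z)). replace (0-1)%C with (-(1))%C in K by ring. pos. Qed.
Lemma Holo_gz D n : Holo D (gz n) (gz' n).
Proof.
 intros s _. split.
 - assert (A := fun a => cderiv_Rcpow_comp a _ _ _ (cderiv_opp_id s)). assert (B := fun a => cderiv_Rcpow_comp a _ _ _ (cderiv_1_minus s)).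
  assert (X := cderiv_mult_const (/2) _ _ _ (cderiv_plus _ _ _ _ _ (A (INR n)) (A (INR n+1)))).
  assert (Y := cderiv_mult _ _ _ _ _ (proj1 (Holo_sub_const (fun _ => True) 1 s I)) X).
  assert (Z := cderiv_plus _ _ _ _ _ Y (cderiv_minus _ _ _ _ _ (B (INR n+1)) (B (INR n)))). cbv beta in Z.
  match type of Z with cderiv _ _ ?l => replace l with (gz' n s) in Z end.
  + apply cderiv_ext with (2 := Z). intro w. unfold gz. fld.
  + unfold gz'. fld.
 - assert (A : forall a, ccont (fun s => Rcpow a (- s)) s) by cont.
  assert (B : forall a, ccont (fun s => Rcpow a (1-s)) s) by cont. repeat (apply ccont_minus || apply ccont_plus || apply ccont_mult || apply ccont_const || apply ccont_id || apply A || apply B).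
Qed.
(** The trapezoidal error is the integral of u(1-u)/2 against the second derivative of x^(-s). [P]
    is a primitive of that integrand, and 1/8 is the maximum of the weight. *)
Lemma gz_bound n s : (1 <= n)%nat -> -2 <= Re s -> Cmod (gz n s) <= Cmod (s-1)*Cmod s*Cmod (s+1)/8*Rpower (INR n) (-(Re s+2)).
Proof.
 intros Hn Hs. assert (N1 : 1 <= INR n) by (apply (le_INR 1); pos).
 set (P := fun u : R => ((s-1)*(RtoC (u*(1-u)/2)*(- s*Rcpow (INR n+u) (- s-1))-RtoC ((1-2*u)/2)*Rcpow (INR n+u) (- s))+Rcpow (INR n+u) (1-s))%C).
 set (dP := fun u : R => ((s-1)*(RtoC (u*(1-u)/2)*(s*(s+1)*Rcpow (INR n+u) (- s-2))))%C).
 assert (D : forall z u, 0 <= u <= 1 -> rderiv (fun u => Rcpow (INR n+u) z) u (z*Rcpow (INR n+u) (z-1))).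
 { intros z u Hu. apply (rderiv_shift (fun x => Rcpow x z)). apply rderiv_Rcpow_base. lra. }
 assert (DR : forall (h : R -> R) h' u, is_derive h u h' -> rderiv (fun u => RtoC (h u)) u (RtoC h')).
 { intros h h' u Hh. apply rderiv_components; simpl; auto. apply (is_derive_const (K := R_AbsRing) (V := R_NormedModule) 0). }
 assert (E : CInt dP 0 1 = gz n s).
 { rewrite (CInt_FTC P); try lra.
  - unfold P, gz. rewrite Rplus_0_r. replace (1*(1-1)/2) with 0 by field. replace (0*(1-0)/2) with 0 by field.
   replace ((1-2*1)/2) with (- (/2)) by field. replace ((1-2*0)/2) with (/ 2) by field. rewrite RtoC_opp, RtoC_inv by lra. fld.
  - intros u Hu.
   assert (A1 := rderiv_mult _ _ _ _ _ (DR (fun u => u*(1-u)/2) ((1-2*u)/2) u ltac:(auto_derive; lra)) (rderiv_mult_const (- s) _ _ _ (D (- s-1)%C u Hu))).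
   assert (A2 := rderiv_mult _ _ _ _ _ (DR (fun u => (1-2*u)/2) (-1) u ltac:(auto_derive; lra)) (D (- s)%C u Hu)).
   assert (A3 := rderiv_plus _ _ _ _ _ (rderiv_mult_const (s-1) _ _ _ (rderiv_plus _ _ _ _ _ A1 (rderiv_mult_const (-(1)) _ _ _ A2))) (D (1-s)%C u Hu)).
   cbv beta in A3. match type of A3 with rderiv _ _ ?l => replace l with (dP u) in A3 end.
   + apply rderiv_ext with (2 := A3). intro v. unfold P. ring.
   + unfold dP. replace (- s-1-1)%C with (- s-2)%C by ring. replace (1-s-1)%C with (-s)%C by ring. ring.
  - intros u Hu. apply rcont_mult; [cont|]. apply rcont_mult.
   + cont.
   + apply rcont_mult; [cont|]. eapply rderiv_rcont, D; lra. }
 rewrite <- E. set (K := Cmod (s-1)*Cmod s*Cmod (s+1)/8*Rpower (INR n) (-(Re s+2))).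
 replace K with (K*(1-0)) by ring. unfold K; clear K. apply CInt_bound; try lra.
 - intros u Hu. apply rcont_mult; [cont|]. apply rcont_mult.
  + cont.
  + apply rcont_mult; [cont|]. eapply rderiv_rcont, D; lra.
 - intros u Hu. unfold dP. rewrite !Cmod_mult, Cmod_RtoC_pos by nra. rewrite Cmod_Rcpow.
  replace (Re (- s-2)) with (-(Re s+2)) by (rewrite Re_Cminus, Re_Copp; simpl; lra).
  assert (K := Rpower_le_contra (INR n) (INR n+u) (Re s+2) ltac:(lra) ltac:(lra) ltac:(lra)).
  assert (W : 0 <= u*(1-u)/2 <= / 8) by (assert (0 <= u*(1-u)) by pos; generalize (Rle_0_sqr (u-1/2)); unfold Rsqr; lra).
  replace (Cmod (s-1)*Cmod s*Cmod (s+1)/8*Rpower (INR n) (- (Re s+2))) with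
   (Cmod (s-1)*(/ 8*(Cmod s*Cmod (s+1)*Rpower (INR n) (- (Re s+2))))) by field.
  mull. apply Rmult_le_compat; try lra. pos.
  apply Rmult_le_compat_l; auto. pos.
Qed.

Lemma ex_series_scal_R c (a : nat -> R) : ex_series a -> ex_series (fun n => c*a n).
Proof. apply (ex_series_scal_l (K := R_AbsRing) (V := R_NormedModule)). Qed.
Definition half_plane (a : R) (s : C) : Prop := a < Re s.
Lemma copen_half_plane a : copen (half_plane a).
Proof.
 intros z Hz. exists (Re z-a). unfold half_plane in *. split; [lra|]. intros w Hw.
 assert (X := re_le_Cmod (w-z)). rewrite Re_Cminus in X. apply Rabs_le_between in X. lra.
Qed.
(* [zf s] is (s - 1) zeta(s), continued to Re s > -1 by the trapezoidal (Euler-Maclaurin) correction terms [gz n]. *)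
Definition zf (s : C) : C := ((s+1)/2+Csum (fun n => gz (S n) s))%C.
Definition zf' (s : C) : C := (/ 2+Csum (fun n => gz' (S n) s))%C.

Lemma gz_local_bound s : half_plane (-1) s -> exists d M, 0 < d /\ ex_series M /\ forall n z, Cmod (z-s) <= d -> Cmod (gz (S n) z) <= M n.
Proof.
 unfold half_plane. set (d := (Re s+1)/2). set (K := Cmod s+d+1).
 exists d, (fun n => (K*K*K/8)*Rpower (INR (S n)) (-(2+Re s-d))). split; [unfold d; lra|]. split.
 - apply ex_series_scal_R. apply Rpower_series. unfold d; lra.
 - intros n z Hz.
  assert (X := re_le_Cmod (z-s)). rewrite Re_Cminus in X. apply Rabs_le_between in X.
  eapply Rle_trans; [apply gz_bound; [lia|unfold d in *; lra]|].
  assert (Z := Cmod_le_minus z s). assert (Z1 := Cmod_sub_le z 1). assert (Z2 := Cmod_triangle z 1). rewrite Cmod_1 in Z1, Z2.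
  assert (K0 := Rpower_pos (INR (S n)) (-(Re z+2))).
  apply Rmult_le_compat; try lra. pos.
  + mulr. mul; [|unfold K; lra]. mul; unfold K; lra.
  + unfold Rpower. destruct (Req_dec (- (Re z+2)*ln (INR (S n))) (- (2+Re s-d)*ln (INR (S n)))) as [->|]; [lra|]. left. apply exp_increasing.
   assert (0 <= ln (INR (S n))). { rewrite <- ln_1. destruct n. simpl; lra. left; apply ln_increasing; [lra|]. apply (lt_INR 1); lia. } nra.
Qed.
Lemma Holo_zf : Holo (half_plane (-1)) zf zf'.
Proof.
 assert (K := proj1 (Holo_Csum (half_plane (-1)) (fun n => gz (S n)) (fun n => gz' (S n)) (copen_half_plane _) (fun n => Holo_gz _ (S n)) gz_local_bound)).
 intros s Hs. specialize (K s Hs). split.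
 - apply cderiv_plus; [|apply K].
  assert (X := cderiv_mult_const (/2) _ _ _ (cderiv_plus _ _ _ _ _ (cderiv_id s) (cderiv_const 1 s))). replace (/ 2*(1+0))%C with (/2)%C in X by ring. apply cderiv_ext with (2 := X). intro w. fld.
 - apply ccont_plus; [cont|apply K].
Qed.
Definition Zp (N : nat) (s : C) : C := cpsum (fun n => Rcpow (INR (S n)) (- s)) N.
Definition Zl (N : nat) (s : C) : C := cpsum (fun n => RtoC (ln (INR (S n)))*Rcpow (INR (S n)) (- s))%C N.
Lemma gz_telescope N s : ((s+1)/2+cpsum (fun n => gz (S n) s) N =
 (s-1)*(Zp (S N) s-Rcpow (INR (S N)) (- s)/2)+Rcpow (INR (S N)) (1-s))%C.
Proof.
 induction N as [|N IH].
 - unfold Zp; simpl. rewrite !Rcpow_1_l. fld.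
 - change (cpsum (fun n => gz (S n) s) (S N)) with (cpsum (fun n => gz (S n) s) N+gz (S N) s)%C.
  rewrite Cplus_assoc, IH. unfold gz. change (Zp (S (S N)) s) with (Zp (S N) s+Rcpow (INR (S (S N))) (- s))%C. rewrite (S_INR (S N)). fld.
Qed.
Lemma gz'_telescope N s : (/ 2+cpsum (fun n => gz' (S n) s) N =
 (Zp (S N) s-Rcpow (INR (S N)) (- s)/2)-(s-1)*(Zl (S N) s-RtoC (ln (INR (S N)))*Rcpow (INR (S N)) (- s)/2)
  - RtoC (ln (INR (S N)))*Rcpow (INR (S N)) (1-s))%C.
Proof.
 induction N as [|N IH].
 - unfold Zp, Zl; simpl. rewrite !Rcpow_1_l, ln_1. fld.
 - change (cpsum (fun n => gz' (S n) s) (S N)) with (cpsum (fun n => gz' (S n) s) N+gz' (S N) s)%C.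
  rewrite Cplus_assoc, IH. unfold gz'. change (Zp (S (S N)) s) with (Zp (S N) s+Rcpow (INR (S (S N))) (- s))%C.
  change (Zl (S (S N)) s) with (Zl (S N) s+RtoC (ln (INR (S (S N))))*Rcpow (INR (S (S N))) (- s))%C. rewrite (S_INR (S N)). fld.
Qed.
Lemma zf_clim s : -1 < Re s -> clim (fun N => (s-1)*(Zp (S N) s-Rcpow (INR (S N)) (- s)/2)+Rcpow (INR (S N)) (1-s))%C (zf s).
Proof.
 intro Hs. apply clim_ext with (1 := fun N => gz_telescope N s). apply clim_plus; [apply clim_const|].
 apply (proj2 (Holo_Csum (half_plane (-1)) (fun n => gz (S n)) (fun n => gz' (S n)) (copen_half_plane _) (fun n => Holo_gz _ (S n)) gz_local_bound)). auto.
Qed.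
Lemma zf'_clim s : -1 < Re s -> clim (fun N => (Zp (S N) s-Rcpow (INR (S N)) (- s)/2)-(s-1)*(Zl (S N) s-RtoC (ln (INR (S N)))*Rcpow (INR (S N)) (- s)/2)
  - RtoC (ln (INR (S N)))*Rcpow (INR (S N)) (1-s))%C (zf' s).
Proof.
 intro Hs. apply clim_ext with (1 := fun N => gz'_telescope N s). apply clim_plus; [apply clim_const|].
 apply (proj2 (Holo_Csum (half_plane (-1)) (fun n => gz (S n)) (fun n => gz' (S n)) (copen_half_plane _) (fun n => Holo_gz _ (S n)) gz_local_bound)). auto.
Qed.
(** The explicit distance from the leading term (s+1)/2: it yields the growth of [zf] in the strip
    as well as the absence of zeros near the real axis. *)
Lemma zf_sub_bound s : -1 < Re s -> Cmod (zf s-(s+1)/2) <= Cmod (s-1)*Cmod s*Cmod (s+1)/8*(1+1/(Re s+1)).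
Proof.
 intro Hs. unfold zf. replace ((s+1)/2+Csum (fun n => gz (S n) s)-(s+1)/2)%C with (Csum (fun n => gz (S n) s)) by ring.
 set (K := Cmod (s-1)*Cmod s*Cmod (s+1)/8). assert (PS := Rpower_series (Re s+2) ltac:(lra)).
 tr (Csum_bound _ (fun n => K*Rpower (INR (S n)) (-(Re s+2)))).
 - intro n. apply gz_bound; [lia|lra].
 - apply ex_series_scal_R, PS.
 - rewrite Series_scal_l. mull. unfold K. pos.
  replace (Re s+1) with (Re s+2-1) by ring. lra.
Qed.

(** * The von Mangoldt function *)

Definition lsum {A} (l : list A) (f : A -> R) : R := fold_right Rplus 0 (map f l).
Lemma lsum_app {A} (l m : list A) f : lsum (l ++ m) f = lsum l f+lsum m f.
Proof. induction l; unfold lsum in *; simpl; lra. Qed.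
Lemma lsum_ext {A} (l : list A) f g : (forall x, In x l -> f x = g x) -> lsum l f = lsum l g.
Proof. induction l; intro H; unfold lsum in *; simpl; auto. rewrite IHl, H; auto. left; auto. intros; apply H; right; pos. Qed.
Lemma lsum_0 {A} (l : list A) f : (forall x, In x l -> f x = 0) -> lsum l f = 0.
Proof. induction l; intro H; unfold lsum in *; simpl; auto. rewrite IHl, H; [lra|left; auto|intros; apply H; right; pos]. Qed.
Lemma lsum_plus {A} (l : list A) f g : lsum l (fun x => f x+g x) = lsum l f+lsum l g.
Proof. induction l; unfold lsum in *; simpl; lra. Qed.
Lemma lsum_scal {A} (l : list A) c f : lsum l (fun x => c*f x) = c*lsum l f.
Proof. induction l; unfold lsum in *; simpl; lra. Qed.
Lemma lsum_le {A} (l : list A) f g : (forall x, In x l -> f x <= g x) -> lsum l f <= lsum l g.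
Proof. induction l; intro H; unfold lsum in *; simpl; [lra|]. apply Rplus_le_compat; [apply H; left; auto|apply IHl; intros; apply H; right; pos]. Qed.
Lemma lsum_nonneg {A} (l : list A) f : (forall x, In x l -> 0 <= f x) -> 0 <= lsum l f.
Proof. intro H. rewrite <- (lsum_0 l (fun _ => 0)) by auto. apply lsum_le; pos. Qed.
Lemma lsum_swap {A B} (l : list A) (m : list B) f : lsum l (fun x => lsum m (f x)) = lsum m (fun y => lsum l (fun x => f x y)).
Proof.
 induction l. symmetry. apply lsum_0. auto.
 unfold lsum at 1. simpl. fold (lsum l (fun x => lsum m (f x))). rewrite IHl, <- lsum_plus. auto.
Qed.
Lemma lsum_seq_S f a n : lsum (seq a (S n)) f = lsum (seq a n) f+f (a+n)%nat.
Proof. rewrite seq_S, lsum_app. unfold lsum at 2. simpl. ring. Qed.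
Lemma lsum_seq_extend f a n m : (n <= m)%nat -> (forall k, (a+n <= k < a+m)%nat -> f k = 0) -> lsum (seq a m) f = lsum (seq a n) f.
Proof.
 intros H K. replace m with (n+(m-n))%nat by lia. rewrite seq_app, lsum_app, (lsum_0 (seq (a+n) _)). ring.
 intros x Hx. apply in_seq in Hx. apply K. lia.
Qed.
Lemma lsum_single f a n k : (a <= k < a+n)%nat -> (forall j, (a <= j < a+n)%nat -> j <> k -> f j = 0) -> lsum (seq a n) f = f k.
Proof.
 intros H K. replace n with ((k-a)+(1+(n-(k-a)-1)))%nat by lia. rewrite !seq_app, !lsum_app, (lsum_0 (seq a (k-a))), (lsum_0 (seq (a+(k-a)+1) _)). replace (a+(k-a))%nat with k by lia. unfold lsum; simpl; lra.
 intros x Hx. apply in_seq in Hx. apply K; lia. intros x Hx. apply in_seq in Hx. apply K; lia.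
Qed.

Definition dvdb (d n : nat) : bool := Nat.eqb (n mod d) 0.
Lemma dvdb_true d n : (d <> 0)%nat -> dvdb d n = true <-> Nat.divide d n.
Proof. intro H. unfold dvdb. rewrite Nat.eqb_eq. apply Nat.Lcm0.mod_divide. Qed.
Definition ind (b : bool) : R := if b then 1 else 0.

Lemma pow_ge_self p k : (2 <= p)%nat -> (k < p^k)%nat.
Proof. intro H. apply Nat.pow_gt_lin_r. lia. Qed.
Lemma pow_ge_base p k : (2 <= p)%nat -> (1 <= k)%nat -> (p <= p^k)%nat.
Proof. intros H K. replace p with (p^1)%nat at 1 by apply Nat.pow_1_r. apply Nat.pow_le_mono_r; lia. Qed.

Lemma vonMangoldt_ext n B : (n <= B)%nat -> vonMangoldt n =
 lsum (seq 2 B) (fun p => lsum (seq 1 B) (fun k => if prime_dec (Z.of_nat p) then if Nat.eqb (Nat.pow p k) n then ln (INR p) else 0 else 0)).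
Proof.
 intro H.
 rewrite (lsum_seq_extend _ 2 n B); auto.
 - apply lsum_ext. intros p Hp. apply in_seq in Hp. symmetry. apply lsum_seq_extend; auto. intros k Hk.
  destruct (prime_dec (Z.of_nat p)); auto. destruct (Nat.eqb_spec (p^k) n) as [E|]; auto. assert (X := pow_ge_self p k ltac:(lia)). lia.
 - intros p Hp. apply lsum_0. intros k Hk. apply in_seq in Hk. destruct (prime_dec (Z.of_nat p)); auto.
  destruct (Nat.eqb_spec (p^k) n) as [E|]; auto. assert (X := pow_ge_base p k ltac:(lia) ltac:(lia)). lia.
Qed.
Lemma ln_INR_nonneg n : 0 <= ln (INR n).
Proof. destruct n as [|[|n]]. simpl. unfold ln. destruct (Rlt_dec 0 0) as [H|H]; [exfalso; lra|lra]. simpl; rewrite ln_1; lra. rewrite <- ln_1. left. apply ln_increasing; [lra|]. apply (lt_INR 1); lia. Qed.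
Lemma vonMangoldt_nonneg n : 0 <= vonMangoldt n.
Proof. apply lsum_nonneg; intros p _. apply lsum_nonneg; intros k _.
 destruct (prime_dec _); [|lra]. destruct (Nat.eqb _ _); [|lra]. apply ln_INR_nonneg.
Qed.
(** Unique factorisation, counted by prime powers: each p^k dividing n contributes ln p. The range
    [B] is separate from [n] so that an induction can compare n = q m with m over the same range. *)
Definition ppsum (B n : nat) : R :=
 lsum (seq 2 B) (fun p => if prime_dec (Z.of_nat p) then ln (INR p)*lsum (seq 1 B) (fun k => ind (dvdb (p^k) n)) else 0).
Lemma divisor_sum_ppsum n : (1 <= n)%nat -> lsum (seq 1 n) (fun d => ind (dvdb d n)*vonMangoldt d) = ppsum n n.
Proof.
 intro Hn. rewrite (lsum_ext _ _ (fun d => lsum (seq 2 n) (fun p => lsum (seq 1 n) (fun k => ind (dvdb d n)*(if prime_dec (Z.of_nat p) then if Nat.eqb (Nat.pow p k) d then ln (INR p) else 0 else 0))))).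
 2:{ intros d Hd. apply in_seq in Hd. rewrite (vonMangoldt_ext d n) by lia. rewrite <- lsum_scal. apply lsum_ext. intros; apply eq_sym, lsum_scal. }
 rewrite lsum_swap. apply lsum_ext. intros p Hp. apply in_seq in Hp. rewrite lsum_swap. destruct (prime_dec (Z.of_nat p)).
 2:{ apply lsum_0. intros; apply lsum_0; intros; lra. }
 rewrite <- lsum_scal. apply lsum_ext. intros k Hk. apply in_seq in Hk.
 destruct (dvdb (p^k) n) eqn:E.
 - assert (D := proj1 (dvdb_true (p^k) n ltac:(apply Nat.pow_nonzero; lia)) E). apply Nat.divide_pos_le in D; [|lia].
  rewrite (lsum_single _ 1 n (p^k)), Nat.eqb_refl, E. ring.
  assert (p^k <> 0)%nat by (apply Nat.pow_nonzero; lia). lia.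
  intros j _ Hj. destruct (Nat.eqb_spec (p^k) j); [congruence|lra].
 - rewrite Rmult_0_r. apply lsum_0. intros d _. destruct (Nat.eqb_spec (p^k) d); [subst; rewrite E; simpl; lra|lra].
Qed.
Lemma divide_of_nat a b : Nat.divide a b <-> (Z.of_nat a | Z.of_nat b)%Z.
Proof.
 split; intros (c & E). exists (Z.of_nat c). lia.
 destruct (Nat.eq_dec a 0) as [->|N]. exists O. lia. exists (Z.to_nat c). lia.
Qed.
Lemma dvdb_pow_other p q k m : prime (Z.of_nat p) -> prime (Z.of_nat q) -> p <> q -> dvdb (p^k) (q*m) = dvdb (p^k) m.
Proof.
 intros Hp Hq N. assert (P2 := prime_ge_2 _ Hp). assert (P0 : (p^k <> 0)%nat) by (apply Nat.pow_nonzero; lia).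
 apply Bool.eq_true_iff_eq. rewrite !dvdb_true, !divide_of_nat by auto. rewrite Nat2Z.inj_mul, Nat2Z.inj_pow. split; intro H.
 - apply Gauss with (Z.of_nat q); auto. apply rel_prime_sym, rel_prime_Zpower_r; [lia|]. apply prime_rel_prime; auto.
  intro D. apply prime_div_prime in D; auto. lia.
 - apply Z.divide_mul_r; pos.
Qed.
Lemma dvdb_pow_same q k m : (2 <= q)%nat -> dvdb (q^S k) (q*m) = dvdb (q^k) m.
Proof.
 intro H. apply Bool.eq_true_iff_eq. rewrite !dvdb_true by (apply Nat.pow_nonzero; lia).
 rewrite Nat.pow_succ_r'. split; intros (c & E). exists c. nia. exists c. lia.
Qed.
Lemma prime_factor n : (2 <= n)%nat -> exists q m, prime (Z.of_nat q) /\ (2 <= q)%nat /\ n = (q*m)%nat /\ (1 <= m < n)%nat.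
Proof.
 induction n as [n IH] using lt_wf_ind. intro Hn. destruct (prime_dec (Z.of_nat n)) as [P|NP].
 - exists n, 1%nat. split; [pos|lia].
 - destruct (not_prime_divide (Z.of_nat n) ltac:(lia) NP) as (d & Hd & c & E).
  destruct (IH (Z.to_nat d) ltac:(lia) ltac:(lia)) as (q & m & Pq & Hq & Em & Hm).
  exists q, (m*Z.to_nat c)%nat.
  assert (En : n = (Z.to_nat d*Z.to_nat c)%nat) by lia. split; [pos|]. split; [pos|]. split; [rewrite En, Em; ring|]. nia.
Qed.
(** Passing from m to q m with q prime shifts the exponents of q by one, which adds one term ln q,
    and leaves all other primes alone. *)
Lemma ppsum_ln B n : (1 <= n <= B)%nat -> ppsum B n = ln (INR n).
Proof.
 induction n as [n IH] using lt_wf_ind. intro Hn. destruct (Nat.eq_dec n 1) as [->|N1].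
 - simpl INR. rewrite ln_1. apply lsum_0. intros p Hp. apply in_seq in Hp. destruct (prime_dec _); auto. rewrite lsum_0; [lra|].
  intros k Hk. apply in_seq in Hk. destruct (dvdb (p^k) 1) eqn:E; auto.
  apply dvdb_true in E; [|apply Nat.pow_nonzero; lia]. apply Nat.divide_pos_le in E; [|lia]. assert (X := pow_ge_base p k ltac:(lia) ltac:(lia)). lia.
 - destruct (prime_factor n ltac:(lia)) as (q & m & Pq & Hq & E & Hm).
  assert (T : ppsum B n = ppsum B m+ln (INR q)).
  { assert (EQ : ln (INR q) = lsum (seq 2 B) (fun p => if Nat.eqb p q then ln (INR q) else 0)).
   { rewrite (lsum_single _ 2 B q). rewrite Nat.eqb_refl; lra. assert (q <= n)%nat by nia. lia.
    intros j _ Hj. destruct (Nat.eqb_spec j q); congruence. }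
   rewrite EQ. unfold ppsum. rewrite <- lsum_plus. apply lsum_ext. intros p Hp. apply in_seq in Hp.
   destruct (Nat.eqb_spec p q) as [->|Npq].
   - destruct (prime_dec (Z.of_nat q)); [|tauto].
    assert (S1 : lsum (seq 1 B) (fun k => ind (dvdb (q^k) n)) = 1+lsum (seq 1 B) (fun k => ind (dvdb (q^k) m))); [|rewrite S1; lra].
    destruct B as [|B]; [lia|]. rewrite (lsum_seq_S (fun k => ind (dvdb (q^k) m))).
    (* The highest exponent of the range contributes nothing for m, since q to that power exceeds m;
       so the shift by one loses nothing at the top. *)
    assert (Z0 : dvdb (q^(1+B)) m = false).
    { destruct (dvdb (q^(1+B)) m) eqn:D; auto. apply dvdb_true in D; [|apply Nat.pow_nonzero; lia]. apply Nat.divide_pos_le in D; [|lia].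
     assert (X := pow_ge_self q (1+B) ltac:(lia)). lia. }
    rewrite Z0, Rplus_0_r.
    change (seq 1 (S B)) with (1%nat :: seq 2 B). rewrite <- (seq_shift B 1).
    unfold lsum. simpl. f_equal.
    + rewrite E. replace (q*1)%nat with (q^1)%nat by auto. rewrite dvdb_pow_same by auto. auto.
    + rewrite map_map. apply (lsum_ext (seq 1 B)). intros k _. rewrite E, dvdb_pow_same by auto. lra.
   - destruct (prime_dec (Z.of_nat p)); [|lra]. rewrite Rplus_0_r. f_equal. apply lsum_ext. intros k _. rewrite E, dvdb_pow_other; pos. }
  rewrite T, IH by lia. rewrite E, mult_INR, ln_mult; try (apply lt_0_INR; lia). ring.
Qed.
Lemma vonMangoldt_divisor_sum n : (1 <= n)%nat -> lsum (seq 1 n) (fun d => ind (dvdb d n)*vonMangoldt d) = ln (INR n).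
Proof. intro H. rewrite divisor_sum_ppsum, ppsum_ln; auto. Qed.
Lemma vonMangoldt_le_ln n : (1 <= n)%nat -> vonMangoldt n <= ln (INR n).
Proof.
 intro H. rewrite <- vonMangoldt_divisor_sum by auto. destruct n as [|n]; [lia|]. rewrite lsum_seq_S.
 replace (1+n)%nat with (S n) by lia. unfold dvdb at 2. rewrite Nat.mod_same by lia. simpl (ind _).
 assert (0 <= lsum (seq 1 n) (fun d => ind (dvdb d (S n))*vonMangoldt d)); [|lra].
 apply lsum_nonneg. intros d _. apply Rmult_le_pos; [|apply vonMangoldt_nonneg]. unfold ind; destruct (dvdb _ _); lra.
Qed.
(** Both 2 and 3 divide 6k, whereas a prime power is divisible by a single prime. *)
Lemma vonMangoldt_6k k : vonMangoldt (6*k) = 0.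
Proof. apply lsum_0; intros p Hp. apply lsum_0; intros j Hj. apply in_seq in Hp. apply in_seq in Hj.
 destruct (prime_dec (Z.of_nat p)) as [P|]; auto. destruct (Nat.eqb_spec (p^j) (6*k)) as [E|]; auto.
 assert (D : forall r, prime r -> (r | 6)%Z -> r = Z.of_nat p).
 { intros r Hr D6. apply prime_div_prime; auto. assert (D : (r | Z.of_nat p^Z.of_nat j)%Z).
  { rewrite <- Nat2Z.inj_pow, E, Nat2Z.inj_mul. apply Z.divide_mul_l. pos. }
  apply prime_power_prime in D; auto; try lia. exists 1%Z; lia. }
 assert (H2 := D 2%Z prime_2 ltac:(exists 3%Z; lia)). assert (H3 := D 3%Z prime_3 ltac:(exists 2%Z; lia)). lia.
Qed.

(** * Dirichlet series in the half-plane of absolute convergence *)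

Definition ds (c : nat -> R) (s : C) (n : nat) : C := (RtoC (c (S n))*Rcpow (INR (S n)) (- s))%C.
Definition Zs (s : C) : C := Csum (ds (fun _ => 1) s).
Definition LZ (s : C) : C := Csum (ds (fun n => ln (INR n)) s).
Definition Dl (s : C) : C := Csum (ds vonMangoldt s).

Lemma ln_le_Rpower x e : 0 < x -> 0 < e -> ln x <= Rpower x e/e.
Proof.
 intros Hx He. assert (E : e*ln x <= Rpower x e-1).
 { unfold Rpower. assert (H := exp_ineq1_le (e*ln x)). lra. }
 apply (Rmult_le_reg_l e); auto. replace (e*(Rpower x e/e)) with (Rpower x e) by fld. lra.
Qed.
Lemma INR_S_ge_1 n : 1 <= INR (S n). Proof. apply (le_INR 1); lia. Qed.
Lemma Rpower_le_exp x a b : 1 <= x -> a <= b -> Rpower x a <= Rpower x b.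
Proof.
 intros Hx Hab. assert (0 <= ln x). { rewrite <- ln_1. destruct Hx as [L| <-]; [left; apply ln_increasing; lra|lra]. }
 unfold Rpower. destruct (Req_dec (a*ln x) (b*ln x)) as [->|]; [lra|]. left. apply exp_increasing. nra.
Qed.
(** A summable majorant of (1 + ln n) n^(-p), with half of the excess p - 1 spent on the
    logarithm. *)
Definition lnpow (p : R) (n : nat) : R := 2/(p-1)*Rpower (INR (S n)) (-((p+1)/2))+Rpower (INR (S n)) (-p).
Lemma lnpow_series p : 1 < p -> ex_series (lnpow p).
Proof.
 intro H. apply (ex_series_plus (K := R_AbsRing) (V := R_NormedModule)).
 apply ex_series_scal_R, Rpower_series; lra. apply Rpower_series; lra.
Qed.
Lemma ds_bound c s n : 1 < Re s -> Rabs (c (S n)) <= 1+ln (INR (S n)) -> Cmod (ds c s n) <= lnpow (Re s) n.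
Proof.
 intros Hs Hc. unfold ds. rewrite Cmod_mult, Cmod_R, Cmod_Rcpow, Re_Copp. set (p := Re s) in *. set (x := INR (S n)) in *.
 assert (X : 1 <= x) by apply INR_S_ge_1. assert (P := Rpower_pos x (-p)).
 via ((1+ln x)*Rpower x (-p)). nra.
 assert (L := ln_le_Rpower x ((p-1)/2) ltac:(lra) ltac:(lra)).
 unfold lnpow. fold x. replace (- ((p+1)/2)) with ((p-1)/2 + - p) by field. rewrite Rpower_plus.
 apply (Rmult_le_compat_r (Rpower x (-p))) in L; [|lra]. replace (Rpower x ((p-1)/2)/((p-1)/2)*Rpower x (- p)) with (2/(p-1)*(Rpower x ((p-1)/2)*Rpower x (-p))) in L by fld.
 lra.
Qed.
Lemma coef_one_bound n : Rabs 1 <= 1+ln (INR (S n)).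
Proof. rewrite Rabs_R1. generalize (ln_INR_nonneg (S n)); lra. Qed.
Lemma coef_ln_bound n : Rabs (ln (INR (S n))) <= 1+ln (INR (S n)).
Proof. generalize (ln_INR_nonneg (S n)); intro. rewrite Rabs_right; lra. Qed.
Lemma coef_Lambda_bound n : Rabs (vonMangoldt (S n)) <= 1+ln (INR (S n)).
Proof. generalize (vonMangoldt_nonneg (S n)), (vonMangoldt_le_ln (S n) ltac:(lia)); intros. rewrite Rabs_right; lra. Qed.
Lemma ds_clim c s : 1 < Re s -> (forall n, Rabs (c (S n)) <= 1+ln (INR (S n))) -> clim (cpsum (ds c s)) (Csum (ds c s)).
Proof. intros Hs Hc. apply clim_Csum with (lnpow (Re s)). intro; apply ds_bound; auto. apply lnpow_series; lra. Qed.
Lemma cpsum_Zp s N : cpsum (ds (fun _ => 1) s) N = Zp N s.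
Proof. apply cpsum_ext. intros; unfold ds. ring. Qed.

Lemma is_lim_INR_power e : 0 < e -> is_lim_seq (fun N => Rpower (INR (S N)) (-e)) 0.
Proof.
 intro He. apply is_lim_seq_spec. intros eps. assert (P := cond_pos eps).
 destruct (archimed (Rpower eps (-/e))) as (A & _). set (K := Z.to_nat (up (Rpower eps (-/e)))). exists K. intros n Hn.
 rewrite Rminus_0_r, Rabs_right by (left; apply Rpower_pos).
 assert (Q := Rpower_pos eps (-/e)).
 assert (B : Rpower eps (-/e) < INR (S n)).
 { rewrite S_INR. apply le_INR in Hn. unfold K in Hn. rewrite INR_IZR_INZ, Z2Nat.id in Hn. lra.
  apply le_IZR. lra. }
 replace (pos eps) with (Rpower (Rpower eps (-/e)) (-e)). 2:{ rewrite Rpower_mult. replace (- / e * - e) with 1 by fld. apply Rpower_1; lra. } apply exp_increasing. assert (X := ln_increasing _ _ Q B). nra.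
Qed.
Lemma clim_power_0 s : 0 < Re s -> clim (fun N => Rcpow (INR (S N)) (- s)) 0.
Proof.
 intro H. apply clim_0_bound with (fun N => Rpower (INR (S N)) (- Re s)). intro n. rewrite Cmod_Rcpow, Re_Copp; lra. apply is_lim_INR_power; lra.
Qed.
Lemma clim_ln_power_0 s : 0 < Re s -> clim (fun N => RtoC (ln (INR (S N)))*Rcpow (INR (S N)) (- s))%C 0.
Proof.
 intro H. apply clim_0_bound with (fun N => 2/Re s*Rpower (INR (S N)) (-(Re s/2))).
 - intro n. rewrite Cmod_mult, Cmod_RtoC_pos, Cmod_Rcpow, Re_Copp by apply ln_INR_nonneg.
  assert (L := ln_le_Rpower (INR (S n)) (Re s/2) ltac:(pos) ltac:(lra)).
  apply (Rmult_le_compat_r (Rpower (INR (S n)) (- Re s))) in L; [|pos].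
  tr L. replace (- (Re s/2)) with (Re s/2 + - Re s) by field. rewrite Rpower_plus. right; fld.
 - replace (Finite 0) with (Rbar_mult (2/Re s) 0) by (simpl; f_equal; lra). apply is_lim_seq_scal_l. apply is_lim_INR_power; lra.
Qed.
Lemma zf_Zs s : 1 < Re s -> zf s = ((s-1)*Zs s)%C.
Proof.
 intro H. apply clim_unique with (1 := zf_clim s ltac:(lra)).
 replace ((s-1)*Zs s)%C with ((s-1)*(Zs s - / 2*0)+0)%C by ring.
 apply clim_plus.
 - apply clim_mult_const. apply clim_minus.
  + apply (clim_shift (fun N => Zp N s)). apply clim_ext with (1 := cpsum_Zp s). apply ds_clim; auto. apply coef_one_bound.
  + apply clim_ext with (fun N => / 2*Rcpow (INR (S N)) (- s))%C. intro; unfold Cdiv; ring. apply clim_mult_const, clim_power_0; lra.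
 - apply clim_ext with (fun N => Rcpow (INR (S N)) (- (s-1))). intro; f_equal; ring. apply clim_power_0. simpl; unfold Re in H; lra.
Qed.
Lemma zf'_LZ s : 1 < Re s -> zf' s = (Zs s-(s-1)*LZ s)%C.
Proof.
 intro H. apply clim_unique with (1 := zf'_clim s ltac:(lra)).
 replace (Zs s-(s-1)*LZ s)%C with ((Zs s - / 2*0)-(s-1)*(LZ s - / 2*0)-0)%C by ring.
 apply clim_minus; [apply clim_minus|].
 - apply clim_minus.
  + apply (clim_shift (fun N => Zp N s)). apply clim_ext with (1 := cpsum_Zp s). apply ds_clim; auto. apply coef_one_bound.
  + apply clim_ext with (fun N => / 2*Rcpow (INR (S N)) (- s))%C. intro; unfold Cdiv; ring. apply clim_mult_const, clim_power_0; lra.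
 - apply clim_mult_const, clim_minus.
  + apply (clim_shift (fun N => Zl N s)). apply (ds_clim (fun n => ln (INR n)) s); auto. apply coef_ln_bound.
  + apply clim_ext with (fun N => / 2*(RtoC (ln (INR (S N)))*Rcpow (INR (S N)) (- s)))%C. intro; unfold Cdiv; ring. apply clim_mult_const, clim_ln_power_0; lra.
 - apply clim_ext with (fun N => RtoC (ln (INR (S N)))*Rcpow (INR (S N)) (- (s-1)))%C. intro; do 2 f_equal; ring. apply clim_ln_power_0. simpl; unfold Re in H; lra.
Qed.

(** * Finite complex sums and the product of Dirichlet series *)

Definition clsum {A} (l : list A) (f : A -> C) : C := fold_right Cplus (RtoC 0) (map f l).
Lemma clsum_app {A} (l m : list A) f : clsum (l ++ m) f = (clsum l f+clsum m f)%C.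
Proof. induction l; unfold clsum in *; simpl; [ring|rewrite IHl; ring]. Qed.
Lemma clsum_ext {A} (l : list A) f g : (forall x, In x l -> f x = g x) -> clsum l f = clsum l g.
Proof. induction l; intro H; unfold clsum in *; simpl; auto. rewrite IHl, H; auto. left; auto. intros; apply H; right; pos. Qed.
Lemma clsum_plus {A} (l : list A) f g : clsum l (fun x => f x+g x)%C = (clsum l f+clsum l g)%C.
Proof. induction l; unfold clsum in *; simpl; [ring|rewrite IHl; ring]. Qed.
Lemma clsum_scal {A} (l : list A) c f : clsum l (fun x => c*f x)%C = (c*clsum l f)%C.
Proof. induction l; unfold clsum in *; simpl; [ring|rewrite IHl; ring]. Qed.
Lemma clsum_swap {A B} (l : list A) (m : list B) f : clsum l (fun x => clsum m (f x)) = clsum m (fun y => clsum l (fun x => f x y)).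
Proof.
 induction l. symmetry. induction m as [|b m IHm]; auto. change (RtoC 0+clsum m (fun y => clsum nil (fun x => f x y)) = 0)%C. rewrite IHm. unfold clsum; simpl; ring.
 unfold clsum at 1. simpl. fold (clsum l (fun x => clsum m (f x))). rewrite IHl, <- clsum_plus. auto.
Qed.
Lemma clsum_Cmod {A} (l : list A) f g : (forall x, In x l -> Cmod (f x) <= g x) -> Cmod (clsum l f) <= lsum l g.
Proof.
 induction l; intro H; unfold clsum, lsum in *; simpl. rewrite Cmod_0; lra.
 tr Cmod_triangle. apply Rplus_le_compat; [apply H; left; auto|apply IHl; intros; apply H; right; pos].
Qed.
Lemma clsum_RtoC {A} (l : list A) f : clsum l (fun x => RtoC (f x)) = RtoC (lsum l f).
Proof. induction l; unfold clsum, lsum in *; simpl; auto. rewrite IHl, RtoC_plus; auto. Qed.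
Lemma clsum_seq_S f a n : clsum (seq a (S n)) f = (clsum (seq a n) f+f (a+n)%nat)%C.
Proof. rewrite seq_S, clsum_app. unfold clsum at 2. simpl. ring. Qed.
Lemma cpsum_clsum u N : cpsum (fun n => u (S n)) N = clsum (seq 1 N) u.
Proof. induction N; auto. rewrite clsum_seq_S, <- IHN. auto. Qed.

Lemma clsum_multiples phi d N : (1 <= d)%nat ->
 clsum (seq 1 N) (fun n => RtoC (ind (dvdb d n))*phi n)%C = clsum (seq 1 (N/d)) (fun m => phi (d*m)%nat).
Proof.
 intro Hd. induction N as [|N IH]. rewrite Nat.div_small by lia. auto.
 rewrite clsum_seq_S, IH. change (1+N)%nat with (S N). unfold dvdb.
 assert (A := Nat.div_mod (S N) d ltac:(lia)). assert (B := Nat.div_mod N d ltac:(lia)).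
 assert (A' := Nat.mod_upper_bound (S N) d ltac:(lia)). assert (B' := Nat.mod_upper_bound N d ltac:(lia)).
 destruct (Nat.eqb_spec (S N mod d) 0) as [E|E].
 - assert (Q : (S N/d = S (N/d))%nat) by nia. rewrite Q, clsum_seq_S. replace (d*(1+N/d))%nat with (S N) by nia. simpl (ind true). ring.
 - assert (Q : (S N/d = N/d)%nat) by nia. rewrite Q. simpl (ind false). ring.
Qed.
Lemma Dirichlet_partial s N : (cpsum (ds (fun n => ln (INR n)) s) N = clsum (seq 1 N) (fun d => RtoC (vonMangoldt d)*Rcpow (INR d) (- s)*Zp (N/d) s))%C.
Proof. rewrite (cpsum_clsum (fun n => RtoC (ln (INR n))*Rcpow (INR n) (- s))%C), (clsum_ext _ _ (fun n => clsum (seq 1 N) (fun d => RtoC (vonMangoldt d)*(RtoC (ind (dvdb d n))*Rcpow (INR n) (- s)))%C)).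
 - rewrite clsum_swap. apply clsum_ext. intros d Hd. apply in_seq in Hd. rewrite clsum_scal, clsum_multiples by lia.
  unfold Zp. rewrite (cpsum_clsum (fun n => Rcpow (INR n) (- s))), <- Cmult_assoc. f_equal. rewrite <- clsum_scal. apply clsum_ext.
  intros m Hm. apply in_seq in Hm. rewrite mult_INR. apply Rcpow_mult; pos.
 - intros n Hn. apply in_seq in Hn. rewrite <- vonMangoldt_divisor_sum by lia.
  rewrite (clsum_ext _ _ (fun d => Rcpow (INR n) (- s)*RtoC (ind (dvdb d n)*vonMangoldt d))%C) by (intros; rewrite RtoC_mult; ring).
  rewrite clsum_scal, clsum_RtoC, Cmult_comm. do 2 f_equal. symmetry. apply lsum_seq_extend; [lia|].
  intros k Hk. unfold dvdb. rewrite Nat.mod_small by lia. destruct (Nat.eqb_spec n 0); [lia|]. simpl; lra.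
Qed.
Lemma Zs_tail s M : 1 < Re s -> (1 <= M)%nat -> Cmod (Zs s-Zp M s) <= Rpower (INR M) (1-Re s)/(Re s-1).
Proof.
 intros Hs HM. set (p := Re s) in *.
 assert (T : forall k, Cmod (Zp (M+k) s-Zp M s) <= (Rpower (INR M) (1-p)-Rpower (INR (M+k)) (1-p))/(p-1)).
 { induction k as [|k IH].
  - rewrite Nat.add_0_r, Cmod_self. lra.
  - replace (M+S k)%nat with (S (M+k)) by lia. change (Zp (S (M+k)) s) with (Zp (M+k) s+Rcpow (INR (S (M+k))) (- s))%C.
   replace (Zp (M+k) s+Rcpow (INR (S (M+k))) (- s)-Zp M s)%C with ((Zp (M+k) s-Zp M s)+Rcpow (INR (S (M+k))) (- s))%C by ring.
   tr Cmod_triangle. rewrite Cmod_Rcpow, Re_Copp. fold p. rewrite S_INR.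
   assert (Q := Rpower_sum_step (INR (M+k)) p ltac:(pos) Hs).
   nra. }
 apply clim_bound with (fun k => Zp (M+k) s-Zp M s)%C.
 - apply clim_minus; [|apply clim_const]. intros eps He.
  destruct (ds_clim (fun _ => 1) s Hs (fun n => coef_one_bound n) eps He) as (N & K). exists N. intros n Hn. rewrite <- cpsum_Zp. apply K. lia.
 - intro k. tr T. apply Rmult_le_compat_r. pos. generalize (Rpower_pos (INR (M+k)) (1-p)); lra.
Qed.
Lemma lsum_sum_n f N : lsum (seq 1 (S N)) f = sum_n (fun n => f (S n)) N.
Proof. induction N. auto. rewrite lsum_seq_S, IHN, sum_Sn. auto. Qed.
(** Partial sums are compared: by log = Lambda * 1 the error at N is the sum over d <= N of
    Lambda(d) d^(-s) times the tail of zeta beyond N/d. Half of the available exponent, [e], turns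
    each tail into a power of N, the other half keeps the sum over d convergent. *)
Lemma LZ_product s : 1 < Re s -> LZ s = (Zs s*Dl s)%C.
Proof.
 intro Hs. set (p := Re s) in *. set (e := (p-1)/2).
 assert (L1 := ds_clim (fun n => ln (INR n)) s Hs (fun n => coef_ln_bound n)).
 assert (L2 := clim_mult_const (Zs s) _ _ (ds_clim vonMangoldt s Hs (fun n => coef_Lambda_bound n))).
 assert (L3 := clim_shift _ _ (clim_minus _ _ _ _ L2 L1)).
 assert (Z : (Zs s*Dl s-LZ s = 0)%C); [|symmetry; apply Cminus_eq_0; pos].
 apply clim_unique with (1 := L3).
 set (B := Series (lnpow (1+e))). set (K := Rpower 2 e/(p-1)).
 apply clim_0_bound with (fun N => (K*B)*Rpower (INR (S N)) (-e)).
 2:{ replace (Finite 0) with (Rbar_mult (K*B) 0) by (simpl; f_equal; lra). apply is_lim_seq_scal_l. apply is_lim_INR_power; unfold e; lra. }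
 intro n. set (N := S n). rewrite Dirichlet_partial, (cpsum_clsum (fun n => RtoC (vonMangoldt n)*Rcpow (INR n) (- s))%C), <- clsum_scal. unfold Cminus. replace (- clsum (seq 1 N) (fun d => vonMangoldt d*Rcpow (INR d) (- s)*Zp (N/d) s))%C with
  (-(1)*clsum (seq 1 N) (fun d => vonMangoldt d*Rcpow (INR d) (- s)*Zp (N/d) s))%C by ring. rewrite <- clsum_scal, <- clsum_plus.
 eapply Rle_trans. apply clsum_Cmod with (g := fun d => K*Rpower (INR N) (-e)*lnpow (1+e) (d-1)).
 - intros d Hd. apply in_seq in Hd.
  replace (Zs s*(RtoC (vonMangoldt d)*Rcpow (INR d) (- s)) + - (1)*(RtoC (vonMangoldt d)*Rcpow (INR d) (- s)*Zp (N/d) s))%C with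
   (RtoC (vonMangoldt d)*Rcpow (INR d) (- s)*(Zs s-Zp (N/d) s))%C by ring.
  rewrite !Cmod_mult, Cmod_RtoC_pos, Cmod_Rcpow, Re_Copp by apply vonMangoldt_nonneg.
  assert (Q1 : (1 <= N/d)%nat) by (apply Nat.div_le_lower_bound; lia).
  assert (T := Zs_tail s (N/d) Hs Q1).
  assert (D1 : 1 <= INR d) by (apply (le_INR 1); lia).
  (* [N/d] is a truncated quotient that is at least 1, hence at least half of the real quotient. *)
  assert (Q2 : INR N/(2*INR d) <= INR (N/d)).
  { apply (Rmult_le_reg_r (2*INR d)); [lra|]. replace (INR N/(2*INR d)*(2*INR d)) with (INR N) by fld.
   replace (INR (N/d)*(2*INR d)) with (INR (N/d*(2*d))) by (rewrite !mult_INR; cont). apply le_INR.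
   assert (A := Nat.div_mod N d ltac:(lia)). assert (A' := Nat.mod_upper_bound N d ltac:(lia)). nia. }
  assert (T2 : Rpower (INR (N/d)) (1-p) <= Rpower 2 e*Rpower (INR d) e*Rpower (INR N) (-e)).
  { via (Rpower (INR (N/d)) (-e)). apply Rpower_le_exp. apply (le_INR 1); pos. unfold e; lra.
   eapply Rle_trans. apply Rpower_le_contra with (a := INR N/(2*INR d)); auto. pos. unfold e; lra.
   right. unfold Rpower, Rdiv. rewrite ln_mult, ln_Rinv, ln_mult by pos. rewrite <- !exp_plus. f_equal. ring. }
  assert (LB := ds_bound vonMangoldt (RtoC (1+e)) (d-1) ltac:(simpl; unfold e; lra) (coef_Lambda_bound _)).
  unfold ds in LB. replace (S (d-1)) with d in LB by lia. rewrite Cmod_mult, Cmod_RtoC_pos, Cmod_Rcpow, Re_Copp, Re_RtoC in LB by apply vonMangoldt_nonneg.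
  assert (G1 := vonMangoldt_nonneg d).
  via (vonMangoldt d*Rpower (INR d) (- p)*((Rpower 2 e*Rpower (INR d) e*Rpower (INR N) (-e))/(p-1))).
  + apply Rmult_le_compat_l. pos. tr T. apply Rmult_le_compat_r; auto. pos.
  + replace (vonMangoldt d*Rpower (INR d) (- p)*(Rpower 2 e*Rpower (INR d) e*Rpower (INR N) (- e)/(p-1))) with
    (K*Rpower (INR N) (-e)*(vonMangoldt d*(Rpower (INR d) (-p)*Rpower (INR d) e))) by (unfold K; lra).
   rewrite <- Rpower_plus. replace (- p+e) with (-(1+e)) by (unfold e; lra). mull; auto.
   apply Rmult_le_pos; [|pos]. apply Rmult_le_pos; [pos|]. pos.
 - rewrite lsum_scal. unfold N. rewrite lsum_sum_n, (sum_n_ext _ (lnpow (1+e))) by (intro; f_equal; lia).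
  fold N. replace (K*B*Rpower (INR N) (- e)) with (K*Rpower (INR N) (-e)*B) by ring. mull.
  { apply Rmult_le_pos; [|pos]. apply Rmult_le_pos; [pos|]. pos. }
  assert (ES := lnpow_series (1+e) ltac:(unfold e; lra)). apply (is_lim_seq_incr_compare (sum_n (lnpow (1+e)))); [apply (Series_correct _ ES)|].
  intro k. rewrite sum_Sn. unfold plus; simpl. assert (0 <= lnpow (1+e) (S k)); [|lra]. apply Rplus_le_le_0_compat; [|pos]. apply Rmult_le_pos; [|pos]. left; apply Rdiv_lt_0_compat; unfold e; lra.
Qed.

(** * Zeta and its logarithmic derivative to the right of 1 *)

Lemma half_plane_neq_1 s : 1 < Re s -> (s-1 <> 0)%C.
Proof. intros H E. apply Cminus_eq_0 in E. subst. simpl in H; lra. Qed.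
Lemma cderiv_Zs s : 1 < Re s -> cderiv Zs s (- (Zs s*Dl s)).
Proof.
 intro H. assert (N := half_plane_neq_1 s H).
 assert (K := cderiv_div _ _ _ _ _ (proj1 (Holo_zf s ltac:(unfold half_plane; lra))) (proj1 (Holo_sub_const (fun _ => True) 1 s I)) N).
 rewrite zf'_LZ, zf_Zs in K by auto.
 replace (((Zs s-(s-1)*LZ s)*(s-1)-(s-1)*Zs s*1)/((s-1)*(s-1)))%C with (- (Zs s*Dl s))%C in K by (rewrite LZ_product by auto; field; pos).
 apply cderiv_ext_loc with (2 := K). exists (Re s-1). split; [lra|]. intros w Hw.
 assert (X := re_le_Cmod (w-s)). rewrite Re_Cminus in X. apply Rabs_le_between in X.
 rewrite zf_Zs by lra. field. apply half_plane_neq_1; lra.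
Qed.
Lemma Re_Rcpow_opp n a t : Re (Rcpow n (- (a, t))) = Rpower n (- a)*cos (t*ln n).
Proof.
 unfold Rcpow, Cexp, Rpower. simpl. f_equal. f_equal; lra. rewrite <- (cos_neg (t*ln n)). f_equal; lra.
Qed.
Lemma clim_Re_nonneg a l : clim a l -> (forall n, 0 <= Re (a n)) -> 0 <= Re l.
Proof. intros H K. apply clim_Re in H. apply (is_lim_seq_le (fun _ => 0) (fun n => Re (a n)) 0 (Re l)); auto. apply is_lim_seq_const. Qed.
(** Term by term 3 + 4 cos t + cos 2t = 2 (1 + cos t)^2, with the non-negative weights Lambda(n)
    n^(-a). *)
Lemma three_four_one a t : 1 < a -> 0 <= 3*Re (Dl (RtoC a))+4*Re (Dl (a, t))+Re (Dl (a, 2*t)).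
Proof.
 intro Ha.
 assert (L : forall u, clim (cpsum (ds vonMangoldt (a, u))) (Dl (a, u))) by (intro; apply ds_clim; [pos|apply coef_Lambda_bound]).
 assert (K := clim_plus _ _ _ _ (clim_plus _ _ _ _ (clim_mult_const 3 _ _ (L 0)) (clim_mult_const 4 _ _ (L t))) (L (2*t))).
 apply clim_Re_nonneg in K. 2:{
  intro N. rewrite !Re_Cplus, !Re_Cmult. simpl (Re 3). simpl (Re 4). rewrite !Rmult_0_l, !Rminus_0_r.
  induction N as [|N IH]. simpl; lra.
  change (cpsum ?u (S N)) with (cpsum u N+u N)%C. rewrite !Re_Cplus. unfold ds at 2 4 6. rewrite !Re_Cmult, !Re_Rcpow_opp. simpl (Re (RtoC _)). simpl (Im (RtoC _)). rewrite Rmult_0_l, cos_0.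
  set (th := t*ln (INR (S N))). replace (2*t*ln (INR (S N))) with (2*th) by (unfold th; lra).
  set (w := vonMangoldt (S N)*Rpower (INR (S N)) (-a)).
  assert (w0 : 0 <= w) by (apply Rmult_le_pos; [apply vonMangoldt_nonneg|pos]).
  assert (0 <= w*(3+4*cos th+cos (2*th))). { apply Rmult_le_pos; auto. rewrite cos_2a_cos. generalize (Rle_0_sqr (1+cos th)); unfold Rsqr; lra. }
  unfold w in H. lra. }
 rewrite !Re_Cplus, !Re_Cmult in K. simpl (Re 3) in K. simpl (Im 3) in K. simpl (Re 4) in K. simpl (Im 4) in K. change (RtoC a) with ((a, 0) : C). lra.
Qed.
Lemma Dl_Re_sum_nonneg a t : 1 < a -> 0 <= Re (Dl (RtoC a))+Re (Dl (a, t)).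
Proof.
 intro Ha. assert (L : forall u, clim (cpsum (ds vonMangoldt (a, u))) (Dl (a, u))) by (intro; apply ds_clim; [pos|apply coef_Lambda_bound]).
 assert (K := clim_plus _ _ _ _ (L 0) (L t)). apply clim_Re_nonneg in K. exact K.
 intro N. rewrite Re_Cplus. induction N as [|N IH]. simpl; lra.
 change (cpsum ?u (S N)) with (cpsum u N+u N)%C. rewrite !Re_Cplus. unfold ds at 2 4. rewrite !Re_Cmult, !Re_Rcpow_opp. simpl (Re (RtoC _)). simpl (Im (RtoC _)). rewrite Rmult_0_l, cos_0.
 set (w := vonMangoldt (S N)*Rpower (INR (S N)) (-a)).
 assert (w0 : 0 <= w) by (apply Rmult_le_pos; [apply vonMangoldt_nonneg|pos]).
 assert (0 <= w*(1+cos (t*ln (INR (S N))))). { apply Rmult_le_pos; auto. generalize (COS_bound (t*ln (INR (S N)))); lra. }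
 unfold w in H. lra.
Qed.
Lemma Zs_sub_1 s : 1 < Re s -> Cmod (Zs s-1) <= 1/(Re s-1).
Proof.
 intro H. assert (T := Zs_tail s 1 H ltac:(lia)). unfold Zp in T. simpl in T. rewrite Rcpow_1_l in T. replace (0+1)%C with (RtoC 1) in T by ring.
 unfold Rpower in T. rewrite ln_1, Rmult_0_r, exp_0 in T. lra.
Qed.
Lemma Zs_upper s : 1 < Re s -> Cmod (Zs s) <= 1+1/(Re s-1).
Proof. intro H. assert (T := Zs_sub_1 s H). assert (X := Cmod_le_minus (Zs s) 1). rewrite Cmod_1 in X. lra. Qed.
Lemma is_derive_Cmod_sqr g t l : rderiv g t l -> is_derive (fun u => Cmod (g u)^2) t (2*Re (Cconj (g t)*l)).
Proof.
 intro H. assert (A := rderiv_Re _ _ _ H). assert (B := rderiv_Im _ _ _ H).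
 apply (is_derive_ext (fun u => Re (g u)^2+Im (g u)^2)). intro; rewrite Cmod2_alt; lra.
 evar (l' : R). replace (2*Re (Cconj (g t)*l)) with l'. apply (is_derive_plus (V := R_NormedModule) (fun u => Re (g u)^2) (fun u => Im (g u)^2)).
 apply (is_derive_pow (fun u => Re (g u)) 2), A. apply (is_derive_pow (fun u => Im (g u)) 2), B.
 unfold l', plus; simpl. unfold Re, Im. ring.
Qed.
(* [|Z(a+it)|^2 Z(a)^2] decreases in [a], because Re D(a+it) + D(a) >= 0; this bounds Z away from 0. *)
Lemma Zs_lower a t : 1 < a <= 3 -> 1/4 <= Cmod (Zs (a, t))*Cmod (Zs (RtoC a)).
Proof.
 intros Ha. set (phi := fun x => Cmod (Zs (x, t))^2*Cmod (Zs (x, 0))^2).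
 assert (N : forall t x, 1 < x -> is_derive (fun x => Cmod (Zs (x, t))^2) x (- 2*Cmod (Zs (x, t))^2*Re (Dl (x, t)))).
 { intros u x Hx. replace (-2*Cmod (Zs (x, u))^2*Re (Dl (x, u))) with (2*Re (Cconj (Zs (x, u)) * - (Zs (x, u)*Dl (x, u)))).
  apply (is_derive_Cmod_sqr (fun x => Zs (x, u))).
  assert (K := rderiv_comp Zs (fun x => (0, u)+1*RtoC x)%C x 1 (- (Zs (x, u)*Dl (x, u))) (rderiv_affine _ _ _)).
  cbv beta in K. replace ((0, u)+1*RtoC x)%C with ((x, u) : C) in K by (apply C_eq; simpl; lra). rewrite Cmult_1_r in K.
  apply rderiv_ext with (2 := K (cderiv_Zs (x, u) Hx)). intro; f_equal; apply C_eq; simpl; lra.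
  rewrite Cmod2_alt. destruct (Zs (x, u)), (Dl (x, u)). simpl. lra. }
 assert (M : phi 3 <= phi a).
 { destruct (Req_dec a 3) as [->|Na]; [lra|].
  destruct (MVT_gen phi a 3 (fun x => -2*phi x*(Re (Dl (RtoC x))+Re (Dl (x, t))))) as (c & Hc & E).
  - minmax. intros x Hx. evar (l : R). replace (-2*phi x*(Re (Dl x)+Re (Dl (x, t)))) with l.
   apply (is_derive_mult (fun x => Cmod (Zs (x, t))^2) (fun x => Cmod (Zs (x, 0))^2)). cont. cont. apply Rmult_comm.
   unfold l, phi, plus, mult; simpl. lra.
  - minmax. intros x Hx. apply continuity_pt_filterlim. apply (ex_derive_continuous phi). eexists.
   apply (is_derive_mult (fun x => Cmod (Zs (x, t))^2) (fun x => Cmod (Zs (x, 0))^2)). cont. cont. apply Rmult_comm.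
  - rewrite Rmin_left, Rmax_right in Hc by lra.
   assert (0 <= phi c) by (apply Rmult_le_pos; pos). assert (S0 := Dl_Re_sum_nonneg c t ltac:(lra)).
   assert (0 <= phi c*(Re (Dl c)+Re (Dl (c, t)))) by pos.
   nra. }
 assert (B3 : forall u, 1/2 <= Cmod (Zs (3, u))).
 { intro u. assert (T := Zs_sub_1 (3, u) ltac:(simpl; lra)). simpl in T. assert (X := Cmod_le_minus 1 (Zs (3, u))). rewrite Cmod_1, Cmod_minus_sym in X. lra. }
 assert (M2 : (1/4)^2 <= (Cmod (Zs (a, t))*Cmod (Zs (RtoC a)))^2).
 { rewrite Rpow_mult_distr. trr M. replace ((1/4)^2) with ((1/2)^2*(1/2)^2) by field.
  mul; apply pow_incr; split; auto; lra. }
 apply Rsqr_incr_0. unfold Rsqr. lra. lra. pos.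
Qed.
Lemma Zs_neq_0 s : 1 < Re s -> Zs s <> 0.
Proof.
 intros H E. destruct (Rle_dec (Re s) 3) as [L|L].
 - assert (X := Zs_lower (Re s) (Im s) ltac:(lra)). replace ((Re s, Im s) : C) with s in X by (destruct s; auto). rewrite E, Cmod_0 in X. lra.
 - assert (T := Zs_sub_1 s H). rewrite E in T. replace (0-1)%C with (-(1))%C in T by ring. rewrite Cmod_opp, Cmod_1 in T.
  assert (1/(Re s-1) < 1/2). { apply Rmult_lt_compat_l; [lra|]. apply Rinv_lt_contravar; lra. } lra.
Qed.
Lemma zf_neq_0 s : 1 < Re s -> zf s <> 0.
Proof. intro H. rewrite zf_Zs by auto. apply Cmult_neq_0. apply half_plane_neq_1; lra. apply Zs_neq_0; lra. Qed.
(** The function -zeta'/zeta minus its polar part 1/(s-1): the Mellin transform of the point masses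
    Lambda(n) at n minus Lebesgue measure on (1, oo), a measure whose second primitive is [A1]. *)
Definition FF (s : C) : C := (- (zf' s/zf s))%C.
Lemma FF_Dl s : 1 < Re s -> FF s = (Dl s-1/(s-1))%C.
Proof.
 intro H. unfold FF. rewrite zf'_LZ, zf_Zs, LZ_product by auto. field. split; [apply half_plane_neq_1|apply Zs_neq_0]; lra.
Qed.

(** * The zeta function of the statement *)

Lemma eta_partial_even s N : (eta_partial s (2*N) = Zp (2*N) s-Rcpow 2 (1-s)*Zp N s)%C.
Proof.
 induction N as [|N IH]. unfold Zp; simpl. ring.
 replace (2*S N)%nat with (S (S (2*N))) by lia.
 change (eta_partial s (S (S (2*N)))) with (eta_partial s (2*N)+RtoC ((-1)^(2*N))*Rcpow (INR (S (2*N))) (- s)+RtoC ((-1)^(S (2*N)))*Rcpow (INR (S (S (2*N)))) (- s))%C.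
 rewrite IH. change (Zp (S (S (2*N))) s) with (Zp (2*N) s+Rcpow (INR (S (2*N))) (- s)+Rcpow (INR (S (S (2*N)))) (- s))%C.
 change (Zp (S N) s) with (Zp N s+Rcpow (INR (S N)) (- s))%C.
 rewrite pow_1_even, pow_1_odd. replace (INR (S (S (2*N)))) with (2*INR (S N)) by (replace (S (S (2*N))) with (2*S N)%nat by lia; rewrite mult_INR; cont).
 rewrite (Rcpow_mult 2 (INR (S N)) (- s)) by pos. replace (1-s)%C with (1 + - s)%C by ring. rewrite Rcpow_plus, Rcpow_1 by lra. ring.
Qed.
(** In the even partial sums, Zp(2N) - 2^(1-s) Zp(N), the growing terms N^(1-s) cancel and leave the
    multiple of [zf]; an odd partial sum differs from an even one by a single term that tends to
    0. *)
Lemma eta_clim s : 0 < Re s < 1 -> clim (eta_partial s) ((1-Rcpow 2 (1-s))*zf s/(s-1)).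
Proof.
 intro H. set (l := ((1-Rcpow 2 (1-s))*zf s/(s-1))%C).
 assert (N1 : (s-1 <> 0)%C) by (intro E; apply Cminus_eq_0 in E; subst; simpl in H; lra).
 set (Y := fun N => ((s-1)*(Zp N s-Rcpow (INR N) (- s)/2)+Rcpow (INR N) (1-s))%C).
 assert (LY : forall eps, 0 < eps -> exists N, (1 <= N)%nat /\ forall n, (N <= n)%nat -> Cmod (Y n-zf s) < eps).
 { intros eps He. destruct (zf_clim s ltac:(lra) eps He) as (N & K). exists (S N). split; [lia|]. intros n Hn. destruct n; [lia|]. apply (K n); lia. }
 assert (LP : clim (fun N => Rcpow (INR N) (- s)) 0).
 { intros eps He. destruct (clim_power_0 s ltac:(lra) eps He) as (N & K). exists (S N). intros n Hn. destruct n; [lia|]. apply (K n); lia. }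
 assert (EV : clim (fun N => eta_partial s (2*N)) l).
 { assert (A : clim (fun N => Y (2*N)%nat) (zf s)). { intros eps He. destruct (LY eps He) as (N & N1' & K). exists N. intros n Hn. apply K; lia. }
  assert (B : clim Y (zf s)). { intros eps He. destruct (LY eps He) as (N & N1' & K). exists N. auto. }
  assert (P2 : clim (fun N => Rcpow (INR (2*N)) (- s)) 0). { intros eps He. destruct (LP eps He) as (N & K). exists N. intros n Hn. apply K; lia. }
  assert (Q := clim_plus _ _ _ _ (clim_mult_const (/ (s-1)) _ _ (clim_minus _ _ _ _ A (clim_mult_const (Rcpow 2 (1-s)) _ _ B)))
   (clim_mult_const (/2) _ _ (clim_minus _ _ _ _ P2 (clim_mult_const (Rcpow 2 (1-s)) _ _ LP)))).
  replace (/ (s-1)*(zf s-Rcpow 2 (1-s)*zf s) + / 2*(0-Rcpow 2 (1-s)*0))%C with l in Q by (unfold l; field; pos).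
  apply (clim_shift) in Q. intros eps He. destruct (Q eps He) as (N & K). exists (S N). intros n Hn. destruct n as [|n]; [lia|]. specialize (K n ltac:(lia)).
  rewrite eta_partial_even. match type of K with Cmod (?X-l) < _ => replace (Zp (2*S n) s-Rcpow 2 (1-s)*Zp (S n) s)%C with X end; auto.
  unfold Y. replace (INR (2*S n)) with (2*INR (S n)) by (rewrite mult_INR; cont).
  rewrite !(Rcpow_mult 2 (INR (S n))) by pos.
  field; pos. }
 intros eps He. destruct (EV (eps/2)) as (N1' & K1); [lra|]. destruct (LP (eps/2)) as (N2 & K2); [lra|].
 exists (2*(N1'+N2)+1)%nat. intros n Hn. destruct (Nat.Even_or_Odd n) as [(k & E)|(k & E)]; subst n.
 - specialize (K1 k ltac:(lia)). lra.
 - replace (2*k+1)%nat with (S (2*k)) by lia.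
  change (eta_partial s (S (2*k))) with (eta_partial s (2*k)+RtoC ((-1)^(2*k))*Rcpow (INR (S (2*k))) (- s))%C. rewrite pow_1_even.
  specialize (K1 k ltac:(lia)). specialize (K2 (S (2*k)) ltac:(lia)). replace (Rcpow (INR (S (2*k))) (- s)-0)%C with (Rcpow (INR (S (2*k))) (- s)) in K2 by ring.
  replace (eta_partial s (2*k)+1*Rcpow (INR (S (2*k))) (- s)-l)%C with ((eta_partial s (2*k)-l)+Rcpow (INR (S (2*k))) (- s))%C by ring.
  eapply Rle_lt_trans; [apply Cmod_triangle|lra].
Qed.
Lemma zeta_zf s : 0 < Re s < 1 -> zeta s = (zf s/(s-1))%C.
Proof.
 intro H. assert (L := eta_clim s H). unfold zeta, eta.
 rewrite (is_lim_seq_unique _ _ (clim_Re _ _ L)), (is_lim_seq_unique _ _ (clim_Im _ _ L)).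
 assert (N1 : (s-1 <> 0)%C) by (intro E; apply Cminus_eq_0 in E; subst; simpl in H; lra).
 (* For Re s < 1 the modulus of 2^(1-s) exceeds 1, so the denominator in [zeta] does not vanish in
    the strip. *)
 assert (N2 : (1-Rcpow 2 (1-s) <> 0)%C).
 { intro E. apply Cminus_eq_0 in E. apply (f_equal Cmod) in E. rewrite Cmod_1, Cmod_Rcpow in E. rewrite Re_Cminus in E. simpl (Re 1) in E. unfold Rpower in E.
  assert (0 < ln 2) by (rewrite <- ln_1; apply ln_increasing; lra). assert (Q : exp 0 < exp ((1-Re s)*ln 2)) by (apply exp_increasing, Rmult_lt_0_compat; lra). rewrite exp_0 in Q. lra. }
 match goal with |- (?X/_ = _)%C => replace X with ((1-Rcpow 2 (1-s))*zf s/(s-1))%C by auto end.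
 field. auto.
Qed.
Lemma nontrivial_zero_zf s : nontrivial_zero s <-> 0 < Re s < 1 /\ zf s = 0.
Proof. split; intros (H & E); split; auto; rewrite ?zeta_zf in * by auto;
 assert (N1 : (s-1 <> 0)%C) by (intro Q; apply Cminus_eq_0 in Q; subst; simpl in H; lra).
 - replace (zf s) with (zf s/(s-1)*(s-1))%C by (field; pos). rewrite E; ring.
 - rewrite E. field; pos.
Qed.

(** * The zeros of zeta and the size of its logarithmic derivative *)

(** Centres to the right of 1, where zeta is bounded below. The radii used with them: 1.3 covers the
    window 0 <= Re s <= 2.4 at heights within 1/2, zeros are divided out up to 1.5, the circle 1.95
    stays in Re s >= -0.75, and 2.1 stays in the domain Re s > -1 of [zf]. *)
Definition zcen (t : R) : C := (1.2, t).
Definition nearb (t : R) (rho : C) : bool := if Rlt_dec (Cmod (rho-zcen t)) 1.5 then true else false.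
Definition near (t : R) (Z : list C) : list C := filter (nearb t) Z.
Definition far (t : R) (Z : list C) : list C := filter (fun rho => negb (nearb t rho)) Z.
Lemma nearb_true t rho : nearb t rho = true <-> Cmod (rho-zcen t) < 1.5.
Proof. unfold nearb. destruct (Rlt_dec _ _); lra. Qed.
Lemma Cprod_split t Z z : Cprod Z z = (Cprod (near t Z) z*Cprod (far t Z) z)%C.
Proof. induction Z as [|a Z IH]; simpl. ring. destruct (nearb t a); simpl; rewrite IH; ring. Qed.
Fixpoint Cprod' (Z : list C) (z : C) : C := match Z with nil => RtoC 0 | rho :: Z' => (1*Cprod Z' z+(z-rho)*Cprod' Z' z)%C end.
Lemma Holo_Cprod D Z : Holo D (Cprod Z) (Cprod' Z).
Proof. induction Z as [|rho Z IH]; [apply Holo_const|]. exact (Holo_mult _ _ _ _ _ (Holo_sub_const D rho) IH). Qed.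
Lemma Cprod_neq_0 Z z : (forall rho, In rho Z -> rho <> z) -> Cprod Z z <> 0.
Proof.
 induction Z as [|rho Z IH]; intro H; simpl. intro E; apply RtoC_inj in E; lra.
 apply Cmult_neq_0. intro E. apply Cminus_eq_0 in E. apply (H rho); [left|]; auto. apply IH. intros; apply H; right; pos.
Qed.
Lemma Cprod_root Z z : In z Z -> Cprod Z z = 0.
Proof. induction Z as [|rho Z IH]; simpl; intros []; [subst; ring|rewrite IH by auto; ring]. Qed.
Lemma Cprod'_log Z z : (forall rho, In rho Z -> rho <> z) -> (Cprod' Z z = Cprod Z z*clsum Z (fun rho => / (z-rho)))%C.
Proof.
 induction Z as [|rho Z IH]; intro H; simpl. unfold clsum; simpl; ring.
 rewrite IH by (intros; apply H; right; pos). unfold clsum; simpl. field.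
 intro E. apply Cminus_eq_0 in E. apply (H rho); [left|]; auto.
Qed.

Lemma Re_in_disc z t r : Cmod (z-zcen t) <= r -> 1.2-r <= Re z <= 1.2+r.
Proof. assert (X := re_le_Cmod (z-zcen t)). rewrite Re_Cminus in X. simpl in X. apply Rabs_le_between in X. lra. Qed.
Lemma Im_in_disc z t r : Cmod (z-zcen t) <= r -> t-r <= Im z <= t+r.
Proof. assert (X := im_le_Cmod (z-zcen t)). rewrite Im_Cminus in X. simpl in X. apply Rabs_le_between in X. lra. Qed.
Lemma disc_half_plane t z : cdisc (zcen t) 2.1 z -> half_plane (-1) z.
Proof. intro H. unfold cdisc in H. assert (X := Re_in_disc z t 2.1 ltac:(lra)). unfold half_plane. lra. Qed.
Lemma Cmod_zcen t : Cmod (zcen t) <= 1.2+Rabs t.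
Proof. tr Cmod_le_Re_Im. simpl. rewrite (Rabs_right 1.2) by lra. lra. Qed.
(** Since zeta(1.2) <= 6, [Zs_lower] gives at least 1/24 for zeta at the centre, while |s-1| >=
    max(0.2, |t|). *)
Lemma zf_center_lower t : (Rabs t+5)/640 <= Cmod (zf (zcen t)).
Proof.
 rewrite zf_Zs by (simpl; lra). rewrite Cmod_mult.
 assert (A := Zs_lower 1.2 t ltac:(lra)). fold (zcen t) in A. assert (B := Zs_upper (RtoC 1.2) ltac:(simpl; lra)). simpl in B. assert (P2 := Cmod_ge_0 (Zs 1.2)).
 assert (X1 := re_le_Cmod (zcen t-1)). assert (X2 := im_le_Cmod (zcen t-1)). rewrite Im_Cminus in X2. simpl in X1, X2. rewrite Rminus_0_r in X2.
 rewrite Rabs_right in X1 by lra.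
 nra.
Qed.
Lemma zf_growth z : -0.75 <= Re z -> Cmod (zf z) <= (Cmod z+1)*(Cmod z+1)*(Cmod z+1).
Proof.
 intro H. assert (B := zf_sub_bound z ltac:(lra)). assert (X := Cmod_le_minus (zf z) ((z+1)/2)).
 assert (Z1 := Cmod_sub_le z 1). assert (Z2 := Cmod_triangle z 1). rewrite Cmod_1 in Z1, Z2. set (m := Cmod z) in *.
 assert (m0 : 0 <= m) by apply Cmod_ge_0. rewrite Cmod_div, (Cmod_RtoC_pos 2) in X by (cnz || lra).
 assert (I4 : 1+1/(Re z+1) <= 5). { assert (1/(Re z+1) <= 1/0.25). mull. apply Rinv_le_contravar; lra. lra. }
 assert (I0 : 0 <= 1/(Re z+1)) by pos. assert (P2 := Cmod_ge_0 (z+1)).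
 assert (Cmod (z-1)*m*Cmod (z+1)/8*(1+1/(Re z+1)) <= (m+1)*m*(m+1)/8*5).
 { apply Rmult_le_compat; try lra. pos.
  mulr. apply Rmult_le_compat; auto. pos. nra. }
 nra.
Qed.
Lemma zf_circle t z : Cmod (z-zcen t) = 1.95 -> Cmod (zf z) <= 640*((Rabs t+5)*(Rabs t+5))*Cmod (zf (zcen t)).
Proof.
 intro H. assert (R := Re_in_disc z t 1.95 ltac:(lra)). assert (G := zf_growth z ltac:(lra)). assert (L := zf_center_lower t).
 assert (Cz : Cmod z+1 <= Rabs t+5). { assert (X := Cmod_le_minus z (zcen t)). assert (Y := Cmod_zcen t). lra. }
 set (T := Rabs t+5) in *. assert (m0 := Cmod_ge_0 z).
 tr G. via (T*T*T).
 apply Rmult_le_compat; try lra. nra. nra.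
 nra.
Qed.
(** The numerical bounds for exp and ln below come from [1+a <= exp a] with a small step, raised to
    a power. *)
Lemma exp_lower_pow a n : 0 <= a -> (1+a)^n <= exp (INR n*a).
Proof.
 intro H. induction n. rewrite Rmult_0_l, exp_0; lra. rewrite S_INR. replace ((INR n+1)*a) with (a+INR n*a) by ring. rewrite exp_plus. simpl.
 apply Rmult_le_compat; try lra. pos. apply exp_ineq1_le.
Qed.
Lemma exp_quarter : exp 0.25 <= 1.3.
Proof.
 assert (E : exp (-0.025) >= 0.975) by (generalize (exp_ineq1_le (-0.025)); lra).
 assert (E2 : 0.975^10 <= exp (-0.25)). { replace (-0.25) with (INR 10 * -0.025) by (simpl; lra).
  assert (G : forall n, 0.975^n <= exp (INR n * -0.025)). { induction n. rewrite Rmult_0_l, exp_0; lra. rewrite S_INR. replace ((INR n+1) * -0.025) with (-0.025+INR n * -0.025) by ring. rewrite exp_plus. simpl.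
   apply Rmult_le_compat; try lra. pos. } auto. }
 assert (E3 : exp 0.25*exp (-0.25) = 1) by (rewrite <- exp_plus; replace (0.25 + -0.25) with 0 by lra; apply exp_0).
 nra.
Qed.
Lemma exp_ge_pow27 n : 2.7^n <= exp (INR n).
Proof.
 assert (E : 2.7 <= exp 1). { assert (H := exp_lower_pow 0.005 200 ltac:(lra)). replace (INR 200*0.005) with 1 in H by (simpl; lra). lra. }
 induction n. simpl. rewrite exp_0; lra. rewrite S_INR, Rplus_comm, exp_plus. simpl. apply Rmult_le_compat; try lra. pos.
Qed.
Lemma ln_le_of_exp x y : 0 < x -> x <= exp y -> ln x <= y.
Proof. intros H K. rewrite <- (ln_exp y). destruct K as [L| ->]; [left; apply ln_increasing; lra|lra]. Qed.
Lemma le_ln_of_exp x y : exp y <= x -> y <= ln x.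
Proof. intros K. rewrite <- (ln_exp y). destruct K as [L| <-]; [left; apply ln_increasing; pos|lra]. Qed.
Lemma ln_le_mono x y : 0 < x -> x <= y -> ln x <= ln y.
Proof. intros H [L| ->]; [left; apply ln_increasing; lra|lra]. Qed.
Definition lt5 (t : R) : R := ln (Rabs t+5).
Lemma exp_1_6 : exp 1.6 <= 5.
Proof.
 assert (G : forall n, 0.99^n <= exp (INR n * -0.01)).
 { induction n. rewrite Rmult_0_l, exp_0; lra. rewrite S_INR. replace ((INR n+1) * -0.01) with (-0.01+INR n * -0.01) by ring. rewrite exp_plus. simpl.
  assert (E := exp_ineq1_le (-0.01)). apply Rmult_le_compat; try lra. pos. }
 specialize (G 160%nat). replace (INR 160 * -0.01) with (-1.6) in G by (simpl; lra).
 assert (E3 : exp 1.6*exp (-1.6) = 1) by (rewrite <- exp_plus; replace (1.6 + -1.6) with 0 by lra; apply exp_0).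
 nra.
Qed.
Lemma lt5_ge t : 1.6 <= lt5 t.
Proof. apply le_ln_of_exp. tr exp_1_6; generalize (Rabs_pos t); lra. Qed.

Lemma near_divides Z g g' t : divides_on (half_plane (-1)) Z zf g g' ->
 divides_on (cdisc (zcen t) 2.1) (near t Z) zf (fun z => Cprod (far t Z) z*g z)%C (fun z => Cprod' (far t Z) z*g z+Cprod (far t Z) z*g' z)%C.
Proof.
 intros (H & E). split.
 - apply Holo_mult. apply Holo_Cprod. intros z Hz. apply H. eapply disc_half_plane; eauto.
 - intros z Hz. rewrite E by (eapply disc_half_plane; eauto). rewrite (Cprod_split t Z z). ring.
Qed.
Lemma near_in t Z rho : In rho (near t Z) -> In rho Z /\ Cmod (rho-zcen t) < 1.5.
Proof. intro H. apply filter_In in H. rewrite nearb_true in H. auto. Qed.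
Lemma zf_center_neq_0 t : zf (zcen t) <> 0.
Proof. apply zf_neq_0. simpl; lra. Qed.
Lemma ln_count_bound t k n : 0 < k -> k <= 2.7^n -> ln (k*((Rabs t+5)*(Rabs t+5))) <= INR n+2*lt5 t.
Proof.
 intros K0 K. assert (Q := Rabs_pos t). rewrite !ln_mult by pos. fold (lt5 t).
 assert (ln k <= INR n); [|lra]. apply ln_le_of_exp; auto. tr K; apply exp_ge_pow27.
Qed.
(** The ratio of the radii is 1.95/1.5 = 1.3 >= exp 0.25, so the number of zeros is at most four
    times the logarithm of the bound in [zf_circle]; with 640 <= 2.7^7 this is 4 (7 + 2 lt5). *)
Lemma near_count Z g g' t : divides_on (half_plane (-1)) Z zf g g' -> INR (length (near t Z)) <= 28+8*lt5 t.
Proof.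
 intro H. assert (C := zero_count (zcen t) 1.5 1.95 2.1 _ _ _ _ _ ltac:(lra) ltac:(lra) ltac:(lra) (near_divides _ _ _ t H)
  (fun rho Hr => Rlt_le _ _ (proj2 (near_in t Z rho Hr))) (zf_center_neq_0 t) (zf_circle t)).
 set (n := length (near t Z)) in *. replace (1.95/1.5) with 1.3 in C by lra.
 assert (E : exp (0.25*INR n) <= 1.3^n).
 { clear C. induction n. rewrite Rmult_0_r, exp_0; lra. rewrite S_INR. replace (0.25*(INR n+1)) with (0.25+0.25*INR n) by ring. rewrite exp_plus.
  mul. apply exp_quarter. }
 assert (L : 0.25*INR n <= ln (640*((Rabs t+5)*(Rabs t+5)))) by (apply le_ln_of_exp; lra).
 assert (B := ln_count_bound t 640 7 ltac:(lra) ltac:(lra)). simpl in B. lra.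
Qed.
(** Landau's lemma for the cofactor of the near zeros, that is, the far factors times [g]. The
    logarithm of 640 (1.95/0.45) (|t|+5)^2 is at most 8 + 2 lt5, and with lt5 >= 1.6 all
    contributions stay below 1000 lt5. *)
Lemma Landau_zf Z g g' t w : divides_on (half_plane (-1)) Z zf g g' -> (forall z, Cmod (z-zcen t) < 1.5 -> g z <> 0) -> Cmod (w-zcen t) <= 1.3 ->
 Cmod (g' w/g w+clsum (far t Z) (fun rho => / (w-rho)))%C <= 1000*lt5 t.
Proof.
 intros H NZ Hw. assert (L5 := lt5_ge t).
 assert (FN : forall z, Cmod (z-zcen t) < 1.5 -> forall rho, In rho (far t Z) -> rho <> z).
 { intros z Hz rho Hr ->. apply filter_In in Hr. destruct Hr as (_ & Hr). rewrite (proj2 (nearb_true t z) Hz) in Hr. lra. }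
 assert (B := Landau_log_derivative (zcen t) 1.5 1.95 2.1 _ _ _ _ _ ltac:(lra) ltac:(lra) ltac:(lra) (near_divides _ _ _ t H)
  (fun rho Hr => Rlt_le _ _ (proj2 (near_in t Z rho Hr))) (zf_center_neq_0 t) (zf_circle t)
  (fun z Hz => Cmult_neq_0 _ _ (Cprod_neq_0 _ _ (FN z Hz)) (NZ z Hz)) 1.45 1.3 w ltac:(lra) ltac:(lra) ltac:(lra) Hw).
 cbv beta in B. assert (N := near_count Z g g' t H).
 set (P := Cprod (far t Z) w) in *. assert (P0 : P <> 0) by (apply Cprod_neq_0, FN; lra). assert (G0 : g w <> 0) by cont.
 rewrite (Cprod'_log (far t Z) w) in B by cont. fold P in B.
 replace (P*clsum (far t Z) (fun rho => / (w-rho))*g w+P*g' w)%C with ((g' w/g w+clsum (far t Z) (fun rho => / (w-rho)))*(P*g w))%C in B by (field; pos).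
 rewrite Cmod_mult in B. assert (PG : 0 < Cmod (P*g w)) by (apply Cmod_gt_0, Cmult_neq_0; pos). apply Rmult_le_reg_r in B; auto.
 tr B.
 replace (640*((Rabs t+5)*(Rabs t+5))*1.95/(1.95-1.5)) with ((640*1.95/0.45)*((Rabs t+5)*(Rabs t+5))) by lra.
 assert (LL := ln_count_bound t (640*1.95/0.45) 8 ltac:(lra) ltac:(lra)). simpl in LL.
 lra.
Qed.

(** * Dividing out all zeros up to a given height *)

Definition ht (K i : nat) : R := INR i-INR K.
Definition PK (K : nat) (z : C) : Prop := exists i, (i <= 2*K)%nat /\ Cmod (z-zcen (ht K i)) < 1.5.
(** A finite substitute for the Hadamard product: all zeros in the discs of radius 1.5 about 1.2 +
    ik, for integers |k| <= K, are divided out, with a cofactor that is free of zeros there. *)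
Definition zdata (K : nat) (Z : list C) (g g' : C -> C) : Prop :=
 divides_on (half_plane (-1)) Z zf g g' /\ (forall rho, In rho Z -> PK K rho) /\ (forall z, PK K z -> g z <> 0).
Definition Nbar (K : nat) : R := 28+8*lt5 (INR K).
Lemma ht_abs K i : (i <= 2*K)%nat -> Rabs (ht K i) <= INR K.
Proof. intro H. unfold ht. apply le_INR in H. rewrite mult_INR in H. simpl in H. apply Rabs_le_between. generalize (pos_INR i); lra. Qed.
Lemma lt5_ht K i : (i <= 2*K)%nat -> lt5 (ht K i) <= lt5 (INR K).
Proof.
 intro H. apply ln_le_mono. generalize (Rabs_pos (ht K i)); lra. rewrite (Rabs_right (INR K)) by (apply Rle_ge, pos_INR). generalize (ht_abs K i H); lra.
Qed.
Lemma lsum_length {A} (l : list A) : lsum l (fun _ => 1) = INR (length l).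
Proof. induction l. reflexivity. change (1+lsum l (fun _ => 1) = INR (S (length l))). rewrite IHl, S_INR. ring. Qed.
Lemma lsum_filter {A} (p : A -> bool) l f : lsum (filter p l) f = lsum l (fun x => ind (p x)*f x).
Proof.
 induction l. auto. simpl. destruct (p a) eqn:E.
 - change (f a+lsum (filter p l) f = ind (p a)*f a+lsum l (fun x => ind (p x)*f x)). rewrite IHl, E. simpl; lra.
 - change (lsum (filter p l) f = ind (p a)*f a+lsum l (fun x => ind (p x)*f x)). rewrite IHl, E. simpl; lra.
Qed.
Lemma ind_bounds b : 0 <= ind b <= 1. Proof. destruct b; simpl; lra. Qed.
(** Every listed zero is caught by at least one disc and no disc holds more than [N], so a sum over
    zeros is dominated by a sum over integral heights. *)
Lemma zeros_by_height K (Z : list C) (w : C -> R) (v : nat -> R) N : (forall rho, In rho Z -> PK K rho) -> (forall rho, In rho Z -> 0 <= w rho) ->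
 (forall i, (i <= 2*K)%nat -> INR (length (near (ht K i) Z)) <= N) ->
 (forall i rho, (i <= 2*K)%nat -> In rho Z -> Cmod (rho-zcen (ht K i)) < 1.5 -> w rho <= v i) -> (forall i, 0 <= v i) ->
 lsum Z w <= N*lsum (seq 0 (2*K+1)) v.
Proof.
 intros HP Hw HN Hv V0. set (I := seq 0 (2*K+1)).
 via (lsum Z (fun rho => lsum I (fun i => ind (nearb (ht K i) rho)*w rho))).
 - apply lsum_le. intros rho Hr. destruct (HP rho Hr) as (i & Hi & Ci).
  assert (Ii : In i I) by (apply in_seq; lia). destruct (in_split _ _ Ii) as (l1 & l2 & E). rewrite E, lsum_app.
  change (lsum (i :: l2) ?f) with (f i+lsum l2 f). cbv beta. rewrite (proj2 (nearb_true _ _) Ci). simpl (ind true).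
  assert (P : forall l, 0 <= lsum l (fun i => ind (nearb (ht K i) rho)*w rho)) by (intro; apply lsum_nonneg; intros; apply Rmult_le_pos; auto; apply ind_bounds).
  generalize (P l1), (P l2). lra.
 - rewrite lsum_swap, <- lsum_scal. apply lsum_le. intros i Hi. apply in_seq in Hi.
  rewrite <- lsum_filter. via (lsum (near (ht K i) Z) (fun _ => v i*1)).
  + apply lsum_le. intros rho Hr. apply near_in in Hr. rewrite Rmult_1_r. apply Hv; try tauto. lia.
  + rewrite lsum_scal, lsum_length, Rmult_comm. mulr; auto. apply HN; lia.
Qed.
Lemma zdata_exists K : exists Z g g', zdata K Z g g'.
Proof.
 assert (C := archimed (Nbar K*(2*INR K+1))). set (N := Z.to_nat (up (Nbar K*(2*INR K+1)))).
 destruct (max_zero_list (half_plane (-1)) zf zf' (PK K) N) as (Z & g & g' & H1 & H2 & H3).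
 - apply copen_half_plane.
 - apply Holo_zf.
 - intros z (i & _ & Hi). apply disc_half_plane with (ht K i). unfold cdisc; lra.
 - intros Z g g' H HP. assert (B := zeros_by_height K Z (fun _ => 1) (fun _ => 1) (Nbar K) HP).
  assert (B' : lsum Z (fun _ => 1) <= Nbar K*lsum (seq 0 (2*K+1)) (fun _ => 1)).
  { apply B; intros; try lra. eapply Rle_trans; [eapply near_count; eauto|]. unfold Nbar. generalize (lt5_ht K i H0); lra. }
  rewrite !lsum_length, length_seq, plus_INR, mult_INR in B'. simpl in B'.
  apply INR_le. unfold N. rewrite (INR_IZR_INZ (Z.to_nat _)), Z2Nat.id. 2:{ apply le_IZR. generalize (pos_INR (length Z)); lra. }
  lra.
 - exists Z, g, g'. split; auto.
Qed.
Definition adist (i j : nat) : nat := ((i-j)+(j-i))%nat.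
Lemma lsum_seq_rev f i : lsum (seq 0 (S i)) (fun j => f (i-j)%nat) = lsum (seq 0 (S i)) f.
Proof.
 induction i. auto. rewrite (lsum_seq_S f 0 (S i)). change (seq 0 (S (S i))) with (0%nat :: seq 1 (S i)). rewrite <- (seq_shift (S i) 0).
 change (lsum (0%nat :: map S (seq 0 (S i))) ?h) with (h 0%nat+lsum (map S (seq 0 (S i))) h).
 unfold lsum at 1. rewrite map_map, <- IHi, Nat.sub_0_r, Rplus_comm. auto.
Qed.
Lemma lsum_adist f i N : (i < N)%nat -> (forall a b, (a <= b)%nat -> f b <= f a) -> (forall a, 0 <= f a) ->
 lsum (seq 0 N) (fun j => f (adist i j)) <= 2*lsum (seq 0 N) f.
Proof.
 intros Hi Hm H0. replace N with (S i+(N-S i))%nat at 1 by lia. rewrite seq_app, lsum_app.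
 assert (A : lsum (seq 0 (S i)) (fun j => f (adist i j)) <= lsum (seq 0 N) f).
 { rewrite (lsum_ext _ _ (fun j => f (i-j)%nat)). 2:{ intros j Hj. apply in_seq in Hj. f_equal. unfold adist; lia. }
  rewrite lsum_seq_rev. replace N with (S i+(N-S i))%nat by lia. rewrite seq_app, lsum_app. assert (0 <= lsum (seq (0+S i) (N-S i)) f) by (apply lsum_nonneg; auto). lra. }
 assert (B : forall n, lsum (seq (S i) n) (fun j => f (adist i j)) <= lsum (seq 0 n) f).
 { induction n. apply Rle_refl. rewrite !lsum_seq_S. apply Rplus_le_compat; auto. apply Hm. unfold adist; lia. }
 assert (B' := B (N-S i)%nat). assert (lsum (seq 0 (N-S i)) f <= lsum (seq 0 N) f).
 { replace N with ((N-S i)+S i)%nat at 2 by lia. rewrite seq_app, lsum_app. assert (0 <= lsum (seq (0+(N-S i)) (S i)) f) by (apply lsum_nonneg; auto). lra. }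
 change (0+S i)%nat with (S i). lra.
Qed.
Lemma harmonic_bound N : (1 <= N)%nat -> lsum (seq 0 N) (fun m => 1/(INR m+1)) <= 1+ln (INR N).
Proof. induction N as [|N IH]; [lia|]. destruct N as [|N]. unfold lsum; simpl. rewrite ln_1; lra.
 rewrite lsum_seq_S. specialize (IH ltac:(lia)). change (0+S N)%nat with (S N). rewrite (S_INR (S N)). set (y := INR (S N)) in *.
 assert (Y : 1 <= y) by apply INR_S_ge_1.
 assert (L : 1/(y+1) <= ln (y+1)-ln y).
 { assert (E : ln (y/(y+1)) <= y/(y+1)-1). { assert (X := exp_ineq1_le (ln (y/(y+1)))). rewrite exp_ln in X by pos. lra. }
  unfold Rdiv in E at 1. rewrite ln_mult, ln_Rinv in E by pos. replace (y/(y+1)-1) with (- (1/(y+1))) in E by fld. lra. }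
 lra.
Qed.
(** Bounds sums over zeros of weights 20/(distance in height + 1): [Nbar K] zeros per height, times
    20 for the weight and 2 for the two directions, times a harmonic sum. Altogether of size log^2
    K. *)
Definition hK (K : nat) : R := Nbar K*(40*(1+ln (INR (2*K+1)))).
Lemma Nbar_pos K : 0 <= Nbar K. Proof. unfold Nbar. generalize (lt5_ge (INR K)); lra. Qed.
Lemma ht_diff K i j : Rabs (ht K i-ht K j) = INR (adist i j).
Proof.
 unfold ht, adist. destruct (le_lt_dec i j).
 - replace (i-j+(j-i))%nat with (j-i)%nat by lia. rewrite minus_INR by auto. apply le_INR in l. rewrite Rabs_left1; lra.
 - replace (i-j+(j-i))%nat with (i-j)%nat by lia. rewrite minus_INR by lia. apply lt_INR in l. rewrite Rabs_right; lra.
Qed.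
Lemma zdata_count K Z g g' i : zdata K Z g g' -> (i <= 2*K)%nat -> INR (length (near (ht K i) Z)) <= Nbar K.
Proof. intros H Hi. eapply Rle_trans; [eapply near_count; apply H|]. unfold Nbar. generalize (lt5_ht K i Hi); lra. Qed.
Lemma zeros_harmonic K Z g g' i w : zdata K Z g g' -> (i <= 2*K)%nat -> (forall rho, In rho Z -> 0 <= w rho) ->
 (forall j rho, (j <= 2*K)%nat -> In rho Z -> Cmod (rho-zcen (ht K j)) < 1.5 -> w rho <= 20/(INR (adist i j)+1)) -> lsum Z w <= hK K.
Proof.
 intros H Hi W0 HW. eapply Rle_trans.
 - apply (zeros_by_height K Z w (fun j => 20/(INR (adist i j)+1)) (Nbar K)); auto. apply H. intros; eapply zdata_count; eauto.
  intros j. left; apply Rdiv_lt_0_compat; [lra|]. generalize (pos_INR (adist i j)); lra.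
 - mull; [apply Nbar_pos|].
  rewrite (lsum_ext _ _ (fun j => 20*(1/(INR (adist i j)+1)))) by (intros; lra). rewrite lsum_scal.
  assert (A := lsum_adist (fun m => 1/(INR m+1)) i (2*K+1) ltac:(lia)).
  assert (B := harmonic_bound (2*K+1) ltac:(lia)).
  assert (A' : lsum (seq 0 (2*K+1)) (fun j => 1/(INR (adist i j)+1)) <= 2*lsum (seq 0 (2*K+1)) (fun m => 1/(INR m+1))).
  { apply A. intros a b Hab. apply le_INR in Hab. generalize (pos_INR a); intro. unfold Rdiv. rewrite !Rmult_1_l. apply Rinv_le_contravar; lra. left; apply Rdiv_lt_0_compat; [lra|]. generalize (pos_INR a); lra. }
  lra.
Qed.
Lemma far_sum_bound K Z g g' i s : zdata K Z g g' -> (i <= 2*K)%nat -> Cmod (s-zcen (ht K i)) <= 1.3 -> Rabs (Im s-ht K i) <= 1/2 ->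
 lsum (far (ht K i) Z) (fun rho => / Cmod (s-rho)) <= hK K.
Proof.
 intros H Hi Hs Hv. unfold far. rewrite lsum_filter.
 assert (FD : forall rho, nearb (ht K i) rho = false -> 0.2 <= Cmod (s-rho)).
 { intros rho E. unfold nearb in E. destruct (Rlt_dec _ _) as [|N]; [lra|]. assert (X := Cmod_minus_le rho s (zcen (ht K i))). rewrite (Cmod_minus_sym rho s) in X. lra. }
 eapply zeros_harmonic; eauto.
 - intros rho Hr. destruct (nearb (ht K i) rho) eqn:E; simpl. lra. rewrite Rmult_1_l. left; apply Rinv_0_lt_compat. specialize (FD rho E). lra.
 - intros j rho Hj Hr Hn. assert (D0 := pos_INR (adist i j)). assert (D1 := ht_diff K i j).
  destruct (nearb (ht K i) rho) eqn:E; simpl. rewrite Rmult_0_l. pos.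
  rewrite Rmult_1_l. specialize (FD rho E).
  (* For heights at most 3 apart the separation 0.2 = 1.5 - 1.3 of a far zero is enough; otherwise
     Im s and Im rho differ by at least the index distance minus 2. *)
  assert (G : (INR (adist i j)+1)/20 <= Cmod (s-rho)).
  { destruct (Rle_dec (INR (adist i j)) 3); [lra|]. assert (X := im_le_Cmod (s-rho)). rewrite Im_Cminus in X.
   assert (Y := Im_in_disc rho (ht K j) 1.5 ltac:(lra)).
   assert (INR (adist i j) <= Rabs (Im s-Im rho)+2). { rewrite <- D1. apply Rabs_le_between in Hv. unfold Rabs. destruct (Rcase_abs (ht K i-ht K j)), (Rcase_abs (Im s-Im rho)); lra. }
   lra. }
  replace (20/(INR (adist i j)+1)) with (/ ((INR (adist i j)+1)/20)) by fld. apply Rinv_le_contravar; lra.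
Qed.
(** Landau's lemma bounds the logarithmic derivative with the near factors removed; removing the far
    factors as well costs their sum, hence [hK] and a second logarithm. *)
Lemma log_deriv_bound K Z g g' i s : zdata K Z g g' -> (i <= 2*K)%nat -> Cmod (s-zcen (ht K i)) <= 1.3 -> Rabs (Im s-ht K i) <= 1/2 ->
 Cmod (g' s/g s) <= 1000*lt5 (INR K)+hK K.
Proof.
 intros H Hi Hs Hv. assert (L := Landau_zf Z g g' (ht K i) s (proj1 H)).
 assert (NZ : forall z, Cmod (z-zcen (ht K i)) < 1.5 -> g z <> 0) by (intros z Hz; apply H; exists i; auto). specialize (L NZ Hs).
 assert (F : Cmod (clsum (far (ht K i) Z) (fun rho => / (s-rho))%C) <= hK K).
 { eapply Rle_trans; [|apply (far_sum_bound K Z g g' i s); pos]. apply clsum_Cmod. intros rho Hr. rewrite Cmod_inv; [lra|].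
  intro E. apply Cminus_eq_0 in E. subst rho. apply filter_In in Hr. destruct Hr as (_ & Hr). assert (Hs' : Cmod (s-zcen (ht K i)) < 1.5) by lra. rewrite (proj2 (nearb_true _ _) Hs') in Hr. lra. }
 assert (X := Cmod_sub_le (g' s/g s+clsum (far (ht K i) Z) (fun rho => / (s-rho)))%C (clsum (far (ht K i) Z) (fun rho => / (s-rho))%C)).
 replace (g' s/g s+clsum (far (ht K i) Z) (fun rho => / (s-rho))-clsum (far (ht K i) Z) (fun rho => / (s-rho)))%C with (g' s/g s)%C in X by ring.
 assert (Y := lt5_ht K i Hi). lra.
Qed.
(** The far zeros stay inside the cofactor that Landau's lemma controls, so the error is a single
    logarithm taken at the local height. *)
Lemma FF_near K Z g g' i s : zdata K Z g g' -> (i <= 2*K)%nat -> Cmod (s-zcen (ht K i)) <= 1.3 -> zf s <> 0 ->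
 Cmod (FF s+clsum (near (ht K i) Z) (fun rho => / (s-rho)))%C <= 1000*lt5 (ht K i).
Proof.
 intros H Hi Hs N. set (t := ht K i) in *. destruct H as (Hd & HP & HN).
 assert (NZ : forall z, Cmod (z-zcen t) < 1.5 -> g z <> 0) by (intros z Hz; apply HN; exists i; auto).
 assert (L := Landau_zf Z g g' t s Hd NZ Hs).
 assert (Hh : half_plane (-1) s) by (apply (disc_half_plane t); unfold cdisc; lra).
 assert (RN : forall rho, In rho Z -> rho <> s). { intros rho Hr ->. apply N. rewrite (proj2 Hd) by auto. rewrite Cprod_root by auto. ring. }
 assert (E : zf' s = (Cprod' Z s*g s+Cprod Z s*g' s)%C).
 { apply (cderiv_unique zf s). apply Holo_zf; pos. assert (X := Holo_mult _ _ _ _ _ (Holo_Cprod (half_plane (-1)) Z) (proj1 Hd)).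
  apply Holo_ext with (g := zf) in X. apply X; pos. apply copen_half_plane. intros z Hz. symmetry. apply Hd; pos. }
 assert (G0 : g s <> 0) by cont. assert (P0 : Cprod Z s <> 0) by (apply Cprod_neq_0; pos).
 assert (S : (clsum Z (fun rho => / (s-rho)) = clsum (near t Z) (fun rho => / (s-rho))+clsum (far t Z) (fun rho => / (s-rho)))%C).
 { clear. induction Z as [|a Z IH]. unfold clsum; simpl; ring. simpl. unfold clsum in *. destruct (nearb t a); simpl; rewrite IH; ring. }
 rewrite <- Cmod_opp. trr L. right. f_equal. unfold FF. rewrite E, (proj2 Hd s Hh), Cprod'_log, S by auto. field. auto.
Qed.

(** * Zero-free regions *)

(** In the part Re s <= 1 the term (s+1)/2 dominates: the remaining series is at most |s-1| |s|
    17/56 times |s+1|, and this factor stays below 1/2 because |s-1|^2 <= 1.94 and |s|^2 <= 1.25. *)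
Lemma zf_low_neq_0 s : -0.3 <= Re s -> Rabs (Im s) <= 1/2 -> zf s <> 0.
Proof.
 intros H1 H2 E. destruct (Rle_dec (Re s) 1) as [L|L]; [|apply (zf_neq_0 s); pos].
 assert (B := zf_sub_bound s ltac:(lra)). rewrite E in B. replace (0-(s+1)/2)%C with (- ((s+1)/2))%C in B by ring.
 rewrite Cmod_opp, Cmod_div, (Cmod_RtoC_pos 2) in B by (cnz || lra).
 assert (P : 0 < Cmod (s+1)). { eapply Rlt_le_trans; [|apply re_le_Cmod]. rewrite Re_Cplus. simpl (Re 1). rewrite Rabs_right; lra. }
 set (u := Cmod (s-1)) in *. set (v := Cmod s) in *.
 assert (I1 : 1+1/(Re s+1) <= 17/7). { assert (1/(Re s+1) <= 1/0.7). mull. apply Rinv_le_contravar; lra. lra. }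
 assert (I0 : 0 <= 1/(Re s+1)) by pos.
 assert (K : 4 <= u*v*(17/7)).
 { apply (Rmult_le_reg_r (Cmod (s+1)/8)); [lra|]. nra. }
 assert (U : u*u <= 1.94). { unfold u. rewrite Cmod_sq, Re_Cminus, Im_Cminus. simpl (Re 1). simpl (Im 1). apply Rabs_le_between in H2. nra. }
 assert (V : v*v <= 1.25). { unfold v. rewrite Cmod_sq. apply Rabs_le_between in H2. nra. }
 nra.
Qed.
Lemma zf_zero_Re_le_1 s : zf s = 0 -> Re s <= 1.
Proof. intro E. destruct (Rle_dec (Re s) 1); auto. exfalso. apply (zf_neq_0 s); pos. Qed.
Lemma nearest_height K y : Rabs y <= INR K -> exists i, (i <= 2*K)%nat /\ Rabs (y-ht K i) <= 1/2.
Proof.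
 intro H. apply Rabs_le_between in H. assert (A := archimed (y+INR K-1/2)). set (u := up (y+INR K-1/2)) in *.
 assert (U0 : (0 <= u)%Z). { apply le_IZR. assert (-1 < IZR u) by lra. apply lt_IZR in H0. apply IZR_le. lia. }
 assert (E : INR (Z.to_nat u) = IZR u) by (rewrite INR_IZR_INZ, Z2Nat.id; pos).
 exists (Z.to_nat u). split.
 - apply INR_le. rewrite E, mult_INR. simpl.
  assert (IZR u < 2*INR K+1) by lra. replace (2*INR K+1) with (IZR (2*Z.of_nat K+1)) in H0 by (rewrite plus_IZR, mult_IZR, <- INR_IZR_INZ; lra).
  apply lt_IZR in H0. replace ((1+1)*INR K) with (IZR (2*Z.of_nat K)) by (rewrite mult_IZR, <- INR_IZR_INZ; lra). apply IZR_le. lia.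
 - unfold ht. apply Rabs_le_between. lra.
Qed.
(** The radius is fixed by the corners: 1.2^2 + 0.5^2 = 1.3^2. *)
Lemma window_disc s t : 0 <= Re s <= 2.4 -> Rabs (Im s-t) <= 1/2 -> Cmod (s-zcen t) <= 1.3.
Proof.
 intros H1 H2. apply Rsqr_incr_0; try pos. unfold Rsqr. rewrite Cmod_sq, Re_Cminus, Im_Cminus. simpl (Re (zcen t)). simpl (Im (zcen t)).
 apply Rabs_le_between in H2. nra.
Qed.
Lemma zdata_zero_in K Z g g' rho : zdata K Z g g' -> PK K rho -> zf rho = 0 -> In rho Z.
Proof.
 intros (Hd & HP & HN) P E. apply NNPP. intro N. assert (half_plane (-1) rho). { destruct P as (i & _ & Hi). apply disc_half_plane with (ht K i). unfold cdisc; lra. }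
 rewrite (proj2 Hd) in E by auto. apply Cmult_eq_0 in E. destruct E as [E|E]; [|apply (HN rho); pos].
 revert E. apply Cprod_neq_0. intros r Hr ->. auto.
Qed.
Lemma zdata_in_zero K Z g g' rho : zdata K Z g g' -> In rho Z -> zf rho = 0 /\ -0.3 < Re rho <= 1 /\ 1/2 < Rabs (Im rho).
Proof.
 intros (Hd & HP & HN) H. destruct (HP rho H) as (i & Hi & Ci).
 assert (E : zf rho = 0). { rewrite (proj2 Hd) by (apply disc_half_plane with (ht K i); unfold cdisc; lra). rewrite Cprod_root by auto. ring. }
 assert (X := re_le_Cmod (rho-zcen (ht K i))). rewrite Re_Cminus in X. simpl (Re (zcen _)) in X. assert (X' := Rle_lt_trans _ _ _ X Ci). apply Rabs_lt_between in X'.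
 split; auto. split. split; [lra|apply zf_zero_Re_le_1; pos]. destruct (Rle_dec (Rabs (Im rho)) (1/2)); [|lra]. exfalso. apply (zf_low_neq_0 rho); pos.
Qed.
Lemma Re_inv_pos z : 0 < Re z -> 0 < Re (/ z).
Proof. intro H. apply Rdiv_lt_0_compat. exact H. unfold Re in H. nra. Qed.
Lemma Re_clsum {A} (l : list A) f : Re (clsum l f) = lsum l (fun x => Re (f x)).
Proof. induction l; unfold clsum, lsum in *; simpl; auto. unfold Re in *. nra. Qed.
(* For Re s > 1 the terms Re 1/(s - rho) are positive, so any one of them may be kept and the rest dropped. *)
Lemma Re_FF_upper K Z g g' s i : zdata K Z g g' -> (i <= 2*K)%nat -> Rabs (Im s-ht K i) <= 1/2 -> 1 < Re s <= 2 ->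
 Re (FF s) <= 1000*lt5 (ht K i) /\
 (forall rho, zf rho = 0 -> 0 <= Re rho -> Rabs (Im rho-ht K i) <= 1/2 -> Re (FF s) <= 1000*lt5 (ht K i)-Re (/ (s-rho))).
Proof.
 intros H Hi Hs1 Hs2. assert (N : zf s <> 0) by (apply zf_neq_0; lra). assert (W : Cmod (s-zcen (ht K i)) <= 1.3) by (apply window_disc; lra). assert (B := FF_near K Z g g' i s H Hi W N).
 set (t := ht K i) in *. assert (X := re_le_Cmod (FF s+clsum (near t Z) (fun rho => / (s-rho)))%C). rewrite Re_Cplus, Re_clsum in X.
 assert (PZ : forall rho, In rho (near t Z) -> 0 <= Re (/ (s-rho))).
 { intros rho Hr. apply near_in in Hr. destruct (zdata_in_zero K Z g g' rho H (proj1 Hr)) as (_ & R1 & _). left. apply Re_inv_pos. rewrite Re_Cminus; lra. }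
 assert (X' := Rle_trans _ _ _ X B). apply Rabs_le_between in X'. split.
 - assert (0 <= lsum (near t Z) (fun rho => Re (/ (s-rho)))) by (apply lsum_nonneg; pos). lra.
 - intros rho Z0 R0 I0. assert (Rl := zf_zero_Re_le_1 rho Z0).
  assert (D := window_disc rho t ltac:(lra) I0).
  assert (In rho (near t Z)). { apply filter_In. split. apply (zdata_zero_in K Z g g'); auto. exists i. split; auto. fold t; lra. apply nearb_true; lra. }
  destruct (in_split _ _ H0) as (l1 & l2 & E). rewrite E in X', PZ. rewrite lsum_app in X'. change (lsum (rho :: l2) ?f) with (f rho+lsum l2 f) in X'.
  assert (P1 : 0 <= lsum l1 (fun rho => Re (/ (s-rho)))) by (apply lsum_nonneg; intros; apply PZ, in_or_app; auto).
  assert (P2 : 0 <= lsum l2 (fun rho => Re (/ (s-rho)))) by (apply lsum_nonneg; intros; apply PZ, in_or_app; right; right; pos). lra.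
Qed.
(** The 3-4-1 inequality at abscissa 1 + d gives 4/(d+1-b) <= 3/d + A0. With d = 1/(2 A0) the right
    side is 7 A0, hence 1 - b >= 4/(7 A0) - 1/(2 A0) = 1/(14 A0), and 14 times 17000 is 238000. *)
Lemma zero_free_region rho : zf rho = 0 -> 0 <= Re rho -> Re rho <= 1-1/(238000*lt5 (Im rho)).
Proof.
 intros Z0 R0. assert (R1 := zf_zero_Re_le_1 rho Z0). set (b := Re rho) in *. set (y := Im rho) in *. set (l := lt5 y). assert (l0 : 1.6 <= l) by apply lt5_ge.
 assert (Y : 1/2 < Rabs y). { destruct (Rle_dec (Rabs y) (1/2)); [|lra]. exfalso. apply (zf_low_neq_0 rho); auto. fold b; lra. }
 destruct (archimed (2*Rabs y)) as (A & _). set (K := Z.to_nat (up (2*Rabs y))).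
 assert (KK : 2*Rabs y <= INR K). { unfold K. rewrite INR_IZR_INZ, Z2Nat.id. lra. apply le_IZR. lra. }
 destruct (zdata_exists K) as (Z & g & g' & H).
 destruct (nearest_height K 0 ltac:(rewrite Rabs_R0; lra)) as (i0 & I0 & J0).
 destruct (nearest_height K y ltac:(lra)) as (i1 & I1 & J1).
 destruct (nearest_height K (2*y) ltac:(rewrite Rabs_mult, (Rabs_right 2) by lra; lra)) as (i2 & I2 & J2).
 assert (HL : forall t u, Rabs (u-t) <= 1/2 -> Rabs u <= 2*Rabs y -> lt5 t <= 2*l).
 { intros t u H1 H2. unfold lt5, l, lt5. replace (2*ln (Rabs y+5)) with (ln ((Rabs y+5)*(Rabs y+5))) by (rewrite ln_mult by lra; lra).
  apply ln_le_mono. generalize (Rabs_pos t); lra. assert (Rabs t <= Rabs u+1/2). { apply Rabs_le_between in H1. unfold Rabs at 1. destruct (Rcase_abs t); generalize (Rle_abs u), (Rle_abs (-u)); rewrite Rabs_Ropp; lra. } nra. }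
 assert (L0 := HL _ _ J0 ltac:(rewrite Rabs_R0; lra)). assert (L1 := HL _ _ J1 ltac:(lra)). assert (L2 := HL _ _ J2 ltac:(rewrite Rabs_mult, (Rabs_right 2) by lra; lra)).
 (* The eight bounds 1000 lt5 with lt5 <= 2 l give 16000 l; the terms 1/(s-1) at heights y and 2y
    contribute at most 4*2 + 2 = 10, which is below 1000 l. *)
 set (A0 := 17000*l). set (d := 1/(2*A0)). assert (A00 : 0 < A0) by (unfold A0; lra).
 assert (dp : 0 < d) by (apply Rdiv_lt_0_compat; lra). assert (d1 : d <= 1). { unfold d. apply (Rmult_le_reg_r (2*A0)); [lra|]. replace (1/(2*A0)*(2*A0)) with 1 by fld. unfold A0; lra. }
 set (s0 := 1+d).
 assert (T := three_four_one s0 y ltac:(unfold s0; lra)).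
 assert (D0 : forall t, Re (Dl (s0, t)) = Re (FF (s0, t))+Re (/ ((s0, t)-1))).
 { intro t. rewrite FF_Dl by (simpl; unfold s0; lra). rewrite Re_Cminus. unfold Cdiv. rewrite Cmult_1_l. ring. }
 change (RtoC s0) with ((s0, 0) : C) in T. rewrite !D0 in T.
 assert (F0 := proj1 (Re_FF_upper K Z g g' (s0, 0) i0 H I0 J0 ltac:(simpl; unfold s0; lra))).
 assert (F1 := proj2 (Re_FF_upper K Z g g' (s0, y) i1 H I1 J1 ltac:(simpl; unfold s0; lra)) rho Z0 R0 J1).
 assert (F2 := proj1 (Re_FF_upper K Z g g' (s0, 2*y) i2 H I2 J2 ltac:(simpl; unfold s0; lra))).
 assert (G1 : forall t, 1/2 <= Rabs t -> Re (/ ((s0, t)-1)) <= 2).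
 { intros t Ht. tr Rle_abs. tr re_le_Cmod.
  assert (X := im_le_Cmod ((s0, t)-1)). rewrite Im_Cminus in X. simpl (Im _) in X. rewrite Rminus_0_r in X.
  rewrite Cmod_inv by (apply half_plane_neq_1; simpl; unfold s0; lra). replace 2 with (/ (1/2)) by field. apply Rinv_le_contravar; lra. }
 assert (G0 : Re (/ ((s0, 0)-1)) = 1/d). { simpl. unfold s0. fld. }
 assert (G3 : Re (/ ((s0, y)-rho)) = 1/(d+(1-b))). { replace ((s0, y)-rho)%C with (RtoC (d+(1-b))). rewrite <- RtoC_inv by lra. simpl. lra.
  unfold y, b, s0. destruct rho. apply C_eq; simpl; lra. } assert (B1 := G1 y ltac:(lra)). assert (B2 := G1 (2*y) ltac:(rewrite Rabs_mult, (Rabs_right 2) by lra; lra)).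
 assert (D2 : 1/d = 2*A0) by (unfold d; fld).
 assert (M : 4*(1/(d+(1-b))) <= 7*A0) by (unfold A0 in *; lra).
 assert (W : 4 <= 7*A0*(d+(1-b))). { apply (Rmult_le_compat_r (d+(1-b))) in M; [|lra]. replace (4*(1/(d+(1-b)))*(d+(1-b))) with 4 in M by fld. lra. }
 assert (AD : A0*d = 1/2) by (unfold d; fld).
 assert (V : 1/14 <= A0*(1-b)) by lra.
 assert (1/(238000*l) <= 1-b); [|lra]. apply (Rmult_le_reg_r (238000*l)); [lra|]. replace (1/(238000*l)*(238000*l)) with 1 by fld. unfold A0 in V. lra.
Qed.

(** * Rectangular contours and Perron's formula *)

(** Integration in [t], without the factor i of ds; this is where the factors [Ci] in Cauchy's
    theorem for rectangles come from. *)
Definition vline (H : C -> C) (a T : R) : C := CInt (fun t => H (a, t)) (- T) T.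
Definition hline (H : C -> C) (t a b : R) : C := CInt (fun x => H (x, t)) a b.
Definition orect (a b T e : R) (z : C) : Prop := a-e < Re z < b+e /\ - T-e < Im z < T+e.

Lemma rderiv_vertical f l a t : cderiv f (a, t) l -> rderiv (fun t => f (a, t)) t (l*Ci).
Proof.
 intro H. apply rderiv_ext with (fun u => f ((a, 0)+Ci*RtoC u)%C). intro; f_equal; apply C_eq; simpl; lra.
 apply (rderiv_comp f (fun u => (a, 0)+Ci*RtoC u)%C). apply rderiv_affine. replace ((a, 0)+Ci*t)%C with ((a, t) : C) by (apply C_eq; simpl; lra). auto.
Qed.
Lemma rderiv_horizontal f l a t : cderiv f (a, t) l -> rderiv (fun a => f (a, t)) a l.
Proof.
 intro H. apply rderiv_ext with (fun u => f ((0, t)+1*RtoC u)%C). intro; f_equal; apply C_eq; simpl; lra.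
 replace l with (l*1)%C by ring.
 apply (rderiv_comp f (fun u => (0, t)+1*RtoC u)%C). apply rderiv_affine. replace ((0, t)+1*a)%C with ((a, t) : C) by (apply C_eq; simpl; lra). auto.
Qed.
Lemma rcont_vertical f a t : ccont f (a, t) -> rcont (fun t => f (a, t)) t.
Proof.
 intro H. apply (rcont_comp f (fun t => (a, t))). auto. cont.
Qed.
Lemma rcont_horizontal f a t : ccont f (a, t) -> rcont (fun a => f (a, t)) a.
Proof.
 intro H. apply (rcont_comp f (fun a => (a, t))). auto. cont.
Qed.
Lemma contin_hline H H' a b T e t : 0 < e -> Holo (orect a b T e) H H' -> - T <= t <= T -> contin (fun x => H (x, t)) a b.
Proof. intros He HH Ht x Hx. apply rcont_horizontal. eapply Holo_ccont; eauto. unfold orect; simpl; lra. Qed.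

(** The vertical integral is differentiated in its abscissa: the derivative is the integral of a
    derivative in [t], hence a difference of values on the horizontal sides, which is then
    integrated back. *)
Lemma Cauchy_rectangle H H' a b T e : a <= b -> 0 <= T -> 0 < e -> Holo (orect a b T e) H H' ->
 (vline H b T-vline H a T = - Ci*(hline H T a b-hline H (- T) a b))%C.
Proof.
 intros Hab HT He HH. symmetry. unfold hline. rewrite <- CInt_minus; auto.
 2: eapply contin_hline; eauto; lra. 2: eapply contin_hline; eauto; lra.
 rewrite <- CInt_mult_const; auto. 2:{ intros x Hx. apply rcont_minus; eapply contin_hline; eauto; lra. }
 apply (CInt_FTC (fun x => vline H x T)); auto.
 2:{ intros x Hx. apply rcont_mult; [cont|]. apply rcont_minus; eapply contin_hline; eauto; lra. }
 intros x Hx. assert (In : forall m t, Rabs (m-x) < e -> - T-e < t < T+e -> orect a b T e (m, t)).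
 { intros m t Hm Ht. apply Rabs_lt_between in Hm. unfold orect; simpl; lra. }
 assert (X0 : Rabs (x-x) < e) by (rewrite Rminus_diag, Rabs_R0; lra).
 replace (- Ci*(H (x, T)-H (x, (- T)%R)))%C with (CInt (fun t => H' (x, t)) (- T) T).
 - apply (CInt_param (fun x t => H (x, t)) (fun x t => H' (x, t)) (- T) T x e e); try lra.
  + intros m t Hm Ht. apply rderiv_horizontal, HH; auto.
  + intros t Ht. apply ccont_ext with (H'). intros (u, v); cont. apply HH; auto.
  + intros m Hm t Ht. apply rcont_vertical. eapply Holo_ccont; eauto. cont.
 - assert (E := CInt_FTC (fun t => H (x, t)) (fun t => H' (x, t)*Ci)%C (- T) T ltac:(lra)).
  rewrite <- E.
  + rewrite (CInt_ext (fun t => H' (x, t)*Ci)%C (fun t => Ci*H' (x, t))%C) by (try lra; intros; ring). rewrite CInt_mult_const; try lra.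
   * rewrite Cmult_assoc. replace (- Ci*Ci)%C with (RtoC 1) by (apply C_eq; simpl; lra). ring.
   * intros t Ht. apply rcont_vertical. apply HH, In; lra.
  + intros t Ht. apply rderiv_vertical, HH, In; lra.
  + intros t Ht. apply rcont_mult; [|cont]. apply rcont_vertical. apply HH, In; lra.
Qed.

Lemma hline_inv_pole (p : C) t a b : a <= b -> t <> Im p ->
 hline (fun z => / (z-p))%C t a b = (/ 2*ln ((b-Re p)^2+(t-Im p)^2) - / 2*ln ((a-Re p)^2+(t-Im p)^2),
  - (atan ((b-Re p)/(t-Im p))-atan ((a-Re p)/(t-Im p)))).
Proof.
 intros Hab Ht. set (v := t-Im p). assert (v0 : v <> 0) by (unfold v; lra). set (al := Re p).
 assert (vv : 0 < v^2) by (rewrite <- Rsqr_pow2; apply Rsqr_pos_lt; lra).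
 assert (N : forall x, ((x, t)-p <> 0)%C). { intros x E. apply (f_equal Im) in E. auto. }
 unfold hline. rewrite (CInt_FTC (fun x => (/ 2*ln ((x-al)^2+v^2), - atan ((x-al)/v)))); auto.
 - apply C_eq; simpl; lra.
 - intros x Hx. assert (Q : 0 < (x-al)^2+v^2) by (generalize (pow2_ge_0 (x-al)); lra).
  replace (/ ((x, t)-p))%C with ((x-al)/((x-al)^2+v^2), - v/((x-al)^2+v^2)).
  2:{ auto. }
  apply rderiv_components; simpl.
  + auto_derive. simpl in Q; lra. fld.
  + auto_derive; auto. fld.
 - intros x Hx. cont.
Qed.
Lemma vline_inv_pole (p : C) T a : 0 <= T -> a <> Re p ->
 vline (fun z => / (z-p))%C a T = (atan ((T-Im p)/(a-Re p))-atan ((- T-Im p)/(a-Re p)),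
  - (/ 2*ln ((a-Re p)^2+(T-Im p)^2) - / 2*ln ((a-Re p)^2+(- T-Im p)^2))).
Proof.
 intros HT Ha. set (v := a-Re p). assert (v0 : v <> 0) by (unfold v; lra). set (al := Im p).
 assert (vv : 0 < v^2) by (rewrite <- Rsqr_pow2; apply Rsqr_pos_lt; lra).
 assert (N : forall x, ((a, x)-p <> 0)%C). { intros x E. apply (f_equal Re) in E. auto. }
 unfold vline. rewrite (CInt_FTC (fun x => (atan ((x-al)/v), - (/ 2*ln (v^2+(x-al)^2))))); try lra.
 - apply C_eq; simpl; lra.
 - intros x Hx. assert (Q : 0 < v^2+(x-al)^2) by (generalize (pow2_ge_0 (x-al)); lra).
  replace (/ ((a, x)-p))%C with (v/(v^2+(x-al)^2), - (x-al)/(v^2+(x-al)^2)).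
  2:{ auto. }
  apply rderiv_components; simpl.
  + auto_derive; auto. fld.
  + auto_derive. simpl in Q; lra. fld.
 - intros x Hx. cont.
Qed.
Lemma atan_pair x y : 0 < x -> 0 < y -> atan (x/y)+atan (y/x) = PI/2.
Proof. intros Hx Hy. replace (y/x) with (/ (x/y)) by fld. rewrite atan_inv by pos. ring. Qed.
(* The residue of 1/(z - p), written as the deficit in Cauchy's theorem for the rectangle. *)
Lemma rectangle_residue (p : C) a b T : a < Re p < b -> - T < Im p < T ->
 (vline (fun z => / (z-p))%C b T-vline (fun z => / (z-p))%C a T
  + Ci*(hline (fun z => / (z-p))%C T a b-hline (fun z => / (z-p))%C (- T) a b))%C = RtoC (2*PI).
Proof.
 intros H1 H2. rewrite !hline_inv_pole, !vline_inv_pole by lra. set (B := b-Re p). set (A := Re p-a). set (u := T-Im p). set (v := T+Im p).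
 assert (B0 : 0 < B) by (unfold B; lra). assert (A0 : 0 < A) by (unfold A; lra). assert (u0 : 0 < u) by (unfold u; lra). assert (v0 : 0 < v) by (unfold v; lra).
 replace (a-Re p) with (- A) by (unfold A; lra). replace (- T-Im p) with (- v) by (unfold v; lra).
 replace (- v/B) with (- (v/B)) by lra. replace (u / - A) with (- (u/A)) by fld. replace (- v / - A) with (v/A) by fld.
 replace (- A/u) with (- (A/u)) by lra. replace (B / - v) with (- (B/v)) by fld. replace (- A / - v) with (A/v) by fld.
 rewrite !atan_opp. assert (P1 := atan_pair u B u0 B0). assert (P2 := atan_pair v B v0 B0). assert (P3 := atan_pair u A u0 A0). assert (P4 := atan_pair v A v0 A0).
 apply C_eq; simpl Re; simpl Im.
 - lra.
 - lra.
Qed.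

Definition on_rect (a b T : R) (z : C) : Prop := ((Re z = a \/ Re z = b) /\ - T <= Im z <= T) \/ (a <= Re z <= b /\ (Im z = T \/ Im z = - T)).
Definition rect (f : C -> C) (a b T : R) : C := (vline f b T-vline f a T+Ci*(hline f T a b-hline f (- T) a b))%C.
Definition crect (f : C -> C) (a b T : R) : Prop := forall z, on_rect a b T z -> ccont f z.
Lemma on_rect_v1 a b T t : - T <= t <= T -> on_rect a b T (a, t). Proof. left; auto. Qed.
Lemma on_rect_v2 a b T t : - T <= t <= T -> on_rect a b T (b, t). Proof. left; auto. Qed.
Lemma on_rect_h1 a b T x : a <= x <= b -> on_rect a b T (x, T). Proof. right; auto. Qed.
Lemma on_rect_h2 a b T x : a <= x <= b -> on_rect a b T (x, - T). Proof. right; auto. Qed.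
Lemma rect_ext f g a b T : a <= b -> 0 <= T -> (forall z, on_rect a b T z -> f z = g z) -> rect f a b T = rect g a b T.
Proof.
 intros Hab HT E. unfold rect, vline, hline.
 rewrite (CInt_ext (fun t => f (b, t)) (fun t => g (b, t))), (CInt_ext (fun t => f (a, t)) (fun t => g (a, t))),
  (CInt_ext (fun x => f (x, T)) (fun x => g (x, T))), (CInt_ext (fun x => f (x, - T)) (fun x => g (x, - T))); try lra; auto using on_rect_v1, on_rect_v2, on_rect_h1, on_rect_h2.
Qed.
Lemma rect_plus f g a b T : a <= b -> 0 <= T -> crect f a b T -> crect g a b T -> rect (fun z => f z+g z)%C a b T = (rect f a b T+rect g a b T)%C.
Proof.
 intros Hab HT Hf Hg. unfold rect, vline, hline.
 rewrite !CInt_plus; try lra; try ring; intros x Hx; (apply rcont_vertical || apply rcont_horizontal);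
 auto using on_rect_v1, on_rect_v2, on_rect_h1, on_rect_h2.
Qed.
Lemma rect_mult_const c f a b T : a <= b -> 0 <= T -> crect f a b T -> rect (fun z => c*f z)%C a b T = (c*rect f a b T)%C.
Proof.
 intros Hab HT Hf. unfold rect, vline, hline.
 rewrite !CInt_mult_const; try lra; try ring; intros x Hx; (apply rcont_vertical || apply rcont_horizontal);
 auto using on_rect_v1, on_rect_v2, on_rect_h1, on_rect_h2.
Qed.
Lemma rect_Holo f f' a b T e : a <= b -> 0 <= T -> 0 < e -> Holo (orect a b T e) f f' -> rect f a b T = 0.
Proof.
 intros. unfold rect. rewrite (Cauchy_rectangle f f' a b T e); auto. ring.
Qed.
Lemma rect_pole (p : C) a b T : a < Re p < b -> - T < Im p < T -> rect (fun z => / (z-p))%C a b T = RtoC (2*PI) /\ crect (fun z => / (z-p))%C a b T.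
Proof.
 intros H1 H2. split. apply rectangle_residue; lra. intros z Hz. apply ccont_inv; [cont|].
 intro E. apply Cminus_eq_0 in E. subst z. unfold on_rect in Hz. lra.
Qed.

(** * Perron's formula for a kernel with two simple poles *)

(** Two simple poles make the kernel decay quadratically, so all integrals converge absolutely. The
    pairs of poles used are (0, -1) for a term of the Dirichlet series and (p, 0), (p, -1) for a
    pole p of the integrand. *)
Definition pker (p q : C) (y : R) (s : C) : C := (Cexp (s*RtoC y)/((s-p)*(s-q)))%C.
Lemma Holo_Cexp_lin D y : Holo D (fun s => Cexp (s*RtoC y)) (fun s => RtoC y*Cexp (s*RtoC y))%C.
Proof.
 intros s _. split.
 - assert (K := cderiv_comp Cexp (fun s => s*RtoC y)%C s (RtoC y) (Cexp (s*RtoC y))). rewrite Cmult_comm. apply K.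
  assert (K2 := cderiv_mult_const (RtoC y) _ _ _ (cderiv_id s)). rewrite Cmult_1_r in K2. apply cderiv_ext with (2 := K2). intro; ring. apply cderiv_Cexp.
 - apply ccont_mult; [cont|]. apply (ccont_comp Cexp (fun s => s*RtoC y)%C). cont. eapply cderiv_ccont, cderiv_Cexp.
Qed.
Lemma Holo_pker D p q y : (forall z, D z -> z <> p /\ z <> q) -> exists f', Holo D (pker p q y) f'.
Proof. eexists. apply Holo_div. apply Holo_Cexp_lin. cont.
 intros z Hz. destruct (H z Hz). apply Cmult_neq_0; intro E; apply Cminus_eq_0 in E; auto.
Qed.
Lemma ccont_pker p q y z : z <> p -> z <> q -> ccont (pker p q y) z.
Proof.
 intros H1 H2. apply ccont_mult. eapply cderiv_ccont. apply (Holo_Cexp_lin (fun _ => True) y z I).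
 apply ccont_inv. cont.
 apply Cmult_neq_0; intro E; apply Cminus_eq_0 in E; auto.
Qed.
Lemma pole_dist (p : C) x t T : 4 <= T -> Rabs (Re p) <= 1 -> Rabs (Im p) <= T/2 -> t = T \/ t = - T -> (Rabs x+T/4)/2 <= Cmod ((x, t)-p).
Proof.
 intros HT H1 H2 Ht. assert (X := re_le_Cmod ((x, t)-p)). assert (Y := im_le_Cmod ((x, t)-p)). rewrite Re_Cminus in X. rewrite Im_Cminus in Y. simpl (Re (x, t)) in X. simpl (Im (x, t)) in Y.
 assert (Rabs x-1 <= Rabs (x-Re p)). { revert H1. unfold Rabs. destruct (Rcase_abs x), (Rcase_abs (Re p)), (Rcase_abs (x-Re p)); lra. }
 assert (T/2 <= Rabs (t-Im p)). { revert H2. unfold Rabs. destruct (Rcase_abs (Im p)), (Rcase_abs (_-Im p)); lra. }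
 lra.
Qed.
Lemma pker_horizontal p q y x t T : 4 <= T -> Rabs (Re p) <= 1 -> Rabs (Re q) <= 1 -> Rabs (Im p) <= T/2 -> Rabs (Im q) <= T/2 -> t = T \/ t = - T -> x*y <= 2*y ->
 Cmod (pker p q y (x, t)) <= exp (2*y)*(4/((Rabs x+T/4)*(Rabs x+T/4))).
Proof.
 intros HT P1 Q1 P2 Q2 Ht Hxy. assert (A := pole_dist p x t T HT P1 P2 Ht). assert (B := pole_dist q x t T HT Q1 Q2 Ht). assert (R0 := Rabs_pos x).
 assert (N : forall r, (Rabs x+T/4)/2 <= Cmod ((x, t)-r) -> ((x, t)-r <> 0)%C) by (intros r Hr; apply Cmod_gt_0; lra).
 unfold pker. rewrite Cmod_div by (apply Cmult_neq_0; auto). rewrite Cmod_Cexp, Cmod_mult.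
 assert (E : exp (Re ((x, t)*RtoC y)) <= exp (2*y)).
 { simpl. replace (x*y-t*0) with (x*y) by ring. destruct Hxy as [L| ->]; [left; apply exp_increasing; lra|lra]. }
 apply Rmult_le_compat; auto. pos. pos.
 replace (4/((Rabs x+T/4)*(Rabs x+T/4))) with (/ ((Rabs x+T/4)/2*((Rabs x+T/4)/2))) by fld.
 apply Rinv_le_contravar. pos. nra.
Qed.
Lemma RInt_inv_sqr c a b : 0 < c -> 0 <= a <= b -> is_RInt (fun x => 1/((x+c)*(x+c))) a b (1/(a+c)-1/(b+c)).
Proof.
 intros Hc Hab. assert (E : 1/(a+c)-1/(b+c) = (- (1/(b+c)))-(- (1/(a+c)))) by ring. rewrite E.
 apply (is_RInt_derive (V := R_CompleteNormedModule) (fun x => - (1/(x+c))) (fun x => 1/((x+c)*(x+c)))); minmax; intros x Hx.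
 auto_derive. lra. nra. apply (ex_derive_continuous (fun x => 1/((x+c)*(x+c)))). auto_derive. nra.
Qed.
(** Each side of 0 contributes at most 4M/c, the negative one after reflection. With a function of
    [Re] alone the lemma also serves for vertical segments. *)
Lemma hline_inv_sqr_bound f t M c a b : 0 < c -> 0 <= M -> a <= b -> contin (fun x => f (x, t)) a b ->
 (forall x, a <= x <= b -> Cmod (f (x, t)) <= M*(4/((Rabs x+c)*(Rabs x+c)))) -> Cmod (hline f t a b) <= 8*M/c.
Proof.
 intros Hc HM Hab Hf HB.
 assert (POS : forall a b, 0 <= a <= b -> forall g, contin g a b -> (forall x, a <= x <= b -> Cmod (g x) <= M*(4/((x+c)*(x+c)))) -> Cmod (CInt g a b) <= 4*M/c).
 { intros u v Huv g Hg HBg. assert (I := RInt_inv_sqr c u v Hc Huv).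
  via (RInt (fun x => 4*M*(1/((x+c)*(x+c)))) u v).
  - apply CInt_bound_RInt; auto; try lra. apply ex_RInt_scal_R. eexists; apply I.
   intros x Hx. eapply Rle_trans; [auto|]. lra.
  - rewrite RInt_scal_R by (eexists; apply I). rewrite (is_RInt_unique _ _ _ _ I).
   assert (1/(u+c) <= 1/c) by (mull; apply Rinv_le_contravar; lra). assert (0 < 1/(v+c)) by pos.
   nra. }
 assert (NEG : forall a b, a <= b <= 0 -> contin (fun x => f (x, t)) a b -> (forall x, a <= x <= b -> Cmod (f (x, t)) <= M*(4/((Rabs x+c)*(Rabs x+c)))) -> Cmod (CInt (fun x => f (x, t)) a b) <= 4*M/c).
 { intros u v Huv Hg HBg.
  replace (CInt (fun x => f (x, t)) u v) with (CInt (fun x => f (- x, t)) (- v) (- u)).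
  - apply POS; try lra.
   + intros x Hx. apply (rcont_comp (fun z => f (Re z, t)) (fun x => RtoC (- x))). apply (Hg (- x)); lra. cont.
   + intros x Hx. eapply Rle_trans; [cont|]. rewrite Rabs_Ropp, Rabs_right by lra. lra.
  - assert (SW : forall h : R -> R, (forall x, u <= x <= v -> continuous h x) -> RInt (fun x => h (- x)) (- v) (- u) = RInt h u v).
   { intros h Hh. assert (K := RInt_comp_lin h (-1) 0 (- v) (- u)). replace (-1 * - v+0) with v in K by ring. replace (-1 * - u+0) with u in K by ring.
    assert (EX : ex_RInt h u v) by cont.
    assert (EX2 : ex_RInt (fun x => h (- x)) (- v) (- u)).
    { apply ex_RInt_cont_R; [lra|]. intros x Hx. apply (continuous_comp (fun x => - x) h). cont. cont. }
    specialize (K (ex_RInt_swap _ _ _ EX)). rewrite <- (opp_RInt_swap h u v) in K by auto.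
    rewrite (RInt_ext _ (fun x => -1*h (- x))) in K by (intros; unfold scal; simpl; unfold mult; simpl; f_equal; f_equal; lra).
    rewrite RInt_scal_R in K by auto. unfold opp in K; simpl in K. lra. }
   apply C_eq; [apply (SW (fun x => Re (f (x, t))))|apply (SW (fun x => Im (f (x, t))))]; cont. }
 assert (P8 : 8*M/c = 4*M/c+4*M/c) by lra.
 assert (M4 : 0 <= 4*M/c) by pos.
 unfold hline. destruct (Rle_dec 0 a).
 - assert (Cmod (CInt (fun x => f (x, t)) a b) <= 4*M/c); [|lra]. apply POS; auto. intros x Hx. eapply Rle_trans; [auto|]. rewrite Rabs_right by lra; lra.
 - destruct (Rle_dec b 0).
  + assert (Cmod (CInt (fun x => f (x, t)) a b) <= 4*M/c); [|lra]. auto.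
  + rewrite <- (CInt_Chasles _ a 0 b) by pos. tr Cmod_triangle. rewrite P8. apply Rplus_le_compat.
   * apply NEG; try lra. intros x Hx; cont. cont.
   * apply POS; try lra. intros x Hx; cont. intros x Hx. eapply Rle_trans; [cont|]. rewrite Rabs_right by lra; lra.
Qed.

Definition pmain (p q : C) (y : R) : C := if Rlt_dec 0 y then ((Cexp (p*RtoC y)-Cexp (q*RtoC y))/(p-q))%C else RtoC 0.
Lemma pker_vertical_bound p q y a T d : 0 <= T -> 0 < d -> d <= Rabs (a-Re p) -> d <= Rabs (a-Re q) ->
 Cmod (vline (pker p q y) a T) <= exp (a*y)/(d*d)*(2*T).
Proof.
 intros HT Hd Hp Hq. replace (2*T) with (T - - T) by ring.
 assert (D : forall r t, d <= Rabs (a-Re r) -> d <= Cmod ((a, t)-r)). { intros r t H. tr H. assert (X := re_le_Cmod ((a, t)-r)). pos. }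
 assert (NE : forall r t, d <= Rabs (a-Re r) -> ((a, t) : C) <> r). { intros r t H E. subst r. rewrite Rminus_diag, Rabs_R0 in H. lra. }
 apply CInt_bound; try lra.
 - intros t Ht. apply rcont_vertical. apply ccont_pker; auto.
 - intros t Ht. unfold pker. rewrite Cmod_div. 2: apply Cmult_neq_0; apply Cmod_gt_0; eapply Rlt_le_trans; try apply Hd; auto.
  rewrite Cmod_Cexp, Cmod_mult, Re_Cmult. simpl. replace (a*y-t*0) with (a*y) by ring. mull.
  apply Rinv_le_contravar. nra. mul; auto.
Qed.
Lemma le_of_eventually_small x B (e : nat -> R) : is_lim_seq e 0 -> (forall n, x <= B+e n) -> x <= B.
Proof.
 intros He H. apply (is_lim_seq_le (fun _ => x) (fun n => B+e n) x B); auto. apply is_lim_seq_const.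
 replace (Finite B) with (Finite (B+0)) by (f_equal; lra). apply (is_lim_seq_plus' (fun _ => B)); auto. apply is_lim_seq_const.
Qed.
Lemma lim_inv_INR c : is_lim_seq (fun n => c/(INR (S n))) 0.
Proof.
 apply is_lim_seq_ext with (fun n => c*Rpower (INR (S n)) (-(1))). intro n. rewrite Rpower_Ropp, Rpower_1 by pos. lra.
 replace (Finite 0) with (Rbar_mult c 0) by (simpl; f_equal; lra). apply is_lim_seq_scal_l. apply (is_lim_INR_power 1); lra.
Qed.
(** For y > 0 the line is moved to the left across both poles, for y <= 0 to the right; the far side
    vanishes in the limit, and the bound is that of the two horizontal sides. *)
Lemma Perron p q y T : 4 <= T -> Rabs (Re p) <= 1 -> Rabs (Re q) <= 1 -> Rabs (Im p) <= T/2 -> Rabs (Im q) <= T/2 -> p <> q ->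
 Cmod (vline (pker p q y) 2 T-RtoC (2*PI)*pmain p q y) <= 64*exp (2*y)/T.
Proof.
 intros HT P1 Q1 P2 Q2 Npq. assert (NPQ : (p-q <> 0)%C) by (intro E; apply Npq, Cminus_eq_0; pos).
 assert (B64 : 64*exp (2*y)/T = 8*exp (2*y)/(T/4)+8*exp (2*y)/(T/4)) by fld.
 assert (E0 : 0 <= exp (2*y)) by pos.
 assert (PA := Rabs_le_between (Re p) 1). assert (QA := Rabs_le_between (Re q) 1).
 assert (NEt : forall x t, t = T \/ t = - T -> (x, t) <> p /\ (x, t) <> q).
 { intros x t Ht. assert (D1 := pole_dist p x t T HT P1 P2 Ht). assert (D2 := pole_dist q x t T HT Q1 Q2 Ht). assert (R0 := Rabs_pos x).
  split; intro Q; rewrite Q, Cmod_self in *; lra. }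
 assert (HH : forall a b t, a <= b -> t = T \/ t = - T -> (forall x, a <= x <= b -> x*y <= 2*y) -> Cmod (hline (pker p q y) t a b) <= 8*exp (2*y)/(T/4)).
 { intros a b t Hab Ht Hxy. apply hline_inv_sqr_bound; try lra.
  - intros x Hx. apply rcont_horizontal. apply ccont_pker; apply NEt; lra.
  - intros x Hx. apply pker_horizontal; auto. }
 unfold pmain. destruct (Rlt_dec 0 y) as [Hy|Hy].
 - apply le_of_eventually_small with (fun n => (2*T)/INR (S n)); [apply lim_inv_INR|]. intro n. assert (n1 := INR_S_ge_1 n). set (R := INR (S n)) in *.
  set (a := - (R+1)). set (Ep := Cexp (p*RtoC y)). set (Eq := Cexp (q*RtoC y)).
  assert (RP : rect (pker p q y) a 2 T = (RtoC (2*PI)*((Ep-Eq)/(p-q)))%C).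
  (* Partial fractions, and in each fraction the exponential is split into its value at the pole and
     a multiple of s - p or s - q by an entire function: only the pure poles contribute to the
     contour. *)
  { set (hp := divide_zero (fun s => Cexp (s*RtoC y)-Ep)%C (fun s => RtoC y*Cexp (s*RtoC y))%C p).
   set (hq := divide_zero (fun s => Cexp (s*RtoC y)-Eq)%C (fun s => RtoC y*Cexp (s*RtoC y))%C q).
   assert (HE : forall E, Holo (fun _ => True) (fun s => Cexp (s*RtoC y)-E)%C (fun s => RtoC y*Cexp (s*RtoC y))%C).
   { intros E z _. destruct (Holo_Cexp_lin (fun _ => True) y z I) as (K1 & K2). split; auto.
    assert (K := cderiv_minus _ _ _ _ _ K1 (cderiv_const E z)). replace (RtoC y*Cexp (z*RtoC y)-0)%C with (RtoC y*Cexp (z*RtoC y))%C in K by ring. pos. }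
   assert (OT : copen (fun _ => True)) by (exists 1; cont).
   assert (Hp := Holo_divide_zero (fun _ => True) _ _ p OT (HE Ep) I ltac:(unfold Ep; ring)).
   assert (Hq := Holo_divide_zero (fun _ => True) _ _ q OT (HE Eq) I ltac:(unfold Eq; ring)).
   assert (ab : a <= 2) by (unfold a; lra).
   assert (IP : a < Re p < 2) by (unfold a; lra). assert (IQ : a < Re q < 2) by (unfold a; lra).
   assert (JP : - T < Im p < T) by (apply Rabs_le_between in P2; lra). assert (JQ : - T < Im q < T) by (apply Rabs_le_between in Q2; lra).
   destruct (rect_pole p a 2 T IP JP) as (RPp & CPp). destruct (rect_pole q a 2 T IQ JQ) as (RPq & CPq).
   assert (Chp : crect hp a 2 T) by (intros z _; eapply Holo_ccont; [apply Hp|lra]).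
   assert (Chq : crect hq a 2 T) by (intros z _; eapply Holo_ccont; [apply Hq|lra]).
   assert (R0p : rect hp a 2 T = 0) by (apply rect_Holo with (Cder hp) 1; try lra; intros z _; cont).
   assert (R0q : rect hq a 2 T = 0) by (apply rect_Holo with (Cder hq) 1; try lra; intros z _; cont).
   rewrite (rect_ext _ (fun z => / (p-q)*((hp z+Ep * / (z-p))+(-(1))*(hq z+Eq * / (z-q))))%C); try lra.
   2:{ intros z Hz. assert (NP : (z-p <> 0)%C) by (intro E; apply Cminus_eq_0 in E; subst; unfold on_rect in Hz; lra).
     assert (NQ : (z-q <> 0)%C) by (intro E; apply Cminus_eq_0 in E; subst; unfold on_rect in Hz; lra).
     assert (A1 := divide_zero_eq (fun s => Cexp (s*RtoC y)-Ep)%C (fun s => RtoC y*Cexp (s*RtoC y))%C p z ltac:(unfold Ep; ring)). fold hp in A1.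
     assert (A2 := divide_zero_eq (fun s => Cexp (s*RtoC y)-Eq)%C (fun s => RtoC y*Cexp (s*RtoC y))%C q z ltac:(unfold Eq; ring)). fold hq in A2.
     replace (hp z+Ep * / (z-p))%C with (Cexp (z*RtoC y)/(z-p))%C. 2:{ replace (Cexp (z*RtoC y)) with ((z-p)*hp z+Ep)%C by (rewrite <- A1; ring). field; pos. }
     replace (hq z+Eq * / (z-q))%C with (Cexp (z*RtoC y)/(z-q))%C. 2:{ replace (Cexp (z*RtoC y)) with ((z-q)*hq z+Eq)%C by (rewrite <- A2; ring). field; pos. }
     unfold pker. field. auto. }
   assert (C1 : crect (fun z => hp z+Ep * / (z-p))%C a 2 T) by (intros z Hz; cont).
   assert (C2 : crect (fun z => hq z+Eq * / (z-q))%C a 2 T) by (intros z Hz; cont).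
   assert (C3 : crect (fun z => -(1)*(hq z+Eq * / (z-q)))%C a 2 T) by (intros z Hz; cont).
   assert (C4 : crect (fun z => Ep * / (z-p))%C a 2 T) by (intros z Hz; cont).
   assert (C5 : crect (fun z => Eq * / (z-q))%C a 2 T) by (intros z Hz; cont).
   assert (T0 : 0 <= T) by lra.
   rewrite rect_mult_const; auto. 2: intros z Hz; cont.
   rewrite rect_plus; auto. rewrite (rect_mult_const (-(1)) (fun z => hq z+Eq * / (z-q))%C); auto.
   rewrite (rect_plus hp (fun z => Ep * / (z-p))%C), (rect_plus hq (fun z => Eq * / (z-q))%C); auto.
   rewrite (rect_mult_const Ep (fun z => / (z-p))%C), (rect_mult_const Eq (fun z => / (z-q))%C); auto.
   rewrite RPp, RPq, R0p, R0q. field. auto. }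
  rewrite <- RP. unfold rect.
  replace (vline (pker p q y) 2 T-(vline (pker p q y) 2 T-vline (pker p q y) a T+Ci*(hline (pker p q y) T a 2-hline (pker p q y) (- T) a 2)))%C with
   (vline (pker p q y) a T-Ci*(hline (pker p q y) T a 2-hline (pker p q y) (- T) a 2))%C by ring.
  tr Cmod_sub_le. rewrite Cmod_mult, Cmod_Ci, Rmult_1_l. assert (X := Cmod_sub_le (hline (pker p q y) T a 2) (hline (pker p q y) (- T) a 2)).
  assert (H1 := HH a 2 T ltac:(unfold a; lra) (or_introl eq_refl) ltac:(intros; nra)). assert (H2 := HH a 2 (- T) ltac:(unfold a; lra) (or_intror eq_refl) ltac:(intros; nra)).
  assert (V : Cmod (vline (pker p q y) a T) <= 2*T/R).
  { eapply Rle_trans. apply pker_vertical_bound with (d := R); try lra; unfold a; rewrite Rabs_left1; lra.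
   assert (exp (a*y) <= 1). { rewrite <- exp_0. left. apply exp_increasing. unfold a. nra. }
   assert (/ (R*R) <= / R) by (apply Rinv_le_contravar; nra). assert (exp (a*y) * / (R*R) <= 1 * / R) by (mul). nra. }
  lra.
 - apply le_of_eventually_small with (fun n => (2*T*exp (2*y))/INR (S n)); [apply lim_inv_INR|]. intro n. assert (n1 := INR_S_ge_1 n). set (R := INR (S n)) in *.
  set (b := 2+R). destruct (Holo_pker (orect 2 b T (1/2)) p q y) as (f' & Hf'). { intros z (Hz & _). split; intros ->; lra. }
  assert (RR := rect_Holo _ _ 2 b T (1/2) ltac:(unfold b; lra) ltac:(lra) ltac:(lra) Hf'). unfold rect in RR.
  replace (vline (pker p q y) 2 T-RtoC (2*PI)*0)%C with (vline (pker p q y) b T+Ci*(hline (pker p q y) T 2 b-hline (pker p q y) (- T) 2 b)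
   - (vline (pker p q y) b T-vline (pker p q y) 2 T+Ci*(hline (pker p q y) T 2 b-hline (pker p q y) (- T) 2 b)))%C by ring.
  rewrite RR. replace (vline (pker p q y) b T+Ci*(hline (pker p q y) T 2 b-hline (pker p q y) (- T) 2 b)-0)%C with (vline (pker p q y) b T+Ci*(hline (pker p q y) T 2 b-hline (pker p q y) (- T) 2 b))%C by ring.
  tr Cmod_triangle. rewrite Cmod_mult, Cmod_Ci, Rmult_1_l. assert (X := Cmod_sub_le (hline (pker p q y) T 2 b) (hline (pker p q y) (- T) 2 b)).
  assert (H1 := HH 2 b T ltac:(unfold b; lra) (or_introl eq_refl) ltac:(intros; nra)). assert (H2 := HH 2 b (- T) ltac:(unfold b; lra) (or_intror eq_refl) ltac:(intros; nra)).
  assert (V : Cmod (vline (pker p q y) b T) <= 2*T*exp (2*y)/R).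
  { eapply Rle_trans. apply pker_vertical_bound with (d := R); try lra; unfold b; rewrite Rabs_right; lra.
   assert (exp (b*y) <= exp (2*y)). { destruct (Req_dec y 0) as [->|]. rewrite !Rmult_0_r; lra. left. apply exp_increasing. unfold b. nra. }
   assert (/ (R*R) <= / R) by (apply Rinv_le_contravar; nra). assert (exp (b*y) * / (R*R) <= exp (2*y) * / R) by (mul). nra. }
  lra.
Qed.

(** * Perron's formula for the smoothed sums of Lambda *)

Definition contv (f : C -> C) (a T : R) : Prop := forall t, - T <= t <= T -> ccont f (a, t).
Lemma contv_contin f a T : contv f a T -> contin (fun t => f (a, t)) (- T) T.
Proof. intros H t Ht. apply rcont_vertical; auto. Qed.
Lemma vline_ext f g a T : 0 <= T -> (forall t, - T <= t <= T -> f (a, t) = g (a, t)) -> vline f a T = vline g a T.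
Proof. intros H E. apply CInt_ext; pos. Qed.
Lemma vline_plus f g a T : 0 <= T -> contv f a T -> contv g a T -> vline (fun s => f s+g s)%C a T = (vline f a T+vline g a T)%C.
Proof. intros H Hf Hg. apply CInt_plus; try lra; apply contv_contin; pos. Qed.
Lemma vline_minus f g a T : 0 <= T -> contv f a T -> contv g a T -> vline (fun s => f s-g s)%C a T = (vline f a T-vline g a T)%C.
Proof. intros H Hf Hg. apply CInt_minus; try lra; apply contv_contin; pos. Qed.
Lemma vline_mult_const c f a T : 0 <= T -> contv f a T -> vline (fun s => c*f s)%C a T = (c*vline f a T)%C.
Proof. intros H Hf. apply CInt_mult_const; [lra|]; apply contv_contin; pos. Qed.
Lemma vline_bound f a T M : 0 <= T -> contv f a T -> (forall t, - T <= t <= T -> Cmod (f (a, t)) <= M) -> Cmod (vline f a T) <= M*(2*T).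
Proof. intros H Hf HM. replace (2*T) with (T - - T) by ring. apply CInt_bound; [lra|apply contv_contin; pos|pos]. Qed.
Lemma vline_clsum {A} (l : list A) (f : A -> C -> C) a T : 0 <= T -> (forall x, In x l -> contv (f x) a T) ->
 vline (fun s => clsum l (fun x => f x s)) a T = clsum l (fun x => vline (f x) a T) /\ contv (fun s => clsum l (fun x => f x s)) a T.
Proof.
 intros HT. induction l as [|x l IH]; intro H.
 - split. unfold vline, clsum; simpl. rewrite CInt_const; ring. intros t Ht. apply (ccont_const (RtoC 0)).
 - destruct IH as (IH1 & IH2). intros; apply H; right; pos. assert (Hx := H x (or_introl eq_refl)). split.
  + change (vline (fun s => f x s+clsum l (fun x => f x s))%C a T = (vline (f x) a T+clsum l (fun x => vline (f x) a T))%C). rewrite vline_plus, IH1; auto.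
  + intros t Ht. apply (ccont_plus (f x)); auto.
Qed.
Lemma pair_neq_lt (a t : R) (p : C) : Re p < a -> ((a, t) : C) <> p.
Proof. intros H E. subst p. simpl in H. lra. Qed.

Ltac re_contra := let E := fresh in intro E; apply (f_equal Re) in E; unfold Re in *; simpl in *; lra.
(** The kernel that weights v^(-s) so that its vertical integral is 2 pi max(0, u-v). *)
Definition Ku (u : R) (s : C) : C := (Rcpow u (s+1)/(s*(s+1)))%C.
Lemma ccont_Ku u s : 0 < Re s -> ccont (Ku u) s.
Proof.
 intro H. apply ccont_mult. cont.
 apply ccont_inv. cont.
 apply Cmult_neq_0; re_contra.
Qed.
Lemma Ku_pker u v s : 0 < u -> 0 < v -> 0 < Re s -> (Rcpow v (- s)*Ku u s = RtoC u*pker 0 (-(1)) (ln (u/v)) s)%C.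
Proof.
 intros Hu Hv Hs. unfold Ku, pker. rewrite Rcpow_plus, Rcpow_1 by auto. unfold Rcpow, Rdiv. rewrite ln_mult, ln_Rinv, RtoC_plus, RtoC_opp by pos.
 replace (s*(RtoC (ln u) + - RtoC (ln v)))%C with (- s*RtoC (ln v)+s*RtoC (ln u))%C by ring. rewrite Cexp_plus.
 field. repeat split; re_contra.
Qed.
Lemma pmain_0_m1 u v : 0 < u -> 0 < v -> (RtoC u*pmain 0 (-(1)) (ln (u/v)) = RtoC (Rmax 0 (u-v)))%C.
Proof.
 intros Hu Hv. unfold pmain. destruct (Rlt_dec 0 (ln (u/v))) as [L|L].
 - assert (v < u). { destruct (Rlt_dec v u); auto. assert (ln (u/v) <= 0). rewrite <- ln_1. apply ln_le_mono. pos. apply (Rmult_le_reg_r v); auto. unfold Rdiv. rewrite Rmult_assoc, Rinv_l; lra. lra. }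
  rewrite Rmax_right by lra. replace (0*RtoC (ln (u/v)))%C with (RtoC 0) by ring. rewrite Cexp_0.
  replace (-(1)*RtoC (ln (u/v)))%C with (RtoC (- ln (u/v))) by (rewrite RtoC_opp; ring). rewrite Cexp_RtoC, exp_Ropp, exp_ln by pos.
  replace (0 - - (1))%C with (RtoC 1) by ring. replace (RtoC u*((1-RtoC (/ (u/v)))/1))%C with (RtoC (u*(1 - / (u/v)))).
  f_equal. fld. rewrite RtoC_mult, RtoC_minus. fld.
 - rewrite Rmax_left. ring. destruct (Rle_dec u v); [lra|]. exfalso. apply L. rewrite <- ln_1. apply ln_increasing; [lra|]. apply (Rmult_lt_reg_r v); auto. unfold Rdiv. rewrite Rmult_assoc, Rinv_l; lra.
Qed.
Lemma Perron_term u v T : 0 < u -> 0 < v -> 4 <= T ->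
 Cmod (vline (fun s => Rcpow v (- s)*Ku u s)%C 2 T-RtoC (2*PI*Rmax 0 (u-v))) <= 64*u*(u/v)^2/T.
Proof.
 intros Hu Hv HT. rewrite (vline_ext _ (fun s => RtoC u*pker 0 (-(1)) (ln (u/v)) s)%C) by (try lra; intros; apply Ku_pker; simpl; lra).
 rewrite vline_mult_const by (try lra; intros t _; apply ccont_pker; apply pair_neq_lt; simpl; lra).
 rewrite RtoC_mult, <- (pmain_0_m1 u v) by auto.
 replace (u*vline (pker 0 (-(1)) (ln (u/v))) 2 T-RtoC (2*PI)*(u*pmain 0 (-(1)) (ln (u/v))))%C with
  (u*(vline (pker 0 (-(1)) (ln (u/v))) 2 T-RtoC (2*PI)*pmain 0 (-(1)) (ln (u/v))))%C by ring.
 rewrite Cmod_mult, Cmod_RtoC_pos by lra.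
 assert (P := Perron 0 (-(1)) (ln (u/v)) T HT). eapply Rle_trans. mull. apply P.
 - simpl. rewrite Rabs_R0; lra.
 - simpl. rewrite Rabs_left; lra.
 - simpl. rewrite Rabs_R0; lra.
 - simpl. rewrite Ropp_0, Rabs_R0; lra.
 - intro E. apply (f_equal Re) in E. simpl in E. lra.
 - replace (exp (2*ln (u/v))) with ((u/v)^2). nra.
  replace (2*ln (u/v)) with (ln (u/v)+ln (u/v)) by ring. rewrite exp_plus, exp_ln by pos. ring.
Qed.
(** The sum of the residues of Ku(s)/(s-p) at p, 0 and -1. *)
Definition Rp (p : C) (u : R) : C := (Rcpow u (p+1)/(p*(p+1))-RtoC u/p+1/(p+1))%C.
Lemma Perron_pole u p T : 1 < u -> 4 <= T -> -1 < Re p <= 1 -> Rabs (Im p) <= T/2 -> p <> 0 ->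
 Cmod (vline (fun s => / (s-p)*Ku u s)%C 2 T-RtoC (2*PI)*Rp p u) <= 128*u^3/T.
Proof.
 intros Hu HT Hp Ip Np. set (y := ln u). assert (y0 : 0 < y) by (rewrite <- ln_1; apply ln_increasing; lra).
 assert (Np1 : (p+1 <> 0)%C) by re_contra.
 rewrite (vline_ext _ (fun s => RtoC u*(pker p 0 y s-pker p (-(1)) y s))%C); [|lra|].
 2:{ intros t _. unfold Ku, pker. rewrite Rcpow_plus, Rcpow_1 by lra. unfold Rcpow, y.
   field. repeat split; re_contra. }
 assert (C1 : contv (pker p 0 y) 2 T) by (intros t _; apply ccont_pker; apply pair_neq_lt; simpl; lra).
 assert (C2 : contv (pker p (-(1)) y) 2 T) by (intros t _; apply ccont_pker; apply pair_neq_lt; simpl; lra).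
 rewrite vline_mult_const, vline_minus; auto; try lra. 2: intros t Ht; cont.
 assert (Mn : Rp p u = (RtoC u*(pmain p 0 y-pmain p (-(1)) y))%C).
 { unfold pmain. destruct (Rlt_dec 0 y); [|lra]. unfold Rp. rewrite Rcpow_plus, Rcpow_1 by lra. unfold Rcpow.
  replace (0*RtoC y)%C with (RtoC 0) by ring. rewrite Cexp_0. replace (-(1)*RtoC y)%C with (RtoC (- y)) by (rewrite RtoC_opp; ring). rewrite Cexp_RtoC, exp_Ropp. unfold y. rewrite exp_ln, RtoC_inv by lra.
  assert (u0 : RtoC u <> 0) by (intro E; apply RtoC_inj in E; lra). field. repeat split; auto. intro E. apply Np1. rewrite <- E; ring. }
 rewrite Mn.
 replace (u*(vline (pker p 0 y) 2 T-vline (pker p (-(1)) y) 2 T)-RtoC (2*PI)*(u*(pmain p 0 y-pmain p (-(1)) y)))%C with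
  (u*((vline (pker p 0 y) 2 T-RtoC (2*PI)*pmain p 0 y)-(vline (pker p (-(1)) y) 2 T-RtoC (2*PI)*pmain p (-(1)) y)))%C by ring.
 rewrite Cmod_mult, Cmod_RtoC_pos by lra.
 assert (E2 : exp (2*y) = u^2). { unfold y. replace (2*ln u) with (ln u+ln u) by ring. rewrite exp_plus, exp_ln by lra. ring. }
 assert (RPa : Rabs (Re p) <= 1) by (apply Rabs_le_between; lra).
 assert (A1 := Perron p 0 y T HT RPa ltac:(simpl; rewrite Rabs_R0; lra) Ip ltac:(simpl; rewrite Rabs_R0; lra) Np).
 assert (A2 := Perron p (-(1)) y T HT RPa ltac:(simpl; rewrite Rabs_left; lra) Ip ltac:(simpl; rewrite Ropp_0, Rabs_R0; lra)).
 specialize (A2 ltac:(intro E; apply Np1; rewrite E; ring)). rewrite E2 in A1, A2.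
 eapply Rle_trans. mull. apply Cmod_sub_le.
 nra.
Qed.
(** The cut-off [N] makes the sum finite; for [u <= INR N] it does not change the value. *)
Definition psi1 (N : nat) (u : R) : R := lsum (seq 1 N) (fun n => vonMangoldt n*Rmax 0 (u-INR n)).
Definition A1 (N : nat) (u : R) : R := psi1 N u-(Rmax 0 (u-1))^2/2.
Lemma psi1_extend N M u : u <= INR N -> (N <= M)%nat -> psi1 M u = psi1 N u.
Proof.
 intros H K. apply lsum_seq_extend; auto. intros k Hk. rewrite Rmax_left; [lra|]. assert (INR N <= INR k) by (apply le_INR; lia). lra.
Qed.
Lemma sum_n_S_R (m : nat -> R) n : sum_n m (S n) = sum_n m n+m (S n).
Proof. rewrite sum_Sn. auto. Qed.
Lemma cpsum_tail u m M : (forall n, Cmod (u n) <= m n) -> ex_series m -> Cmod (Csum u-cpsum u (S M)) <= Series m-sum_n m M.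
Proof.
 intros H K. assert (m0 : forall n, 0 <= m n) by (intro n; tr Cmod_ge_0; cont).
 apply clim_bound with (fun k => cpsum u (S M+k)-cpsum u (S M))%C.
 - apply clim_minus; [|apply clim_const]. intros eps He. destruct (clim_Csum u m H K eps He) as (N & L). exists N. intros n Hn. apply L; lia.
 - intro k. assert (B : Cmod (cpsum u (S M+k)-cpsum u (S M)) <= sum_n m (M+k)-sum_n m M).
  { induction k as [|k IH]. rewrite !Nat.add_0_r, Cmod_self. lra. replace (S M+S k)%nat with (S (S M+k)) by lia. replace (M+S k)%nat with (S (M+k)) by lia. rewrite sum_n_S_R.
   change (cpsum u (S (S M+k))) with (cpsum u (S M+k)+u (S M+k)%nat)%C. replace (cpsum u (S M+k)+u (S M+k)%nat-cpsum u (S M))%C with ((cpsum u (S M+k)-cpsum u (S M))+u (S M+k)%nat)%C by ring.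
   tr Cmod_triangle. specialize (H (S M+k)%nat). replace (S M+k)%nat with (S (M+k)) in * by lia. lra. }
  assert (sum_n m (M+k) <= Series m). { apply (is_lim_seq_incr_compare (sum_n m)). apply (Series_correct _ K). intro n. rewrite sum_Sn. unfold plus; simpl. generalize (m0 (S n)); lra. }
  lra.
Qed.
Lemma ccont_FF s : -1 < Re s -> zf s <> 0 -> ccont FF s.
Proof. intros H N. apply ccont_opp, ccont_mult. apply Holo_zf; pos. apply ccont_inv; auto. eapply Holo_ccont; [apply Holo_zf|]; pos. Qed.
Lemma ccont_Dl s : 1 < Re s -> ccont Dl s.
Proof.
 intro H. apply ccont_ext_loc with (fun s => FF s+1/(s-1))%C.
 - exists (Re s-1). split; [lra|]. intros w Hw. assert (X := re_le_Cmod (w-s)). rewrite Re_Cminus in X. apply Rabs_le_between in X. rewrite FF_Dl by lra. ring.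
 - apply ccont_plus. apply ccont_FF; [lra|apply zf_neq_0; lra]. apply ccont_mult; [cont|]. apply ccont_inv. cont. apply half_plane_neq_1; lra.
Qed.
Lemma Cmod_Ku_2 u t : 0 < u -> Cmod (Ku u (2, t)) <= u^3.
Proof.
 intro Hu. unfold Ku. assert (N1 : ((2, t) : C) <> 0) by (intro E; apply (f_equal Re) in E; simpl in E; lra). assert (N2 : ((2, t)+1)%C <> 0) by (intro E; apply (f_equal Re) in E; simpl in E; lra).
 rewrite Cmod_div, Cmod_mult, Cmod_Rcpow by (apply Cmult_neq_0; pos). replace (Re ((2, t)+1)) with (INR 3) by auto. rewrite Rpower_pow by auto.
 assert (A := re_le_Cmod (2, t)). assert (B := re_le_Cmod ((2, t)+1)). simpl in A. simpl in B. rewrite Rabs_right in A, B by lra.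
 assert (U : 0 < u^3) by pos. assert (PP : 1 <= Cmod ((2, t) : C)*Cmod ((2, t)+1)%C) by (via (1*1); [lra|]; mul; lra).
 apply (Rmult_le_reg_r (Cmod (2, t)*Cmod ((2, t)+1))); [lra|]. unfold Rdiv. rewrite Rmult_assoc, Rinv_l by lra. nra.
Qed.
Lemma lnpow_2_series : Series (lnpow 2) <= 8.
Proof.
 unfold lnpow. assert (S1 := Rpower_series ((2+1)/2) ltac:(lra)). assert (S2 := Rpower_series 2 ltac:(lra)).
 rewrite (Series_plus (fun n => 2/(2-1)*Rpower (INR (S n)) (- ((2+1)/2))) (fun n => Rpower (INR (S n)) (-(2)))).
 - rewrite Series_scal_l. lra.
 - apply ex_series_scal_R, S1.
 - apply S2.
Qed.
(** Perron's formula term by term: the errors 64 u^3/T times Lambda(n) n^(-2) add up to 512 u^3/T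
    since the majorant series is at most 8, and the pole at 1 adds 128 u^3/T. The series is cut at
    [M], which tends to infinity for fixed T. *)
Lemma A1_Perron u N T : 1 < u -> u <= INR N -> 4 <= T -> Cmod (vline (fun s => FF s*Ku u s)%C 2 T-RtoC (2*PI*A1 N u)) <= 640*u^3/T.
Proof.
 intros Hu HN HT. assert (T0 : 0 <= T) by lra.
 assert (CK : contv (Ku u) 2 T) by (intros t _; apply ccont_Ku; simpl; lra).
 assert (CD : contv Dl 2 T) by (intros t _; apply ccont_Dl; simpl; lra).
 assert (CP : contv (fun s => / (s-1))%C 2 T) by (intros t _; apply ccont_inv; [cont|apply half_plane_neq_1; simpl; lra]).
 assert (CDK : contv (fun s => Dl s*Ku u s)%C 2 T) by (intros t Ht; cont).
 assert (CPK : contv (fun s => / (s-1)*Ku u s)%C 2 T) by (intros t Ht; cont).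
 rewrite (vline_ext _ (fun s => Dl s*Ku u s - / (s-1)*Ku u s)%C); auto.
 2:{ intros t _. rewrite FF_Dl by (simpl; lra). unfold Cdiv. ring. }
 rewrite vline_minus; auto.
 assert (P1 := Perron_pole u 1 T Hu HT ltac:(simpl; lra) ltac:(simpl; rewrite Rabs_R0; lra) ltac:(intro E; apply RtoC_inj in E; lra)).
 assert (M1 : Rp 1 u = RtoC ((Rmax 0 (u-1))^2/2)).
 { rewrite Rmax_right by lra. unfold Rp. replace (1+1)%C with (RtoC 2) by (ring). rewrite Rcpow_RtoC. replace 2 with (INR 2) at 1 by auto. rewrite Rpower_pow by lra.
  replace ((u-1)^2/2) with (u^2/2-u + / 2) by field. rewrite RtoC_plus, RtoC_minus, RtoC_div, RtoC_inv by lra. fld. }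
 rewrite M1 in P1. rewrite RtoC_mult.
 set (VD := vline (fun s => Dl s*Ku u s)%C 2 T) in *. set (VP := vline (fun s => / (s-1)*Ku u s)%C 2 T) in *.
 assert (PD : Cmod (VD-RtoC (2*PI*psi1 N u)) <= 512*u^3/T).
 { apply le_of_eventually_small with (fun k => (Series (lnpow 2)-sum_n (lnpow 2) (N+k))*u^3*(2*T)).
  { replace (Finite 0) with (Rbar_mult (Rbar_mult (Rbar_minus (Series (lnpow 2)) (Series (lnpow 2))) (u^3)) (2*T)) by (simpl; f_equal; lra).
   apply is_lim_seq_scal_r, is_lim_seq_scal_r. apply is_lim_seq_minus'; [apply is_lim_seq_const|].
   assert (L : is_lim_seq (sum_n (lnpow 2)) (Series (lnpow 2))) by exact (Series_correct _ (lnpow_series 2 ltac:(lra))). apply (is_lim_seq_incr_n (sum_n (lnpow 2)) N) in L. apply is_lim_seq_ext with (2 := L). intro n; rewrite Nat.add_comm; lra. }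
  intro k. set (M := S (N+k)). rewrite <- (psi1_extend N M u) by (auto; lia).
  set (pt := fun n => (fun s => RtoC (vonMangoldt n)*(Rcpow (INR n) (- s)*Ku u s))%C).
  assert (CR : forall n, contv (fun s => Rcpow (INR n) (- s)*Ku u s)%C 2 T).
  { intros n t Ht. cont. }
  assert (CPt : forall n, In n (seq 1 M) -> contv (pt n) 2 T) by (intros n _ t Ht; apply (ccont_mult (fun _ => RtoC (vonMangoldt n))); cont).
  destruct (vline_clsum (seq 1 M) pt 2 T T0 CPt) as (ES & CS).
  set (W := fun s => clsum (seq 1 M) (fun n => pt n s)) in *.
  assert (EW : forall s, (cpsum (ds vonMangoldt s) M*Ku u s = W s)%C).
  { intro s. rewrite (cpsum_clsum (fun n => RtoC (vonMangoldt n)*Rcpow (INR n) (- s))%C). unfold W, pt. rewrite Cmult_comm, <- clsum_scal. apply clsum_ext. intros; ring. }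
  replace (VD-RtoC (2*PI*psi1 M u))%C with ((vline W 2 T-RtoC (2*PI*psi1 M u))+(VD-vline W 2 T))%C by ring.
  tr Cmod_triangle. apply Rplus_le_compat.
  - rewrite ES. unfold psi1. rewrite <- lsum_scal, <- clsum_RtoC.
   replace (clsum (seq 1 M) (fun n => vline (pt n) 2 T)-clsum (seq 1 M) (fun x => RtoC (2*PI*(vonMangoldt x*Rmax 0 (u-INR x)))))%C with
    (clsum (seq 1 M) (fun n => vline (pt n) 2 T) + -(1)*clsum (seq 1 M) (fun x => RtoC (2*PI*(vonMangoldt x*Rmax 0 (u-INR x)))))%C by ring.
   rewrite <- clsum_scal, <- clsum_plus.
   via (lsum (seq 1 M) (fun n => 64*u^3/T*lnpow 2 (n-1))).
   + apply clsum_Cmod. intros n Hn. apply in_seq in Hn. assert (n0 : 0 < INR n) by pos.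
    unfold pt. rewrite vline_mult_const by auto. replace (2*PI*(vonMangoldt n*Rmax 0 (u-INR n))) with (vonMangoldt n*(2*PI*Rmax 0 (u-INR n))) by ring. rewrite (RtoC_mult (vonMangoldt n)).         match goal with |- Cmod (?a * ?b + ?d*(?a * ?c))%C <= _ => replace (a*b+d*(a*c))%C with (a*(b-c))%C by ring end.
    rewrite Cmod_mult, Cmod_RtoC_pos by apply vonMangoldt_nonneg. assert (PT := Perron_term u (INR n) T ltac:(lra) n0 HT).
    assert (LB := ds_bound vonMangoldt (RtoC 2) (n-1) ltac:(simpl; lra) (coef_Lambda_bound _)). unfold ds in LB. replace (S (n-1)) with n in LB by lia. rewrite Cmod_mult, Cmod_RtoC_pos, Cmod_Rcpow, Re_Copp, Re_RtoC in LB by apply vonMangoldt_nonneg.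
    assert (V0 := vonMangoldt_nonneg n). eapply Rle_trans. mull; apply PT.
    replace (vonMangoldt n*(64*u*(u/INR n)^2/T)) with (64*u^3/T*(vonMangoldt n*Rpower (INR n) (-(2)))).
    apply Rmult_le_compat_l; auto. left. pos.
    rewrite Rpower_Ropp. replace 2 with (INR 2) at 1 by auto. rewrite Rpower_pow by auto. fld.
   + rewrite lsum_scal. unfold M. rewrite lsum_sum_n, (sum_n_ext _ (lnpow 2)) by (intro; f_equal; lia).
    replace (512*u^3/T) with (64*u^3/T*8) by lra. apply Rmult_le_compat_l. left. pos.
    trr lnpow_2_series. assert (ES2 := lnpow_series 2 ltac:(lra)). apply (is_lim_seq_incr_compare (sum_n (lnpow 2))); [apply (Series_correct _ ES2)|].
    intro j. rewrite sum_n_S_R. assert (0 <= lnpow 2 (S j)); [|lra].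
    unfold lnpow. pos.
  - unfold VD. rewrite <- vline_minus; auto. apply vline_bound; auto.
   { intros t Ht. cont. }
   intros t Ht. rewrite <- EW. replace (Dl (2, t)*Ku u (2, t)-cpsum (ds vonMangoldt (2, t)) M*Ku u (2, t))%C with ((Dl (2, t)-cpsum (ds vonMangoldt (2, t)) M)*Ku u (2, t))%C by ring.
   rewrite Cmod_mult. mul; [|apply Cmod_Ku_2; lra]. apply cpsum_tail. intro n. apply (ds_bound vonMangoldt (2, t) n); [simpl; lra|apply coef_Lambda_bound]. apply lnpow_series; lra. }
 replace (VD-VP-RtoC (2*PI)*RtoC (A1 N u))%C with ((VD-RtoC (2*PI*psi1 N u))-(VP-RtoC (2*PI)*RtoC (Rmax 0 (u-1)^2/2)))%C.
 2:{ unfold A1. rewrite RtoC_minus, !RtoC_mult. ring. }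
 tr Cmod_sub_le. lra.
Qed.

(** * The explicit formula *)

Lemma Cmod_Ku u s : s <> RtoC 0 -> (s+1 <> 0)%C -> Cmod (Ku u s) = Rpower u (Re s+1)/(Cmod s*Cmod (s+1)).
Proof.
 intros N1 N2. unfold Ku. rewrite Cmod_div, Cmod_mult, Cmod_Rcpow by (apply Cmult_neq_0; pos). auto.
Qed.
Lemma Rpower_le_base u a b : 1 <= u -> a <= b -> Rpower u a <= Rpower u b.
Proof. intros. apply Rpower_le_exp; lra. Qed.
Lemma Rpower_nat u n : 0 < u -> Rpower u (INR n) = u^n.
Proof. apply Rpower_pow. Qed.
Lemma Ku_horizontal u x t : 1 <= u -> 0 < x <= 2 -> t <> 0 -> Cmod (Ku u (x, t)) <= u^3/(t*t).
Proof.
 intros Hu Hx Ht. rewrite Cmod_Ku by re_contra.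
 assert (A := im_le_Cmod (x, t)). assert (B := im_le_Cmod ((x, t)+1)). rewrite Im_Cplus in B. rewrite Rplus_0_r in B.
 assert (t0 := Rabs_pos_lt t Ht). assert (P : t*t <= Cmod (x, t)*Cmod ((x, t)+1)) by (rewrite <- Rabs_sqr_eq; mul).
 assert (0 < t*t) by (rewrite <- Rabs_sqr_eq; pos). apply Rmult_le_compat. pos. pos.
 rewrite <- Rpower_nat by lra. apply Rpower_le_base; simpl; lra. apply Rinv_le_contravar; lra.
Qed.
Lemma Ku_vertical u x t : 0 < x <= 2 -> Cmod (Ku u (x, t)) <= Rpower u (x+1)/x*(8/((Rabs t+1)*(Rabs t+1))).
Proof.
 intros Hx. rewrite Cmod_Ku by re_contra.
 assert (A := im_le_Cmod (x, t)). assert (B := im_le_Cmod ((x, t)+1)). simpl in A, B. rewrite Rplus_0_r in B.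
 assert (A' := re_le_Cmod (x, t)). assert (B' := re_le_Cmod ((x, t)+1)). simpl in A', B'. rewrite Rabs_right in A', B' by lra.
 assert (t0 := Rabs_pos t). set (r := Rabs t) in *. assert (P : x/4*(r+1)*((r+1)/2) <= Cmod (x, t)*Cmod ((x, t)+1)) by nra.
 via (Rpower u (x+1)/(x/4*(r+1)*((r+1)/2))).
 - mull. apply Rinv_le_contravar; auto. nra.
 - right. fld.
Qed.
Lemma Holo_Ku u D : (forall z, D z -> 0 < Re z) -> exists K', Holo D (Ku u) K'.
Proof. eexists. apply Holo_div.
 - intros z Hz. assert (X : cderiv (fun s => s+1)%C z (1+0)) by (apply cderiv_plus; [apply cderiv_id|apply cderiv_const]). split. apply (cderiv_Rcpow_comp u _ z _ X).
  cont.
 - cont.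
 - intros z Hz. specialize (H z Hz). apply Cmult_neq_0; re_contra.
Qed.

Lemma shift_contour H H' u a T e M : 0 < a <= 2 -> 1 <= u -> 0 < T -> 0 < e -> Holo (orect a 2 T e) H H' ->
 (forall x, a <= x <= 2 -> Cmod (H (x, T)) <= M /\ Cmod (H (x, (- T)%R)) <= M) ->
 Cmod (vline (fun s => H s*Ku u s)%C 2 T-vline (fun s => H s*Ku u s)%C a T) <= 4*M*u^3/(T*T).
Proof.
 intros Ha Hu HT He HH HM. set (e' := Rmin e (a/2)). assert (e1 : 0 < e') by (apply Rmin_pos; lra). assert (e2 : e' <= e) by apply Rmin_l. assert (e3 : e' <= a/2) by apply Rmin_r.
 assert (HH' : Holo (orect a 2 T e') H H') by (apply Holo_sub with (2 := HH); unfold orect; cont).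
 destruct (Holo_Ku u (orect a 2 T e')) as (K' & HK). unfold orect; cont.
 assert (HP := Holo_mult _ _ _ _ _ HH' HK). rewrite (Cauchy_rectangle _ _ _ _ _ _ (proj2 Ha) (Rlt_le _ _ HT) e1 HP).
 assert (B : forall t, t = T \/ t = - T -> Cmod (hline (fun s => H s*Ku u s)%C t a 2) <= M*(u^3/(T*T))*(2-a)).
 { intros t Ht. apply CInt_bound; try lra.
  - apply (contin_hline _ _ _ _ _ _ _ e1 HP); lra.
  - intros x Hx. rewrite Cmod_mult. specialize (HM x Hx). mul. destruct Ht as [-> | ->]; lra.
   replace (T*T) with (t*t) by (destruct Ht as [-> | ->]; lra). apply Ku_horizontal; lra. }
 rewrite Cmod_mult, Cmod_opp. replace (Cmod Ci) with 1 by (unfold Cmod, Ci; simpl; replace (0*(0*1)+1*(1*1)) with 1 by ring; rewrite sqrt_1; lra). rewrite Rmult_1_l.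
 assert (B1 := B T (or_introl eq_refl)). assert (B2 := B (- T) (or_intror eq_refl)). tr Cmod_sub_le.
 assert (0 <= M) by (destruct (HM a ltac:(lra)) as (X & _); tr Cmod_ge_0; apply X). assert (0 <= M*(u^3/(T*T))) by pos.
 nra.
Qed.
Lemma line_bound H u a T M : 0 < a <= 2 -> 0 <= T -> contv H a T -> (forall t, - T <= t <= T -> Cmod (H (a, t)) <= M) ->
 Cmod (vline (fun s => H s*Ku u s)%C a T) <= 16*M*(Rpower u (a+1)/a).
Proof.
 intros Ha HT HC HM. assert (M0 : 0 <= M) by (specialize (HM 0 ltac:(lra)); tr Cmod_ge_0; apply HM).
 assert (X := hline_inv_sqr_bound (fun z => H (a, Re z)*Ku u (a, Re z))%C 0 (2*(M*(Rpower u (a+1)/a))) 1 (- T) T).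
 via (8*(2*(M*(Rpower u (a+1)/a)))/1); [|lra]. apply X; try lra.
 - pos.
 - apply (contv_contin (fun s => H s*Ku u s)%C). intros t Ht. apply ccont_mult; auto. apply ccont_Ku; simpl; lra.
 - intros t Ht. rewrite Cmod_mult. via (M*(Rpower u (a+1)/a*(8/((Rabs t+1)*(Rabs t+1))))).
  mul; auto. apply Ku_vertical; lra. nra.
Qed.
Lemma FF_zdata K Z g g' s : zdata K Z g g' -> half_plane (-1) s -> zf s <> 0 -> FF s = (- (clsum Z (fun rho => / (s-rho))+g' s/g s))%C.
Proof.
 intros H Hh N. destruct H as (Hd & _).
 assert (P0 : Cprod Z s <> 0) by (intro E; apply N; rewrite (proj2 Hd), E by auto; ring). assert (G0 : g s <> 0) by (intro E; apply N; rewrite (proj2 Hd), E by auto; ring).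
 assert (E : zf' s = (Cprod' Z s*g s+Cprod Z s*g' s)%C).
 { apply (cderiv_unique zf s). apply Holo_zf; pos. assert (X := Holo_mult _ _ _ _ _ (Holo_Cprod (half_plane (-1)) Z) (proj1 Hd)).
  apply Holo_ext with (g := zf) in X. apply X; pos. apply copen_half_plane. intros z Hz. symmetry. apply Hd; pos. }
 unfold FF. rewrite E, (proj2 Hd s Hh), Cprod'_log. field; auto. intros rho Hr ->. apply P0, Cprod_root; pos.
Qed.
Lemma zdata_length K Z g g' : zdata K Z g g' -> INR (length Z) <= Nbar K*(2*INR K+1).
Proof.
 intro H. rewrite <- lsum_length. eapply Rle_trans. apply (zeros_by_height K Z (fun _ => 1) (fun _ => 1) (Nbar K)); try (cont).
 apply H. intros i Hi. apply (zdata_count K Z g g' i H Hi). rewrite lsum_length, length_seq, plus_INR, mult_INR. simpl. lra.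
Qed.
(** For |t| > K the end point of the range is taken: replacing t by it only shortens the distances
    to the other heights. *)
Lemma height_index K t : exists i, (i <= 2*K)%nat /\ forall j, (j <= 2*K)%nat -> INR (adist i j) <= Rabs (t-ht K j)+1/2.
Proof.
 destruct (Rle_dec (Rabs t) (INR K)) as [L|L].
 - destruct (nearest_height K t L) as (i & Hi & D). exists i; split; auto. intros j Hj. rewrite <- (ht_diff K).
  replace (ht K i-ht K j) with ((t-ht K j) + - (t-ht K i)) by ring. tr Rabs_triang. rewrite Rabs_Ropp. lra.
 - assert (HJ : forall j, (j <= 2*K)%nat -> - INR K <= ht K j <= INR K) by (intros j Hj; assert (X := ht_abs K j Hj); apply Rabs_le_between in X; lra).
  destruct (Rle_dec 0 t) as [P|P].
  + rewrite Rabs_right in L by lra. exists (2*K)%nat; split; [lia|]. intros j Hj. specialize (HJ j Hj). rewrite <- (ht_diff K). assert (E : ht K (2*K) = INR K) by (unfold ht; rewrite mult_INR; simpl; lra). rewrite !Rabs_right by lra. lra.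
  + rewrite Rabs_left in L by lra. exists 0%nat; split; [lia|]. intros j Hj. specialize (HJ j Hj). rewrite <- (ht_diff K). assert (E : ht K 0 = - INR K) by (unfold ht; simpl; lra). rewrite !Rabs_left1 by lra. lra.
Qed.
Lemma line2_sum K Z g g' t : zdata K Z g g' -> lsum Z (fun rho => / Cmod ((2, t)-rho)) <= hK K.
Proof.
 intro H. destruct (height_index K t) as (i & Hi & D).
 assert (R1 : forall rho, In rho Z -> 1 <= Cmod ((2, t)-rho)).
 { intros rho Hr. destruct (zdata_in_zero K Z g g' rho H Hr) as (_ & X & _). assert (Y := re_le_Cmod ((2, t)-rho)). rewrite Re_Cminus in Y. simpl in Y. rewrite Rabs_right in Y by lra. lra. }
 apply (zeros_harmonic K Z g g' i _ H Hi).
 - intros rho Hr. specialize (R1 rho Hr). pos.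
 - intros j rho Hj Hr Hc. specialize (R1 rho Hr). specialize (D j Hj). assert (X := Im_in_disc rho (ht K j) 1.5 ltac:(lra)).
  assert (Y := im_le_Cmod ((2, t)-rho)). rewrite Im_Cminus in Y. simpl in Y.
  assert (Rabs (t-ht K j) <= Rabs (t-Im rho)+1.5). { replace (t-ht K j) with ((t-Im rho)+(Im rho-ht K j)) by ring. tr Rabs_triang. apply Rplus_le_compat_l, Rabs_le_between. lra. }
  assert (A0 := pos_INR (adist i j)). apply (Rmult_le_reg_r (Cmod ((2, t)-rho)*(INR (adist i j)+1))). pos.
  field_simplify; lra.
Qed.
Definition Hb (K : nat) : R := 1000*lt5 (INR K)+hK K.
Lemma hK_ge K : 40*Nbar K <= hK K.
Proof.
 unfold hK. assert (0 <= ln (INR (2*K+1))). { rewrite <- ln_1. apply ln_le_mono; [lra|]. rewrite plus_INR. generalize (pos_INR (2*K)). simpl; lra. }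
 assert (X := Nbar_pos K). nra.
Qed.
Lemma Nbar_ge K : 1 <= Nbar K. Proof. unfold Nbar. generalize (lt5_ge (INR K)). lra. Qed.

Lemma contv_pole p u T : Re p < 2 -> contv (fun s => / (s-p)*Ku u s)%C 2 T.
Proof.
 intros Hp t _. apply ccont_mult; [|apply ccont_Ku; simpl; lra]. apply ccont_inv. cont. re_contra.
Qed.
(** Beyond T one has 1/t^2 <= 4/(|t|+T)^2, so each of the two added segments falls under
    [hline_inv_sqr_bound] with c = T. *)
Lemma vline_tail f a T T' M : 0 < T <= T' -> 0 <= M -> contv f a T' -> (forall t, T <= Rabs t <= T' -> Cmod (f (a, t)) <= M/(t*t)) ->
 Cmod (vline f a T'-vline f a T) <= 16*M/T.
Proof.
 intros HT HM HC HB. assert (C' := contv_contin _ _ _ HC).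
 assert (E : (vline f a T'-vline f a T = CInt (fun t => f (a, t)) (- T') (- T)+CInt (fun t => f (a, t)) T T')%C).
 { unfold vline. rewrite <- (CInt_Chasles _ (- T') (- T) T') by pos. rewrite <- (CInt_Chasles _ (- T) T T') by (try lra; intros t Ht; cont). ring. }
 rewrite E. replace (16*M/T) with (8*M/T+8*M/T) by lra. tr Cmod_triangle.
 assert (G : forall b c, b <= c -> (forall t, b <= t <= c -> T <= Rabs t <= T') -> Cmod (CInt (fun t => f (a, t)) b c) <= 8*M/T).
 { intros b c Hbc HR. assert (X := hline_inv_sqr_bound (fun z => f (a, Re z)) 0 M T b c). unfold hline in X; simpl Re in X. apply X; try lra.
  - intros t Ht. specialize (HR t Ht). apply C'. assert (Y := Rle_abs t). assert (Y' := Rle_abs (- t)). rewrite Rabs_Ropp in Y'. lra.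
  - intros t Ht. specialize (HR t Ht). eapply Rle_trans; [auto|]. mull. rewrite <- Rabs_sqr_eq.
   apply (Rmult_le_reg_r (Rabs t*Rabs t*((Rabs t+T)*(Rabs t+T)))). pos. field_simplify; try lra. nra. }
 apply Rplus_le_compat; apply G; try lra; intros t Ht; [rewrite Rabs_left1 by lra|rewrite Rabs_right by lra]; lra.
Qed.
Lemma zdata_window K s : 0 <= Re s <= 2.4 -> Rabs (Im s) <= INR K -> exists i, (i <= 2*K)%nat /\ Rabs (Im s-ht K i) <= 1/2 /\ Cmod (s-zcen (ht K i)) <= 1.3.
Proof. intros H1 H2. destruct (nearest_height K (Im s) H2) as (i & Hi & D). exists i. repeat split; auto. apply window_disc; lra. Qed.
(** On Re s = 2 the function [FF] is minus the sum of 1/(s-rho) over the listed zeros minus g'/g.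
    The second part is holomorphic up to height K - 1 and is moved to Re s = a; the first gives
    residues, zero by zero. Perron's formula wants the zeros below half the height of integration,
    so those integrals are first prolonged from K - 1 to K^2. The condition [u^3 <= INR K] makes all
    factors u^3/T bounded. *)
Lemma explicit_formula K Z g g' u N a : zdata K Z g g' -> 1 < u -> u <= INR N -> u^3 <= INR K -> 10 <= INR K -> 0 < a <= 1 ->
 Cmod (RtoC (A1 N u)+clsum Z (fun rho => Rp rho u)) <= 1000*Hb K*(Rpower u (a+1)/a).
Proof.
 intros HZ Hu HN HK K10 Ha. set (T := INR K-1). set (T' := INR K*INR K). set (h := hK K). set (B := Hb K).
 assert (hN : 40*Nbar K <= h) by apply hK_ge. assert (N1 := Nbar_ge K). assert (L1 := lt5_ge (INR K)). assert (hB : h <= B-1600) by (unfold B, Hb; fold h; lra).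
 assert (u3 : 0 < u^3) by pos.
 set (H := fun s => (g' s/g s)%C). set (e := Rmin (a/2) (1/4)). assert (e0 : 0 < e) by (apply Rmin_pos; lra). assert (e1 : e <= a/2) by apply Rmin_l. assert (e2 : e <= 1/4) by apply Rmin_r.
 assert (Dom : forall z, orect a 2 T e z -> half_plane (-1) z /\ g z <> 0).
 { intros z (D1 & D2). split. unfold half_plane; lra. destruct (zdata_window K z) as (i & Hi & _ & X). lra. apply Rabs_le_between. unfold T in *; lra.
  apply HZ. exists i. cont. }
 assert (HH : exists H', Holo (orect a 2 T e) H H').
 { eexists. apply Holo_div. 3: intros; apply Dom; pos. apply Holo_sub with (half_plane (-1)). apply Dom. apply Holo_deriv with g. apply copen_half_plane. apply HZ.
  apply Holo_sub with (half_plane (-1)). apply Dom. apply HZ. }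
 destruct HH as (H' & HH).
 assert (HBd : forall x t, 0 <= x <= 2 -> - T <= t <= T -> Cmod (H (x, t)) <= B).
 { intros x t Hx Ht. destruct (zdata_window K (x, t)) as (i & Hi & X & Y). simpl; lra. simpl. apply Rabs_le_between; unfold T in *; lra. apply (log_deriv_bound K Z g g' i); pos. }
 assert (CH : forall x, a <= x <= 2 -> contv H x T). { intros x Hx t Ht. apply (Holo_ccont _ _ _ _ HH). unfold orect; simpl; lra. }
 assert (S1 := shift_contour H H' u a T e B ltac:(lra) ltac:(lra) ltac:(unfold T; lra) e0 HH ltac:(split; apply HBd; unfold T; lra)).
 assert (S2 := line_bound H u a T B ltac:(lra) ltac:(unfold T; lra) (CH a ltac:(lra)) ltac:(cont)).
 assert (S3 := A1_Perron u N T Hu HN ltac:(unfold T; lra)).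
 assert (ZR : forall rho, In rho Z -> -1 < Re rho <= 1 /\ Rabs (Im rho) <= T'/2 /\ rho <> 0).
 { intros rho Hr. destruct (zdata_in_zero K Z g g' rho HZ Hr) as (_ & X & Y). split; [lra|]. split.
  - destruct HZ as (_ & HP & _). destruct (HP rho Hr) as (i & Hi & D). assert (W := Im_in_disc rho (ht K i) 1.5 ltac:(lra)). assert (V := ht_abs K i Hi). apply Rabs_le_between in V.
   apply Rabs_le_between. unfold T'. nra.
  - intros ->. rewrite Im_RtoC, Rabs_R0 in Y. lra. }
 set (pt := fun rho s => (/ (s-rho)*Ku u s)%C).
 assert (T0 : 0 <= T) by (unfold T; lra). assert (T'0 : T <= T') by (unfold T, T'; nra).
 destruct (vline_clsum Z pt 2 T T0) as (E1 & C1). { intros rho Hr. apply contv_pole. apply ZR in Hr; lra. }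
 destruct (vline_clsum Z pt 2 T' ltac:(lra)) as (E2 & C2). { intros rho Hr. apply contv_pole. apply ZR in Hr; lra. }
 set (V := fun s => clsum Z (fun rho => pt rho s)) in *.
 assert (EV : forall s, V s = (clsum Z (fun rho => / (s-rho))*Ku u s)%C) by (intro s; unfold V, pt; rewrite Cmult_comm, <- clsum_scal; apply clsum_ext; intros; ring).
 assert (S4 : Cmod (vline V 2 T'-vline V 2 T) <= 16*(h*u^3)/T).
 { apply vline_tail; auto. unfold T in *; lra. nra. intros t Ht. rewrite EV, Cmod_mult. replace (h*u^3/(t*t)) with (h*(u^3/(t*t))) by lra.
  mul. trr (line2_sum K Z g g' t HZ). apply clsum_Cmod. intros rho Hr. rewrite Cmod_inv. lra.
  intro E. apply ZR in Hr. apply (f_equal Re) in E. rewrite Re_Cminus in E. simpl in E. lra.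
  apply Ku_horizontal; try lra. intros ->. rewrite Rabs_R0 in Ht. unfold T in Ht; lra. }
 set (RS := clsum Z (fun rho => Rp rho u)).
 assert (S5 : Cmod (vline V 2 T'-RtoC (2*PI)*RS) <= 128*u^3/T'*INR (length Z)).
 { rewrite E2. unfold RS. rewrite <- clsum_scal, <- lsum_length, <- lsum_scal.
  replace (clsum Z (fun rho => vline (pt rho) 2 T')-clsum Z (fun x => RtoC (2*PI)*Rp x u))%C with (clsum Z (fun rho => vline (pt rho) 2 T'-RtoC (2*PI)*Rp rho u)%C).
  - apply clsum_Cmod. intros rho Hr. rewrite Rmult_1_r. apply ZR in Hr. apply Perron_pole; try tauto. unfold T'; nra.
  - replace (clsum Z (fun rho => vline (pt rho) 2 T')-clsum Z (fun x => RtoC (2*PI)*Rp x u))%C with (clsum Z (fun rho => vline (pt rho) 2 T') + -(1)*clsum Z (fun x => RtoC (2*PI)*Rp x u))%C by ring.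
   rewrite <- clsum_scal, <- clsum_plus. apply clsum_ext. intros; ring. }
 assert (S6 : vline (fun s => FF s*Ku u s)%C 2 T = (- (vline V 2 T+vline (fun s => H s*Ku u s)%C 2 T))%C).
 { assert (CHK : contv (fun s => H s*Ku u s)%C 2 T) by (intros t Ht; apply ccont_mult; [apply (CH 2); lra|apply ccont_Ku; simpl; lra]).
  rewrite <- vline_plus by auto. replace (- vline (fun s => V s+H s*Ku u s) 2 T)%C with (-(1)*vline (fun s => V s+H s*Ku u s) 2 T)%C by ring.
  rewrite <- vline_mult_const; auto. 2: intros t Ht; cont.
  apply vline_ext; auto. intros t Ht. rewrite EV, (FF_zdata K Z g g') by (auto; try apply zf_neq_0; unfold half_plane; simpl; lra). unfold H. ring. }
 rewrite S6 in S3. set (VT := vline V 2 T) in *. set (VT' := vline V 2 T') in *. set (V2 := vline (fun s => H s*Ku u s)%C 2 T) in *. set (Va := vline (fun s => H s*Ku u s)%C a T) in *.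
 set (P := 2*PI) in *. assert (P0 : 1 <= P) by (unfold P; generalize PI2_1; lra).
 rewrite RtoC_mult in S3.
 set (W := Rpower u (a+1)/a) in *. assert (W1 : 1 <= W). { via (1/a). apply (Rmult_le_reg_r a); [lra|]. unfold Rdiv. rewrite Rmult_assoc, Rinv_l; lra. apply Rmult_le_compat_r. pos. via (Rpower u 0); [rewrite Rpower_O; lra|]. apply Rpower_le_base; lra. }
 assert (F : Cmod (RtoC P*(RtoC (A1 N u)+RS)) <= 640*u^3/T+(16*(h*u^3)/T+(128*u^3/T'*INR (length Z)+(4*B*u^3/(T*T)+16*B*W)))).
 { replace (RtoC P*(RtoC (A1 N u)+RS))%C with (- ((- (VT+V2)-P*A1 N u)+((VT-VT')+((VT'-P*RS)+((V2-Va)+Va)))))%C by ring.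
  rewrite Cmod_opp. rewrite Cmod_minus_sym in S4.
  repeat (tr Cmod_triangle; apply Rplus_le_compat; auto). }
 rewrite Cmod_mult, Cmod_RtoC_pos in F by lra.
 assert (T9 : 0 < T) by (unfold T; lra).
 assert (uT : u^3/T <= 1.2). { apply (Rmult_le_reg_r T); auto. unfold Rdiv. rewrite Rmult_assoc, Rinv_l by lra. unfold T in *; lra. }
 assert (uT0 : 0 <= u^3/T) by pos.
 assert (Q1 : 640*u^3/T <= 768) by lra.
 assert (Q2 : 16*(h*u^3)/T <= 20*h) by (nra).
 assert (Q3 : 4*B*u^3/(T*T) <= B). { replace (4*B*u^3/(T*T)) with (4*B*(u^3/T) * / T) by fld. assert (/ T <= / 9) by (apply Rinv_le_contravar; unfold T; lra). assert (0 < / T) by pos.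
   via (4*B*1.2 * / 9); [|lra]. apply Rmult_le_compat; try lra. pos. mull; lra. }
 assert (Q4 : 128*u^3/T'*INR (length Z) <= 270*Nbar K).
 { assert (LZ := zdata_length K Z g g' HZ). via (128*u^3/T'*(Nbar K*(2*INR K+1))).
  apply Rmult_le_compat_l; auto. pos.
  via (128*INR K/T'*(Nbar K*(21/10*INR K))). 2: via (2688/10*Nbar K); [right; unfold T'; fld|lra].
  mul. apply Rmult_le_compat_r. pos. lra. mull; lra. }
 assert (C0 := Cmod_ge_0 (RtoC (A1 N u)+RS)).
 assert (B <= B*W) by nra. nra.
Qed.

(** * Mean squares *)

Lemma Cauchy_Schwarz_RInt (f : R -> R) a b : a <= b -> (forall t, a <= t <= b -> continuous f t) ->
 RInt f a b*RInt f a b <= (b-a)*RInt (fun t => f t*f t) a b.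
Proof.
 intros H Hc. destruct (Req_dec a b) as [->|N]. { rewrite !RInt_point. unfold zero; simpl. lra. }
 assert (E1 : ex_RInt f a b) by cont.
 assert (E2 : ex_RInt (fun t => f t*f t) a b) by cont.
 destruct (ex_intro (fun I : R => I = RInt f a b) _ eq_refl) as (I & EI). set (m := I/(b-a)).
 assert (P : 0 <= RInt (fun t => f t*f t+(-2*m*f t+m*m)) a b).
 { apply RInt_ge_0; auto. cont. intros t Ht. replace (f t*f t+(-2*m*f t+m*m)) with ((f t-m)*(f t-m)) by ring. apply Rle_0_sqr. }
 assert (EP : RInt (fun t => f t*f t+(-2*m*f t+m*m)) a b = RInt (fun t => f t*f t) a b+(-2*m*RInt f a b+(b-a)*(m*m))).
 { rewrite (RInt_plus_R (fun t => f t*f t) (fun t => -2*m*f t+m*m)), (RInt_plus_R (fun t => -2*m*f t) (fun _ => m*m)), RInt_scal_R, RInt_const_R; [lra|pos|cont|cont|pos|].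
  cont. } destruct (ex_intro (fun I : R => I = RInt (fun t => f t*f t) a b) _ eq_refl) as (Q & EQ). assert (Em : I = m*(b-a)) by (unfold m; fld).
 nra.
Qed.
Lemma Cauchy_Schwarz_CInt f a b : a <= b -> contin f a b -> Cmod (CInt f a b)^2 <= (b-a)*RInt (fun t => Cmod (f t)^2) a b.
Proof.
 intros H Hc. assert (X := CInt_norm_le f a b H Hc). assert (Y := Cauchy_Schwarz_RInt (fun t => Cmod (f t)) a b H ltac:(cont)).
 rewrite (RInt_ext (fun t => Cmod (f t)^2) (fun t => Cmod (f t)*Cmod (f t))) by (intros; lra).
 assert (Z := Cmod_ge_0 (CInt f a b)). nra.
Qed.
Lemma is_derive_RInt_upper (f : R -> R) a b : (forall t, continuous f t) -> is_derive (fun x => RInt f a x) b (f b).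
Proof.
 intro H. apply (is_derive_RInt f (fun x => RInt f a x) a b). exists (mkposreal 1 Rlt_0_1). intros y _. apply (RInt_correct (V := R_CompleteNormedModule)). apply ex_RInt_continuous. auto. auto.
Qed.
Lemma ex_RInt_all (f : R -> R) a b : (forall t, continuous f t) -> ex_RInt f a b.
Proof. intro H. apply (ex_RInt_continuous (V := R_CompleteNormedModule)). auto. Qed.
#[export] Hint Resolve ex_RInt_all : cont.
Lemma mean_sq_difference (Y Y1 : R -> R) a b h : a <= b -> 0 <= h -> (forall t, a-h <= t <= b -> is_derive Y t (Y1 t) /\ continuous Y1 t) ->
 RInt (fun u => (Y u-Y (u-h))^2) a b <= h^2*RInt (fun u => Y1 u^2) (a-h) b.
Proof.
 (* [w] clamps its argument to the interval, so that the integrand becomes continuous on the whole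
    line and its primitives are differentiable everywhere. *)
 intros Hab Hh HY. set (w := fun t => Rmax (a-h) (Rmin b t)). set (y := fun t => Y1 (w t)).
 assert (wr : forall t, a-h <= w t <= b) by (intro t; assert (X := Rmax_l (a-h) (Rmin b t)); split; auto; apply Rmax_lub; [lra|apply Rmin_l]).
 assert (we : forall t, a-h <= t <= b -> w t = t) by (intros t Ht; unfold w; rewrite Rmin_right, Rmax_right; lra).
 assert (wc : forall t, continuous w t).
 { intro t. apply continuity_pt_filterlim. apply continuity_pt_filterlim. intros P (eps & HP). exists eps. intros z Hz. apply HP. change (Rabs (z-t) < eps) in Hz. change (Rabs (w z-w t) < eps). eapply Rle_lt_trans; [|apply Hz].
  unfold w, Rmax, Rmin, Rabs. repeat destruct Rle_dec; repeat destruct Rcase_abs; lra. }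
 assert (yc : forall t, continuous y t) by (intro t; apply (continuous_comp w Y1); auto; apply HY; auto).
 set (q := fun t => y t*y t). assert (qc : forall t, continuous q t) by (intro t; apply continuous_mult_R; auto). assert (q0 : forall t, 0 <= q t) by (intro t; apply Rle_0_sqr).
 set (P := fun u => RInt q (a-h) u). assert (Pd : forall u, is_derive P u (q u)) by (intro u; apply is_derive_RInt_upper; pos).
 assert (Pc : forall u, continuous P u) by (intro u; apply (ex_derive_continuous P); eexists; cont).
 set (R1 := fun u => RInt P (a-h) u). assert (Rd : forall u, is_derive R1 u (P u)) by (intro u; apply is_derive_RInt_upper; pos).
 assert (PM : forall u v, u <= v -> P u <= P v).
 { intros u v Huv. unfold P. rewrite <- (RInt_Chasles_R q (a-h) u v) by cont. assert (0 <= RInt q u v) by (apply RInt_ge_0; cont). lra. }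
 assert (P00 : P (a-h) = 0) by (unfold P; rewrite RInt_point; cont).
 assert (Yc : forall u, a <= u <= b -> continuous (fun u => (Y u-Y (u-h))^2) u).
 { intros u Hu. apply (ex_derive_continuous (fun u => (Y u-Y (u-h))^2)). exists (INR 2*(Y1 u-Y1 (u-h))*(Y u-Y (u-h))^1). apply (is_derive_pow (fun u => Y u-Y (u-h)) 2).
  apply (is_derive_minus (K := R_AbsRing) (V := R_NormedModule)). apply HY; lra. replace (Y1 (u-h)) with (1*Y1 (u-h)) by ring. apply (is_derive_comp Y (fun u => u-h)). apply HY; lra. auto_derive; lra. }
 via (RInt (fun u => h*(P u + -1*P (u-h))) a b).
 - assert (Pc2 : forall t, continuous (fun u => h*(P u + -1*P (u-h))) t).
  { intro t. apply (continuous_mult (K := R_AbsRing) (fun _ => h)); [cont|]. apply (continuous_plus (V := R_NormedModule)); auto. apply (continuous_mult (K := R_AbsRing) (fun _ => -1)); [cont|].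
   apply (continuous_comp (fun u => u-h) P); auto. cont. }
  apply RInt_le; auto. cont. cont.
  intros u Hu. assert (E : Y u-Y (u-h) = RInt y (u-h) u).
  { symmetry. apply is_RInt_unique. apply (is_RInt_derive Y y); minmax; intros t Ht; auto. unfold y. rewrite we by lra. apply HY; lra. }
  rewrite E. assert (X := Cauchy_Schwarz_RInt y (u-h) u ltac:(lra) ltac:(auto)). simpl. rewrite Rmult_1_r.
  replace (P u + -1*P (u-h)) with (RInt q (u-h) u). replace (u-(u-h)) with h in X by ring. apply X.
  unfold P. rewrite <- (RInt_Chasles_R q (a-h) (u-h) u) by cont. lra.
 - assert (E : RInt (fun u => h*(P u + -1*P (u-h))) a b = h*((R1 b-R1 (b-h))-(R1 a-R1 (a-h)))).
  { replace (h*((R1 b-R1 (b-h))-(R1 a-R1 (a-h)))) with (h*(R1 b-R1 (b-h))-h*(R1 a-R1 (a-h))) by ring. apply is_RInt_unique. apply (is_RInt_derive (fun u => h*(R1 u-R1 (u-h)))).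
   - intros t _. apply (is_derive_scal (fun u => R1 u-R1 (u-h))). replace (P t + -1*P (t-h)) with (P t-1*P (t-h)) by ring. apply (is_derive_minus (K := R_AbsRing) (V := R_NormedModule)); auto.
    apply (is_derive_comp R1 (fun u => u-h)); auto. auto_derive; lra.
   - intros t _. apply (continuous_mult (K := R_AbsRing) (fun _ => h)); [cont|]. apply (continuous_plus (V := R_NormedModule)); auto. apply (continuous_mult (K := R_AbsRing) (fun _ => -1)); [cont|].
   apply (continuous_comp (fun u => u-h) P); auto. cont. } assert (B1 : R1 b-R1 (b-h) <= h*P b).
  { unfold R1. rewrite <- (RInt_Chasles_R P (a-h) (b-h) b) by cont. replace (h*P b) with ((b-(b-h))*P b) by ring. rewrite <- RInt_const_R.
   assert (RInt P (b-h) b <= RInt (fun _ => P b) (b-h) b) by (apply RInt_le; cont). lra. }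
  assert (B2 : 0 <= R1 a-R1 (a-h)).
  { unfold R1 at 2. rewrite RInt_point, Rminus_0_r. apply RInt_ge_0; try cont. intros t Ht. rewrite <- P00. cont. }
  replace (RInt (fun u => Y1 u^2) (a-h) b) with (P b). nra.
  apply RInt_ext. minmax. intros t Ht. unfold q, y. rewrite we by lra. lra.
Qed.
Lemma param_continuous_le (f : R -> R -> R) a b y : a <= b -> (forall r y, continuity_2d_pt f r y) -> continuous (fun y => RInt (fun r => f r y) a b) y.
Proof.
 intros Hab Hf.
 assert (cf : forall y r, continuous (fun r => f r y) r).
 { intros y' r P (eps & HP). destruct (Hf r y' eps) as (d & Hd). exists d. intros z Hz. apply HP. apply Hd. apply Hz. rewrite Rminus_diag, Rabs_R0. apply cond_pos. }
 intros P (eps & HP). set (e := mkposreal (eps/(b-a+1)) ltac:(apply Rdiv_lt_0_compat; [apply cond_pos|lra])).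
 destruct (uniform_continuity_2d_1d f a b y (fun r _ => Hf r y) e) as (d & Hd). exists d. intros z Hz. apply HP. change (Rabs (z-y) < d) in Hz. change (Rabs (RInt (fun r => f r z) a b-RInt (fun r => f r y) a b) < eps).
 assert (E : RInt (fun r => f r z) a b-RInt (fun r => f r y) a b = RInt (fun r => f r z + -1*f r y) a b).
 { assert (F : forall v, ex_RInt (fun r => f r v) a b) by cont.
  rewrite (RInt_plus_R (fun r => f r z) (fun r => -1*f r y)), RInt_scal_R; [lra|auto|auto|cont]. }
 rewrite E. apply Rabs_def2 in Hz. assert (D0 := cond_pos d).
 apply Rle_lt_trans with ((b-a)*e).
 - apply (abs_RInt_le_const (fun r => f r z + -1*f r y) a b e); auto. cont.
  intros t Ht. left. replace (f t z + -1*f t y) with (f t z-f t y) by ring. apply Hd; try lra. rewrite Rminus_diag, Rabs_R0. auto.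
 - simpl. assert (E0 := cond_pos eps). apply (Rmult_lt_reg_r (b-a+1)); [lra|]. unfold Rdiv. replace ((b-a)*(eps * / (b-a+1))*(b-a+1)) with ((b-a)*eps*(/ (b-a+1)*(b-a+1))) by ring. rewrite Rinv_l by lra. lra.
Qed.
Lemma param_continuous (f : R -> R -> R) a b y : (forall r y, continuity_2d_pt f r y) -> continuous (fun y => RInt (fun r => f r y) a b) y.
Proof.
 intro Hf. destruct (Rle_dec a b). apply param_continuous_le; pos.
 apply continuous_ext with (fun y => opp (RInt (fun r => f r y) b a)). intro z. apply (opp_RInt_swap (fun r => f r z)). apply ex_RInt_cont_R; [lra|]. intros t _. intros P (eps & HP). destruct (Hf t z eps) as (d & Hd). exists d. intros v Hv. apply HP. apply Hd. apply Hv. rewrite Rminus_diag, Rabs_R0. apply cond_pos.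
 apply (continuous_opp (V := R_NormedModule)). apply param_continuous_le; auto. lra.
Qed.
Lemma continuity_2d_swap (f : R -> R -> R) x y : continuity_2d_pt f x y -> continuity_2d_pt (fun u v => f v u) y x.
Proof. intros H eps. destruct (H eps) as (d & Hd). exists d. auto. Qed.
Lemma continuity_2d_1 (f : R -> R -> R) y r : (forall r y, continuity_2d_pt f r y) -> continuous (fun r => f r y) r.
Proof. intros Hf P (eps & HP). destruct (Hf r y eps) as (d & Hd). exists d. intros z Hz. apply HP. apply Hd. apply Hz. rewrite Rminus_diag, Rabs_R0. apply cond_pos. Qed.
(** As functions of [b] both sides vanish at 0 and have the same derivative. *)
Lemma Fubini (f : R -> R -> R) b c d : (forall r y, continuity_2d_pt f r y) ->
 RInt (fun y => RInt (fun r => f r y) 0 b) c d = RInt (fun r => RInt (fun y => f r y) c d) 0 b.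
Proof.
 intros Hf. assert (cf : forall y r, continuous (fun r => f r y) r) by (intros; apply continuity_2d_1; pos).
 assert (Hf' : forall r y, continuity_2d_pt (fun u v => f v u) r y) by (intros; apply continuity_2d_swap; auto).
 set (Phi := fun b => RInt (fun y => RInt (fun r => f r y) 0 b) c d).
 assert (DP : forall t, is_derive Phi t (RInt (fun y => f t y) c d)).
 { intros t. assert (DE : forall z v, Derive (fun z => RInt (fun r => f r v) 0 z) z = f z v) by (intros z v; apply is_derive_unique, (is_derive_RInt_upper (fun r => f r v)); auto).
  rewrite <- (RInt_ext (fun y => Derive (fun z => RInt (fun r => f r y) 0 z) t)) by auto.
  apply (is_derive_RInt_param (fun b y => RInt (fun r => f r y) 0 b)).
  - exists (mkposreal 1 Rlt_0_1). intros z _ v _. eexists. apply (is_derive_RInt_upper (fun r => f r v)); auto.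
  - intros v _. apply continuity_2d_pt_ext with f; auto.
  - exists (mkposreal 1 Rlt_0_1). intros z _. apply ex_RInt_all. intro y. apply param_continuous; pos. }
 assert (X : is_RInt (fun r => RInt (fun y => f r y) c d) 0 b (minus (Phi b) (Phi 0))).
 { apply (is_RInt_derive Phi). intros; cont. intros y _. apply (param_continuous (fun u v => f v u)); pos. }
 apply is_RInt_unique in X. rewrite X. change (Phi b = Phi b-Phi 0). replace (Phi 0) with 0. nra.
 unfold Phi. rewrite (RInt_ext _ (fun _ => 0)) by (intros; rewrite RInt_point; cont). rewrite RInt_const_R. ring.
Qed.

(** * Trigonometric polynomials and a Parseval inequality *)

Lemma cis_plus a b : cis (a+b) = (cis a*cis b)%C.
Proof. apply C_eq; simpl; [apply cos_plus|rewrite sin_plus; lra]. Qed.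
Lemma rderiv_cis_lin a y : rderiv (fun y => cis (a*y)) y (Ci*RtoC a*cis (a*y))%C.
Proof. apply rderiv_components; simpl; auto_derive; lra. Qed.
Lemma rcont_cis_lin a y : rcont (fun y => cis (a*y)) y.
Proof. eapply rderiv_rcont, rderiv_cis_lin. Qed.
#[export] Hint Resolve rcont_cis_lin : cont.
Lemma cis_period m y : cis (INR m*(y+2*PI)) = cis (INR m*y).
Proof. unfold cis. replace (INR m*(y+2*PI)) with (INR m*y+2*INR m*PI) by ring. rewrite cos_period, sin_period. auto. Qed.
Definition tpoly (c : nat -> C) (N : nat) (y : R) : C := clsum (seq 0 N) (fun k => c k*cis (INR k*y))%C.
Lemma tpoly_S c N y : tpoly c (S N) y = (tpoly c N y+c N*cis (INR N*y))%C.
Proof. unfold tpoly. rewrite clsum_seq_S. auto. Qed.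
Lemma rcont_tpoly c N y : rcont (tpoly c N) y.
Proof.
 induction N as [|N IH]. apply (rcont_const (RtoC 0)). apply rcont_ext with (fun y => tpoly c N y+c N*cis (INR N*y))%C. symmetry; apply tpoly_S.
 cont.
Qed.
#[export] Hint Resolve rcont_tpoly : cont.
Lemma CInt_cis m y0 : (1 <= m)%nat -> CInt (fun y => cis (- INR m*y)) y0 (y0+2*PI) = 0.
Proof.
 intro Hm. assert (m0 : INR m <> 0) by (apply not_0_INR; lia). assert (P := PI_RGT_0). assert (N : (Ci*RtoC (- INR m) <> 0)%C) by (intro E; apply (f_equal Im) in E; simpl in E; lra).
 rewrite (CInt_FTC (fun y => / (Ci*RtoC (- INR m))*cis (- INR m*y))%C); try lra.
 - replace (- INR m*(y0+2*PI)) with (- (INR m*(y0+2*PI))) by ring. replace (- INR m*y0) with (- (INR m*y0)) by ring.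
  assert (E : forall a, cis (- a) = Cconj (cis a)) by (intro a; unfold cis, Cconj; rewrite cos_neg, sin_neg; auto). rewrite !E, cis_period. ring.
 - intros t _. replace (cis (- INR m*t)) with (/ (Ci*RtoC (- INR m))*(Ci*RtoC (- INR m)*cis (- INR m*t)))%C by (field; repeat split; intro E; apply N; rewrite E; ring). apply rderiv_mult_const, rderiv_cis_lin.
 - intros t _. cont.
Qed.
Lemma tpoly_orthogonal c N M y0 : (N <= M)%nat -> CInt (fun y => tpoly c N y*cis (- INR M*y))%C y0 (y0+2*PI) = 0.
Proof.
 assert (P := PI_RGT_0). induction N as [|N IH]; intro H.
 - rewrite (CInt_ext _ (fun _ => RtoC 0)); [|lra|intros; unfold tpoly, clsum; simpl; ring]. rewrite CInt_const. ring.
 - assert (C1 : contin (fun y => tpoly c N y*cis (- INR M*y))%C y0 (y0+2*PI)) by (intros t _; cont).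
  assert (C2 : contin (fun y => cis (- INR (M-N)*y)) y0 (y0+2*PI)) by (intros t _; cont).
  rewrite (CInt_ext _ (fun y => tpoly c N y*cis (- INR M*y)+c N*cis (- INR (M-N)*y))%C); [|lra|].
  + assert (C3 : contin (fun y => c N*cis (- INR (M-N)*y))%C y0 (y0+2*PI)) by (intros t Ht; cont).
   rewrite CInt_plus, CInt_mult_const, IH, CInt_cis by (auto; try lra; try lia). ring.
  + intros t _. rewrite tpoly_S, minus_INR by lia. replace (- (INR M-INR N)*t) with (INR N*t + - INR M*t) by ring. rewrite cis_plus. ring.
Qed.
Lemma Cmod_sqr z : Cmod z^2 = Re z*Re z+Im z*Im z.
Proof. simpl. rewrite Rmult_1_r. apply Cmod_sq. Qed.
Lemma tpoly_norm c N y0 : RInt (fun y => Cmod (tpoly c N y)^2) y0 (y0+2*PI) = 2*PI*lsum (seq 0 N) (fun k => Cmod (c k)^2).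
Proof.
 assert (P := PI_RGT_0). induction N as [|N IH].
 - rewrite (RInt_ext _ (fun _ => 0)), RInt_const_R. unfold lsum; simpl; lra. intros y _. unfold tpoly, clsum; simpl. rewrite Cmod_0; lra.
 - rewrite lsum_seq_S.
  set (q := fun y => (Cconj (c N)*(tpoly c N y*cis (- INR N*y)))%C).
  assert (cq : contin q y0 (y0+2*PI)) by (intros t _; apply rcont_mult; cont).
  assert (E0 : RInt (fun y => Re (q y)) y0 (y0+2*PI) = 0).
  { change (Re (CInt q y0 (y0+2*PI)) = 0). assert (C3 : contin (fun y => tpoly c N y*cis (- INR N*y))%C y0 (y0+2*PI)) by (intros t _; cont).
   unfold q. rewrite CInt_mult_const, tpoly_orthogonal by cont. rewrite Cmult_0_r. auto. }
  assert (e1 : ex_RInt (fun y => Cmod (tpoly c N y)^2) y0 (y0+2*PI)).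
  { apply ex_RInt_all. intro t. apply continuous_ext with (fun y => Cmod (tpoly c N y)*Cmod (tpoly c N y)). intro; lra. cont. }
  assert (e2 : ex_RInt (fun y => Re (q y)) y0 (y0+2*PI)) by (apply contin_Re; pos).
  transitivity (RInt (fun y => Cmod (tpoly c N y)^2+(2*Re (q y)+Cmod (c N)^2)) y0 (y0+2*PI)).
  + apply RInt_ext. intros y _. rewrite tpoly_S, !Cmod_sqr. unfold q.
   replace (- INR N*y) with (- (INR N*y)) by ring. unfold cis, Cconj, Re, Im; simpl. rewrite cos_neg, sin_neg. assert (T := sin2_cos2 (INR N*y)). unfold Rsqr in T.
   nra.
  + rewrite (RInt_plus_R (fun y => Cmod (tpoly c N y)^2) (fun y => 2*Re (q y)+Cmod (c N)^2)), (RInt_plus_R (fun y => 2*Re (q y)) (fun _ => Cmod (c N)^2)), RInt_scal_R, RInt_const_R, E0;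
    [change (0+N)%nat with N; lra|exact e2|apply ex_RInt_scal_R; pos|apply ex_RInt_const|exact e1|apply ex_RInt_plus_R; [apply ex_RInt_scal_R; pos|cont]].
Qed.
Lemma CInt_shift f a b c : a <= b -> contin f (a+c) (b+c) -> CInt f (a+c) (b+c) = CInt (fun t => f (t+c)) a b.
Proof.
 intros H Hc. assert (G : forall p : C -> R, ex_RInt (fun t => p (f t)) (a+c) (b+c) -> RInt (fun t => p (f t)) (a+c) (b+c) = RInt (fun t => p (f (t+c))) a b).
 { intros p E. assert (X := RInt_comp_lin (fun t => p (f t)) 1 c a b). rewrite !Rmult_1_l in X. specialize (X E). rewrite <- X. apply RInt_ext. intros t _. rewrite !Rmult_1_l. lra. }
 unfold CInt. f_equal; apply G; [apply contin_Re|apply contin_Im]; pos.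
Qed.
Lemma RInt_shift (f : R -> R) a b c : ex_RInt f (a+c) (b+c) -> RInt f (a+c) (b+c) = RInt (fun t => f (t+c)) a b.
Proof.
 intro H. assert (X := RInt_comp_lin f 1 c a b). rewrite !Rmult_1_l in X. rewrite <- X by auto. apply RInt_ext. intros t _. rewrite !Rmult_1_l. lra.
Qed.
Lemma rcont_clsum (l : list nat) (f : nat -> R -> C) t : (forall k, rcont (f k) t) -> rcont (fun t => clsum l (fun k => f k t)) t.
Proof. intro H. induction l as [|k l IH]. apply (rcont_const (RtoC 0)). apply (rcont_plus (f k)); auto. Qed.
Lemma ccont_clsum (l : list nat) (f : nat -> C -> C) t : (forall k, ccont (f k) t) -> ccont (fun t => clsum l (fun k => f k t)) t.
Proof. intro H. induction l as [|k l IH]. apply (ccont_const (RtoC 0)). apply (ccont_plus (f k)); auto. Qed.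
Lemma continuous_lsum {A} (l : list A) (f : A -> R -> R) t : (forall k, continuous (f k) t) -> continuous (fun t => lsum l (fun k => f k t)) t.
Proof. intro H. induction l as [|k l IH]. cont. apply (continuous_plus_R (f k)); auto. Qed.
#[export] Hint Resolve rcont_clsum ccont_clsum continuous_lsum : cont.
Lemma CInt_unit_pieces f p N : (forall t, rcont f t) -> CInt f p (p+INR N) = CInt (fun r => clsum (seq 0 N) (fun k => f (r+(p+INR k)))) 0 1.
Proof.
 intro H. assert (S : forall c t, rcont (fun t => f (t+c)) t) by (intros c t; apply (rcont_comp (fun z => f (Re z)) (fun t => RtoC (t+c))); [apply H|cont]).
 induction N as [|N IH].
 - rewrite Rplus_0_r, CInt_point, (CInt_ext _ (fun _ => RtoC 0)) by cont. rewrite CInt_const. ring.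
 - rewrite S_INR. assert (N0 := pos_INR N). rewrite <- (CInt_Chasles f p (p+INR N)) by (try lra; intros t _; auto). rewrite IH.
  replace (p+INR N) with (0+(p+INR N)) by ring. replace (p+(INR N+1)) with (1+(p+INR N)) by ring. rewrite CInt_shift by (try lra; intros t _; auto).
  rewrite <- CInt_plus; try lra. apply CInt_ext; [lra|]. intros t _. rewrite clsum_seq_S. reflexivity. intros t _. cont. intros t _; cont.
Qed.
Lemma RInt_unit_pieces (f : R -> R) p N : (forall t, continuous f t) -> RInt f p (p+INR N) = RInt (fun r => lsum (seq 0 N) (fun k => f (r+(p+INR k)))) 0 1.
Proof.
 intro H. assert (X := CInt_unit_pieces (fun t => RtoC (f t)) p N ltac:(cont)). apply (f_equal fst) in X. etransitivity; [apply X|].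
 apply RInt_ext. intros t _. rewrite clsum_RtoC. auto.
Qed.
(** The range is cut into N unit pieces and t = r + p + k. For fixed r the sum over k is, up to a
    phase, a trigonometric polynomial in y, so over one period the orthogonality of finite sums
    gives equality; Cauchy-Schwarz in r over [0, 1] costs nothing. *)
Lemma Parseval (g : R -> C) p N y0 : (forall t, rcont g t) ->
 RInt (fun y => Cmod (CInt (fun t => g t*cis (t*y))%C p (p+INR N))^2) y0 (y0+2*PI) <= 2*PI*RInt (fun t => Cmod (g t)^2) p (p+INR N).
Proof.
 intro Hg. assert (P := PI_RGT_0).
 set (S := fun r y => clsum (seq 0 N) (fun k => g (r+(p+INR k))%R*cis ((r+(p+INR k))*y))%C).
 assert (gs : forall c z, ccont (fun z => g (Re z+c)) z).
 { intros c z. apply (ccont_comp (fun w => g (Re w)) (fun z => RtoC (Re z+c))). apply (ccont_Re_comp (fun x => x+c)). cont. apply Hg. }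
 assert (cx : forall c z, ccont (fun z => cis ((Re z+c)*Im z)) z).
 { intros c z. apply ccont_ext with (fun z => Cexp (Ci*(RtoC (Re z+c)*RtoC (Im z))))%C. intro w. unfold cis, Cexp, Ci, Cmult, RtoC, Re, Im; simpl. replace (0*((fst w+c)*snd w-0*0)-1*((fst w+c)*0+0*snd w)) with 0 by ring. rewrite exp_0. f_equal; rewrite Rmult_1_l; f_equal; lra.
  apply (ccont_comp Cexp (fun z => Ci*(RtoC (Re z+c)*RtoC (Im z)))%C); [|eapply cderiv_ccont, cderiv_Cexp]. apply ccont_mult; [cont|]. apply ccont_mult. apply (ccont_Re_comp (fun x => x+c)). cont. apply (ccont_Im_comp (fun x => x)). cont. }
 assert (Sc : forall z, ccont (fun z => S (Re z) (Im z)) z).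
 { intro z. apply (ccont_clsum (seq 0 N) (fun k z => g (Re z+(p+INR k))%R*cis ((Re z+(p+INR k))*Im z))%C). cont. }
 set (f := fun r y => Cmod (S r y)^2).
 assert (fc : forall r y, continuity_2d_pt f r y).
 { intros r y. assert (X := ccont_continuity_2d S r y Cmod Cmod_lipschitz (Sc (r, y))). apply continuity_2d_pt_ext with (fun u v => Cmod (S u v)*Cmod (S u v)). intros; unfold f; lra. apply continuity_2d_pt_mult; pos. }
 assert (gc : forall t y, rcont (fun t => g t*cis (t*y))%C t) by (intros t y; apply rcont_mult; auto; apply rcont_ext with (fun t => cis (y*t)); [intro; f_equal; lra|cont]).
 via (RInt (fun y => RInt (fun r => f r y) 0 1) y0 (y0+2*PI)).
 - apply RInt_le; try lra.
  + apply ex_RInt_all. intro y. apply continuous_ext with (fun y => Cmod (CInt (fun r => S r y) 0 1)*Cmod (CInt (fun r => S r y) 0 1)).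
   intro v. rewrite (CInt_unit_pieces (fun t => g t*cis (t*v))%C) by auto. unfold S. lra.
   assert (X : continuous (fun y => Cmod (CInt (fun r => S r y) 0 1)) y).
   { apply rcont_Cmod. apply rcont_pair. apply (param_continuous (fun r y => Re (S r y))). intros r v. apply (ccont_continuity_2d S r v Re); auto. intros z w. rewrite <- Re_Cminus. apply re_le_Cmod.
    apply (param_continuous (fun r y => Im (S r y))). intros r v. apply (ccont_continuity_2d S r v Im); auto. intros z w. rewrite <- Im_Cminus. apply im_le_Cmod. }
   cont.
  + apply ex_RInt_all. intro y. apply param_continuous; pos.
  + intros y _. rewrite (CInt_unit_pieces (fun t => g t*cis (t*y))%C) by auto. eapply Rle_trans. apply Cauchy_Schwarz_CInt; [lra|].
   intros t _. apply (rcont_clsum (seq 0 N) (fun k r => g (r+(p+INR k))%R*cis ((r+(p+INR k))*y))%C). intro k.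
   apply (rcont_comp (fun z => g (Re z)*cis (Re z*y))%C (fun t => RtoC (t+(p+INR k)))); [apply gc|cont].
   right. rewrite Rminus_0_r, Rmult_1_l. auto.
 - rewrite Fubini by auto. right. rewrite RInt_unit_pieces. 2:{ intro t. apply continuous_ext with (fun t => Cmod (g t)*Cmod (g t)). intro; lra. cont. }
  rewrite <- RInt_scal_R. 2:{ apply ex_RInt_all. intro t. apply (continuous_lsum (seq 0 N) (fun k r => Cmod (g (r+(p+INR k)))^2)). intro k.
   assert (X : continuous (fun r => Cmod (g (r+(p+INR k)))) t) by (apply rcont_Cmod; apply (rcont_comp (fun z => g (Re z)) (fun t => RtoC (t+(p+INR k)))); [apply Hg|cont]).
   apply continuous_ext with (fun r => Cmod (g (r+(p+INR k)))*Cmod (g (r+(p+INR k)))). intro; lra. cont. }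
  apply RInt_ext. intros r _. rewrite <- tpoly_norm with (y0 := y0). apply RInt_ext. intros y _. unfold f, S.
  replace (clsum (seq 0 N) (fun k => g (r+(p+INR k))%R*cis ((r+(p+INR k))*y)))%C with (cis ((r+p)*y)*tpoly (fun k => g (r+(p+INR k))%R) N y)%C.
  rewrite Cmod_mult, Cmod_cis, Rmult_1_l. reflexivity. unfold tpoly. rewrite <- clsum_scal. apply clsum_ext. intros k _. replace ((r+(p+INR k))*y) with ((r+p)*y+INR k*y) by ring. rewrite cis_plus. ring.
Qed.

(** * Mean squares of Mellin integrals over segments *)

Lemma Rcpow_pair u a t : Rcpow u (a, t) = (RtoC (Rpower u a)*cis (t*ln u))%C.
Proof. unfold Rcpow, Cexp, cis, Rpower, Cmult, RtoC, Re, Im; simpl. f_equal; rewrite !Rmult_0_r, !Rmult_0_l, ?Rminus_0_r, ?Rplus_0_r; f_equal; f_equal; lra. Qed.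
Lemma ccont_Rcpow_var z l : 0 < Re l -> ccont z l -> ccont (fun w => Rcpow (Re w) (z w)) l.
Proof.
 intros H Hz. apply (ccont_comp Cexp (fun w => z w*RtoC (ln (Re w)))%C); [|eapply cderiv_ccont, cderiv_Cexp].
 apply ccont_mult; auto. apply (ccont_Re_comp ln). cont.
Qed.
Lemma ccont_line (G : R -> C) z : (forall t, rcont G t) -> ccont (fun w => G (Im w)) z.
Proof. intro H. apply (ccont_comp (fun w => G (Re w)) (fun w => RtoC (Im w))). apply (ccont_Im_comp (fun x => x)), continuous_id. apply H. Qed.
Definition Mel (G : R -> C) (a p q u : R) : C := CInt (fun t => G t*Rcpow u (a, t))%C p q.
Lemma Mel_rcont G a u t : (forall t, rcont G t) -> rcont (fun t => G t*Rcpow u (a, t))%C t.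
Proof. intro H. apply rcont_mult; auto. apply (rcont_comp (fun z => Rcpow u z) (fun t => (a, t))); cont. Qed.
Lemma Mel_deriv G a p q u : p <= q -> 0 < u -> (forall t, rcont G t) -> rderiv (Mel G a p q) u (Mel (fun t => G t*(a, t))%C (a-1) p q u).
Proof.
 intros Hpq Hu HG.
 assert (X := CInt_param (fun u t => G t*Rcpow u (a, t))%C (fun u t => G t*(a, t)*Rcpow u ((a-1)%R, t))%C p q u u 1 Hpq Hu Rlt_0_1). apply X.
 - intros m t Hm _. apply Rabs_def2 in Hm. rewrite <- Cmult_assoc. apply rderiv_mult_const. replace (((a-1)%R, t) : C) with ((a, t)-1)%C by (apply C_eq; simpl; lra). apply rderiv_Rcpow_base; lra.
 - intros t _. apply ccont_mult. apply (ccont_line (fun t => G t*(a, t))%C). cont.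
  apply (ccont_Rcpow_var (fun w => ((a-1)%R, Im w)) (u, t)); auto. apply (ccont_line (fun t => ((a-1)%R, t))). cont.
 - intros m _ t _. apply Mel_rcont; pos.
Qed.
Lemma Fourier_rcont G p q y : p <= q -> (forall t, rcont G t) -> rcont (fun y => CInt (fun t => G t*cis (t*y))%C p q) y.
Proof.
 intros Hpq HG. apply rcont_ext with (fun y => Mel G 0 p q (exp y)). intro v. apply CInt_ext; auto. intros t _. rewrite Rcpow_pair, ln_exp, Rpower_O by apply exp_pos. ring.
 apply (rcont_comp (fun z => Mel G 0 p q (Re z)) (fun y => RtoC (exp y))). apply (rderiv_rcont (Mel G 0 p q) (exp y) _ (Mel_deriv G 0 p q (exp y) Hpq (exp_pos y) HG)).
 cont.
Qed.
Lemma continuous_sqr (f : R -> R) t : continuous f t -> continuous (fun t => f t^2) t.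
Proof. intro H. apply continuous_ext with (fun t => f t*f t). intro; lra. cont. Qed.
#[export] Hint Resolve continuous_sqr : cont.
Lemma Rsqr_le a b : 0 <= a <= b -> a^2 <= b^2.
Proof. nra. Qed.
(** With u = exp y the integral is u^a times a Fourier integral in y, and B <= 4 A keeps y within
    one period 2 pi. [W] bounds u^a, and the factor [B] bounds du/dy. *)
Lemma Mel_mean_sq G a p N A B W : 0 < A <= B -> B <= 4*A -> (forall t, rcont G t) -> (forall u, A <= u <= B -> Rpower u a <= W) ->
 RInt (fun u => Re (Mel G a p (p+INR N) u)^2) A B <= W^2*(B*(2*PI*RInt (fun t => Cmod (G t)^2) p (p+INR N))).
Proof.
 intros HA HB HG HW. set (q := p+INR N). assert (Hpq : p <= q) by (unfold q; generalize (pos_INR N); lra). assert (P := PI2_1).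
 set (Phi := fun y => CInt (fun t => G t*cis (t*y))%C p q). assert (Pc : forall y, rcont Phi y) by (intro; apply Fourier_rcont; pos).
 set (F := fun y => Cmod (Phi y)^2). assert (Fc : forall y, continuous F y) by (intro y; apply continuous_sqr, rcont_Cmod, Pc). assert (F0 : forall y, 0 <= F y) by (intro; pos).
 assert (lab : ln A <= ln B) by (apply ln_le_mono; lra).
 assert (l4 : ln B <= ln A+2*PI). { via (ln (4*A)). apply ln_le_mono; lra. rewrite ln_mult by lra. assert (ln 4 <= 2); [|lra]. apply ln_le_of_exp; [lra|]. assert (X := exp_ge_pow27 2); replace (INR 2) with 2 in X by auto; lra. }
 assert (Fl : forall u, 0 < u -> continuous (fun u => F (ln u)) u) by (intros u Hu; apply (continuous_comp ln F); cont).
 assert (Mc : forall u, 0 < u -> continuous (fun u => Re (Mel G a p q u)^2) u) by (intros u Hu; apply continuous_sqr, rcont_Re; eapply rderiv_rcont, Mel_deriv; pos).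
 via (RInt (fun u => W^2*F (ln u)) A B).
 - apply RInt_le; try lra. apply ex_RInt_cont_R; [lra|]. cont. cont.
  intros u Hu. unfold Mel. rewrite (CInt_ext _ (fun t => RtoC (Rpower u a)*(G t*cis (t*ln u)))%C); auto. 2: intros t _; rewrite Rcpow_pair; ring.
  rewrite CInt_mult_const; auto. 2: intros t _; apply rcont_mult; auto; apply rcont_ext with (fun t => cis (ln u*t)); [intro; f_equal; lra|cont].
  fold (Phi (ln u)). unfold F. rewrite <- Rpow_mult_distr, Re_Cmult, Re_RtoC, Im_RtoC. replace (Rpower u a*Re (Phi (ln u))-0*Im (Phi (ln u))) with (Rpower u a*Re (Phi (ln u))) by ring.
  rewrite <- (pow2_abs (Rpower u a*_)). apply Rsqr_le. split; [pos|]. rewrite Rabs_mult. assert (Pw := Rpower_pos u a). mul; [rewrite Rabs_right by lra; cont|apply re_le_Cmod].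
 - rewrite RInt_scal_R by cont. mull.
  rewrite <- (exp_ln A), <- (exp_ln B) by lra. rewrite <- (RInt_comp (fun u => F (ln u)) exp exp).
  2: intros; apply Fl, exp_pos. 2:{ intros y _. split. auto_derive; lra. cont. }
  rewrite (exp_ln B) by lra.
  via (RInt (fun y => B*F y) (ln A) (ln B)).
  + apply RInt_le; auto. { apply ex_RInt_cont_R; auto. intros y _. apply (continuous_mult (K := R_AbsRing)). cont. apply continuous_ext with F; auto. intro; rewrite ln_exp; lra. }
   cont. intros y Hy. rewrite ln_exp. mulr. rewrite <- (exp_ln B) by lra. left; apply exp_increasing; lra.
  + rewrite RInt_scal_R by cont. mull. trr (Parseval G p N (ln A) HG). change (RInt F (ln A) (ln B) <= RInt F (ln A) (ln A+2*PI)).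
   rewrite <- (RInt_Chasles_R F (ln A) (ln B) (ln A+2*PI)) by cont. assert (0 <= RInt F (ln B) (ln A+2*PI)) by (apply RInt_ge_0; cont). lra.
Qed.

Lemma RInt_Cauchy_kernel d c a b : 0 < d -> a <= b -> RInt (fun t => / (d*d+(t-c)*(t-c))) a b <= PI/d.
Proof.
 intros Hd Hab. assert (X : is_RInt (fun t => / (d*d+(t-c)*(t-c))) a b (/ d*atan ((b-c)/d) - / d*atan ((a-c)/d))).
 { apply (is_RInt_derive (fun t => / d*atan ((t-c)/d))).
  - intros t _. auto_derive; auto. assert (Y := Rle_0_sqr (t-c)). unfold Rsqr in Y. field. nra.
  - intros t _. apply (ex_derive_continuous (fun t : R => / (d*d+(t-c)*(t-c)))). auto_derive. apply Rgt_not_eq. assert (Y := Rle_0_sqr (t-c)). unfold Rsqr in Y. nra. }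
 rewrite (is_RInt_unique (V := R_CompleteNormedModule) _ _ _ _ X). assert (A := atan_bound ((b-c)/d)). assert (B := atan_bound ((a-c)/d)). assert (0 < / d) by pos. nra.
Qed.
Lemma RInt_lsum {A} (l : list A) (f : A -> R -> R) a b : (forall x, In x l -> ex_RInt (f x) a b) ->
 ex_RInt (fun t => lsum l (fun x => f x t)) a b /\ RInt (fun t => lsum l (fun x => f x t)) a b = lsum l (fun x => RInt (f x) a b).
Proof.
 induction l as [|x l IH]; intro H.
 - split. cont. unfold lsum; simpl. rewrite RInt_const_R. ring.
 - destruct IH as (I1 & I2). intros; apply H; right; pos. assert (Hx := H x (or_introl eq_refl)). split. apply (ex_RInt_plus_R (f x)); pos.
  change (RInt (fun t => f x t+lsum l (fun x => f x t)) a b = RInt (f x) a b+lsum l (fun x => RInt (f x) a b)). rewrite RInt_plus_R, I2; pos.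
Qed.
Lemma Cauchy_Schwarz_lsum {A} (l : list A) f : lsum l f^2 <= INR (length l)*lsum l (fun x => f x^2).
Proof.
 induction l as [|x l IH]. unfold lsum; simpl; lra. change (lsum (x :: l) f) with (f x+lsum l f). change (lsum (x :: l) (fun x => f x^2)) with (f x^2+lsum l (fun x => f x^2)). simpl length. rewrite S_INR.
 set (n := INR (length l)) in *. set (s := lsum l f) in *. set (q := lsum l (fun x => f x^2)) in *. assert (n0 : 0 <= n) by apply pos_INR. assert (q0 : 0 <= q) by (apply lsum_nonneg; intros; pos).
 destruct (Req_dec n 0) as [E|N]. { rewrite E in *. nra. }
(* AM-GM: 2 f(x) s <= n f(x)^2 + s^2/n *)
 assert (K : 2*f x*s <= n*f x^2+q). { assert (0 <= (n*f x-s)^2) by apply pow2_ge_0. nra. }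
 nra.
Qed.
(** The shift 7 = 5 + 2 lets [lw t] dominate [lt5] at every height within 2 of t. *)
Definition lw (t : R) : R := ln (Rabs t+7).
Lemma lt5_le_lw a t : Rabs (a-t) <= 2 -> lt5 a <= lw t.
Proof. intro H. assert (X := Rabs_triang (a-t) t). replace (a-t+t) with a in X by ring. assert (0 <= Rabs a) by apply Rabs_pos. apply ln_le_mono; lra. Qed.

Lemma RInt_pieces (f : R -> R) p N (c : nat -> R) : (forall t, continuous f t) -> (forall k, (k < N)%nat -> RInt f (p+INR k) (p+INR k+1) <= c k) -> RInt f p (p+INR N) <= lsum (seq 0 N) c.
Proof.
 intros Hf. induction N as [|N IH]; intro H. rewrite Rplus_0_r, RInt_point. unfold lsum; unfold zero; simpl; lra.
 rewrite S_INR, lsum_seq_S. replace (p+(INR N+1)) with (p+INR N+1) by ring. rewrite <- (RInt_Chasles_R f p (p+INR N)) by cont. apply Rplus_le_compat. auto. auto.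
Qed.
Lemma lsum_telescope f n : lsum (seq 0 n) (fun k => f (S k)-f k) = f n-f 0%nat.
Proof. induction n as [|n IH]. unfold lsum; simpl; lra. rewrite lsum_seq_S, IH. simpl. ring. Qed.

(** * Second differences in mean square *)

Definition D2 (f : R -> R) (h u : R) : R := f u-2*f (u-h)+f (u-2*h).
Lemma continuous_shift (f : R -> R) c t : continuous f (t-c) -> continuous (fun u => f (u-c)) t.
Proof. apply (continuous_comp (fun u => u-c) f). cont. Qed.
#[export] Hint Resolve continuous_shift : cont.
Lemma continuous_D2 f h t : continuous f t -> continuous f (t-h) -> continuous f (t-2*h) -> continuous (D2 f h) t.
Proof.
 intros A B C. apply (continuous_plus (V := R_NormedModule) (fun u => f u-2*f (u-h)) (fun u => f (u-2*h))); [|cont].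
 cont.
Qed.
Lemma RInt_lin3 (f g k : R -> R) x y z a b : ex_RInt f a b -> ex_RInt g a b -> ex_RInt k a b ->
 ex_RInt (fun u => x*f u+(y*g u+z*k u)) a b /\ RInt (fun u => x*f u+(y*g u+z*k u)) a b = x*RInt f a b+(y*RInt g a b+z*RInt k a b).
Proof.
 intros F G K. assert (F' := ex_RInt_scal_R f a b x F). assert (G' := ex_RInt_scal_R g a b y G). assert (K' := ex_RInt_scal_R k a b z K). assert (GK := ex_RInt_plus_R _ _ _ _ G' K').
 split. cont.
 rewrite (RInt_plus_R (fun u => x*f u) (fun u => y*g u+z*k u)), (RInt_plus_R (fun u => y*g u) (fun u => z*k u)) by assumption. rewrite !RInt_scal_R by assumption. lra.
Qed.
(** (x-2y+z)^2 <= 4x^2 + 8y^2 + 4z^2, whose weights add up to 16. This is the bound for high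
    frequencies, where differencing gains nothing. *)
Lemma D2_sq_le f h a b : a <= b -> 0 <= h -> (forall t, a-2*h <= t <= b -> continuous f t) -> RInt (fun u => D2 f h u^2) a b <= 16*RInt (fun u => f u^2) (a-2*h) b.
Proof.
 intros Hab Hh Hc. set (q := fun u => f u^2). assert (qc : forall t, a-2*h <= t <= b -> continuous q t) by (intros; apply continuous_sqr; auto).
 assert (qi : forall x y, a-2*h <= x -> x <= y -> y <= b -> ex_RInt q x y) by cont.
 assert (q0 : forall x y, a-2*h <= x -> x <= y -> y <= b -> 0 <= RInt q x y) by (intros; apply RInt_ge_0; auto; intros; pos).
 assert (S : forall c, 0 <= c <= 2*h -> ex_RInt (fun u => q (u-c)) a b /\ RInt (fun u => q (u-c)) a b <= RInt q (a-2*h) b).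
 { intros c Hc'. split. cont.
  assert (E := RInt_shift q a b (- c) ltac:(cont)). change (RInt (fun u => q (u-c)) a b) with (RInt (fun u => q (u + - c)) a b).
  rewrite <- (RInt_Chasles_R q (a-2*h) (a + - c) b), <- (RInt_Chasles_R q (a + - c) (b + - c) b) by cont.
  assert (X := q0 (a-2*h) (a + - c)). assert (Y := q0 (b + - c) b). lra. }
 destruct (S 0 ltac:(lra)) as (i0 & s0). destruct (S h ltac:(lra)) as (i1 & s1). destruct (S (2*h) ltac:(lra)) as (i2 & s2).
 destruct (RInt_lin3 (fun u => q (u-0)) (fun u => q (u-h)) (fun u => q (u-2*h)) 4 8 4 a b i0 i1 i2) as (Iex & IE).
 via (RInt (fun u => 4*q (u-0)+(8*q (u-h)+4*q (u-2*h))) a b).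
 - apply RInt_le; auto. apply ex_RInt_cont_R; auto. intros t Ht. apply continuous_sqr, continuous_D2; cont.
  intros u _. unfold D2, q. rewrite Rminus_0_r. set (x := f u). set (y := f (u-h)). set (z := f (u-2*h)). assert (A := pow2_ge_0 (x+y)). assert (B := pow2_ge_0 (y+z)). nra.
 - change (RInt (fun u => f u^2) (a-2*h) b) with (RInt q (a-2*h) b). lra.
Qed.
(** One application of [mean_sq_difference] for each of the two differences, each gaining h^2. This
    is the bound for low frequencies. *)
Lemma D2_sq_deriv (f f1 f2 : R -> R) h a b : a <= b -> 0 <= h -> (forall t, a-2*h <= t <= b -> is_derive f t (f1 t) /\ is_derive f1 t (f2 t) /\ continuous f2 t) ->
 RInt (fun u => D2 f h u^2) a b <= h^4*RInt (fun u => f2 u^2) (a-2*h) b.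
Proof.
 intros Hab Hh H. assert (C1 : forall t, a-2*h <= t <= b -> continuous f1 t) by (intros t Ht; apply (ex_derive_continuous f1); exists (f2 t); apply H; lra).
 assert (X := mean_sq_difference (fun u => f u-f (u-h)) (fun u => f1 u-f1 (u-h)) a b h Hab Hh). assert (Y := mean_sq_difference f1 f2 (a-h) b h ltac:(lra) Hh).
 replace (a-h-h) with (a-2*h) in Y by ring. replace (h^4) with (h^2*h^2) by ring. eapply Rle_trans; [|rewrite Rmult_assoc; mull; apply Y].
 - trr X. right. apply RInt_ext. intros u _. unfold D2. replace (u-2*h) with (u-h-h) by ring. nra.
  intros t Ht. split. apply (is_derive_minus (K := R_AbsRing) (V := R_NormedModule)). apply H; lra. replace (f1 (t-h)) with (1*f1 (t-h)) by ring. apply (is_derive_comp f (fun u => u-h)). apply H; lra. auto_derive; lra.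
  cont.
 - intros t Ht. apply H; lra.
Qed.
(** -(2 + ln(1+t))/(1+t) is a primitive of (1 + ln(1+t))/(1+t)^2 and rises by 2 over the half-line;
    the sign [e] treats both half-lines at once. *)
Lemma CInt_log_bound f T B : 0 <= T -> contin f (- T) T -> (forall t, - T <= t <= T -> Cmod (f t) <= B*((1+ln (1+Rabs t))/((Rabs t+1)*(Rabs t+1)))) -> Cmod (CInt f (- T) T) <= 4*B.
Proof.
 intros HT Hc HB. assert (B0 : 0 <= B). { specialize (HB 0 ltac:(lra)). rewrite Rabs_R0, Rplus_0_r, ln_1 in HB. assert (X := Cmod_ge_0 (f 0)). lra. }
 assert (G : forall e a b, (e = 1 \/ e = -1) -> a <= b -> - T <= a -> b <= T -> (forall t, a <= t <= b -> Rabs t = e*t) -> (a = 0 \/ b = 0) -> Cmod (CInt f a b) <= B*2).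
 { intros e a b He Hab Ha Hb HR H0.
  set (m := fun t => (1+ln (1+e*t))/((e*t+1)*(e*t+1))). set (F := fun t => - e*((2+ln (1+e*t))/(1+e*t))).
  assert (P : forall t, a <= t <= b -> 0 <= e*t) by (intros t Ht; rewrite <- HR by auto; pos).
  assert (mc : forall t, a <= t <= b -> continuous m t) by (intros t Ht; specialize (P t Ht); apply (ex_derive_continuous m); unfold m; auto_derive; try lra; nra).
  assert (I : is_RInt m a b (F b-F a)).
  { apply (is_RInt_derive F); minmax; [|pos]. intros t Ht. specialize (P t Ht). unfold F, m. auto_derive. lra. destruct He as [-> | ->]; fld. }
  via (RInt (fun t => B*m t) a b).
  - apply CInt_bound_RInt; auto. intros t Ht; cont. cont. intros t Ht. unfold m. rewrite <- HR by auto. cont.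
  - rewrite RInt_scal_R by cont. rewrite (is_RInt_unique (V := R_CompleteNormedModule) _ _ _ _ I). mull.
   assert (FP : forall t, a <= t <= b -> 0 <= (2+ln (1+e*t))/(1+e*t)). { intros t Ht. specialize (P t Ht). apply Rmult_le_pos; [|pos]. assert (0 <= ln (1+e*t)) by (rewrite <- ln_1; apply ln_le_mono; lra). lra. }
   assert (Fa := FP a ltac:(lra)). assert (Fb := FP b ltac:(lra)). assert (Pa := P a ltac:(lra)). assert (Pb := P b ltac:(lra)). unfold F.
   assert (E0 : (2+ln (1+e*0))/(1+e*0) = 2) by (rewrite Rmult_0_r, Rplus_0_r, ln_1; lra).
   destruct He as [-> | ->]; try (assert (a = 0) by lra; subst); try (assert (b = 0) by lra; subst); lra. }
 rewrite <- (CInt_Chasles f (- T) 0 T) by pos. tr Cmod_triangle.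
 assert (X := G (-1) (- T) 0 ltac:(lra) ltac:(lra) ltac:(lra) ltac:(lra) ltac:(intros t Ht; rewrite Rabs_left1 by lra; lra) ltac:(lra)).
 assert (Y := G 1 0 T ltac:(lra) ltac:(lra) ltac:(lra) ltac:(lra) ltac:(intros t Ht; rewrite Rabs_right by lra; lra) ltac:(lra)). lra.
Qed.

Lemma continuous_lip (f : R -> R) t : (forall x y, Rabs (f x-f y) <= Rabs (x-y)) -> continuous f t.
Proof. intros H P (eps & HP). exists eps. intros z Hz. apply HP. eapply Rle_lt_trans; auto. Qed.
Lemma continuous_Rmax_shift k t : continuous (fun u => Rmax 0 (u-k)) t.
Proof. apply continuous_lip. intros x y. unfold Rmax, Rabs. repeat destruct Rle_dec; repeat destruct Rcase_abs; lra. Qed.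
#[export] Hint Resolve continuous_Rmax_shift : cont.
Lemma continuous_A1 N t : continuous (A1 N) t.
Proof.
 apply (continuous_minus (V := R_NormedModule) (psi1 N) (fun u => Rmax 0 (u-1)^2/2)).
 - apply (continuous_lsum (seq 1 N) (fun n u => vonMangoldt n*Rmax 0 (u-INR n))). cont.
 - apply (continuous_mult (K := R_AbsRing) (fun u => Rmax 0 (u-1)^2) (fun _ => / 2)); [|cont]. cont.
Qed.
#[export] Hint Resolve continuous_A1 : cont.
Lemma nat_ceil r : 0 <= r -> exists M, r <= INR M <= r+1.
Proof. destruct (archimed r). exists (Z.to_nat (up r)). rewrite INR_IZR_INZ, Z2Nat.id by (apply le_IZR; lra). lra. Qed.

(** * Mean squares of [A1] from a line just to the right of all zeros *)

Section Line.
(** [sg] is the line of integration and [dl] its distance from the zeros on its left. In the main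
    case they are B1 + 1/log x and 1/log x. *)
Variables (sg dl : R).
Hypotheses (Hsg : 1/4 <= sg <= 1.01) (Hdl : 0 < dl <= / 1000000) (ZF : forall rho, zf rho = 0 -> 0 <= Re rho -> Re rho <= sg-dl).
Lemma zf_line x t : sg <= x -> zf (x, t) <> 0.
Proof. intros Hx E. assert (X := ZF _ E). simpl in X. lra. Qed.
Lemma rcont_FF_line t : rcont (fun t => FF (sg, t)) t.
Proof. apply rcont_vertical. apply ccont_FF. simpl; lra. apply zf_line; lra. Qed.
Lemma zero_dist K Z g g' rho x t : zdata K Z g g' -> In rho Z -> sg <= x -> dl <= x-Re rho /\ (dl <= Cmod ((x, t)-rho)).
Proof.
 intros H Hr Hx. destruct (zdata_in_zero K Z g g' rho H Hr) as (E & X & _). assert (D : dl <= x-Re rho). { destruct (Rle_dec 0 (Re rho)). specialize (ZF rho E r). lra. lra. }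
 split; auto. assert (Y := re_le_Cmod ((x, t)-rho)). rewrite Re_Cminus in Y. simpl in Y. rewrite Rabs_right in Y by lra. lra.
Qed.
(** Every near zero is estimated by 1/dl. The loss is harmless where this is used: on horizontal
    sides far up, and for small arguments of [A1]. *)
Lemma FF_pointwise x t : sg <= x <= 2 -> Cmod (FF (x, t)) <= (28+8*lw t)/dl+1000*lw t.
Proof.
 intro Hx. destruct (INR_unbounded (Rabs t)) as (K & HK). destruct (zdata_exists K) as (Z & g & g' & HZ). destruct (zdata_window K (x, t)) as (i & Hi & X & Y). simpl; lra. simpl; lra. simpl in X.
 assert (F := FF_near K Z g g' i (x, t) HZ Hi Y (zf_line x t ltac:(lra))). set (S := clsum (near (ht K i) Z) (fun rho => / ((x, t)-rho))%C) in *.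
 assert (L : lt5 (ht K i) <= lw t) by (apply lt5_le_lw; rewrite Rabs_minus_sym; lra).
 assert (SB : Cmod S <= (28+8*lw t)/dl).
 { via (lsum (near (ht K i) Z) (fun _ => / dl*1)).
  - apply clsum_Cmod. intros rho Hr. apply near_in in Hr. destruct (zero_dist K Z g g' rho x t HZ (proj1 Hr) ltac:(lra)) as (_ & D). rewrite Cmod_inv by (intro E; rewrite E, Cmod_0 in D; lra). rewrite Rmult_1_r. apply Rinv_le_contravar; lra.
  - rewrite lsum_scal, lsum_length. assert (N := near_count Z g g' (ht K i) (proj1 HZ)). rewrite Rmult_comm. apply Rmult_le_compat_r. pos. lra. }
 replace (FF (x, t)) with ((FF (x, t)+S)-S)%C by ring. tr Cmod_sub_le. lra.
Qed.
(** Squaring the pointwise bound would cost 1/dl^2. Over a unit of height each of the n near zeros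
    contributes at most pi/dl to the integral of |s-rho|^(-2), so Cauchy-Schwarz over the zeros
    leaves n^2/dl. The factor [r] allows the logarithm to grow with the height. *)
Lemma FF_mean_sq K i Lx r : (i <= 2*K)%nat -> 1000 <= Lx -> 1 <= r -> lt5 (ht K i) <= r*Lx ->
 RInt (fun t => Cmod (FF (sg, t))^2) (ht K i-1/2) (ht K i+1/2) <= 520*(r^2*Lx^2)/dl.
Proof.
 intros Hi HL Hr HrL. set (a := ht K i) in *. destruct (zdata_exists K) as (Z & g & g' & HZ).
 set (n := INR (length (near a Z))). assert (N := near_count Z g g' a (proj1 HZ)). fold n in N. assert (n0 : 0 <= n) by apply pos_INR. assert (l0 := lt5_ge a).
 set (w := fun rho t => / ((sg-Re rho)*(sg-Re rho)+(t-Im rho)*(t-Im rho))).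
 assert (D : forall rho, In rho (near a Z) -> dl <= sg-Re rho) by (intros rho Hr'; apply near_in in Hr'; apply (zero_dist K Z g g' rho sg 0 HZ (proj1 Hr') (Rle_refl _))).
 assert (wi : forall rho, In rho (near a Z) -> ex_RInt (w rho) (a-1/2) (a+1/2)).
 { intros rho Hr'. apply ex_RInt_all. intro t. apply (ex_derive_continuous (w rho)). unfold w. auto_derive. apply D in Hr'. assert (Y := Rle_0_sqr (t-Im rho)). unfold Rsqr in Y. nra. }
 destruct (RInt_lsum (near a Z) w _ _ wi) as (E1 & E2).
 via (RInt (fun t => 2*n*lsum (near a Z) (fun rho => w rho t)+2*(1000*lt5 a)^2) (a-1/2) (a+1/2)).
 - apply RInt_le; try lra.
  + apply ex_RInt_all. intro t. apply continuous_sqr, rcont_Cmod, rcont_FF_line.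
  + apply ex_RInt_plus_R; [apply ex_RInt_scal_R; pos|cont].
  + intros t Ht. assert (F := FF_near K Z g g' i (sg, t) HZ Hi (window_disc (sg, t) (ht K i) ltac:(simpl; lra) ltac:(simpl; apply Rabs_le_between; fold a; lra)) (zf_line sg t ltac:(lra))). fold a in F.
   set (S := clsum (near a Z) (fun rho => / ((sg, t)-rho))%C) in *.
   assert (SB : Cmod S <= lsum (near a Z) (fun rho => / Cmod ((sg, t)-rho))).
   { apply clsum_Cmod. intros rho Hr'. apply near_in in Hr'. destruct (zero_dist K Z g g' rho sg t HZ (proj1 Hr') (Rle_refl _)) as (_ & X). rewrite Cmod_inv by (intro E; rewrite E, Cmod_0 in X; lra). lra. }
   assert (SQ := Cauchy_Schwarz_lsum (near a Z) (fun rho => / Cmod ((sg, t)-rho))). fold n in SQ.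
   assert (EW : lsum (near a Z) (fun rho => (/ Cmod ((sg, t)-rho))^2) = lsum (near a Z) (fun rho => w rho t)) by (apply lsum_ext; intros rho _; rewrite pow_inv, Cmod_sqr, Re_Cminus, Im_Cminus; cont).
   cbv beta in SQ. rewrite EW in SQ. assert (S0 := Cmod_ge_0 S). assert (F0 := Cmod_ge_0 (FF (sg, t))).
   assert (T : Cmod (FF (sg, t)) <= 1000*lt5 a+Cmod S). { replace (FF (sg, t)) with ((FF (sg, t)+S)-S)%C by ring. tr Cmod_sub_le. lra. }
   via ((1000*lt5 a+Cmod S)^2). nra. assert (Cmod S^2 <= lsum (near a Z) (fun rho => / Cmod ((sg, t)-rho))^2) by (apply Rsqr_le; lra).
   assert (X := pow2_ge_0 (1000*lt5 a-Cmod S)). lra.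
 - rewrite (RInt_plus_R (fun t => 2*n*lsum (near a Z) (fun rho => w rho t)) (fun _ => 2*(1000*lt5 a)^2)), RInt_scal_R, RInt_const_R, E2; [|pos|apply ex_RInt_scal_R; pos|cont].
  assert (B : lsum (near a Z) (fun rho => RInt (w rho) (a-1/2) (a+1/2)) <= 4/dl*n).
  { unfold n. rewrite <- lsum_length, <- lsum_scal. apply lsum_le. intros rho Hr'. specialize (D rho Hr'). rewrite Rmult_1_r. eapply Rle_trans. apply RInt_Cauchy_kernel; lra.
   assert (P := PI_4). assert (P0 := PI_RGT_0). apply Rmult_le_compat; try lra. pos. apply Rinv_le_contravar; lra. } assert (nb : n <= 8.028*(r*Lx)) by nra.
  via (2*n*(4/dl*n)+2*(1000*(r*Lx))^2). nra.
  (* 8 times 8.028^2 is below 516, and the term 2*1000^2 from Landau's lemma is at most 2/dl because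
     dl <= 10^(-6). *)
  replace (r^2*Lx^2) with ((r*Lx)^2) by ring. set (q := r*Lx) in *. assert (id : 1000000 <= / dl) by (rewrite <- (Rinv_inv 1000000); apply Rinv_le_contravar; lra).
  assert (n2 : n^2 <= (8.028*q)^2) by (apply Rsqr_le; lra). nra.
Qed.

Definition Gl (t : R) : C := (FF (sg, t)/((sg, t)*((sg, t)+1)))%C.
Lemma line_neq_0 t : ((sg, t) : C) <> 0 /\ ((sg, t)+1)%C <> 0.
Proof. split; re_contra. Qed.
Lemma rcont_Gl t : rcont Gl t.
Proof.
 destruct (line_neq_0 t). apply rcont_mult; [apply rcont_FF_line|]. apply rcont_inv. cont. apply Cmult_neq_0; pos.
Qed.
Lemma low_sq M Lx : 1000 <= Lx -> lt5 (INR M) <= Lx ->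
 RInt (fun t => Cmod (FF (sg, t))^2) (- INR M-1/2) (- INR M-1/2+INR (2*M+1)) <= 520*Lx^2/dl*(2*INR M+1).
Proof.
 intros HL HM. eapply Rle_trans. apply RInt_pieces with (c := fun _ => 520*Lx^2/dl*1). intro t; apply continuous_sqr, rcont_Cmod, rcont_FF_line.
 - intros k Hk. assert (X := FF_mean_sq M k Lx 1 ltac:(lia) HL ltac:(lra)). assert (Y := lt5_ht M k ltac:(lia)).
  replace (ht M k-1/2) with (- INR M-1/2+INR k) in X by (unfold ht; lra). replace (ht M k+1/2) with (- INR M-1/2+INR k+1) in X by (unfold ht; lra). lra.
 - rewrite lsum_scal, lsum_length, length_seq, plus_INR, mult_INR. simpl. lra.
Qed.
(** At height a >= m the logarithm is at most (a/m) Lx, and |s(s+1)|^(-2) supplies a^(-4), so a unit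
    piece is O(Lx^2/(dl m^2 a^2)) and the pieces telescope. The telescoping majorant [e] is left
    abstract because the upper and the lower tail are enumerated in opposite directions. *)
Lemma high_sq M p N Lx (e : nat -> R) : 8 <= INR M -> 1000 <= Lx -> lt5 (INR M) <= Lx -> e N-e 0%nat <= / INR M ->
 (forall k, (k < N)%nat -> exists K i, (i <= 2*K)%nat /\ p+INR k+1/2 = ht K i /\ INR M+1 <= Rabs (ht K i) /\ / (Rabs (ht K i)*(Rabs (ht K i)-1)) <= e (S k)-e k) ->
 RInt (fun t => Cmod (Gl t)^2) p (p+INR N) <= 660*Lx^2/(dl*INR M^3).
Proof.
 intros HM8 HL HM He Hk. set (m := INR M) in *. set (Q := 660*Lx^2/(dl*m^2)).
 assert (Q0 : 0 <= Q) by (unfold Q, Rdiv; pos).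
 eapply Rle_trans. apply RInt_pieces with (c := fun k => Q*(e (S k)-e k)). intro t; apply continuous_sqr, rcont_Cmod, rcont_Gl.
 - intros k Hk'. destruct (Hk k Hk') as (K & i & Hi & E & Ha & He'). set (a := Rabs (ht K i)) in *. set (r := a/m).
  assert (r1 : 1 <= r) by (unfold r; apply (Rmult_le_reg_r m); [lra|]; unfold Rdiv; rewrite Rmult_assoc, Rinv_l; lra).
  assert (lr : lt5 (ht K i) <= r*Lx).
  { unfold lt5 in *. fold a. rewrite Rabs_right in HM by lra. via (ln (m+5)+(a-m)/m).
   - replace (a+5) with ((m+5)*((a+5)/(m+5))) by fld. assert (0 < (a+5)/(m+5)) by pos. rewrite ln_mult by lra. apply Rplus_le_compat_l.
    via ((a+5)/(m+5)-1). apply ln_le_of_exp; auto. assert (X := exp_ineq1_le ((a+5)/(m+5)-1)). lra.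
    replace ((a+5)/(m+5)-1) with ((a-m)/(m+5)) by fld. mull. apply Rinv_le_contravar; lra.
   - replace ((a-m)/m) with (r-1) by (unfold r; fld). nra. }
  assert (X := FF_mean_sq K i Lx r Hi HL r1 lr).
  via (RInt (fun t => 1.26/a^4*Cmod (FF (sg, t))^2) (ht K i-1/2) (ht K i+1/2)).
  + replace (p+INR k) with (ht K i-1/2) by lra. replace (ht K i-1/2+1) with (ht K i+1/2) by field. apply RInt_le; try lra.
   apply ex_RInt_all; intro t; apply continuous_sqr, rcont_Cmod, rcont_Gl. apply ex_RInt_scal_R, ex_RInt_all; intro t; apply continuous_sqr, rcont_Cmod, rcont_FF_line.
   intros t Ht. destruct (line_neq_0 t) as (N1 & N2). unfold Gl. rewrite Cmod_div, Cmod_mult by (apply Cmult_neq_0; pos). unfold Rdiv. rewrite Rpow_mult_distr, Rmult_comm. mulr.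
   assert (Ta : a-1/2 <= Rabs t). { unfold a. assert (Y := Rabs_triang (ht K i-t) t). replace (ht K i-t+t) with (ht K i) in Y by ring. assert (Rabs (ht K i-t) <= 1/2) by (apply Rabs_le_between; lra). lra. }
   (* Here a >= 9, so a - 1/2 >= 17/18 a; the constant 1.26 exceeds (18/17)^4. *)
   assert (A1' := im_le_Cmod (sg, t)). assert (A2 := im_le_Cmod ((sg, t)+1)). simpl in A1', A2. rewrite Rplus_0_r in A2. set (b := 17/18*a). assert (b0 : 0 < b) by (unfold b; lra). assert (P : b*b <= Cmod (sg, t)*Cmod ((sg, t)+1)) by (mul; unfold b in *; lra).
   rewrite pow_inv. via (/ (b*b)^2). apply Rinv_le_contravar. pos. nra.
   unfold b. replace (/ (17/18*a*(17/18*a))^2) with (104976/83521 * / a^4) by fld. apply Rmult_le_compat_r; [|lra]. pos.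
  + rewrite RInt_scal_R by (apply ex_RInt_all; intro t; apply continuous_sqr, rcont_Cmod, rcont_FF_line).
   assert (w0 : 0 <= 1.26/a^4) by pos.
   via (1.26/a^4*(520*(r^2*Lx^2)/dl)). nra.
   replace (1.26/a^4*(520*(r^2*Lx^2)/dl)) with (1.26*520/660*Q * / (a*a)) by (unfold r, Q; fld).
   apply Rmult_le_compat. lra. pos. lra. trr He'. apply Rinv_le_contravar; nra.
 - rewrite lsum_scal, lsum_telescope. via (Q * / m). nra. right. unfold Q. fld.
Qed.
Variables (N n : nat) (c Lx : R).
(** Half an odd integer, so that the unit intervals centred at the integral heights tile [-T, T].
    This truncation height is chosen far beyond c. *)
Let T : R := INR n+1/2.
Hypotheses (Hc : 10 <= c) (HcN : c <= INR N) (HT1 : 1000*c^4 <= T) (HT2 : (28+8*lw T)/dl+1000*lw T <= T) (HLx : 1000 <= Lx) (HLc : ln (3*c+7) <= Lx).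
Let c4 : 10000 <= c^4.
Proof. replace 10000 with (10^4) by ring. apply pow_incr; lra. Qed.
(** By the choice of T the function [FF] is at most T on the horizontal sides, so the whole
    truncation error is at most 644 u^3/T, and T >= 1000 c^4 brings it below 1/c. *)
Lemma A1_line u : 1 < u <= c -> Rabs (2*PI*A1 N u-Re (Mel Gl (sg+1) (- T) T u)) <= 1/c.
Proof.
 intro Hu. assert (T0 : 0 < T) by lra.
 assert (E : vline (fun s => FF s*Ku u s)%C sg T = Mel Gl (sg+1) (- T) T u).
 { apply CInt_ext; [lra|]. intros t _. destruct (line_neq_0 t). unfold Gl, Ku. replace (((sg+1)%R, t) : C) with ((sg, t)+1)%C by (apply C_eq; simpl; lra). field; auto. }
 assert (Hol : exists F', Holo (orect sg 2 T (dl/2)) FF F').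
 { assert (HD : forall z, orect sg 2 T (dl/2) z -> half_plane (-1) z /\ zf z <> 0). { intros z (A & B). split. unfold half_plane; lra. intro E0. apply ZF in E0; lra. }
  assert (H1 : Holo (orect sg 2 T (dl/2)) zf' (Cder zf')) by (apply Holo_sub with (half_plane (-1)); [apply HD|apply Holo_deriv with zf; [apply copen_half_plane|apply Holo_zf]]).
  assert (H2 : Holo (orect sg 2 T (dl/2)) zf zf') by (apply Holo_sub with (half_plane (-1)); [apply HD|apply Holo_zf]).
  assert (Q := Holo_div _ _ _ _ _ H1 H2 ltac:(apply HD)). eexists. intros z Hz. split; [apply cderiv_opp|apply ccont_opp]; apply (Q z Hz). }
 destruct Hol as (F' & Hol).
 assert (S1 := shift_contour FF F' u sg T (dl/2) T ltac:(lra) ltac:(lra) T0 ltac:(lra) Hol).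
 assert (S2 := A1_Perron u N T ltac:(lra) ltac:(lra) ltac:(lra)). rewrite E in S1.
 assert (S3 : forall x, sg <= x <= 2 -> Cmod (FF (x, T)) <= T /\ Cmod (FF (x, (- T)%R)) <= T).
 { intros x Hx. split; eapply Rle_trans; [apply FF_pointwise; lra|lra|apply FF_pointwise; lra|]. unfold lw in *. rewrite Rabs_Ropp. auto. }
 specialize (S1 S3). set (V2 := vline (fun s => FF s*Ku u s)%C 2 T) in *. set (V := Mel Gl (sg+1) (- T) T u) in *.
 replace (2*PI*A1 N u-Re V) with (Re (RtoC (2*PI*A1 N u)-V)) by auto. tr re_le_Cmod.
 replace (RtoC (2*PI*A1 N u)-V)%C with ((V2-V)-(V2-RtoC (2*PI*A1 N u)))%C by ring. tr Cmod_sub_le.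
 assert (u3 : 0 < u^3 <= c^3) by (split; [pos|apply pow_incr; lra]).
 via (4*T*u^3/(T*T)+640*u^3/T). lra. replace (4*T*u^3/(T*T)+640*u^3/T) with (644*u^3/T) by fld.
 apply (Rmult_le_reg_r (T*c)). pos. replace (644*u^3/T*(T*c)) with (644*(u^3*c)) by fld. replace (1/c*(T*c)) with T by fld.
 nra.
Qed.
Lemma A1_small u : u <= 1 -> A1 N u = 0.
Proof.
 intro H. unfold A1, psi1. rewrite (Rmax_left 0 (u-1)) by lra. rewrite lsum_0; [lra|]. intros k Hk. apply in_seq in Hk. assert (1 <= INR k) by (replace 1 with (INR 1) by auto; apply le_INR; lia). rewrite Rmax_left by lra. ring.
Qed.
(** Absolute integration along the line, with a loss of 1/dl. It covers the initial range u <= 26 h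
    of the mean square. *)
Lemma A1_pointwise u : u <= c -> Rabs (A1 N u) <= 1000/dl*Rpower (Rmax 1 u) (sg+1).
Proof.
 intro Hu. assert (id : 1000000 <= / dl) by (rewrite <- (Rinv_inv 1000000); apply Rinv_le_contravar; lra). assert (Pw : 1 <= Rpower (Rmax 1 u) (sg+1)).
 { via (Rpower (Rmax 1 u) 0). rewrite Rpower_O; [lra|]. assert (X := Rmax_l 1 u); lra. apply Rpower_le_base; [apply Rmax_l|lra]. }
 destruct (Rle_dec u 1) as [L|L]. { rewrite A1_small, Rabs_R0 by auto. nra. }
 rewrite Rmax_right in * by lra. set (P := Rpower u (sg+1)) in *.
 assert (X := A1_line u ltac:(lra)).
 assert (Y : Cmod (Mel Gl (sg+1) (- T) T u) <= 4*(1472/dl*P)).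
 { apply CInt_log_bound; [lra|intros t _; apply Mel_rcont, rcont_Gl|]. intros t _. unfold Gl. destruct (line_neq_0 t).
  replace (FF (sg, t)/((sg, t)*((sg, t)+1))*Rcpow u ((sg+1)%R, t))%C with (FF (sg, t)*Ku u (sg, t))%C.
  2:{ unfold Ku. replace (((sg+1)%R, t) : C) with ((sg, t)+1)%C by (apply C_eq; simpl; lra). field; auto. }
  rewrite Cmod_mult. set (l := 1+ln (1+Rabs t)). assert (t0 := Rabs_pos t). assert (l1 : 1 <= l) by (unfold l; assert (0 <= ln (1+Rabs t)) by (rewrite <- ln_1; apply ln_le_mono; lra); lra).
  assert (lwl : lw t <= 2*l). { via (ln (7*(1+Rabs t))). apply ln_le_mono; lra. rewrite ln_mult by lra. assert (ln 7 <= 2). { apply ln_le_of_exp; [lra|]. assert (Z := exp_ge_pow27 2). replace (INR 2) with 2 in Z by auto. lra. } unfold l in *. lra. }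
  assert (F := FF_pointwise sg t ltac:(lra)). assert (F2 : Cmod (FF (sg, t)) <= 46/dl*l).
  { tr F. via (44*l * / dl+2000*l). apply Rplus_le_compat. nra. lra. nra. }
  via (46/dl*l*(Rpower u (sg+1)/sg*(8/((Rabs t+1)*(Rabs t+1))))). mul. apply Ku_vertical; lra.
  fold P. replace (46/dl*l*(P/sg*(8/((Rabs t+1)*(Rabs t+1))))) with (/ sg*(368/dl*P*(l/((Rabs t+1)*(Rabs t+1))))) by lra.
  replace (1472/dl*P*(l/((Rabs t+1)*(Rabs t+1)))) with (4*(368/dl*P*(l/((Rabs t+1)*(Rabs t+1))))) by lra.
  apply Rmult_le_compat_r. pos.
  replace 4 with (/ (1/4)) by field. apply Rinv_le_contravar; lra. }
 assert (Z := re_le_Cmod (Mel Gl (sg+1) (- T) T u)). set (V := Re (Mel Gl (sg+1) (- T) T u)) in *.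
 assert (A : Rabs (2*PI*A1 N u) <= 5890/dl*P). { replace (2*PI*A1 N u) with ((2*PI*A1 N u-V)+V) by ring. tr Rabs_triang. assert (1/c <= 1) by (apply (Rmult_le_reg_r c); [lra|]; unfold Rdiv; rewrite Rmult_assoc, Rinv_l; lra).
  nra. }
 rewrite Rabs_mult, (Rabs_right (2*PI)) in A by (generalize PI_RGT_0; lra). assert (P6 := PI2_3_2). assert (0 <= / dl*P) by nra. nra.
Qed.

(** The line is cut at height M, about X/h. Below it the second difference is traded for h^4 times
    the second derivative, which cancels s(s+1); above it the trivial bound for the difference is
    used and the kernel decays like t^(-4). At this M both parts have size h^3 X^(2 sg). The fourth
    piece [fe] is the truncation error. *)
Lemma window_mean_sq h X : 1/3 <= h -> 8*h+6 <= X -> X <= c ->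
 RInt (fun u => D2 (A1 N) h u^2) (X/2) X <= 27300*(h^3*Rpower X (2*sg)*Lx^2/dl)+2*X/c^2.
Proof.
 intros Hh HX HXc. destruct (nat_ceil (X/h)) as (M & HM). pos.
 assert (Mh : X <= INR M*h /\ INR M*h <= X+h). { destruct HM as (A & B). apply (Rmult_le_compat_r h) in A, B; try lra. unfold Rdiv in *. rewrite Rmult_plus_distr_r, !Rmult_assoc, Rinv_l in * by lra. lra. }
 assert (M8 : 8 <= INR M) by nra. assert (M3 : INR M <= 3*c+1) by nra.
 assert (LM : lt5 (INR M) <= Lx). { trr HLc. unfold lt5. rewrite Rabs_right by lra. apply ln_le_mono; lra. }
 assert (c4b : c <= c^4). { assert (1 <= c*(c*c)) by nra. nra. }
 assert (Mn : (M <= n)%nat) by (apply INR_le; unfold T in HT1; lra).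
 set (N1 := (n-M)%nat). assert (EN : INR N1 = INR n-INR M) by (apply minus_INR; pos).
 set (p := - INR M-1/2). assert (Ep : p+INR (2*M+1) = INR M+1/2) by (unfold p; rewrite plus_INR, mult_INR; simpl; lra).
 assert (E1 : INR M+1/2+INR N1 = T) by (unfold T; lra). assert (E2 : - T+INR N1 = p) by (unfold T, p; lra).
 set (fl := fun u => Re (Mel Gl (sg+1) p (p+INR (2*M+1)) u)). set (fp := fun u => Re (Mel Gl (sg+1) (INR M+1/2) (INR M+1/2+INR N1) u)). set (fm := fun u => Re (Mel Gl (sg+1) (- T) (- T+INR N1) u)).
 set (fe := fun u => 2*PI*A1 N u-(fl u+(fp u+fm u))).
 assert (EM : forall u, fl u+(fp u+fm u) = Re (Mel Gl (sg+1) (- T) T u)).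
 { intro u. unfold fl, fp, fm. rewrite Ep, E1, E2, <- !Re_Cplus. f_equal. assert (C := fun t => Mel_rcont Gl (sg+1) u t rcont_Gl). unfold Mel.
  rewrite <- (CInt_Chasles _ (- T) p T), <- (CInt_Chasles _ p (INR M+1/2) T) by (try (lra); intros t _; cont). ring. }
 (* The left end after two shifts by h. X >= 8h + 6 gives a >= X/4, the ratio that [Mel_mean_sq]
    admits. *)
 set (a := X/2-2*h). assert (a4 : X/4 <= a) by (unfold a; lra). assert (a1 : 1 < a <= X) by (unfold a; lra).
 assert (cM : forall p q u, p <= q -> 0 < u -> continuous (fun u => Re (Mel Gl (sg+1) p q u)) u) by (intros; apply rcont_Re; eapply rderiv_rcont, Mel_deriv; auto using rcont_Gl).
 assert (cl : forall t, 0 < t -> continuous fl t) by (intros; apply cM; lra). assert (cp : forall t, 0 < t -> continuous fp t) by (intros; apply cM; lra). assert (cm : forall t, 0 < t -> continuous fm t) by (intros; apply cM; lra).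
 assert (ce : forall t, 0 < t -> continuous fe t).
 { intros t Ht. apply (continuous_minus (V := R_NormedModule) (fun u => 2*PI*A1 N u)). cont.
  cont. }
 set (l := fl :: fp :: fm :: fe :: nil).
 assert (li : forall f, In f l -> ex_RInt (fun u => D2 f h u^2) (X/2) X).
 { assert (lc : forall f, In f l -> forall t, 0 < t -> continuous f t) by (intros f Hf; destruct Hf as [<-|[<-|[<-|[<-|[]]]]]; pos).
  intros f Hf. apply ex_RInt_cont_R; [lra|]. intros t Ht. apply continuous_sqr. apply continuous_D2; cont. }
 destruct (RInt_lsum l (fun f u => D2 f h u^2) _ _ li) as (J1 & J2).
 set (Y := Rpower X sg). assert (Y0 : 0 < Y) by apply Rpower_pos. assert (EY : Rpower X (2*sg) = Y^2) by (unfold Y; replace (2*sg) with (sg+sg) by ring; rewrite Rpower_plus; lra). rewrite EY.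
 set (S := h^3*Y^2*Lx^2/dl). assert (P3 := PI2_3_2). set (P := 2*PI) in *. assert (P6 : 6 <= P) by (unfold P; lra). assert (idl : 0 < / dl) by pos.
 assert (S0 : 0 < S) by (unfold S, Rdiv; pos).
 assert (I0 : P^2*RInt (fun u => D2 (A1 N) h u^2) (X/2) X <= 4*lsum l (fun f => RInt (fun u => D2 f h u^2) (X/2) X)).
 { rewrite <- J2. assert (A : ex_RInt (fun u => D2 (A1 N) h u^2) (X/2) X) by (apply ex_RInt_all; intro t; apply continuous_sqr, continuous_D2; cont).
  rewrite <- (RInt_scal_R _ _ _ (P^2) A), <- (RInt_scal_R _ _ _ 4 J1). apply RInt_le; [lra|cont|apply ex_RInt_scal_R; pos|].
  intros u _. rewrite <- Rpow_mult_distr. replace (P*D2 (A1 N) h u) with (lsum l (fun f => D2 f h u)) by (unfold l, lsum, D2, fe, P; simpl; lra).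
  tr Cauchy_Schwarz_lsum. simpl INR. lra. }
 assert (Bl : RInt (fun u => D2 fl h u^2) (X/2) X <= P*(19760*S)).
 { set (G1 := fun t => (Gl t*((sg+1)%R, t))%C). set (G2 := fun t => (G1 t*(sg, t))%C).
  assert (r1 : forall t, rcont G1 t) by (intro; apply rcont_mult; [apply rcont_Gl|cont]). assert (r2 : forall t, rcont G2 t) by (intro; apply rcont_mult; cont).
  assert (pq : p <= p+INR (2*M+1)) by lra.
  eapply Rle_trans. apply (D2_sq_deriv fl (fun u => Re (Mel G1 sg p (p+INR (2*M+1)) u)) (fun u => Re (Mel G2 (sg-1) p (p+INR (2*M+1)) u))); try lra.
  { intros t Ht. assert (0 < t) by lra. split; [|split].
   - replace (Mel G1 sg p (p+INR (2*M+1)) t) with (Mel G1 (sg+1-1) p (p+INR (2*M+1)) t) by (f_equal; lra). apply rderiv_Re, (Mel_deriv Gl); auto using rcont_Gl.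
   - apply rderiv_Re, (Mel_deriv G1); pos.
   - apply rcont_Re; eapply rderiv_rcont, Mel_deriv; pos. } assert (Q := Mel_mean_sq G2 (sg-1) p (2*M+1) a X (4*Y/X) ltac:(lra) ltac:(lra) r2).
  eapply Rle_trans. mull. apply Q.
  { intros u Hu. unfold Rminus. rewrite Rpower_plus, Rpower_Ropp, Rpower_1 by lra. replace (4*Y/X) with (Y * / (X/4)) by fld. apply Rmult_le_compat. pos. pos. apply Rle_Rpower_l; lra. apply Rinv_le_contravar; lra. }
  rewrite (RInt_ext (fun t => Cmod (G2 t)^2) (fun t => Cmod (FF (sg, t))^2)). 2:{ intros t _. f_equal. f_equal. unfold G2, G1, Gl. destruct (line_neq_0 t). replace (((sg+1)%R, t) : C) with ((sg, t)+1)%C by (apply C_eq; simpl; lra). field; auto. }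
  assert (Lq := low_sq M Lx HLx LM).
  via (h^4*((4*Y/X)^2*(X*(P*(520*Lx^2/dl*(2.375*X/h)))))).
  - assert (2*INR M+1 <= 2.375*X/h). { apply (Rmult_le_reg_r h); [lra|]. replace (2.375*X/h*h) with (2.375*X) by fld. lra. }
   mull. mull. mull. mull. tr Lq. apply Rmult_le_compat_l; [|lra]. nra.
  - right. replace 2.375 with (19/8) by lra. unfold S. fld. }
 assert (Bh : forall p0, (forall t, 0 < t -> continuous (fun u => Re (Mel Gl (sg+1) p0 (p0+INR N1) u)) t) -> RInt (fun t => Cmod (Gl t)^2) p0 (p0+INR N1) <= 660*Lx^2/(dl*INR M^3) ->
  RInt (fun u => D2 (fun u => Re (Mel Gl (sg+1) p0 (p0+INR N1) u)) h u^2) (X/2) X <= P*(10560*S)).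
 { intros p0 C0 H0. eapply Rle_trans. apply D2_sq_le; try lra. cont.
  assert (Q := Mel_mean_sq Gl (sg+1) p0 N1 a X (Y*X) ltac:(lra) ltac:(lra) rcont_Gl). eapply Rle_trans. mull. apply Q.
  { intros u Hu. unfold Y. rewrite <- (Rpower_1 X) at 2 by lra. rewrite <- Rpower_plus. apply Rle_Rpower_l; lra. } via (16*((Y*X)^2*(X*(P*(660*Lx^2/(dl*(X/h)^3)))))).
  - mull. mull. mull. mull. tr H0. mull. apply Rinv_le_contravar. pos. mull. apply pow_incr. lra.
  - right. unfold S. fld. }
 assert (Bp : RInt (fun u => D2 fp h u^2) (X/2) X <= P*(10560*S)).
 { apply Bh; [pos|]. apply (high_sq M (INR M+1/2) N1 Lx (fun k => - / (INR M+INR k))); auto.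
  - rewrite Rplus_0_r. assert (0 < / (INR M+INR N1)) by pos. lra.
  - intros k Hk. exists (n+1)%nat, (n+1+(M+1+k))%nat. assert (k0 := pos_INR k). assert (E : ht (n+1) (n+1+(M+1+k)) = INR M+1+INR k) by (unfold ht; rewrite !plus_INR; simpl; lra). rewrite E, Rabs_right by lra. split; [lia|]. split; [lra|]. split; [lra|]. rewrite S_INR. right. fld. }
 assert (Bm : RInt (fun u => D2 fm h u^2) (X/2) X <= P*(10560*S)).
 { apply Bh; [pos|]. apply (high_sq M (- T) N1 Lx (fun k => / (INR n-INR k))); auto.
  - rewrite Rminus_0_r. replace (INR n-INR N1) with (INR M) by lra. assert (0 < / INR n) by pos. lra.
  - intros k Hk. exists n, k. assert (k0 : INR k+1 <= INR N1) by (rewrite <- S_INR; apply le_INR; lia). unfold ht. rewrite Rabs_left by lra. split; [lia|]. split; [lra|]. split; [lra|]. rewrite S_INR. right. fld. }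
 assert (Be : RInt (fun u => D2 fe h u^2) (X/2) X <= 16*(X/c^2)).
 { eapply Rle_trans. apply D2_sq_le; try lra. cont. mull.
  via (RInt (fun _ => (1/c)^2) a X). apply RInt_le; try cont.
  intros u Hu. rewrite <- pow2_abs. apply Rsqr_le. split; [pos|]. unfold fe. rewrite EM. apply A1_line; lra.
  rewrite RInt_const_R. replace (X/c^2) with (X*(1/c)^2) by fld. mulr; lra. }
 unfold l, lsum in I0. cbn [map fold_right] in I0.
 set (I := RInt (fun u => D2 (A1 N) h u^2) (X/2) X) in *. assert (c2 : 0 < X/c^2) by pos.
 assert (F : P^2*I <= 4*(P*(40880*S)+16*(X/c^2))) by lra.
 replace (27300*S+2*X/c^2) with (27300*S+2*(X/c^2)) by lra. set (E := X/c^2) in *. clear-F P6 S0 c2.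
 apply Rmult_le_reg_l with (P^2); [nra|]. assert (6*(P*S) <= P*(P*S)) by (mulr; nra). assert (36*E <= P*P*E) by (mulr; nra). nra.
Qed.
(** Dyadic windows are added downwards from X until X <= 8h + 6 <= 26 h, where the pointwise bound
    takes over. Since 27300/(1 - 0.71) < 96000, the constant reproduces itself in the induction. *)
Lemma A1_mean_sq h X : 1/3 <= h -> 0 < X <= c ->
 RInt (fun u => D2 (A1 N) h u^2) 0 X <= 96000*(h^3*Rpower X (2*sg)*Lx^2/dl)+4*X/c^2+26*h*(4*(1000/dl*Rpower (26*h) (sg+1)))^2.
Proof.
 intros Hh HX. set (Bt := 26*h*(4*(1000/dl*Rpower (26*h) (sg+1)))^2).
 assert (SP : forall X, 0 < h^3*Rpower X (2*sg)*Lx^2/dl) by (intro Y; pos).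
 assert (ex : forall a b, ex_RInt (fun u => D2 (A1 N) h u^2) a b) by (intros; apply ex_RInt_all; intro t; apply continuous_sqr, continuous_D2; cont).
 assert (Ind : forall j X, 0 < X <= c -> X <= 2^j*(8*h+6) -> RInt (fun u => D2 (A1 N) h u^2) 0 X <= 96000*(h^3*Rpower X (2*sg)*Lx^2/dl)+4*X/c^2+Bt).
 { intros j. induction j as [|j IH]; intros Y HY Hj; (destruct (Rle_dec Y (8*h+6)) as [L|L]; try lra).
  1, 2: apply Rle_trans with Bt; [|specialize (SP Y); assert (0 < 4*Y/c^2) by pos; lra];
   set (m := 1000/dl*Rpower (26*h) (sg+1)) in *; apply Rle_trans with (RInt (fun _ => (4*m)^2) 0 Y);
   [apply RInt_le; [lra|auto|apply ex_RInt_const|]|rewrite RInt_const_R; unfold Bt; apply Rmult_le_compat_r; [apply pow2_ge_0|lra]];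
   intros u Hu; rewrite <- pow2_abs; apply Rsqr_le; split; [apply Rabs_pos|];
   assert (pw : forall v, v <= Y -> Rabs (A1 N v) <= m) by (intros v Hv; eapply Rle_trans; [apply A1_pointwise; lra|]; unfold m; mull; apply Rle_Rpower_l; [lra|]; split; [assert (Z := Rmax_l 1 v); lra|apply Rmax_lub; lra]);
   assert (A := pw u ltac:(lra)); assert (B := pw (u-h) ltac:(lra)); assert (C := pw (u-2*h) ltac:(lra)); apply Rabs_le_between in A, B, C; apply Rabs_le_between; unfold D2; lra.
  simpl in Hj. assert (H1 := IH (Y/2) ltac:(lra) ltac:(lra)). assert (H2 := window_mean_sq h Y Hh ltac:(lra) ltac:(lra)).
  rewrite <- (RInt_Chasles_R _ 0 (Y/2) Y) by apply ex. set (S := h^3*Rpower Y (2*sg)*Lx^2/dl) in *.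
  (* Halving Y gains 2^(-2 sg), which is at most 2^(-1/2) < 0.71 as sg >= 1/4. *)
  assert (SH : h^3*Rpower (Y/2) (2*sg)*Lx^2/dl <= 0.71*S).
  { replace (Y/2) with (Y * / 2) by field. rewrite <- Rpower_mult_distr by lra. replace (h^3*(Rpower Y (2*sg)*Rpower (/ 2) (2*sg))*Lx^2/dl) with (Rpower (/ 2) (2*sg)*S) by (unfold S, Rdiv; lra). mulr; [left; apply SP|].
   unfold Rpower. rewrite ln_Rinv by lra. via (exp (- (ln 2/2))). destruct (Req_dec (2*sg * - ln 2) (- (ln 2/2))) as [E|E]. rewrite E; lra. left; apply exp_increasing. assert (Z := ln_lt_2). nra.
   rewrite exp_Ropp. assert (Q : exp (ln 2/2)*exp (ln 2/2) = 2) by (rewrite <- exp_plus; replace (ln 2/2+ln 2/2) with (ln 2) by field; apply exp_ln; lra). assert (E0 := exp_pos (ln 2/2)).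
   assert (1.41 <= exp (ln 2/2)) by nra. rewrite <- (Rinv_inv 0.71). apply Rinv_le_contravar; [|lra]. lra. }
  assert (SY := SP Y). fold S in SY. lra. }
 destruct (Pow_x_infinity 2 ltac:(rewrite Rabs_right; lra) c) as (j & Hj). specialize (Hj j (le_n _)). rewrite Rabs_right in Hj by (apply Rle_ge, pow_le; lra).
 apply (Ind j); auto. nra.
Qed.
End Line.
Lemma ln_linear_bound k y : 0 < k -> 0 < y -> ln y <= y/k+ln k.
Proof.
 intros Hk Hy. replace (ln y) with (ln (y/k)+ln k). apply Rplus_le_compat_r. apply ln_le_of_exp. pos. assert (X := exp_ineq1_le (y/k)). lra.
 rewrite <- ln_mult; auto. f_equal; fld. pos.
Qed.
(** The tangent bound ln y <= y/k + ln k with k = 2q makes the logarithmic side at most half of T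
    plus a constant. *)
Lemma height_exists dl B : 0 < dl -> exists n, B <= INR n+1/2 /\ (28+8*lw (INR n+1/2))/dl+1000*lw (INR n+1/2) <= INR n+1/2.
Proof.
 intro Hd. assert (idl : 0 < / dl) by pos. set (q := 8 * / dl+1000). set (k := 2*q). assert (q0 : 0 < q) by (unfold q; lra).
 destruct (INR_unbounded (Rabs B+(7+2*q*Rabs (ln k)+56 * / dl))) as (n & Hn). exists n. assert (X := Rle_abs B). assert (A1 := Rle_abs (ln k)). assert (B0 := Rabs_pos B). assert (0 <= 2*q*Rabs (ln k)) by pos.
 split; [lra|]. set (T := INR n+1/2). assert (T0 : 0 < T) by (unfold T; lra). unfold lw. rewrite Rabs_right by lra. assert (L := ln_linear_bound k (T+7) ltac:(unfold k; lra) ltac:(lra)).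
 replace ((28+8*ln (T+7))/dl+1000*ln (T+7)) with (28 * / dl+q*ln (T+7)) by (unfold q, Rdiv; lra).
 via (28 * / dl+q*((T+7)/k+ln k)). nra. replace (q*((T+7)/k+ln k)) with ((T+7)/2+q*ln k) by (unfold k; fld).
 assert (q*ln k <= q*Rabs (ln k)) by (mull; lra). unfold T in *. lra.
Qed.

(** * Decomposition of the additive convolution *)

Definition am (n : nat) : R := vonMangoldt n-1.
Definition kp (a u : R) : R := Rmax 0 (u-a).
(** The companion of [A1] in which the 1 is summed instead of integrated. It is the one that
    convolves exactly, while [A1] is the one produced by the contour integral. *)
Definition A1d (N : nat) (u : R) : R := lsum (seq 1 N) (fun n => am n*kp (INR n) u).
Definition K3 (t : R) : R := Rmax 0 t^3/6.
Definition dsum (N : nat) (w : nat -> nat -> R) : R := lsum (seq 1 N) (fun m => lsum (seq 1 N) (fun l => w m l)).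
Definition Dsum (N : nat) : R := dsum N (fun m l => am m*am l*ind (Nat.leb (m+l) N)).
Definition Qc (N : nat) (c : R) : R := dsum N (fun m l => am m*am l*K3 (c-INR m-INR l)).

Lemma K3_conv a b c : 0 <= a -> 0 <= b -> 0 <= c -> RInt (fun u => kp a u*kp b (c-u)) 0 c = K3 (c-a-b).
Proof.
 intros Ha Hb Hc. assert (kz : forall a u, u <= a -> kp a u = 0) by (intros x y H; apply Rmax_left; lra). assert (kr : forall a u, a <= u -> kp a u = u-a) by (intros x y H; apply Rmax_right; lra).
 destruct (Rle_dec (c-a-b) 0) as [L|L].
 - unfold K3. rewrite Rmax_left by lra. rewrite (RInt_ext _ (fun _ => 0)), RInt_const_R. nra. intros u _. destruct (Rle_dec u a). rewrite (kz a u) by lra. nra. rewrite (kz b (c-u)) by lra. nra.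
 - set (d := c-b). assert (C : forall t, continuous (fun u => kp a u*kp b (c-u)) t).
  { intro t. apply (continuous_mult (K := R_AbsRing)). apply continuous_Rmax_shift. apply (continuous_comp (fun u => c-u) (kp b)); [|apply continuous_Rmax_shift]. cont. }
  rewrite <- (RInt_Chasles_R _ 0 a c), <- (RInt_Chasles_R _ a d c) by cont.
  rewrite (RInt_ext _ (fun _ => 0) 0 a). 2:{ minmax. intros u Hu. rewrite (kz a u) by lra. lra. }
  rewrite (RInt_ext _ (fun _ => 0) (c-b) c). 2:{ minmax. intros u Hu. rewrite (kz b (c-u)) by lra. lra. }
  rewrite (RInt_ext _ (fun u => (u-a)*(c-b-u)) a (c-b)). 2:{ minmax. intros u Hu. rewrite (kr a u), (kr b (c-u)) by lra. lra. }
  assert (X : is_RInt (fun u => (u-a)*(c-b-u)) a (c-b) (((c-b-a)*(c-b-a)^2/2-(c-b-a)^3/3)-((c-b-a)*(a-a)^2/2-(a-a)^3/3))).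
  { apply (is_RInt_derive (fun u => (c-b-a)*(u-a)^2/2-(u-a)^3/3)). intros t _. auto_derive; auto. nra. cont. }
  rewrite (is_RInt_unique (V := R_CompleteNormedModule) _ _ _ _ X), !RInt_const_R. unfold K3. rewrite Rmax_right by lra. lra.
Qed.
Definition N3 (f : R -> R) (h c : R) : R := f c-3*f (c-h)+3*f (c-2*h)-f (c-3*h).
Definition N4 (f : R -> R) (h c : R) : R := f c-4*f (c-h)+6*f (c-2*h)-4*f (c-3*h)+f (c-4*h).
Lemma dsum_ext N v w : (forall m l, (1 <= m)%nat -> (1 <= l)%nat -> v m l = w m l) -> dsum N v = dsum N w.
Proof. intro H. apply lsum_ext. intros m Hm. apply lsum_ext. intros l Hl. apply in_seq in Hm, Hl. apply H; lia. Qed.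
Lemma dsum_plus N v w : dsum N (fun m l => v m l+w m l) = dsum N v+dsum N w.
Proof. unfold dsum. rewrite <- lsum_plus. apply lsum_ext. intros. apply lsum_plus. Qed.
Lemma dsum_scal N k v : dsum N (fun m l => k*v m l) = k*dsum N v.
Proof. unfold dsum. rewrite <- lsum_scal. apply lsum_ext. intros. apply lsum_scal. Qed.
Lemma kp_shift a h u : kp a (u-h) = kp (a+h) u.
Proof. unfold kp. f_equal. ring. Qed.
Lemma D2_A1d N h u : D2 (A1d N) h u = lsum (seq 1 N) (fun m => am m*(kp (INR m) u-2*kp (INR m+h) u+kp (INR m+2*h) u)).
Proof.
 unfold D2, A1d. rewrite (lsum_ext _ (fun m => am m*(kp (INR m) u-2*kp (INR m+h) u+kp (INR m+2*h) u)) (fun m => (am m*kp (INR m) u + -2*(am m*kp (INR m) (u-h)))+am m*kp (INR m) (u-2*h))), !lsum_plus, lsum_scal. ring. intros m _. rewrite !kp_shift. ring.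
Qed.
(** The cubic K3(c-a-b) is the convolution of two ramps, and differencing each factor twice with
    step h differences the convolution four times. *)
Lemma Q_conv N h c : 0 <= c -> 0 <= h -> N4 (Qc N) h c = RInt (fun u => D2 (A1d N) h u*D2 (A1d N) h (c-u)) 0 c.
Proof.
 intros Hc Hh. set (k3 := fun m u => kp (INR m) u-2*kp (INR m+h) u+kp (INR m+2*h) u).
 assert (ck : forall a t, continuous (kp a) t) by (apply continuous_Rmax_shift).
 assert (ckr : forall a t, continuous (fun u => kp a (c-u)) t) by (intros a t; apply (continuous_comp (fun u => c-u) (kp a)); cont).
 assert (pe : forall a b, ex_RInt (fun u => kp a u*kp b (c-u)) 0 c) by cont.
 assert (pair : forall m l, ex_RInt (fun u => k3 m u*k3 l (c-u)) 0 c /\ RInt (fun u => k3 m u*k3 l (c-u)) 0 c = N4 (fun c => K3 (c-INR m-INR l)) h c).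
 { intros m l. set (L := ((1, (0, 0)) :: (-2, (0, h)) :: (1, (0, 2*h)) :: (-2, (h, 0)) :: (4, (h, h)) :: (-2, (h, 2*h)) :: (1, (2*h, 0)) :: (-2, (2*h, h)) :: (1, (2*h, 2*h)) :: nil) : list (R*(R*R))).
  assert (Le : forall q, In q L -> ex_RInt (fun u => fst q*(kp (INR m+fst (snd q)) u*kp (INR l+snd (snd q)) (c-u))) 0 c) by cont.
  destruct (RInt_lsum L _ 0 c Le) as (J1 & J2).
  assert (EE : forall u, lsum L (fun q => fst q*(kp (INR m+fst (snd q)) u*kp (INR l+snd (snd q)) (c-u))) = k3 m u*k3 l (c-u)) by (intro u; unfold L, lsum, k3; simpl; rewrite !Rplus_0_r; lra).
  split. apply ex_RInt_ext with (2 := J1). auto. rewrite <- (RInt_ext _ _ _ _ (fun u _ => EE u)), J2, (lsum_ext L _ (fun q => fst q*K3 (c-INR m-INR l-(fst (snd q)+snd (snd q))))).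
  2:{ intros q Hq. rewrite RInt_scal_R by apply pe. rewrite K3_conv; auto. f_equal. f_equal. ring. 1, 2: apply Rplus_le_le_0_compat; [pos|]; repeat (destruct Hq as [<-|Hq]; [simpl; lra|]); destruct Hq. }
  unfold L, lsum, N4; cbn [map fold_right fst snd]. set (t := c-INR m-INR l).
  replace (c-h-INR m-INR l) with (t-h) by (unfold t; lra). replace (c-2*h-INR m-INR l) with (t-2*h) by (unfold t; lra). replace (c-3*h-INR m-INR l) with (t-3*h) by (unfold t; lra). replace (c-4*h-INR m-INR l) with (t-4*h) by (unfold t; lra).
  replace (t-(0+0)) with t by ring. replace (t-(0+h)) with (t-h) by ring. replace (t-(0+2*h)) with (t-2*h) by ring. replace (t-(h+0)) with (t-h) by ring. replace (t-(h+h)) with (t-2*h) by ring. replace (t-(h+2*h)) with (t-3*h) by ring.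
  replace (t-(2*h+0)) with (t-2*h) by ring. replace (t-(2*h+h)) with (t-3*h) by ring. replace (t-(2*h+2*h)) with (t-4*h) by ring. lra. }
 transitivity (dsum N (fun m l => am m*am l*N4 (fun c => K3 (c-INR m-INR l)) h c)).
 { set (w := fun d m l => am m*am l*K3 (d-INR m-INR l)).
  rewrite (dsum_ext N _ (fun m l => w c m l+(-4*w (c-h) m l+(6*w (c-2*h) m l+(-4*w (c-3*h) m l+w (c-4*h) m l))))) by (intros; unfold w, N4; lra).
  rewrite !dsum_plus, !dsum_scal. unfold N4, Qc, w. ring. }
 set (F := fun m l u => am m*am l*(k3 m u*k3 l (c-u))).
 assert (Fe : forall m l, ex_RInt (F m l) 0 c) by (intros; apply ex_RInt_scal_R, pair).
 assert (I1 := fun m => RInt_lsum (seq 1 N) (F m) 0 c (fun l _ => Fe m l)).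
 destruct (RInt_lsum (seq 1 N) (fun m u => lsum (seq 1 N) (fun l => F m l u)) 0 c (fun m _ => proj1 (I1 m))) as (_ & I2).
 transitivity (RInt (fun u => lsum (seq 1 N) (fun m => lsum (seq 1 N) (fun l => F m l u))) 0 c).
 - rewrite I2. apply lsum_ext. intros m _. rewrite (proj2 (I1 m)). apply lsum_ext. intros l _. unfold F. rewrite RInt_scal_R by apply pair. rewrite (proj2 (pair m l)). reflexivity.
 - apply RInt_ext. intros u _. rewrite !D2_A1d, Rmult_comm, <- lsum_scal. apply lsum_ext. intros m _. rewrite Rmult_comm, <- lsum_scal. apply lsum_ext. intros l _. unfold F, k3. ring.
Qed.
Lemma Qc_nonpos N c : c <= 0 -> Qc N c = 0.
Proof.
 intro H. unfold Qc. rewrite (dsum_ext N _ (fun m l => 0*0)), dsum_scal. ring. intros m l _ _. unfold K3. rewrite Rmax_left. lra. generalize (pos_INR m) (pos_INR l); lra.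
Qed.
Lemma continuous_A1d N t : continuous (A1d N) t.
Proof. apply (continuous_lsum (seq 1 N) (fun n u => am n*kp (INR n) u)). intro k. apply (continuous_mult_R (fun _ => am k)); [cont|apply continuous_Rmax_shift]. Qed.
#[export] Hint Resolve continuous_A1d : cont.
Definition Vd (N : nat) (h c : R) : R := RInt (fun u => D2 (A1d N) h u^2) 0 c.
(** After 2|fg| <= f^2 + g^2 the reflection u -> d - u makes the two integrals equal; enlarging the
    range to c gives one bound for all the shifted arguments. *)
Lemma N4_bound N h c d : 0 <= h -> 0 <= c -> d <= c -> Rabs (N4 (Qc N) h d) <= Vd N h c.
Proof.
 intros Hh Hc Hd. set (f := D2 (A1d N) h). assert (fc : forall t, continuous f t) by (intro; apply continuous_D2; cont). assert (f2 : forall a b, ex_RInt (fun u => f u^2) a b) by cont.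
 assert (V0 : forall a b, a <= b -> 0 <= RInt (fun u => f u^2) a b) by (intros; apply RInt_ge_0; auto; intros; pos).
 destruct (Rle_dec d 0) as [L|L]. { unfold N4. rewrite !Qc_nonpos by lra. replace (0-4*0+6*0-4*0+0) with 0 by ring. rewrite Rabs_R0. apply V0; lra. }
 rewrite Q_conv by lra. assert (cr : forall t, continuous (fun u => f (d-u)) t) by (intro t; apply (continuous_comp (fun u => d-u) f); cont).
 assert (ER : RInt (fun u => f (d-u)^2) 0 d = RInt (fun u => f u^2) 0 d).
 { assert (X := RInt_comp_lin (fun u => f u^2) (-1) d 0 d (f2 _ _)). replace (-1*0+d) with d in X by ring. replace (-1*d+d) with 0 in X by ring. rewrite <- (opp_RInt_swap (fun u => f u^2) 0 d) in X by apply f2.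
  assert (Z : RInt (fun y => scal (-1) (f (-1*y+d)^2)) 0 d = -1*RInt (fun u => f (d-u)^2) 0 d).
  { rewrite <- RInt_scal_R by cont. apply RInt_ext. intros u _. unfold scal; simpl; unfold mult; simpl. replace (-1*u+d) with (d-u) by ring. lra. }
  assert (W : -1*RInt (fun u => f (d-u)^2) 0 d = - RInt (fun u => f u^2) 0 d) by (rewrite <- Z; pos). lra. }
 assert (e1 : ex_RInt (fun u => f u^2) 0 d) by apply f2. assert (e2 : ex_RInt (fun u => f (d-u)^2) 0 d) by cont.
 via (RInt (fun u => / 2*f u^2 + / 2*f (d-u)^2) 0 d).
 - apply (norm_RInt_le (fun u => f u*f (d-u)) (fun u => / 2*f u^2 + / 2*f (d-u)^2) 0 d); try lra.
  + intros u _. assert (A := pow2_ge_0 (f u-f (d-u))). assert (B := pow2_ge_0 (f u+f (d-u))). apply Rabs_le_between. lra.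
  + apply (RInt_correct (V := R_CompleteNormedModule)). cont.
  + apply (RInt_correct (V := R_CompleteNormedModule)). cont.
 - rewrite (RInt_plus_R (fun u => / 2*f u^2) (fun u => / 2*f (d-u)^2) 0 d (ex_RInt_scal_R _ _ _ _ e1) (ex_RInt_scal_R _ _ _ _ e2)), (RInt_scal_R _ _ _ _ e1), (RInt_scal_R _ _ _ _ e2), ER. unfold Vd. fold f. rewrite <- (RInt_Chasles_R (fun u => f u^2) 0 d c) by apply f2.
  assert (X := V0 d c Hd). lra.
Qed.
(* 1 - (1+S)^3/8 = (1-S)(7+4S+S^2)/8, where S is the shift by h. *)
Lemma N3_double f h c : 0 < h -> / h^3*N3 f h c = / (2*h)^3*N3 f (2*h) c + / h^3*((7*N4 f h c+4*N4 f h (c-h)+N4 f h (c-2*h))/8).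
Proof.
 intro H. unfold N3, N4. replace (c-h-h) with (c-2*h) by ring. replace (c-h-2*h) with (c-3*h) by ring. replace (c-h-3*h) with (c-4*h) by ring. replace (c-h-4*h) with (c-5*h) by ring.
 replace (c-2*h-h) with (c-3*h) by ring. replace (c-2*h-2*h) with (c-4*h) by ring. replace (c-2*h-3*h) with (c-5*h) by ring. replace (c-2*h-4*h) with (c-6*h) by ring.
 replace (c-2*(2*h)) with (c-4*h) by ring. replace (c-3*(2*h)) with (c-6*h) by ring. fld.
Qed.
(** With c = N + 1 and h = 1/3 the number c - m - l is an integer. If it is at least 1 = 3h, all
    four arguments lie where [K3] is a cubic, and the third difference is exactly h^3; otherwise all
    four are at most 0. So the sharp cut-off is reproduced without error. *)
Lemma Dsum_N3 N : Dsum N = / (1/3)^3*N3 (Qc N) (1/3) (INR N+1).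
Proof.
 set (c := INR N+1). set (w := fun d m l => am m*am l*K3 (d-INR m-INR l)).
 replace (N3 (Qc N) (1/3) c) with (dsum N (fun m l => w c m l+(-3*w (c-1/3) m l+(3*w (c-2*(1/3)) m l + -1*w (c-3*(1/3)) m l)))).
 2:{ rewrite !dsum_plus, !dsum_scal. unfold N3, Qc, w. ring. }
 rewrite <- dsum_scal. apply dsum_ext. intros m l _ _. unfold w, K3. destruct (Nat.leb_spec (m+l) N) as [L|L].
 - apply le_INR in L. rewrite plus_INR in L. unfold ind, c. rewrite !Rmax_right by lra. nra.
 - assert (L' : INR (S N) <= INR (m+l)) by (apply le_INR; lia). rewrite S_INR, plus_INR in L'. unfold ind, c. rewrite !Rmax_left by lra. lra.
Qed.
(** The factor 3/2 is (7+4+1)/8 from [N3_double]. The doubling stops once the step reaches c: then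
    only the value at c itself survives, and third and fourth differences agree. *)
Lemma Dsum_bound N K : INR N+1 <= 2^K/3 -> Rabs (Dsum N) <= 3/2*lsum (seq 0 (S K)) (fun k => Vd N (2^k/3) (INR N+1)/(2^k/3)^3).
Proof.
 intro HK. rewrite Dsum_N3. set (c := INR N+1) in *. assert (c0 : 0 < c) by (unfold c; generalize (pos_INR N); lra).
 set (h := fun k => 2^k/3). assert (h0 : forall k, 0 < h k) by (intro k; unfold h; pos). assert (hi : forall k, 0 < / h k^3) by (intro; apply Rinv_0_lt_compat, pow_lt; auto).
 assert (Ind : forall k, Rabs (/ (1/3)^3*N3 (Qc N) (1/3) c) <= Rabs (/ h k^3*N3 (Qc N) (h k) c)+3/2*lsum (seq 0 k) (fun k => Vd N (h k) c/h k^3)).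
 { induction k as [|k IH]. unfold h, lsum; simpl map. simpl. lra. rewrite lsum_seq_S. tr IH. rewrite N3_double by auto.
  replace (2*h k) with (h (S k)) by (unfold h; simpl; lra). eapply Rle_trans. apply Rplus_le_compat_r, Rabs_triang.
  assert (B := fun d Hd => N4_bound N (h k) c d (Rlt_le _ _ (h0 k)) (Rlt_le _ _ c0) Hd). assert (B1 := B c (Rle_refl _)). assert (hk := h0 k). assert (B2 := B (c-h k) ltac:(lra)). assert (B3 := B (c-2*h k) ltac:(lra)).
  rewrite (Rabs_mult (/ h k^3)), (Rabs_right (/ h k^3)) by (apply Rle_ge, Rlt_le; pos).
  assert (X : Rabs ((7*N4 (Qc N) (h k) c+4*N4 (Qc N) (h k) (c-h k)+N4 (Qc N) (h k) (c-2*h k))/8) <= 3/2*Vd N (h k) c) by (apply Rabs_le_between in B1, B2, B3; apply Rabs_le_between; lra).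
  replace (2*h k) with (h (S k)) in X by (unfold h; simpl; lra). apply (Rmult_le_compat_l (/ h k^3)) in X; [|pos]. change (0+k)%nat with k. lra. }
 tr (Ind K). rewrite lsum_seq_S. change (0+K)%nat with K. fold (h K). change (fun k => Vd N (2^k/3) c/(2^k/3)^3) with (fun k => Vd N (h k) c/h k^3).
 assert (E : N3 (Qc N) (h K) c = N4 (Qc N) (h K) c) by (unfold N3, N4; unfold h; rewrite !(Qc_nonpos N (c-_)) by lra; lra).
 rewrite E. assert (B := N4_bound N (h K) c c (Rlt_le _ _ (h0 K)) (Rlt_le _ _ c0) (Rle_refl _)). rewrite Rabs_mult, (Rabs_right (/ h K^3)) by (apply Rle_ge, Rlt_le; auto). apply (Rmult_le_compat_l (/ h K^3)) in B; [|left; auto].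
 assert (0 <= / h K^3*Rabs (N4 (Qc N) (h K) c)) by (apply Rmult_le_pos; [left; auto|pos]). lra.
Qed.
Lemma kp_sum_closed N u : INR N <= u -> lsum (seq 1 N) (fun n => kp (INR n) u) = INR N*u-INR N*(INR N+1)/2.
Proof.
 induction N as [|N IH]; intro H. unfold lsum; simpl; lra. rewrite lsum_seq_S, S_INR in *. rewrite IH by lra. rewrite S_INR. unfold kp. rewrite Rmax_right by lra. lra.
Qed.
(** Between consecutive integers the discrepancy is t(1-t)/2 with t the fractional part, hence at
    most 1/8. *)
Lemma kp_sum_approx N u : u <= INR N+1 -> Rabs (lsum (seq 1 N) (fun n => kp (INR n) u)-Rmax 0 (u-1)^2/2-Rmax 0 (u-1)/2) <= 1/8.
Proof.
 induction N as [|N IH]; intro H.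
 - simpl in H. rewrite Rmax_left by lra. unfold lsum; simpl. replace (0-0*(0*1)/2-0/2) with 0 by field. rewrite Rabs_R0. lra.
 - rewrite S_INR in H. destruct (Rle_dec u (INR N+1)) as [L|L].
  + rewrite lsum_seq_S. replace (1+N)%nat with (S N) by lia. replace (kp (INR (S N)) u) with 0 by (unfold kp; rewrite Rmax_left; rewrite ?S_INR; lra). rewrite Rplus_0_r. auto.
  + rewrite kp_sum_closed, S_INR by (rewrite S_INR; lra). assert (N0 := pos_INR N). rewrite Rmax_right by lra. set (t := u-INR N-1). assert (0 <= t <= 1) by (unfold t; lra).
   replace ((INR N+1)*u-(INR N+1)*(INR N+1+1)/2-(u-1)^2/2-(u-1)/2) with (t*(1-t)/2) by (unfold t; lra). assert (X := pow2_ge_0 (t-1/2)). apply Rabs_le_between. nra.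
Qed.
Lemma A1d_A1 N u : u <= INR N+1 -> Rabs (A1d N u-A1 N u+Rmax 0 (u-1)/2) <= 1/8.
Proof.
 intro H. assert (X := kp_sum_approx N u H). rewrite <- Rabs_Ropp. trr X. right. f_equal. unfold A1d, A1, psi1.
 rewrite (lsum_ext (seq 1 N) (fun n => am n*kp (INR n) u) (fun n => vonMangoldt n*Rmax 0 (u-INR n) + -1*kp (INR n) u)) by (intros; unfold am, kp; lra). rewrite lsum_plus, lsum_scal. lra.
Qed.
Lemma Vd_le N h : 1/3 <= h -> Vd N h (INR N+1) <= 2*RInt (fun u => D2 (A1 N) h u^2) 0 (INR N+1)+8*(INR N+1)*h^2.
Proof.
 intro Hh. set (c := INR N+1). assert (c0 : 0 <= c) by (unfold c; pos).
 assert (e1 : ex_RInt (fun u => D2 (A1 N) h u^2) 0 c) by (apply ex_RInt_all; intro; apply continuous_sqr, continuous_D2; cont).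
 via (RInt (fun u => 2*D2 (A1 N) h u^2+8*h^2) 0 c).
 - apply RInt_le; auto. apply ex_RInt_all; intro; apply continuous_sqr, continuous_D2; cont. cont.
  intros u Hu. assert (A := A1d_A1 N u ltac:(fold c; lra)). assert (B := A1d_A1 N (u-h) ltac:(fold c; lra)). assert (C := A1d_A1 N (u-2*h) ltac:(fold c; lra)).
  apply Rabs_le_between in A, B, C.
  assert (k1 : 0 <= Rmax 0 (u-1)-Rmax 0 (u-h-1) <= h) by (unfold Rmax; repeat destruct Rle_dec; lra). assert (k2 : 0 <= Rmax 0 (u-h-1)-Rmax 0 (u-2*h-1) <= h) by (unfold Rmax; repeat destruct Rle_dec; lra).
  (* The linear correction contributes at most h/2, the errors 1/8 with weights 1, 2, 1 at most 1/2,
     and h >= 1/3 makes the total at most 2h. *)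
  set (b := D2 (A1d N) h u-D2 (A1 N) h u). assert (Bb : - (2*h) <= b <= 2*h) by (unfold b, D2; lra). replace (D2 (A1d N) h u) with (D2 (A1 N) h u+b) by (unfold b; lra).
  assert (X := pow2_ge_0 (D2 (A1 N) h u-b)). nra.
 - rewrite (RInt_plus_R (fun u => 2*D2 (A1 N) h u^2) (fun _ => 8*h^2) 0 c (ex_RInt_scal_R _ _ _ _ e1) (ex_RInt_const _ _ _)), (RInt_scal_R _ _ _ _ e1), RInt_const_R. lra.
Qed.

(** * From the sums of G to the double sum D and its bound *)

Lemma G_dsum N n : (n <= N)%nat -> G n = dsum N (fun m l => vonMangoldt m*vonMangoldt l*ind (Nat.eqb (m+l) n)).
Proof.
 transitivity (lsum (seq 1 N) (fun l => if Nat.ltb l n then vonMangoldt l*vonMangoldt (n-l) else 0)).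
 - rewrite (lsum_seq_extend _ 1 (n-1) N) by (try lia; intros k Hk; destruct (Nat.ltb_spec k n); (lia || (auto))). apply lsum_ext. intros l Hl. apply in_seq in Hl. destruct (Nat.ltb_spec l n); [lra|lia].
 - apply lsum_ext. intros m Hm. apply in_seq in Hm. destruct (Nat.ltb_spec m n) as [L|L].
  + rewrite (lsum_single _ 1 N (n-m)) by (try lia; intros j Hj Hne; destruct (Nat.eqb_spec (m+j) n); (lia || (unfold ind; lra))). replace (m+(n-m))%nat with n by lia. rewrite Nat.eqb_refl. unfold ind; lra.
  + rewrite lsum_0; auto. intros l Hl. apply in_seq in Hl. destruct (Nat.eqb_spec (m+l) n); [lia|unfold ind; lra].
Qed.
Lemma S_dsum N : lsum (seq 1 N) G = dsum N (fun m l => vonMangoldt m*vonMangoldt l*ind (Nat.leb (m+l) N)).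
Proof.
 rewrite (lsum_ext _ G (fun n => dsum N (fun m l => vonMangoldt m*vonMangoldt l*ind (Nat.eqb (m+l) n)))) by (intros n Hn; apply in_seq in Hn; apply G_dsum; lia).
 unfold dsum. rewrite lsum_swap. apply lsum_ext. intros m Hm. rewrite lsum_swap. apply lsum_ext. intros l Hl. apply in_seq in Hm, Hl. rewrite lsum_scal. f_equal.
 destruct (Nat.leb_spec (m+l) N) as [L|L]. rewrite (lsum_single _ 1 N (m+l)) by (try lia; intros j Hj Hne; destruct (Nat.eqb_spec (m+l) j); (lia || (auto))). rewrite Nat.eqb_refl. auto.
 apply lsum_0. intros n Hn. apply in_seq in Hn. destruct (Nat.eqb_spec (m+l) n); [lia|auto].
Qed.
Lemma ind_count N m : (1 <= m <= N)%nat -> lsum (seq 1 N) (fun l => ind (Nat.leb (m+l) N)) = INR N-INR m.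
Proof.
 intro H. rewrite (lsum_seq_extend _ 1 (N-m) N) by (try lia; intros k Hk; destruct (Nat.leb_spec (m+k) N); (lia || (auto))). rewrite (lsum_ext _ _ (fun _ => 1)). rewrite lsum_length, length_seq, minus_INR by lia. auto.
 intros k Hk. apply in_seq in Hk. destruct (Nat.leb_spec (m+k) N); [auto|lia].
Qed.
(** Expand (Lambda-1)(Lambda-1). For given m there are N - m values l with m + l <= N, so both mixed
    sums equal [psi1] at N; the polynomial collects the sum of ones and the main term hidden in
    [A1]. *)
Lemma S_Dsum N : (1 <= N)%nat -> lsum (seq 1 N) G = Dsum N+2*A1 N (INR N)+INR N^2/2-3*INR N/2+1.
Proof.
 intro HN. rewrite S_dsum. set (i := fun m l => ind (Nat.leb (m+l) N)).
 assert (E : Dsum N = dsum N (fun m l => vonMangoldt m*vonMangoldt l*i m l+(-1*(vonMangoldt m*i m l)+(-1*(vonMangoldt l*i m l)+i m l)))) by (apply dsum_ext; intros; unfold am, i; lra).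
 rewrite !dsum_plus, !dsum_scal in E.
 assert (E1 : dsum N (fun m l => vonMangoldt m*i m l) = psi1 N (INR N)).
 { apply lsum_ext. intros m Hm. apply in_seq in Hm. rewrite lsum_scal. unfold i. rewrite ind_count by lia. rewrite Rmax_right; auto. assert (INR m <= INR N) by (apply le_INR; lia). lra. }
 assert (E2 : dsum N (fun m l => vonMangoldt l*i m l) = psi1 N (INR N)).
 { rewrite <- E1. unfold dsum. rewrite lsum_swap. apply lsum_ext. intros m _. apply lsum_ext. intros l _. unfold i. rewrite Nat.add_comm. auto. }
 assert (E3 : dsum N i = INR N*(INR N-1)/2).
 { unfold dsum. rewrite (lsum_ext _ _ (fun m => kp (INR m) (INR N))). rewrite kp_sum_closed by lra. nra. intros m Hm. apply in_seq in Hm. unfold i. rewrite ind_count by lia. unfold kp. rewrite Rmax_right; auto. assert (INR m <= INR N) by (apply le_INR; lia). lra. } change (dsum N (fun m l => vonMangoldt m*vonMangoldt l*ind (Nat.leb (m+l) N))) with (dsum N (fun m l => vonMangoldt m*vonMangoldt l*i m l)). unfold A1. apply le_INR in HN. simpl in HN. rewrite Rmax_right by lra. lra.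
Qed.

Lemma A1_succ N u : u <= INR N+1 -> A1 (S N) u = A1 N u.
Proof. intro H. unfold A1, psi1. rewrite lsum_seq_S. replace (1+N)%nat with (S N) by lia. rewrite (Rmax_left 0 (u-INR (S N))) by (rewrite S_INR; lra). ring. Qed.
Lemma geometric_sum_le (f : nat -> R) q C n : 0 < q < 1 -> C*q+1 <= C -> (forall k, 0 <= f k) -> (forall k, f k <= q*f (S k)) -> lsum (seq 0 (S n)) f <= C*f n.
Proof.
 intros Hq HC F0 Hf. induction n as [|n IH]. unfold lsum; simpl. specialize (F0 0%nat). nra.
 rewrite lsum_seq_S. change (0+S n)%nat with (S n). specialize (Hf n). assert (0 <= C) by nra. assert (X := F0 (S n)). nra.
Qed.
Lemma inv_pow2_sum n : lsum (seq 0 n) (fun k => / 2^k) <= 2.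
Proof.
 assert (H : lsum (seq 0 n) (fun k => / 2^k) = 2-2 * / 2^n). { induction n as [|n IH]. unfold lsum; simpl; lra. rewrite lsum_seq_S, IH. simpl. field. apply pow_nonzero; lra. } assert (0 < / 2^n) by pos. lra.
Qed.
(** The h^3 of [A1_mean_sq] cancels the h^(-3) of [Dsum_bound], so each of the K + 1 scales
    contributes equally: this is the additional logarithm. The pointwise contributions of the range
    u <= 26 h grow geometrically with h and are governed by the last scale. *)
Lemma Dsum_mean_bound sg dl N K Lx : 1/4 <= sg <= 1.01 -> 0 < dl <= / 1000000 -> (forall rho, zf rho = 0 -> 0 <= Re rho -> Re rho <= sg-dl) ->
 10 <= INR N -> 1000 <= Lx -> ln (3*(INR N+1)+7) <= Lx -> INR N+1 <= 2^K/3 <= 2*(INR N+1) ->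
 Rabs (Dsum N) <= 288000*(INR K+1)*(Rpower (INR N+1) (2*sg)*Lx^2/dl)+43*10^16*(Rpower (INR N+1) (2*sg)/dl^2)+200*(INR N+1).
Proof.
 intros Hsg Hdl ZF HN HL HLc HK. set (c := INR N+1) in *. destruct (height_exists dl (1000*c^4) (proj1 Hdl)) as (n & HT1 & HT2).
 set (Y := Rpower c (2*sg)). assert (Y0 : 0 < Y) by apply Rpower_pos. set (h := fun k => 2^k/3). assert (p0 : forall k, 1 <= 2^k) by (intro; apply pow_R1_Rle; lra). assert (h0 : forall k, 1/3 <= h k) by (intro k; unfold h; specialize (p0 k); lra).
 set (W := fun k => Rpower (26*h k) (2*sg)). assert (W0 : forall k, 0 <= W k) by (left; apply Rpower_pos).
 assert (B : forall k, Vd N (h k) c/h k^3 <= 192000*(Y*Lx^2/dl)+(22*10 * / 2^k+(57*10^10/dl^2*W k+24*c * / 2^k))).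
 { intro k. specialize (h0 k). assert (h3 : 0 < h k^3) by pos. assert (A := Vd_le N (h k) h0). fold c in A.
  assert (Vb := A1_mean_sq sg dl Hsg Hdl ZF (S N) n c Lx ltac:(unfold c; lra) ltac:(rewrite S_INR; unfold c; lra) HT1 HT2 HL HLc (h k) c h0 ltac:(unfold c; lra)).
  rewrite (RInt_ext (fun u => D2 (A1 N) (h k) u^2) (fun u => D2 (A1 (S N)) (h k) u^2)) in A by (minmax; intros u Hu; unfold D2; rewrite !A1_succ by (fold c; lra); reflexivity).
  fold Y in Vb. apply (Rmult_le_reg_r (h k^3)); auto. unfold Rdiv at 1. rewrite Rmult_assoc, Rinv_l by lra. rewrite Rmult_1_r.
  assert (EW : (4*(1000/dl*Rpower (26*h k) (sg+1)))^2 = 16000000/dl^2*(W k*(26*h k)^2)).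
  { replace ((4*(1000/dl*Rpower (26*h k) (sg+1)))^2) with (16000000/dl^2*(Rpower (26*h k) (sg+1)*Rpower (26*h k) (sg+1))) by fld. unfold W. rewrite <- Rpower_plus. replace (sg+1+(sg+1)) with (2*sg+INR 2) by (simpl; lra). rewrite Rpower_plus, Rpower_pow by lra. lra. }
  rewrite EW in Vb. assert (hp : h k = 2^k/3) by reflexivity. set (p := 2^k) in *.
  tr A. eapply Rle_trans. apply Rplus_le_compat_r, Rmult_le_compat_l; [lra|apply Vb].
  replace (2*(96000*(h k^3*Y*Lx^2/dl)+4*c/c^2+26*h k*(16000000/dl^2*(W k*(26*h k)^2)))+8*c*h k^2) with
   ((192000*(Y*Lx^2/dl)+562432000000/dl^2*W k)*h k^3+(8/c+8*c*h k^2)) by (field; unfold c; lra).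
  replace ((192000*(Y*Lx^2/dl)+(22*10 * / p+(57*10^10/dl^2*W k+24*c * / p)))*h k^3) with
   ((192000*(Y*Lx^2/dl)+570000000000/dl^2*W k)*h k^3+(220 * / p*h k^3+24*c * / p*h k^3)) by lra.
  apply Rplus_le_compat. nra.
  apply Rplus_le_compat. rewrite hp. replace (220 * / p*(p/3)^3) with (220/27*p^2) by fld. assert (8/c <= 1) by (apply (Rmult_le_reg_r c); [unfold c; lra|]; unfold Rdiv; rewrite Rmult_assoc, Rinv_l; unfold c; lra). nra.
  right. rewrite hp. fld. }
 assert (D := Dsum_bound N K (proj1 HK)).
 assert (S1 : lsum (seq 0 (S K)) (fun k => Vd N (2^k/3) c/(2^k/3)^3) <= lsum (seq 0 (S K)) (fun k => 192000*(Y*Lx^2/dl)*1+(22*10 * / 2^k+(57*10^10/dl^2*W k+24*c * / 2^k)))) by (apply lsum_le; intros k _; rewrite Rmult_1_r; apply (B k)).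
 rewrite !lsum_plus, !lsum_scal, lsum_length, length_seq, S_INR in S1.
 assert (S2 := inv_pow2_sum (S K)).
 assert (S3 : lsum (seq 0 (S K)) W <= 3.5*W K).
 { apply geometric_sum_le with 0.71; try lra; auto. intro k. unfold W. replace (26*h (S k)) with (2*(26*h k)) by (unfold h; simpl; lra). rewrite <- (Rpower_mult_distr 2) by (specialize (h0 k); lra). rewrite <- Rmult_assoc, <- (Rmult_1_l (Rpower (26*h k) (2*sg))) at 1. mulr.
  via (0.71*Rpower 2 (1/2)). 2: mull; apply Rpower_le_base; lra. replace (1/2) with (/2) by field. rewrite Rpower_sqrt by lra. assert (Q := sqrt_sqrt 2 ltac:(lra)). assert (Q0 := sqrt_pos 2). nra. }
 (* 26 h is at most 52 c at the last scale, and 140608 = 52^3. *)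
 assert (S4 : W K <= 140608*Y).
 { via (Rpower (52*c) (2*sg)). apply Rle_Rpower_l; [lra|]. unfold h. specialize (h0 K). unfold h in h0. lra.
  rewrite <- Rpower_mult_distr by (unfold c; lra). mulr. via (Rpower 52 (INR 3)). apply Rpower_le_base; simpl; lra. rewrite Rpower_pow by lra. lra. } set (E := / dl^2). assert (E0 : 0 < E) by (apply Rinv_0_lt_compat, pow_lt; lra). replace (Y/dl^2) with (Y*E) by reflexivity. replace (57*10^10/dl^2) with (57*10^10*E) in S1 by reflexivity.
 assert (S5 : 57*10^10*E*lsum (seq 0 (S K)) W <= 57*10^10*E*(3.5*(140608*Y))) by (mull; lra).
 assert (YE : 0 < Y*E) by pos. assert (S6 : 24*c*lsum (seq 0 (S K)) (fun k => / 2^k) <= 24*c*2) by (mull; lra). unfold c in *. lra.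
Qed.

(** * Zeros close to the critical line *)

(** [nontrivial_zero] is about the open strip: zeros with Re = 0 satisfy the bound because B >= 0,
    and [zero_free_region] keeps the others off the line Re = 1. *)
Lemma zf_zero_bound B : 0 <= B -> (forall rho, nontrivial_zero rho -> Re rho <= B) -> forall rho, zf rho = 0 -> 0 <= Re rho -> Re rho <= B.
Proof.
 intros HB H rho E R0. destruct (Req_dec (Re rho) 0) as [->|N]; auto. apply H, nontrivial_zero_zf. split; auto. split; [lra|]. assert (X := zero_free_region rho E R0). assert (L := lt5_ge (Im rho)).
 assert (0 < 1/(238000*lt5 (Im rho))) by pos. lra.
Qed.
(* No prime power lies in (6k-1, 6k+1), so psi1 is linear there and the second difference is that of the main term. *)
Lemma D2_A1_gap N k u : (1 <= k)%nat -> INR (6*k) < u < INR (6*k)+1 -> D2 (A1 N) (1/2) u = - / 4.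
Proof.
 intros Hk Hu. assert (k6 : 6 <= INR (6*k)) by (replace 6 with (INR 6) by (simpl; lra); apply le_INR; lia).
 assert (E : psi1 N u-2*psi1 N (u-1/2)+psi1 N (u-2*(1/2)) = 0).
 { unfold psi1. transitivity (lsum (seq 1 N) (fun n => (vonMangoldt n*Rmax 0 (u-INR n) + -2*(vonMangoldt n*Rmax 0 (u-1/2-INR n)))+vonMangoldt n*Rmax 0 (u-2*(1/2)-INR n))).
  rewrite !lsum_plus, lsum_scal. ring. apply lsum_0. intros n _. destruct (Nat.lt_trichotomy n (6*k)) as [L|[->|L]].
  - assert (INR (S n) <= INR (6*k)) by (apply le_INR; lia). rewrite S_INR in H. rewrite !Rmax_right by lra. ring.
  - rewrite vonMangoldt_6k. ring.
  - assert (INR (S (6*k)) <= INR n) by (apply le_INR; lia). rewrite S_INR in H. rewrite !Rmax_left by lra. ring. }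
 unfold D2, A1. rewrite !(Rmax_right 0 (_-1)) by lra. lra.
Qed.
(** Each period of length 6 contains a unit gap on which the second difference is -1/4, contributing
    1/16; elsewhere the integrand is non-negative. *)
Lemma V_lower N m : INR m/16 <= RInt (fun u => D2 (A1 N) (1/2) u^2) 0 (INR (6*m)+1).
Proof.
 set (f := fun u => D2 (A1 N) (1/2) u^2). assert (ex : forall a b, ex_RInt f a b) by (intros; apply ex_RInt_all; intro; apply continuous_sqr, continuous_D2; cont).
 assert (f0 : forall a b, a <= b -> 0 <= RInt f a b) by (intros; apply RInt_ge_0; auto; intros; pos).
 induction m as [|m IH]. assert (X := f0 0 (INR (6*0)+1)). simpl in *. lra.
 assert (E : INR (6*S m) = INR (6*m)+6) by (replace (6*S m)%nat with (6*m+6)%nat by lia; rewrite plus_INR; simpl; lra). rewrite S_INR, E. set (b := INR (6*m)) in *.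
 rewrite <- (RInt_Chasles_R f 0 (b+1) (b+6+1)), <- (RInt_Chasles_R f (b+1) (b+6) (b+6+1)) by apply ex. assert (X := f0 (b+1) (b+6)).
 assert (Y : RInt f (b+6) (b+6+1) = / 16). { rewrite (RInt_ext f (fun _ => / 16)), RInt_const_R. lra. minmax. intros u Hu. unfold f. rewrite (D2_A1_gap N (S m)) by (try lia; lra). lra. }
 lra.
Qed.
(** If all zeros had Re <= s0 < 1/2, the mean square of the second differences with step 1/2 up to c
    would be of smaller order than c, against the lower bound of about c/96 from [V_lower]. *)
Lemma zeros_to_the_right s0 : s0 < 1/2 -> exists rho, nontrivial_zero rho /\ s0 < Re rho.
Proof. apply NNPP. intro NE. set (B := Rmax s0 (1/4)). assert (B1' : s0 <= B) by apply Rmax_l. assert (B2 : 1/4 <= B) by apply Rmax_r. assert (B3 : B < 1/2) by (apply Rmax_lub_lt; lra).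
 assert (HB : forall rho, nontrivial_zero rho -> Re rho <= B). { intros rho Hr. destruct (Rle_dec (Re rho) B); auto. exfalso. apply NE. exists rho. cont. }
 (* The gap 1 - 2B is at least 8 dl: moving the line costs 2 dl in the exponent, the squared
    logarithm another 2 dl, and a saving c^(-4 dl) remains. *)
 set (dl := Rmin (/ 1000000) ((1/2-B)/4)). assert (d0 : 0 < dl) by (apply Rmin_pos; lra). assert (d1 : dl <= / 1000000) by apply Rmin_l. assert (d2 : dl <= (1/2-B)/4) by apply Rmin_r.
 set (sg := B+dl). assert (ZF : forall rho, zf rho = 0 -> 0 <= Re rho -> Re rho <= sg-dl) by (unfold sg; replace (B+dl-dl) with B by ring; apply zf_zero_bound; pos).
 set (C1 := 120000/dl^3). set (C2 := 1+13*(4*(1000/dl*Rpower 13 (sg+1)))^2). assert (C10 : 0 < C1) by (apply Rdiv_lt_0_compat; pos). assert (C20 : 1 <= C2) by (unfold C2; assert (X := pow2_ge_0 (4*(1000/dl*Rpower 13 (sg+1)))); lra).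
 assert (L := is_lim_INR_power (4*dl) ltac:(lra)). apply is_lim_seq_spec in L. destruct (L (mkposreal (/ (300*C1)) ltac:(pos))) as (n0 & Hn0'). assert (Hn0 : forall n, (n0 <= n)%nat -> Rabs (Rpower (INR (S n)) (- (4*dl))-0) < / (300*C1)) by exact Hn0'.
 (* Beyond 300 C2 the constant C2 is at most m/300; together with c/300 for c = 6m + 1 this stays
    below m/16. The summand exp 1000 makes the logarithm at least 1000. *)
 destruct (INR_unbounded (INR n0+300*C2+exp 1000)) as (m & Hm). assert (e0 := exp_pos 1000). assert (n00 := pos_INR n0).
 set (N := (6*m+1)%nat). set (c := INR (6*m)+1). assert (Ec : c = INR N) by (unfold c, N; rewrite plus_INR; cont). assert (c6 : c = 6*INR m+1) by (unfold c; rewrite mult_INR; simpl; lra).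
 destruct (height_exists dl (1000*c^4) d0) as (n & HT1 & HT2).
 assert (HL : 1000 <= ln (3*c+7)) by (apply le_ln_of_exp; lra).
 assert (V := A1_mean_sq sg dl ltac:(unfold sg; lra) (conj d0 d1) ZF N n c (ln (3*c+7)) ltac:(lra) ltac:(lra) HT1 HT2 HL (Rle_refl _) (1/2) c ltac:(lra) ltac:(lra)).
 assert (W := V_lower N m). set (Y := Rpower c (2*sg)) in *. set (P := Rpower c (- (4*dl))).
 assert (Y0 : 0 < Y) by apply Rpower_pos. assert (P0 : 0 < P) by apply Rpower_pos.
 assert (HP : P < / (300*C1)). { assert (X := Hn0 (6*m)%nat). rewrite S_INR in X. fold c in X. fold P in X. rewrite Rminus_0_r, Rabs_right in X by lra. apply X. apply INR_le. rewrite mult_INR. simpl (INR 6). lra. }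
 assert (LB : Y*ln (3*c+7)^2 <= 10*(c*P)/dl^2).
 { set (e := Rpower (10*c) dl). assert (l1 : ln (3*c+7) <= e/dl). { eapply Rle_trans; [|apply ln_le_Rpower; lra]. apply ln_le_mono; lra. }
  assert (l2 : ln (3*c+7)^2 <= (e/dl)^2) by (apply Rsqr_le; lra). via (Y*(e/dl)^2). nra.
  replace (Y*(e/dl)^2) with (Y*(e*e)/dl^2) by fld. apply Rmult_le_compat_r. pos.
  unfold e. rewrite <- Rpower_mult_distr by lra. assert (t2 : Rpower 10 (dl+dl) <= 10) by (rewrite <- (Rpower_1 10) at 2 by lra; apply Rpower_le_base; lra). rewrite Rpower_plus in t2.
  replace (Y*(Rpower 10 dl*Rpower c dl*(Rpower 10 dl*Rpower c dl))) with (Rpower 10 dl*Rpower 10 dl*(Y*Rpower c dl*Rpower c dl)) by ring. unfold Y. rewrite <- !Rpower_plus.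
  apply Rmult_le_compat. pos. pos. rewrite Rpower_plus; lra. rewrite <- (Rpower_1 c) at 2 by lra. unfold P. rewrite <- Rpower_plus. apply Rpower_le_base; [lra|]. unfold sg. lra. }
 assert (F : INR m/16 <= C1*(c*P)+C2).
 { tr W. tr V. replace (26*(1/2)) with 13 by field. unfold C1, C2. assert (4*c/c^2 <= 1). { replace (4*c/c^2) with (4/c) by fld. apply (Rmult_le_reg_r c); [lra|]. unfold Rdiv. rewrite Rmult_assoc, Rinv_l; lra. }
  assert (96000*((1/2)^3*Y*ln (3*c+7)^2/dl) <= 120000/dl^3*(c*P)); [|lra].
  replace (96000*((1/2)^3*Y*ln (3*c+7)^2/dl)) with (12000/dl*(Y*ln (3*c+7)^2)) by lra. replace (120000/dl^3*(c*P)) with (12000/dl*(10*(c*P)/dl^2)) by fld. apply Rmult_le_compat_l; auto. pos. }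
 assert (G : C1*(c*P) <= c/300). { replace (c/300) with (c*(C1 * / (300*C1))) by fld. nra. }
 lra.
Qed.

(** * The explicit formula over the non-trivial zeros *)

Definition ceq (z w : C) : {z = w} + {z <> w} := excluded_middle_informative (z = w).
(** Continuity in [zero_order] is that of the product structure, whose balls are squares; the
    modulus is at most the sum of the coordinates, which explains eps/3. *)
Lemma continuous_ccont (g : C -> C) z : continuous (T := C_UniformSpace) (U := C_UniformSpace) g z -> ccont g z.
Proof.
 intros H eps He. assert (L : locally (T := C_UniformSpace) (g z) (fun w => Cmod (w-g z) < eps)).
 { exists (mkposreal (eps/3) ltac:(lra)). intros w Hw. destruct Hw as (A & B). change (Rabs (Re w-Re (g z)) < eps/3) in A. change (Rabs (Im w-Im (g z)) < eps/3) in B. eapply Rle_lt_trans; [apply Cmod_le_Re_Im|]. rewrite Re_Cminus, Im_Cminus. lra. }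
 destruct (H _ L) as (d & Hd). exists d. split; [apply cond_pos|]. intros w Hw. apply Hd. split.
 - change (Rabs (Re w-Re z) < d). rewrite <- Re_Cminus. eapply Rle_lt_trans; [apply re_le_Cmod|lra].
 - change (Rabs (Im w-Im z) < d). rewrite <- Im_Cminus. eapply Rle_lt_trans; [apply im_le_Cmod|lra].
Qed.
Lemma ccont_Cpown rho m z : ccont (fun s => Cpown (s-rho) m) z.
Proof. induction m as [|m IH]. apply (ccont_const (RtoC 1)). apply (ccont_mult (fun s => s-rho)%C); auto. cont. Qed.
#[export] Hint Resolve ccont_Cpown : cont.
Lemma Cpown_neq_0 (z : C) m : z <> 0 -> Cpown z m <> 0.
Proof. intro H. induction m as [|m IH]; simpl. intro E; apply RtoC_inj in E; lra. apply Cmult_neq_0; pos. Qed.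
Lemma Cpown_plus z m k : Cpown z (m+k) = (Cpown z m*Cpown z k)%C.
Proof. induction m as [|m IH]; simpl. ring. rewrite IH. ring. Qed.
(** Otherwise p would equal a positive power of s - rho times q at all nearby s other than rho, and
    would vanish at rho by continuity. *)
Lemma order_le rho m k (p q : C -> C) e : ccont p rho -> ccont q rho -> p rho <> 0 -> 0 < e ->
 (forall s, Cmod (s-rho) < e -> (Cpown (s-rho) m*p s = Cpown (s-rho) k*q s)%C) -> (k <= m)%nat.
Proof.
 intros Cp Cq Hp He H. destruct (Nat.le_gt_cases k m) as [L|L]; auto. replace k with (m+S (k-m-1))%nat in H by lia. set (j := (k-m-1)%nat) in *.
 set (F := fun s => (p s-Cpown (s-rho) (S j)*q s)%C). assert (CF : ccont F rho) by (apply ccont_minus; cont).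
 assert (F0 : F rho = p rho) by (unfold F; simpl; ring).
 destruct (ccont_neq_0 F rho CF) as (d & Hd & X). rewrite F0; pos. set (r := Rmin d e/2). assert (M1 := Rmin_l d e). assert (M2 := Rmin_r d e). assert (M0 : 0 < Rmin d e) by (apply Rmin_pos; lra).
 set (s := (rho+RtoC r)%C). assert (Es : (s-rho = RtoC r)%C) by (unfold s; ring). assert (Er : Cmod (s-rho) = r) by (rewrite Es; apply Cmod_RtoC_pos; unfold r; lra).
 assert (Y := X s ltac:(rewrite Er; unfold r; lra)). assert (Z := H s ltac:(rewrite Er; unfold r; lra)). rewrite Cpown_plus in Z.
 assert (N : Cpown (s-rho) m <> 0) by (apply Cpown_neq_0; rewrite Es; intro E; apply RtoC_inj in E; unfold r in E; lra).
 assert (E : F s = 0). { destruct (Cmult_eq_0 (Cpown (s-rho) m) (F s)); auto; [|contradiction]. unfold F. replace (Cpown (s-rho) m*(p s-Cpown (s-rho) (S j)*q s))%C with (Cpown (s-rho) m*p s-Cpown (s-rho) m*Cpown (s-rho) (S j)*q s)%C by ring. rewrite Z. ring. }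
 rewrite E, Cmod_0 in Y. assert (W := Cmod_ge_0 (F rho)). lra.
Qed.
Lemma Cprod_count Z rho s : (Cprod Z s = Cpown (s-rho) (count_occ ceq Z rho)*Cprod (filter (fun z => if ceq z rho then false else true) Z) s)%C.
Proof.
 induction Z as [|z Z IH]; simpl. ring. destruct (ceq z rho) as [->|N]; simpl. rewrite IH. ring. rewrite IH. ring.
Qed.
(** Near rho there are two factorisations of [zf]: the one of [zero_order] multiplied by s - 1, and
    the one of [zdata] with the copies of rho collected. Both cofactors are non-zero at rho, so
    [order_le] applies in both directions. *)
Lemma zero_order_count K Z g g' rho m : zdata K Z g g' -> nontrivial_zero rho -> PK K rho -> zero_order rho m -> m = count_occ ceq Z rho.
Proof.
 intros HZ HN HP (g1 & Cg & G0 & e & He & H). apply continuous_ccont in Cg. apply nontrivial_zero_zf in HN. destruct HN as (HR & E0).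
 set (k := count_occ ceq Z rho). set (Z' := filter (fun z => if ceq z rho then false else true) Z).
 set (p := fun s => ((s-1)*g1 s)%C). set (q := fun s => (Cprod Z' s*g s)%C).
 assert (Cp : ccont p rho) by (apply ccont_mult; cont).
 assert (Cq : ccont q rho). { apply ccont_mult. apply (Holo_ccont (fun _ => True) _ (Cprod' Z')); auto. apply Holo_Cprod. destruct HZ as ((Hg & _) & _). apply (Holo_ccont _ _ _ _ Hg). unfold half_plane; lra. }
 assert (p0 : p rho <> 0). { apply Cmult_neq_0; auto. intro E. apply Cminus_eq_0 in E. subst rho. simpl in HR. lra. }
 assert (q0 : q rho <> 0). { apply Cmult_neq_0. apply Cprod_neq_0. intros z Hz. apply filter_In in Hz. destruct Hz as (_ & Hz). destruct (ceq z rho); pos. apply HZ; pos. }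
 set (d := Rmin e (Rmin (Re rho) (1-Re rho))). assert (d0 : 0 < d) by (repeat apply Rmin_pos; lra). assert (d1 : d <= e) by apply Rmin_l. assert (d2 : d <= Re rho) by (tr Rmin_r; apply Rmin_l). assert (d3 : d <= 1-Re rho) by (tr Rmin_r; apply Rmin_r).
 assert (HE : forall s, Cmod (s-rho) < d -> (Cpown (s-rho) m*p s = Cpown (s-rho) k*q s)%C).
 { intros s Hs. assert (X := re_le_Cmod (s-rho)). rewrite Re_Cminus in X. apply Rabs_le_between in X. assert (S1 : (s-1 <> 0)%C) by (intro E; apply Cminus_eq_0 in E; subst s; simpl in X; lra).
  assert (Y := H s ltac:(lra)). rewrite zeta_zf in Y by lra. unfold p, q. replace (Cpown (s-rho) m*((s-1)*g1 s))%C with ((s-1)*(Cpown (s-rho) m*g1 s))%C by ring. rewrite <- Y.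
  replace ((s-1)*(zf s/(s-1)))%C with (zf s) by (field; pos). destruct HZ as ((_ & Hd) & _). rewrite Hd by (unfold half_plane; lra). rewrite (Cprod_count Z rho). unfold k, Z'. ring. }
 apply Nat.le_antisymm. apply (order_le rho k m q p d); auto. intros s Hs. symmetry; auto. apply (order_le rho m k p q d); pos.
Qed.
(** Passes from pairs (zero, multiplicity), as in the statement, to the list with repetitions;
    points of [l] outside [Z] have count 0. *)
Lemma clsum_counted (l : list (C*nat)) (Z : list C) (f : C -> C) : NoDup (map fst l) -> (forall z, In z Z -> In z (map fst l)) ->
 clsum l (fun p => RtoC (INR (count_occ ceq Z (fst p)))*f (fst p))%C = clsum Z f.
Proof.
 intros ND. induction Z as [|z Z IH]; intro H.
 - rewrite (clsum_ext l _ (fun p => 0*0)%C) by (intros; simpl; ring). rewrite clsum_scal. unfold clsum at 2. simpl. ring.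
 - assert (S : forall l, NoDup (map fst l) -> In z (map fst l) -> clsum l (fun p : C*nat => if ceq z (fst p) then f z else RtoC 0) = f z).
  { clear. induction l as [|p l IH]; intros ND Hz; [destruct Hz|]. inversion ND as [|a b N1 N2]; subst. change (clsum (p :: l) (fun p => if ceq z (fst p) then f z else RtoC 0)) with ((if ceq z (fst p) then f z else RtoC 0)+clsum l (fun p : C*nat => if ceq z (fst p) then f z else RtoC 0))%C.
   destruct (ceq z (fst p)) as [E|N].
   - rewrite (clsum_ext l _ (fun p => 0*0)%C), clsum_scal. ring. intros q Hq. destruct (ceq z (fst q)) as [E'|]; [|ring]. exfalso. apply N1. rewrite <- E, E'. apply in_map; pos.
   - rewrite IH; auto. ring. destruct Hz as [E|]; auto. exfalso; auto. }
  change (clsum (z :: Z) f) with (f z+clsum Z f)%C. rewrite <- IH by (intros; apply H; right; pos). rewrite <- (S l ND (H z (or_introl eq_refl))), <- clsum_plus. apply clsum_ext. intros p _. simpl. destruct (ceq z (fst p)) as [->|N]. rewrite S_INR, RtoC_plus. ring. ring.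
Qed.
Definition Ez (u : R) (rho : C) : C := (Rcpow u (rho+1)/(rho*(rho+1)))%C.
Lemma zero_facts K Z g g' rho : zdata K Z g g' -> In rho Z -> rho <> 0 /\ (rho+1 <> 0)%C /\ 1/2 < Rabs (Im rho) <= Cmod rho /\ Rabs (Im rho) <= Cmod (rho+1) /\ -0.3 < Re rho <= 1.
Proof.
 intros HZ Hr. destruct (zdata_in_zero K Z g g' rho HZ Hr) as (_ & X & Y). assert (A := im_le_Cmod rho). assert (B := im_le_Cmod (rho+1)). rewrite Im_Cplus, Im_RtoC, Rplus_0_r in B.
 repeat split; try lra. intros ->. rewrite Im_RtoC, Rabs_R0 in Y. lra. intro E. rewrite E, Cmod_0 in B. lra.
Qed.
Lemma inv_Im_sum K Z g g' : zdata K Z g g' -> lsum Z (fun rho => / Rabs (Im rho)) <= hK K.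
Proof.
 intro HZ. apply (zeros_harmonic K Z g g' K _ HZ ltac:(lia)).
 - intros rho Hr. destruct (zero_facts K Z g g' rho HZ Hr) as (_ & _ & X & _). pos.
 - intros j rho Hj Hr Hc. destruct (zero_facts K Z g g' rho HZ Hr) as (_ & _ & X & _). assert (Y := Im_in_disc rho (ht K j) 1.5 ltac:(lra)). assert (D := ht_diff K K j).
  replace (ht K K) with 0 in D by (unfold ht; lra). rewrite Rminus_0_l, Rabs_Ropp in D. rewrite <- D. assert (T : Rabs (ht K j) <= Rabs (Im rho)+1.5). { replace (ht K j) with (Im rho+(ht K j-Im rho)) by ring. tr Rabs_triang. apply Rplus_le_compat_l, Rabs_le_between; lra. }
  assert (P := Rabs_pos (ht K j)). apply (Rmult_le_reg_r (Rabs (Im rho)*(Rabs (ht K j)+1))). pos. field_simplify; lra.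
Qed.
(** The residues at 0 and -1 contained in [Rp] are discarded; over all zeros they amount to at most
    u + 1 times the sum of 1/|Im rho|. *)
Lemma A1_zero_sum K Z g g' u N a : zdata K Z g g' -> 1 < u -> u <= INR N -> u^3 <= INR K -> 10 <= INR K -> 0 < a <= 1 ->
 Cmod (RtoC (A1 N u)+clsum Z (Ez u)) <= 1000*Hb K*(Rpower u (a+1)/a)+(u+1)*hK K.
Proof.
 intros HZ Hu HN HK K10 Ha. assert (X := explicit_formula K Z g g' u N a HZ Hu HN HK K10 Ha). assert (Y := inv_Im_sum K Z g g' HZ).
 set (S := clsum Z (fun rho => - RtoC u/rho+1/(rho+1))%C). assert (E : (clsum Z (fun rho => Rp rho u) = clsum Z (Ez u)+S)%C) by (unfold S; rewrite <- clsum_plus; apply clsum_ext; intros rho _; unfold Rp, Ez, Cdiv; ring).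
 assert (B : Cmod S <= (u+1)*hK K).
 { via (lsum Z (fun rho => (u+1) * / Rabs (Im rho))). 2: rewrite lsum_scal; mull; lra. apply clsum_Cmod. intros rho Hr. destruct (zero_facts K Z g g' rho HZ Hr) as (N1 & N2 & A & B & _).
  tr Cmod_triangle. rewrite !Cmod_div, Cmod_opp, !Cmod_RtoC_pos by pos. rewrite Rmult_plus_distr_r. apply Rplus_le_compat; mull; apply Rinv_le_contravar; lra. }
 rewrite E in X. replace (RtoC (A1 N u)+clsum Z (Ez u))%C with ((RtoC (A1 N u)+(clsum Z (Ez u)+S))-S)%C by ring. tr Cmod_sub_le. lra.
Qed.
Lemma Cmod_Ez K Z g g' u rho : 1 < u -> zdata K Z g g' -> In rho Z -> Cmod (Ez u rho) = Rpower u (Re rho+1)/(Cmod rho*Cmod (rho+1)) /\ (Re rho <= 0 -> Cmod (Ez u rho) <= 1.5*u * / Rabs (Im rho)).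
Proof.
 intros Hu HZ Hr. destruct (zero_facts K Z g g' rho HZ Hr) as (N1 & N2 & A & B & C). assert (E : Cmod (Ez u rho) = Rpower u (Re rho+1)/(Cmod rho*Cmod (rho+1))).
 { unfold Ez. rewrite Cmod_div, Cmod_mult, Cmod_Rcpow, Re_Cplus by (apply Cmult_neq_0; pos). auto. }
 split; auto. intro R0. rewrite E. assert (R7 := re_le_Cmod (rho+1)). rewrite Re_Cplus, Re_RtoC, Rabs_right in R7 by lra.
 via (u * / (Rabs (Im rho)*0.7)).
 - apply Rmult_le_compat. pos. pos. rewrite <- (Rpower_1 u) at 2 by lra. apply Rpower_le_base; lra. apply Rinv_le_contravar. nra. nra.
 - rewrite Rinv_mult. assert (0 < / Rabs (Im rho)) by pos. nra.
Qed.
Lemma Hb_bound x K : 10^6 <= ln x -> 1 < x -> INR K <= 16*x^3 -> 1 <= INR K -> hK K <= 3000*ln x^2 /\ Hb K <= 3010*ln x^2.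
Proof.
 intros HL Hx HK K1. set (L := ln x) in *. assert (E3 : ln (x^3) = 3*L) by (unfold L; rewrite ln_pow by lra; simpl; lra).
 assert (E5 : ln 200 <= 6). { apply ln_le_of_exp; [lra|]. assert (X := exp_ge_pow27 6). replace (INR 6) with 6 in X by (simpl; lra). lra. }
 assert (l1 : lt5 (INR K) <= 3*L+6). { unfold lt5. rewrite Rabs_right by lra. via (ln (200*x^3)). apply ln_le_mono; lra. rewrite ln_mult, E3 by lra. lra. }
 assert (l2 : ln (INR (2*K+1)) <= 3*L+6). { rewrite plus_INR, mult_INR. simpl (INR 2). simpl (INR 1). via (ln (200*x^3)). apply ln_le_mono; lra. rewrite ln_mult, E3 by lra. lra. }
 assert (n1 : 0 <= Nbar K <= 24.1*L) by (split; [apply Nbar_pos|unfold Nbar; lra]).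
 assert (h1 : hK K <= 3000*L^2). { unfold hK. nra. }
 split; auto. unfold Hb. nra.
Qed.
Lemma exp_1_over x : 0 < ln x -> 0 < x -> Rpower x (/ ln x+1) = exp 1*x.
Proof. intros H Hx. rewrite Rpower_plus, Rpower_1 by auto. f_equal. unfold Rpower. f_equal. fld. Qed.
(** The list at height K, about x^3, contains more zeros than the statement. Those with Re rho <= 0
    contribute O(x/|Im rho|) each, and so do those with |rho| >= x, where |x^(rho+1)| <= x^2 is
    divided by |rho| >= x. The line Re s = 1/log x turns x^(a+1)/a into a multiple of x log x. *)
Lemma explicit_zero_sum x l N : 10^6 <= ln x -> 1 < x -> NoDup (map fst l) -> (forall rho : C, In rho (map fst l) <-> (nontrivial_zero rho /\ Cmod rho < x)) ->
 (forall p : C*nat, In p l -> zero_order (fst p) (snd p)) -> x <= INR N -> Cmod (RtoC (A1 N x)+zero_sum x l) <= 10^10*(ln x^3*x).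
Proof.
 intros HL Hx ND HI HO HN. set (L := ln x) in *. assert (x10 : 10 <= x). { assert (X := exp_ineq1_le L). unfold L in X at 2. rewrite exp_ln in X by lra. lra. } assert (x3 : 1000 <= x^3) by nra. destruct (nat_ceil (x^3) ltac:(lra)) as (K & HK). destruct (zdata_exists K) as (Z & g & g' & HZ).
 destruct (Hb_bound x K) as (h1 & h2); auto; try lra. fold L in h1, h2.
 assert (X := A1_zero_sum K Z g g' x N (/ L) HZ Hx HN (proj1 HK) ltac:(lra) ltac:(split; [pos|rewrite <- Rinv_1; apply Rinv_le_contravar; lra])). rewrite exp_1_over in X by (fold L; lra).
 (* Selects from the list exactly the zeros over which the statement sums. *)
 set (good := fun rho => if Rlt_dec 0 (Re rho) then if Rlt_dec (Cmod rho) x then true else false else false). set (Zg := filter good Z).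
 assert (Gd : forall rho, good rho = true <-> 0 < Re rho /\ Cmod rho < x) by (intro rho; unfold good; destruct (Rlt_dec 0 (Re rho)); [destruct (Rlt_dec (Cmod rho) x)|]; lra).
 assert (EZ : zero_sum x l = clsum Zg (Ez x)).
 { rewrite <- (clsum_counted l Zg (Ez x) ND).
  - apply clsum_ext. intros p Hp. f_equal. f_equal. f_equal.
   assert (Hz := proj1 (HI (fst p)) (in_map fst l p Hp)). destruct Hz as (Hz & Hx'). assert (Hz' := proj1 (nontrivial_zero_zf _) Hz).
   assert (P : PK K (fst p)). { destruct (zdata_window K (fst p)) as (i & Hi & _ & Y). lra. tr im_le_Cmod. nra. exists i; cont. }
   rewrite (zero_order_count K Z g g' (fst p) (snd p) HZ Hz P (HO p Hp)). unfold Zg.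
   assert (Gp : good (fst p) = true) by (apply Gd; lra). clear-Gp. induction Z as [|z Z IH]; simpl; auto. destruct (ceq z (fst p)) as [->|N]. rewrite Gp. simpl. destruct (ceq (fst p) (fst p)); [lia|contradiction]. destruct (good z); simpl; auto. destruct (ceq z (fst p)); [contradiction|pos].
  - intros z Hz. apply filter_In in Hz. destruct Hz as (Hz & Hg). apply Gd in Hg. apply HI. split; [|lra]. apply nontrivial_zero_zf. destruct (zdata_in_zero K Z g g' z HZ Hz) as (E0 & _). split; auto. split; [lra|]. assert (V := zero_free_region z E0 ltac:(lra)). assert (T := lt5_ge (Im z)). assert (0 < 1/(238000*lt5 (Im z))) by pos. lra. }
 set (Zb := filter (fun rho => negb (good rho)) Z). assert (ES : (clsum Z (Ez x) = clsum Zg (Ez x)+clsum Zb (Ez x))%C).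
 { unfold Zg, Zb. clear. induction Z as [|z Z IH]. unfold clsum; simpl; ring. simpl. change (clsum (z :: Z) (Ez x)) with (Ez x z+clsum Z (Ez x))%C. rewrite IH. destruct (good z); unfold clsum; simpl; ring. }
 assert (EB : Cmod (clsum Zb (Ez x)) <= 1.5*x*hK K).
 { via (lsum Z (fun rho => 1.5*x * / Rabs (Im rho))). 2: rewrite lsum_scal; mull; apply (inv_Im_sum K Z g g' HZ).
  via (lsum Zb (fun rho => 1.5*x * / Rabs (Im rho))).
  - apply clsum_Cmod. intros rho Hr. apply filter_In in Hr. destruct Hr as (Hr & Hb'). destruct (Cmod_Ez K Z g g' x rho Hx HZ Hr) as (E & E'). destruct (Rle_dec (Re rho) 0) as [R0|R0]. auto. destruct (zero_facts K Z g g' rho HZ Hr) as (N1 & N2 & A & B & C).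
   assert (Cx : x <= Cmod rho). { destruct (Rle_dec x (Cmod rho)); auto. assert (good rho = true) by (apply Gd; lra). rewrite H in Hb'. lra. }
   rewrite E. via (x*x * / (x*Rabs (Im rho))). apply Rmult_le_compat. pos. pos.
   replace (x*x) with (Rpower x (INR 2)) by (rewrite Rpower_pow by lra; lra). apply Rpower_le_base; simpl; lra. apply Rinv_le_contravar. pos. nra.
   replace (x*x * / (x*Rabs (Im rho))) with (x * / Rabs (Im rho)) by fld. mulr; lra.
  - unfold Zb. rewrite lsum_filter. apply lsum_le. intros rho Hr. destruct (zero_facts K Z g g' rho HZ Hr) as (_ & _ & A & _). assert (I := ind_bounds (negb (good rho))). assert (0 < 1.5*x * / Rabs (Im rho)) by pos. nra. }
 rewrite EZ. replace (RtoC (A1 N x)+clsum Zg (Ez x))%C with ((RtoC (A1 N x)+clsum Z (Ez x))-clsum Zb (Ez x))%C by (rewrite ES; ring). tr Cmod_sub_le.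
 assert (e3 := exp_le_3). replace (exp 1*x / / L) with (exp 1*(x*L)) in X by fld. assert (xL : 0 < x*L) by pos.
 assert (Q1 : 1000*Hb K*(exp 1*(x*L)) <= 1000*(3010*L^2)*(3*(x*L))). { apply Rmult_le_compat. unfold Hb. assert (T := lt5_ge (INR K)). assert (U := hK_ge K). assert (V := Nbar_ge K). lra. pos. lra. nra. }
 assert (Q4 : x*L^2*1000000 <= x*L^2*L) by (mull; lra). nra.
Qed.

(** * Bounds from the zero-free region *)

Lemma am_bound N L n : 1 <= L -> ln (INR N) <= L -> In n (seq 1 N) -> Rabs (am n) <= L.
Proof.
 intros H1 HL Hn. apply in_seq in Hn. unfold am. assert (A := vonMangoldt_nonneg n). assert (B := vonMangoldt_le_ln n ltac:(lia)). assert (C : ln (INR n) <= ln (INR N)) by (apply ln_le_mono; [pos|apply le_INR; lia]). apply Rabs_le_between. lra.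
Qed.
Lemma lsum_Rabs {A} (l : list A) f g : (forall x, In x l -> Rabs (f x) <= g x) -> Rabs (lsum l f) <= lsum l g.
Proof. induction l as [|a l IH]; intro H. unfold lsum; simpl. rewrite Rabs_R0; lra. tr Rabs_triang. apply Rplus_le_compat; [apply H; left; auto|apply IH; intros; apply H; right; pos]. Qed.
(** For fixed m the inner sum runs over l <= N - m and is a partial sum of [am]; the outer sum is
    estimated by |am m| <= L. *)
Lemma Dsum_partial_sums N L M : 1 <= L -> ln (INR N) <= L -> (forall v, (v <= N)%nat -> Rabs (lsum (seq 1 v) am) <= M) -> Rabs (Dsum N) <= L*M*INR N.
Proof.
 intros H1 HL HM. replace (INR N) with (lsum (seq 1 N) (fun _ => 1)) by (rewrite lsum_length, length_seq; lra). rewrite <- lsum_scal. apply lsum_Rabs. intros m Hm. rewrite Rmult_1_r, (lsum_ext _ _ (fun l => am m*(am l*ind (Nat.leb (m+l) N)))) by (intros; lra). rewrite lsum_scal, Rabs_mult. assert (Hm' := Hm). apply in_seq in Hm'.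
 mul. apply (am_bound N); pos.
 rewrite (lsum_seq_extend _ 1 (N-m) N) by (try lia; intros k Hk; destruct (Nat.leb_spec (m+k) N); (lia || (unfold ind; lra))). rewrite (lsum_ext _ _ am). apply HM; lia. intros k Hk. apply in_seq in Hk. destruct (Nat.leb_spec (m+k) N); [unfold ind; lra|lia].
Qed.
Lemma Dsum_trivial N L : 1 <= L -> ln (INR N) <= L -> Rabs (Dsum N) <= L*(L*INR N)*INR N.
Proof.
 intros H1 HL. apply Dsum_partial_sums; auto. intros v Hv. via (lsum (seq 1 v) (fun _ => L*1)). apply lsum_Rabs. intros n Hn. rewrite Rmult_1_r. apply (am_bound N); auto. apply in_seq in Hn. apply in_seq; lia.
 rewrite lsum_scal, lsum_length, length_seq. mull. apply le_INR; pos.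
Qed.
(* psi is monotone, so a bound for its smoothed version A1 gives one for the partial sums themselves. *)
Lemma partial_sum_bound N v H M : (v <= N)%nat -> 0 < H -> (forall u, u <= INR v+H -> Rabs (A1 N u) <= M) -> Rabs (lsum (seq 1 v) am) <= 2*M/H+H/2+1.
Proof.
 intros Hv HH HM. set (ps := lsum (seq 1 v) vonMangoldt). assert (E : lsum (seq 1 v) am = ps-INR v).
 { unfold am, ps. rewrite (lsum_ext _ _ (fun n => vonMangoldt n + -1*1)) by (intros; lra). rewrite lsum_plus, lsum_scal, lsum_length, length_seq. ring. }
 assert (v0 := pos_INR v). set (V := INR v) in *.
 assert (EP : ps = lsum (seq 1 N) (fun n => if Nat.leb n v then vonMangoldt n else 0)).
 { rewrite (lsum_seq_extend _ 1 v N) by (try lia; intros k Hk; destruct (Nat.leb_spec k v); (lia || (auto))). apply lsum_ext. intros n Hn. apply in_seq in Hn. destruct (Nat.leb_spec n v); [lra|lia]. }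
 assert (U : H*ps <= psi1 N (V+H)-psi1 N V).
 { assert (H*ps+psi1 N V <= psi1 N (V+H)); [|lra]. rewrite EP. unfold psi1. rewrite <- lsum_scal, <- lsum_plus. apply lsum_le. intros n Hn. assert (L0 := vonMangoldt_nonneg n). destruct (Nat.leb_spec n v) as [L|L].
  apply le_INR in L. fold V in L. rewrite !Rmax_right by lra. lra. rewrite Rmult_0_r, Rplus_0_l. mull. apply Rle_max_compat_l. lra. }
 assert (W : psi1 N V-psi1 N (V-H) <= H*ps).
 { assert (psi1 N V <= H*ps+psi1 N (V-H)); [|lra]. rewrite EP. unfold psi1. rewrite <- lsum_scal, <- lsum_plus. apply lsum_le. intros n Hn. assert (L0 := vonMangoldt_nonneg n). destruct (Nat.leb_spec n v) as [L|L].
  replace (H*vonMangoldt n+vonMangoldt n*Rmax 0 (V-H-INR n)) with (vonMangoldt n*(H+Rmax 0 (V-H-INR n))) by ring. mull. unfold Rmax; repeat destruct Rle_dec; lra.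
  assert (INR (S v) <= INR n) by (apply le_INR; lia). rewrite S_INR in *. fold V in H0. rewrite !Rmax_left by lra. lra. }
 assert (a1 := HM (V+H) ltac:(lra)). assert (a2 := HM V ltac:(lra)). assert (a3 := HM (V-H) ltac:(lra)). apply Rabs_le_between in a1, a2, a3. unfold A1 in *.
 set (k1 := Rmax 0 (V+H-1)) in *. set (k2 := Rmax 0 (V-1)) in *. set (k3 := Rmax 0 (V-H-1)) in *.
 assert (B1' : (k1^2-k2^2)/2 <= H*(V+H/2)). { assert (0 <= k2 <= V) by (unfold k2, Rmax; destruct Rle_dec; lra). assert (k2 <= k1 <= k2+H) by (unfold k1, k2, Rmax; repeat destruct Rle_dec; lra). nra. }
 assert (B2 : H*(V-H/2-1) <= (k2^2-k3^2)/2). { assert (V-1 <= k2) by apply Rmax_r. destruct (Rle_dec (V-H-1) 0) as [L|L]. unfold k3. rewrite Rmax_left by lra. assert (X := pow2_ge_0 (k2-H)). nra. unfold k3. rewrite Rmax_right by lra. nra. }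
 assert (R1 : (ps-V)*H <= (2*M/H+H/2+1)*H) by (replace ((2*M/H+H/2+1)*H) with (2*M+H*H/2+H) by fld; lra).
 assert (R2 : - (2*M/H+H/2+1)*H <= (ps-V)*H) by (replace (- (2*M/H+H/2+1)*H) with (- (2*M+H*H/2+H)) by fld; lra).
 apply Rabs_le_between. nra.
Qed.
(** Of the two factors 1/|Im rho| one is kept for the sum over zeros; the other is at most 11
    exp(-l), with l the logarithm of the zero-free region, and is played off against the saving
    exp(-ln u/(238000 l)). The parameter [w] is the resulting exponent, uniform in the zeros. *)
Lemma A1_zero_free_bound K Z g g' u N a w : zdata K Z g g' -> 1 < u -> u <= INR N -> u^3 <= INR K -> 10 <= INR K -> 0 < a <= 1 -> 0 <= w -> w^2 <= ln u/238000 ->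
 Rabs (A1 N u) <= hK K*(11*u^2*exp (- (2*w))+3*u+1)+1000*Hb K*(Rpower u (a+1)/a).
Proof.
 intros HZ Hu HN HK K10 Ha Hw Hwl. assert (X := A1_zero_sum K Z g g' u N a HZ Hu HN HK K10 Ha). set (q := 11*u^2*exp (- (2*w))+1.5*u).
 assert (e0 := exp_pos (- (2*w))). assert (q0 : 0 <= q) by (unfold q; nra).
 assert (S : Cmod (clsum Z (Ez u)) <= q*hK K).
 { via (lsum Z (fun rho => q * / Rabs (Im rho))). 2: rewrite lsum_scal; mull; apply (inv_Im_sum K Z g g' HZ).
  apply clsum_Cmod. intros rho Hr. destruct (Cmod_Ez K Z g g' u rho Hu HZ Hr) as (E & E'). destruct (zero_facts K Z g g' rho HZ Hr) as (N1 & N2 & A & B & C). set (t := Rabs (Im rho)) in *.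
  destruct (Rle_dec (Re rho) 0) as [R0|R0]. eapply Rle_trans; [auto|]. mulr. unfold q. nra.
  destruct (zdata_in_zero K Z g g' rho HZ Hr) as (E0 & _). assert (ZR := zero_free_region rho E0 ltac:(lra)). set (l := lt5 (Im rho)) in *. assert (l1 : 1.6 <= l) by apply lt5_ge.
  rewrite E. via (u^2*(11*exp (- (2*w))) * / t). 2: mulr; unfold q; nra.
  assert (P1 : Rpower u (Re rho+1) <= u^2*exp (- (ln u/(238000*l)))).
  { replace (u^2) with (Rpower u (INR 2)) by (apply Rpower_pow; lra). unfold Rpower at 2. rewrite <- exp_plus. replace (INR 2*ln u + - (ln u/(238000*l))) with ((2-1/(238000*l))*ln u) by (simpl; lra). apply Rpower_le_base; lra. }
  assert (P2 : / (Cmod rho*Cmod (rho+1)) <= 11*exp (- l) * / t).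
  { rewrite exp_Ropp. unfold l, lt5. fold t. rewrite exp_ln by lra. via (/ (t*t)). apply Rinv_le_contravar; [nra|]. nra. rewrite Rinv_mult. mulr. apply (Rmult_le_reg_r (t*(t+5))); [nra|]. replace (/ t*(t*(t+5))) with (t+5) by fld. replace (11 * / (t+5)*(t*(t+5))) with (11*t) by fld. lra. }
  via (u^2*exp (- (ln u/(238000*l)))*(11*exp (- l) * / t)). apply Rmult_le_compat; auto. pos. pos.
  replace (u^2*exp (- (ln u/(238000*l)))*(11*exp (- l) * / t)) with (u^2*(11*(exp (- (ln u/(238000*l)))*exp (- l))) * / t) by ring. mulr. mull. mull. rewrite <- exp_plus.
(* AM-GM: w^2/l + l >= 2 w *)
  assert (AM : 2*w <= ln u/(238000*l)+l). { assert (w^2/l+l >= 2*w). { apply Rle_ge. apply (Rmult_le_reg_r l); [lra|]. replace ((w^2/l+l)*l) with (w^2+l*l) by fld. assert (Y := pow2_ge_0 (w-l)). lra. }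
   assert (w^2/l <= ln u/(238000*l)). { replace (ln u/(238000*l)) with (ln u/238000/l) by fld. mulr; lra. } lra. }
  destruct (Req_dec (- (ln u/(238000*l)) + - l) (- (2*w))) as [EE|NE]. rewrite EE; lra. left; apply exp_increasing; lra. }
 assert (Y : Rabs (A1 N u) <= Cmod (RtoC (A1 N u)+clsum Z (Ez u))+Cmod (clsum Z (Ez u))). { rewrite <- Cmod_R. replace (RtoC (A1 N u)) with ((RtoC (A1 N u)+clsum Z (Ez u))-clsum Z (Ez u))%C at 1 by ring. apply Cmod_sub_le. }
 assert (h0 : 0 <= hK K) by (assert (A := hK_ge K); assert (B := Nbar_ge K); lra). unfold q in S. nra.
Qed.

(** * Assembling the estimate for S(x) *)

Lemma floor_nat x : 1 < x -> INR (Z.to_nat (Int_part x)) <= x < INR (Z.to_nat (Int_part x))+1 /\ (1 <= Z.to_nat (Int_part x))%nat.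
Proof.
 intro H. destruct (base_Int_part x) as (A & B). assert (I : (1 <= Int_part x)%Z). { assert (0 < Int_part x)%Z; [|lia]. apply lt_IZR. lra. }
 rewrite INR_IZR_INZ, Z2Nat.id by lia. split; [lra|lia].
Qed.
(** S is a sum up to N, the integral part of x, whereas the explicit formula is taken at x. Between
    N and x the function [psi1] is linear with slope at most N log x, so this change, like that of
    the quadratic terms, is O(x log x). *)
Lemma S_reduction x l : 10^6 <= ln x -> 1 < x -> NoDup (map fst l) -> (forall rho : C, In rho (map fst l) <-> (nontrivial_zero rho /\ Cmod rho < x)) ->
 (forall p : C*nat, In p l -> zero_order (fst p) (snd p)) ->
 Cmod (Cplus (Cminus (RtoC (S_sum x)) (RtoC (x^2/2))) (Cmult (RtoC 2) (zero_sum x l))) <= Rabs (Dsum (Z.to_nat (Int_part x)))+3*10^10*(ln x^3*x).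
Proof.
 intros HL Hx ND HI HO. set (N := Z.to_nat (Int_part x)). destruct (floor_nat x Hx) as (HN & N1). fold N in HN, N1.
 assert (X := explicit_zero_sum x l (S N) HL Hx ND HI HO ltac:(rewrite S_INR; lra)). rewrite A1_succ in X by lra.
 change (S_sum x) with (lsum (seq 1 N) G). rewrite S_Dsum by auto. set (L := ln x) in *. set (A := A1 N x) in *. set (n := INR N) in *. assert (n1 : 1 <= n) by (apply le_INR in N1; pos).
 assert (lnN : ln n <= L) by (apply ln_le_mono; lra).
 assert (D : Rabs (A1 N n-A) <= x*L+x).
 { unfold A, A1. assert (P : 0 <= psi1 N x-psi1 N n <= L*n).
  { assert (E : psi1 N x = psi1 N n+(x-n)*lsum (seq 1 N) vonMangoldt). { unfold psi1. rewrite <- lsum_scal, <- lsum_plus. apply lsum_ext. intros k Hk. apply in_seq in Hk. assert (INR k <= n) by (apply le_INR; lia). rewrite !Rmax_right by lra. ring. } assert (0 <= lsum (seq 1 N) vonMangoldt) by (apply lsum_nonneg; intros; apply vonMangoldt_nonneg). assert (lsum (seq 1 N) vonMangoldt <= L*n).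
   { unfold n. rewrite <- (length_seq N 1) at 2. rewrite <- lsum_length, <- lsum_scal. apply lsum_le. intros k Hk. apply in_seq in Hk. rewrite Rmult_1_r. eapply Rle_trans; [apply vonMangoldt_le_ln; lia|]. trr lnN. apply ln_le_mono. pos. apply le_INR; lia. }
   nra. }
  rewrite !Rmax_right by lra. assert (Q : 0 <= (x-1)^2/2-(n-1)^2/2 <= x) by nra. assert (L*n <= L*x) by (mull; lra). apply Rabs_le_between. lra. }
 set (r := 2*(A1 N n-A)+n^2/2-x^2/2-3*n/2+1).
 replace (RtoC (Dsum N+2*A1 N n+n^2/2-3*n/2+1)-RtoC (x^2/2)+RtoC 2*zero_sum x l)%C with (RtoC (Dsum N)+(RtoC r+RtoC 2*(RtoC A+zero_sum x l)))%C.
 2:{ unfold r. rewrite <- RtoC_minus. replace (Dsum N+2*A1 N n+n^2/2-3*n/2+1-x^2/2) with (Dsum N+((2*(A1 N n-A)+n^2/2-x^2/2-3*n/2+1)+2*A)) by ring. rewrite !RtoC_plus, (RtoC_mult 2 A). ring. }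
 tr Cmod_triangle. rewrite Cmod_R. apply Rplus_le_compat_l. tr Cmod_triangle. rewrite Cmod_R, Cmod_mult, Cmod_R, (Rabs_right 2) by lra.
 assert (Rr : Rabs r <= 2*(x*L)+6*x) by (apply Rabs_le_between in D; apply Rabs_le_between; unfold r; nra).
 assert (L3 : 1000000*1000000*L <= L^3) by (nra). nra.
Qed.
(** [real] sends an infinite supremum to 0, so both finiteness claims matter: Re rho < 1 bounds the
    set from above, and [zeros_to_the_right] provides an element and then the lower bound 1/2. *)
Lemma B1_facts : 1/2 <= B1 <= 1 /\ (forall rho, nontrivial_zero rho -> Re rho <= B1).
Proof.
 unfold B1. set (E := fun r => exists rho, nontrivial_zero rho /\ Re rho = r). destruct (Lub_Rbar_correct E) as (UB & LU).
 assert (U1 : Rbar_le (Lub_Rbar E) 1) by (apply LU; intros r (rho & ((_ & H) & _) & <-); simpl; lra).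
 assert (Z := zeros_to_the_right). destruct (Z 0 ltac:(lra)) as (r0 & Hr0 & _). assert (X := UB (Re r0) (ex_intro _ r0 (conj Hr0 eq_refl))).
 destruct (Lub_Rbar E) as [b| |]; simpl in *; try contradiction. assert (HB : forall rho, nontrivial_zero rho -> Re rho <= b) by (intros rho Hr; apply (UB (Re rho)); exists rho; auto).
 split; auto. split; auto. destruct (Rle_dec (1/2) b); auto. destruct (Z b ltac:(lra)) as (rho & Hr & Hl). specialize (HB rho Hr). lra.
Qed.
Lemma pow2_between c : 1 <= c -> exists K, c <= 2^K/3 <= 2*c /\ INR K <= 2*ln (6*c).
Proof.
 intro Hc. assert (H : exists K, c <= 2^K/3 <= 2*c).
 { destruct (Pow_x_infinity 2 ltac:(rewrite Rabs_right; lra) (3*c)) as (j & Hj). specialize (Hj j (le_n _)). rewrite Rabs_right in Hj by (apply Rle_ge, pow_le; lra).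
  induction j as [|j IH]. nra. destruct (Rle_dec (3*c) (2^j)) as [A|A]. apply IH; lra. exists (S j). simpl in *. lra. }
 destruct H as (K & HK). exists K. split; auto. assert (P : ln (2^K) <= ln (6*c)) by (apply ln_le_mono; lra). rewrite ln_pow in P by lra. assert (Z := ln_lt_2). assert (K0 := pos_INR K). nra.
Qed.
Lemma exp_pow1 n : exp (INR n) <= 3^n.
Proof. induction n as [|n IH]. simpl. rewrite exp_0. lra. rewrite S_INR, exp_plus. simpl. assert (A := exp_le_3). assert (B := exp_pos (INR n)). nra. Qed.

(* Here x^(2 (1 - delta(x))) = x^2 exp(-2 delta(x) log x), and 2 delta(x) log x is below q^2/26 with q = (log x)^(1/6). *)
Definition delta (L : R) : R := 1/(53.989*Rpower L (2/3)*Rpower (ln L) (1/3)).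
Lemma delta_bound L : 10^6 <= L -> 0 < delta L <= 1/4 /\ 2*(delta L*L) <= Rpower L (1/6)^2/26 /\ Rpower L (1/6)^6 = L.
Proof.
 intro HL. set (q := Rpower L (1/6)). assert (Eq : forall n, q^n = Rpower L (1/6*INR n)) by (intro n; unfold q; rewrite <- Rpower_pow, Rpower_mult by apply Rpower_pos; lra).
 assert (E6 : q^6 = L) by (rewrite Eq; replace (1/6*INR 6) with 1 by (simpl; lra); apply Rpower_1; lra). assert (E4 : Rpower L (2/3) = q^4) by (rewrite Eq; f_equal; simpl; lra).
 assert (l1 : 1 <= ln L). { apply le_ln_of_exp. assert (X := exp_le_3). lra. }
 assert (r1 : 1 <= Rpower (ln L) (1/3)) by (via (Rpower (ln L) 0); [rewrite Rpower_O; lra|apply Rpower_le_base; lra]).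
 assert (q1 : 1 <= q) by (via (Rpower L 0); [rewrite Rpower_O; lra|apply Rpower_le_base; lra]). assert (q4 : 1 <= q^4) by (apply pow_R1_Rle; lra).
 assert (D : delta L <= / (53.989*q^4)). { unfold delta, Rdiv. rewrite Rmult_1_l. apply Rinv_le_contravar; nra. }
 assert (D0 : 0 < delta L). { apply Rdiv_lt_0_compat; [lra|]. pos. }
 split; split; auto. tr D. via (/ 4); [|lra]. apply Rinv_le_contravar; lra.
 via (2*(/ (53.989*q^4)*L)). nra. rewrite <- E6 at 1. replace (2*(/ (53.989*q^4)*q^6)) with (q^2*(2/53.989)) by fld. nra.
Qed.
Lemma Rpower_one_minus x d : 1 < x -> Rpower x (2*(1-d)) = x^2*exp (- (2*(d*ln x))).
Proof. intro H. unfold Rpower. replace (2*(1-d)*ln x) with (INR 2*ln x + - (2*(d*ln x))) by (simpl; lra). rewrite exp_plus. f_equal. apply Rpower_pow; lra. Qed.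
Lemma exp_le_mono a b : a <= b -> exp a <= exp b.
Proof. destruct (Req_dec a b) as [->|]; [lra|]. left; apply exp_increasing; lra. Qed.
(** Up to logarithms [A1] is bounded by x^2 exp(-2w); unsmoothing takes the square root and bounds
    the partial sums of [am] by x exp(-w); the trivial outer sum adds a factor x log x. *)
Lemma Dsum_zero_free_bound x N : 10^9 <= ln x -> 1 < x -> INR N <= x -> (1 <= N)%nat -> Rabs (Dsum N) <= 3*ln x^4*(x^2*exp (- (Rpower (ln x) (1/6)^3/690))).
Proof.
 intros HL Hx HN HN1. set (L := ln x) in *. destruct (delta_bound L ltac:(lra)) as (_ & _ & E6). set (q := Rpower L (1/6)) in *. set (w := q^3/690). assert (q0 : 0 < q) by apply Rpower_pos.
 assert (ex : exp L = x) by (apply exp_ln; lra).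
 (* 690^2 = 476100 exceeds twice 238000, so w is admissible in [A1_zero_free_bound] as soon as ln u
    > L/2. *)
 assert (ww : w^2 = L/476100) by (unfold w; lra). assert (w0 : 0 < w) by (unfold w; pos). assert (w2 : 2*w <= L/2) by nra.
 set (e := exp (- w)). assert (e0 : 0 < e) by apply exp_pos. assert (e1 : e <= 1) by (rewrite <- exp_0; apply exp_le_mono; lra). assert (ee : exp (- (2*w)) = e*e) by (unfold e; rewrite <- exp_plus; f_equal; lra).
 assert (xe : 10^8 <= x*(e*e)). { rewrite <- ee, <- ex, <- exp_plus. assert (X := exp_ineq1_le (L + - (2*w))). lra. }
 destruct (nat_ceil (2*x) ltac:(lra)) as (N' & HN'). destruct (nat_ceil ((2*x)^3) ltac:(pos)) as (K & HK). destruct (zdata_exists K) as (Z & g & g' & HZ).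
 assert (x3 : 1000 <= x^3) by nra.
 destruct (Hb_bound x K ltac:(fold L; lra) Hx ltac:(lra) ltac:(lra)) as (h1 & h2). fold L in h1, h2. assert (h0 : 0 <= hK K) by (assert (A := hK_ge K); assert (B := Nbar_ge K); lra). assert (H0 : 0 <= Hb K) by (unfold Hb; assert (A := lt5_ge (INR K)); lra).
 set (M := L^3*(x*e)^2). assert (L3 : L^3 = L^2*L) by ring.
 assert (HM : forall u, u <= 2*x -> Rabs (A1 N' u) <= M).
 { intros u Hu. assert (M0 : 0 <= M) by (unfold M; pos). destruct (Rle_dec u 1) as [U|U]. rewrite A1_small, Rabs_R0; lra.
  assert (u3 : u^3 <= INR K). { via ((2*x)^3). apply pow_incr; lra. lra. }
  assert (ia : 0 < / L <= 1) by (split; [pos|rewrite <- Rinv_1; apply Rinv_le_contravar; lra]).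
  assert (P : Rpower u (/ L+1) / / L <= 12*x*L).
  { unfold Rdiv. rewrite Rinv_inv. mulr. via (Rpower (2*x) (/ L+1)). apply Rle_Rpower_l; lra. rewrite <- Rpower_mult_distr by lra. rewrite exp_1_over by (fold L; lra). assert (Rpower 2 (/ L+1) <= 4). { via (Rpower 2 (INR 2)). apply Rpower_le_base; simpl; lra. rewrite Rpower_pow by lra. lra. }
   assert (A := exp_le_3). replace (12*x) with (4*(3*x)) by ring. mul; nra. }
  (* Arguments up to the square root of x are treated with v = 0: there u^2 <= x, which is below (x
     e)^2 by [xe]. *)
  assert (G : exists v, 0 <= v /\ v^2 <= ln u/238000 /\ u^2*exp (- (2*v)) <= 5*(x*e)^2).
  { assert (lu : 0 <= ln u) by (rewrite <- ln_1; apply ln_le_mono; lra). destruct (Rle_dec (ln u) (L/2)) as [A|A].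
   - exists 0. split; [lra|]. split; [lra|]. replace (- (2*0)) with 0 by ring. rewrite exp_0, Rmult_1_r. assert (u^2 <= x). { rewrite <- ex, <- (exp_ln u) at 1 by lra. simpl. rewrite Rmult_1_r, <- exp_plus. apply exp_le_mono; lra. } nra.
   - exists w. split; [lra|]. split; [lra|]. rewrite ee. replace (5*(x*e)^2) with (5*x^2*(e*e)) by ring. mulr. nra. }
  destruct G as (v & v0 & v1 & v2). assert (X := A1_zero_free_bound K Z g g' u N' (/ L) v HZ ltac:(lra) ltac:(lra) u3 ltac:(lra) ia v0 v1).
  tr X. set (xx := (x*e)^2) in *. assert (Exx : x*10^8 <= xx) by (unfold xx; replace ((x*e)^2) with (x*(x*(e*e))) by ring; mull; lra).
  via (3000*L^2*(56*xx)+1000*(3010*L^2)*(12*x*L)).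
  apply Rplus_le_compat. nra. apply Rmult_le_compat; try lra. pos.
  unfold M. rewrite L3. replace (1000*(3010*L^2)*(12*x*L)) with (L^2*(L*(36120000*x))) by ring. replace (3000*L^2*(56*xx)) with (L^2*(168000*xx)) by ring. rewrite <- Rmult_plus_distr_l, Rmult_assoc. mull. nra. }
 assert (lnN : ln (INR N) <= L) by (apply ln_le_mono; pos).
 (* This length balances M/H against H up to logarithms, since M = L^3 H^2. *)
 set (H := x*e). assert (HH : 0 < H <= x) by (unfold H; nra). assert (H1 : 1 <= H) by (unfold H; nra).
 via (L*(3*L^3*H)*INR N).
 - apply Dsum_partial_sums; try lra. intros v Hv. assert (V : INR v <= x) by (apply le_INR in Hv; lra). eapply Rle_trans. apply (partial_sum_bound N' v H M); try lra. apply INR_le; lra. cont.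
  unfold M. fold H. replace (2*(L^3*H^2)/H) with (2*L^3*H) by fld. assert (2*H <= L^3*H) by (mulr; nra). lra.
 - via (L*(3*L^3*H)*x); [|unfold H, e, w; lra]. apply Rmult_le_compat_l; auto. pos.
Qed.

Theorem theorem2 (x : R) (l : list (C * nat)) :
  ln x >= 10 ^ 6 ->
  NoDup (map fst l) ->
  (forall rho : C, In rho (map fst l) <-> (nontrivial_zero rho /\ Cmod rho < x)) ->
  (forall p : C * nat, In p l -> zero_order (fst p) (snd p)) ->
  Cmod (Cplus (Cminus (RtoC (S_sum x)) (RtoC (x ^ 2 / 2)))
              (Cmult (RtoC 2) (zero_sum x l)))
    <= 13.149 * (ln x) ^ 5 * Rpower x (2 * B1star x).
Proof.
 intros HL' ND HI HO. assert (HL : 10^6 <= ln x) by lra.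
 (* [ln] is 0 at non-positive arguments, so the hypothesis on [ln x] excludes them as well. *)
 assert (Hx : 1 < x). { destruct (Rle_dec x 1) as [H|H]; [|lra]. destruct (Rle_dec x 0). unfold ln in HL. destruct (Rlt_dec 0 x); lra. assert (ln x <= ln 1) by (apply ln_le_mono; lra). rewrite ln_1 in *. lra. }
 assert (R0 := S_reduction x l HL Hx ND HI HO). tr R0. clear R0 HI HO ND HL'. set (N := Z.to_nat (Int_part x)). destruct (floor_nat x Hx) as (HN & N1). fold N in HN, N1.
 destruct B1_facts as (Bh & HB). set (L := ln x) in *. destruct (delta_bound L HL) as (D1 & D2 & E6). unfold B1star. fold L. fold (delta L).
 assert (ex : exp L = x) by (apply exp_ln; lra). assert (xL : L <= x) by (generalize (exp_ineq1_le L); lra). assert (L2 : 10^12 <= L^2) by nra. assert (L3 : 10^18 <= L^3) by (nra). assert (L5 : L^5 = L^3*L^2) by ring.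
 assert (lnN : ln (INR N) <= L) by (apply ln_le_mono; lra).
 (* The constant is split as 13 + 0.149: as L^2 >= 10^12, the part 0.149 absorbs the error 3*10^10
    L^3 x of the explicit formula. *)
 assert (Fin : forall b, 1/2 <= b -> Rabs (Dsum N) <= 13*L^5*Rpower x (2*b) -> Rabs (Dsum N)+3*10^10*(L^3*x) <= 13.149*L^5*Rpower x (2*b)).
 { intros b Hb HD. assert (Xb : x <= Rpower x (2*b)) by (rewrite <- (Rpower_1 x) at 1 by lra; apply Rpower_le_base; lra). assert (3*10^10*(L^3*x) <= 0.149*(L^5*Rpower x (2*b))); [|lra].
  rewrite L5. replace (0.149*(L^3*L^2*Rpower x (2*b))) with (L^3*(0.149*(L^2*Rpower x (2*b)))) by ring. replace (3*10^10*(L^3*x)) with (L^3*(3*10^10*x)) by ring. mull. nra. }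
 destruct (Rle_dec B1 (1-delta L)) as [C|C].
 (* At distance 1/L from B1 the power x^(2 sg) exceeds x^(2 B1) only by e^2 <= 9, and the factor
    1/dl is a single logarithm. *)
 - rewrite Rmin_left by auto. apply Fin; [lra|]. set (c := INR N+1). destruct (pow2_between c ltac:(unfold c; lra)) as (K & HK & KK). set (sg := B1 + / L). assert (iL : 0 < / L <= / 1000000) by (split; [pos|apply Rinv_le_contravar; lra]).
  assert (l4 : forall k, 0 < k <= 7 -> ln (k*x) <= L+2). { intros k Hk. rewrite ln_mult by lra. fold L. assert (ln k <= 2); [|lra]. apply ln_le_of_exp; [lra|]. assert (Z := exp_ge_pow27 2). replace (INR 2) with 2 in Z by auto. lra. }
  assert (M := Dsum_mean_bound sg (/ L) N K (L+2) ltac:(unfold sg; lra) iL).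
  assert (ZF : forall rho, zf rho = 0 -> 0 <= Re rho -> Re rho <= sg - / L) by (unfold sg; replace (B1 + / L - / L) with B1 by ring; apply zf_zero_bound; pos).
  specialize (M ZF ltac:(lra) ltac:(lra)). fold c in M. specialize (M ltac:(eapply Rle_trans; [|apply (l4 4); lra]; apply ln_le_mono; unfold c; lra) HK). tr M.
  assert (K2 : INR K+1 <= 2.00001*L). { assert (ln (6*c) <= L+2); [|lra]. eapply Rle_trans; [|apply (l4 7); lra]. apply ln_le_mono; unfold c; lra. }
  set (P := Rpower x (2*B1)). assert (P1 : x <= P) by (rewrite <- (Rpower_1 x) at 1 by lra; apply Rpower_le_base; lra).
  assert (Y : Rpower c (2*sg) <= 9.1*P).
  { via (Rpower (1.001*x) (2*sg)). apply Rle_Rpower_l; [unfold sg; lra|unfold c; lra]. rewrite <- Rpower_mult_distr by lra.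
   assert (A : Rpower 1.001 (2*sg) <= 1.01) by (via (Rpower 1.001 (INR 3)); [apply Rpower_le_base; unfold sg; simpl; lra|rewrite Rpower_pow; lra]).
   assert (B : Rpower x (2*sg) <= 9*P). { unfold sg. replace (2*(B1 + / L)) with (2 * / L+2*B1) by ring. rewrite Rpower_plus. mulr. unfold Rpower. fold L. replace (2 * / L*L) with (INR 2) by (simpl; fld). tr exp_pow1; lra. }
   assert (A0 := Rpower_pos 1.001 (2*sg)). nra. }
  assert (Y0 := Rpower_pos c (2*sg)). set (y := Rpower c (2*sg)) in *. replace (y*(L+2)^2 / / L) with (y*((L+2)^2*L)) by fld. replace (y/(/ L)^2) with (y*L^2) by fld.
  (* Relative to L^4 P, the term [T1] is about 5.3*10^6 and [T2] at most about 4*10^6; their sum is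
     below 13*10^6 <= 13 L. *)
  assert (T1 : 288000*(INR K+1)*(y*((L+2)^2*L)) <= 288000*(2.00001*L)*(9.1*P*(1.00001*L^2*L))).
  { assert (K0 := pos_INR K). assert ((L+2)^2 <= 1.00001*L^2) by nra. apply Rmult_le_compat; try lra. nra. mul. mulr; lra. }
  assert (T2 : 43*10^16*(y*L^2) <= 43*10^16*(9.1*P*L^2)) by (mull; mulr; lra).
  assert (T3 : 200*c <= 400*P) by (unfold c; lra).
  assert (U1 : 10^12*(L^2*P) <= L^2*(L^2*P)) by (mulr; pos). assert (U2 : 10^12*P <= L^2*P) by (mulr; lra).
  assert (U3 : 10^6*(L^2*(L^2*P)) <= L*(L^2*(L^2*P))) by (mulr; lra). lra.
 - rewrite Rmin_right by lra. apply Fin; [lra|]. rewrite Rpower_one_minus by auto. fold L. set (q := Rpower L (1/6)) in *. assert (q0 : 0 < q) by apply Rpower_pos. set (d := 2*(delta L*L)) in *.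
  destruct (Rle_dec L (10^9)) as [S|S].
  (* For L <= 10^9 the exponent d is at most 1000/26 < 39, and 3^39 < 13*10^18 <= 13 L^3, so the
     trivial bound for D suffices. *)
  + assert (Q : q^2 <= 1000). { destruct (Rle_dec (q^2) 1000); auto. assert (E : L = q^2*q^2*q^2) by lra. set (t := q^2) in *. nra. }
   assert (F := exp_pow1 39). assert (G : / 3^39 <= exp (- d)). { rewrite exp_Ropp. apply Rinv_le_contravar; [pos|]. trr F. apply exp_le_mono. simpl. lra. }
   assert (T := Dsum_trivial N L ltac:(lra) lnN). via (L^2*x^2). { assert (INR N^2 <= x^2) by (apply Rsqr_le; lra). nra. }
   rewrite L5. replace (13*(L^3*L^2)*(x^2*exp (- d))) with (L^2*x^2*(13*L^3*exp (- d))) by ring. rewrite <- (Rmult_1_r (L^2*x^2)) at 1. mull.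
   nra.
  + assert (T := Dsum_zero_free_bound x N ltac:(fold L; lra) Hx ltac:(lra) N1). fold L in T. fold q in T. tr T.
   (* 27^6 < 10^9; and q >= 27 gives q^3/690 >= q^2/26 >= d because 27/690 > 1/26. From here on the
      classical region beats the term in question. *)
   assert (q27 : 27 <= q). { destruct (Rle_dec 27 q); auto. assert (q^6 <= 27^6) by (apply pow_incr; lra). lra. }
   assert (Ed : exp (- (q^3/690)) <= exp (- d)). { apply exp_le_mono. nra. } apply Rmult_le_compat. pos. pos. nra. nra.
Qed.
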